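(* Let $n\ge3$, let $B=B_r(x)\subset\mathbb{R}^n$ be an open ball and let $\{B_\alpha=B_{r_\alpha}(x_\alpha)\}$ be a family of (possibly empty, at most countably many) open and mutually non-overlapping balls contained in $B$. Let $\Lambda$ be a (possibly empty) closed subset of $\bar B\setminus(\bigcup_\alpha B_\alpha)$ satisfying: (i) $(\bigcup_\alpha B_\alpha)\cup\Lambda\ne\emptyset$; (ii) if $\bar B_\alpha\cap\bar B_\beta=\{p\}$, or $\bar B_\alpha\cap\partial B=\{p\}$, then $p\in\Lambda$; (iii) if $\{B_{\alpha_j}\}\subset\{B_\alpha\}$ is a sequence of distinct balls converging to a point $p\in\bar B$, in the sense that $x_{\alpha_j}\to p$ and $r_{\alpha_j}\to0$, then $p\in\Lambda$. Set $\Omega:=B\setminus(\bigcup_\alpha\bar B_\alpha\cup\Lambda)$ (an open set). Let $\Gamma\subset\mathbb{R}^n$ and $f$ satisfy: $\Gamma$ is an open convex symmetric cone with vertex at the origin; $\Gamma_n\subset\Gamma\subset\Gamma_1$, where $\Gamma_n=\{\lambda:\lambda_i>0\ \forall i\}$ and $\Gamma_1=\{\lambda:\lambda_1+\dots+\lambda_n>0\}$; $f\in C^\infty(\Gamma)\cap C^0(\bar\Gamma)$ is a non-negative symmetric function; $f>0$ and $\frac{\partial f}{\partial\lambda_k}>0$ in $\Gamma$ for $1\le k\le n$, and $f|_{\partial\Gamma}=0$; and there is a constant $\delta>0$ with $\sum_{k=1}^n\frac{\partial f}{\partial\lambda_k}\ge\delta$ in $\Gamma$. Then for any given $\beta>0$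 and $\epsilon>0$ there exists a constant $C=C(n,f,\Gamma,(\Omega,\Lambda),\beta,\epsilon)$ such that if $u\in C^2(\bar\Omega\setminus\Lambda)$ satisfies $$\left\{\begin{array}{l} f(\lambda(A_{u^{4/(n-2)}g_{flat}}))=1\ \text{ in }\Omega,\\ \lambda(A_{u^{4/(n-2)}g_{flat}})\in\Gamma\ \text{ and } u>0\ \text{ in }\bar\Omega\setminus\Lambda,\\ u(x)\to\infty\ \text{ as } x\to\Lambda,\\ \frac{\partial u}{\partial\nu}+\frac{n-2}{2r}u=c(B)\,u^{\frac{n}{n-2}}\ \text{ on }\partial B\setminus\Lambda,\\ \frac{\partial u}{\partial\nu}-\frac{n-2}{2r_\alpha}u=c(B_\alpha)\,u^{\frac{n}{n-2}}\ \text{ on }\partial B_\alpha\setminus\Lambda\ \text{ for every }\alpha,\end{array}\right.$$ for some constants $c(B),c(B_\alpha)>-\beta$, then $$\sup\{u(x):x\in\bar\Omega,\ \mathrm{dist}(x,\Lambda)\ge\epsilon\}\le C,$$ where, when $\Lambda=\emptyset$, the set $\{x\in\bar\Omega:\mathrm{dist}(x,\Lambda)\ge\epsilon\}$ is understood as $\bar\Omega$.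
   Context: $g_{flat}$ is the Euclidean metric and $\nu$ is the outer unit normal to $\partial\Omega$ (so on $\partial B_\alpha$ it points into $B_\alpha$). For a metric $g$, $A_g=\frac{1}{n-2}\big(Ric_g-\frac{R_g}{2(n-1)}g\big)$ is the Schouten tensor and $\lambda(A_g)$ denotes the eigenvalues of $A_g$ with respect to $g$. Explicitly, $\lambda(A_{u^{4/(n-2)}g_{flat}})$ are the eigenvalues of the symmetric matrix $$A^u=-\tfrac{2}{n-2}u^{-\frac{n+2}{n-2}}\nabla^2u+\tfrac{2n}{(n-2)^2}u^{-\frac{2n}{n-2}}\nabla u\otimes\nabla u-\tfrac{2}{(n-2)^2}u^{-\frac{2n}{n-2}}|\nabla u|^2I.$$ Symmetric (cone, function) means invariant under permutations of coordinates. Non-overlapping means pairwise disjoint. ''$u(x)\to\infty$ as $x\to\Lambda$'' is vacuous if $\Lambda=\emptyset$. *)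

(* Defs.v *)
From HB Require Import structures.
From mathcomp Require Import all_boot all_order all_algebra all_fingroup.
From mathcomp Require Import all_classical all_reals all_analysis.

Set Implicit Arguments.
Unset Strict Implicit.
Unset Printing Implicit Defensive.

Import Order.TTheory GRing.Theory Num.Theory.
Import numFieldNormedType.Exports.

Local Open Scope classical_set_scope.
Local Open Scope ring_scope.

(* The library norm on 'rV[R]_n is the sup norm: it induces the usual topology,
   but its balls and distances are not the Euclidean ones. *)
Section Euclidean.
Context {R : realType} {n : nat}.
Implicit Types (x y v w : 'rV[R]_n) (A : set 'rV[R]_n) (r : R).

Definition edot v w : R := \sum_(i < n) v 0 i * w 0 i.

Definition enorm v : R := Num.sqrt (edot v v).

Definition eball x r : set 'rV[R]_n := [set y | enorm (y - x) < r].

Definition bdry A : set 'rV[R]_n := closure A `\` A°.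

(* Extended-real valued, so that the distance to the empty set is +oo. *)
Definition edist_to x A : \bar R :=
  ereal_inf [set (enorm (x - y))%:E | y in A].

End Euclidean.

Section Smoothness.
Context {R : realType} {n : nat}.
Implicit Types (g u : 'rV[R]_n -> R) (U E : set 'rV[R]_n) (s : seq 'I_n).

Definition partial (i : 'I_n) g : 'rV[R]_n -> R :=
  fun x => 'D_(delta_mx 0 i) g x.

Definition partials s g : 'rV[R]_n -> R := foldr partial g s.

(* g is of class C^k on the open set U. *)
Definition Ck_on (k : nat) U g : Prop :=
  forall s, (size s <= k)%N -> forall x, U x ->
    {for x, continuous (partials s g)} /\
    ((size s < k)%N -> forall i, derivable (partials s g) x (delta_mx 0 i)).

Definition smooth_on U g : Prop := forall k, Ck_on k U g.

(* u is of class C^k in the open set U, and u and all its partial derivatives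
   of order at most k extend continuously from U to E, where U `<=` E and
   E `<=` closure U (u itself is already defined on E). *)
Definition Ck_upto (k : nat) U E u : Prop :=
  [/\ Ck_on k U u,
      {within E, continuous u} &
      forall s, (size s <= k)%N ->
        exists2 h : 'rV[R]_n -> R, {within E, continuous h} &
          forall x, U x -> h x = partials s u x].

(* The value at x, possibly on the boundary of U, of the continuous extension
   of g from U. *)
Definition ext U g (x : 'rV[R]_n) : R := lim (g y @[y --> within U (nbhs x)]).

Definition egrad U u (x : 'rV[R]_n) : 'rV[R]_n :=
  \row_i ext U (partial i u) x.

Definition ehess U u (x : 'rV[R]_n) : 'M[R]_n :=
  \matrix_(i, j) ext U (partials [:: i; j] u) x.

End Smoothness.

Section ConformalSchouten.
Context {R : realType} {n : nat}.

(* The eigenvalues of A counted with multiplicity, listed in an unspecified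
   order; they exist as soon as A is symmetric. *)
Definition eigvals (A : 'M[R]_n) : 'rV[R]_n :=
  xget 0 [set l : 'rV[R]_n | char_poly A = \prod_(i < n) ('X - (l 0 i)%:P)].

(* The Schouten tensor A_g = (Ric_g - R_g / (2 (n - 1)) g) / (n - 2) of the
   conformal metric g = u^(4 / (n - 2)) g_flat, with one index raised by g,
   written in terms of the value t, gradient p and Hessian H of u at a point:
   its eigenvalues with respect to g are those of this symmetric matrix. *)
Definition conf_schouten_mx (t : R) (p : 'rV[R]_n) (H : 'M[R]_n) : 'M[R]_n :=
  let m := n%:R - 2 : R in
  - (2 / m * t `^ (- ((n%:R + 2) / m))) *: H
  + (2 * n%:R / m ^+ 2 * t `^ (- (2 * n%:R / m))) *: (p^T *m p)
  - (2 / m ^+ 2 * t `^ (- (2 * n%:R / m)) * edot p p)%:M.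

Definition conf_schouten (U : set 'rV[R]_n) (u : 'rV[R]_n -> R)
    (x : 'rV[R]_n) : 'M[R]_n :=
  conf_schouten_mx (u x) (egrad U u x) (ehess U u x).

End ConformalSchouten.

Section ConesAndFunctions.
Context {R : realType} {n : nat}.
Implicit Types (Gam : set 'rV[R]_n) (f : 'rV[R]_n -> R).

Definition Gamma_n : set 'rV[R]_n := [set l | forall i, 0 < l 0 i].

Definition Gamma_1 : set 'rV[R]_n := [set l | 0 < \sum_(i < n) l 0 i].

Record admissible_cone Gam : Prop := AdmissibleCone {
  cone_open : open Gam;
  cone_convex : convex_set Gam;
  cone_scale : forall (t : R) l, 0 < t -> Gam l -> Gam (t *: l);
  cone_sym : forall (s : 'S_n) l, Gam l -> Gam (col_perm s l);
  cone_sup : Gamma_n `<=` Gam;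
  cone_sub : Gam `<=` Gamma_1
}.

(* Only the values of f on closure Gam are constrained. *)
Record admissible_function Gam f : Prop := AdmissibleFunction {
  fun_smooth : smooth_on Gam f;
  fun_continuous : {within closure Gam, continuous f};
  fun_ge0 : forall l, closure Gam l -> 0 <= f l;
  fun_sym : forall (s : 'S_n) l, closure Gam l -> f (col_perm s l) = f l;
  fun_gt0 : forall l, Gam l -> 0 < f l;
  fun_partial_gt0 : forall l k, Gam l -> 0 < partial k f l;
  fun_bdry : forall l, bdry Gam l -> f l = 0;
  fun_sum_partial : exists2 delta : R, 0 < delta &
    forall l, Gam l -> delta <= \sum_(k < n) partial k f l
}.

End ConesAndFunctions.

Section Configuration.
Context {R : realType} {n : nat} {I : countType}.
Variables (x0 : 'rV[R]_n) (r : R) (xb : I -> 'rV[R]_n) (rb : I -> R).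
Variable Lam : set 'rV[R]_n.

Let B := eball x0 r.
Let Bb a := eball (xb a) (rb a).

(* I may be empty, finite or countably infinite. *)
Record ball_configuration : Prop := BallConfiguration {
  conf_r_gt0 : 0 < r;
  conf_rb_gt0 : forall a, 0 < rb a;
  conf_sub : forall a, Bb a `<=` B;
  conf_disjoint : trivIset setT Bb;
  conf_closed : closed Lam;
  conf_Lam_sub : Lam `<=` closure B `\` \bigcup_a Bb a;
  conf_nonempty : (\bigcup_a Bb a) `|` Lam !=set0;
  conf_touch : forall a b p,
    closure (Bb a) `&` closure (Bb b) = [set p] -> Lam p;
  conf_touch_outer : forall a p,
    closure (Bb a) `&` bdry B = [set p] -> Lam p;
  conf_shrink : forall (sigma : nat -> I) p, injective sigma ->
    closure B p -> xb (sigma j) @[j --> \oo] --> p ->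
    rb (sigma j) @[j --> \oo] --> (0 : R) -> Lam p
}.

Definition domain : set 'rV[R]_n :=
  B `\` ((\bigcup_a closure (Bb a)) `|` Lam).

Variables (Gam : set 'rV[R]_n) (f : 'rV[R]_n -> R).
Variables (cB : R) (cb : I -> R) (u : 'rV[R]_n -> R).

Let E := closure domain `\` Lam.

(* The outer unit normal of the domain is (x - x0) / r on the outer sphere and
   - (x - xb a) / rb a on the sphere bounding the removed ball a. *)
Record conf_solution : Prop := ConfSolution {
  sol_C2 : Ck_upto 2 domain E u;
  sol_eq : forall x, domain x -> f (eigvals (conf_schouten domain u x)) = 1;
  sol_cone : forall x, E x -> Gam (eigvals (conf_schouten domain u x));
  sol_gt0 : forall x, E x -> 0 < u x;
  sol_blowup : forall M : R, exists2 d : R, 0 < d &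
    forall x, E x -> (edist_to x Lam < d%:E)%E -> M < u x;
  sol_outer : forall x, (bdry B `\` Lam) x ->
    edot (egrad domain u x) (r^-1 *: (x - x0)) + (n%:R - 2) / (2 * r) * u x
      = cB * u x `^ (n%:R / (n%:R - 2));
  sol_inner : forall a x, (bdry (Bb a) `\` Lam) x ->
    edot (egrad domain u x) (- ((rb a)^-1 *: (x - xb a)))
      - (n%:R - 2) / (2 * rb a) * u x
      = cb a * u x `^ (n%:R / (n%:R - 2))
}.

End Configuration.

(* Main.v *)
(* Put w = u^(-2/(n-2)).  The equation becomes f(lambda(w D^2 w - |Dw|^2/2 I)) = 1, the boundary
   condition on a sphere of signed radius R (negative for the removed balls) becomes
   w_nu = w/R - 2c/(n-2), and an upper bound for u is a lower bound for w.  The equation is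
   conformally invariant, so w can be compared with its Kelvin transforms
   W(y) = |y-z|^2/L w(z + L(y-z)/|y-z|^2).  Let w >= m on the part in the domain of a ball of radius
   N around a, in which a single sphere s is taken into account.  The inequality w <= W outside the
   sphere of center z and squared radius L holds for all (z, L) with L <= k (N^2 - |z-a|^2), k small,
   whose inversion preserves the inner side of s: at the smallest level k at which it fails, the
   graphs touch.  An interior contact, or a contact on s, is excluded by the strong maximum principle
   and the Hopf lemma, and a contact on any other sphere by the derivative of the level along a family
   of spheres, using c > -beta.

   Take x1 minimizing w divided by the distance to the boundary of a ball B(x, rho) where only one
   sphere is met, and m = w(x1)/2, so that w >= m near x1.  If m is much smaller than rho, then
   reflecting points to x1 with factor 1/2 bounds w by 4m in a ball much larger than m, away from the
   spheres; close to a sphere s the reflection gives the bound only on the parallel surface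
   {depth = 2 depth(x1)}, and comparison with P^(-2), for a subharmonic polynomial P, extends it to
   a ball.  But then w is touched from above by a paraboloid with small eigenvalues, where f < 1.

   Hypotheses (ii) and (iii) enter through compactness: around the points at distance at least eps
   from Lambda, there are balls of uniform radius that meet at most one of the spheres. *)
Require Import Defs.
From mathcomp Require Import all_boot all_order all_algebra all_fingroup.
From mathcomp Require Import all_classical all_reals all_analysis.
From mathcomp Require Import ring lra.

Set Implicit Arguments.
Unset Strict Implicit.
Unset Printing Implicit Defensive.

Import Order.TTheory GRing.Theory Num.Theory.
Import numFieldNormedType.Exports.

Local Open Scope classical_set_scope.
Local Open Scope ring_scope.

(** * Euclidean space *)

(** The parameter that grows is the level [L / (N^2 - |z-a|^2)], not the radius at a fixed center.
    It confines the centers to the ball and makes [L] vanish towards its boundary, so a first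
    failing sphere can be perturbed in center and radius at once. A contact on a sphere requires
    this freedom: the boundary condition controls [w] along the normal only, so the contact point is
    pushed along the normal with its image fixed, and what remains is to see that the level drops. A
    reflection preserves the inner side of [s] when [2 * rho s z + L / rad s >= 0], with equality
    for orthogonal spheres. For a point y sent to x with factor t this reads
    [rho s x >= t * rho s y]. Hence near [s] the factor 1/2 reaches no deeper than twice the depth
    of x1, which may be arbitrarily small; this is the obstacle that the subharmonic barrier
    overcomes. To make the level drop at contacts on [s] itself, the center [a] is put beyond [s],
    leaving only a thin cap of the ball in the domain. *)

Section EuclideanSpace.
Context {R : realType} {n : nat}.
Implicit Types (x y z u v w : 'rV[R]_n) (A K : set 'rV[R]_n) (a b : R).

Lemma edotC v w : edot v w = edot w v.
Proof. by apply: eq_bigr => i _; rewrite mulrC. Qed.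

Lemma edotDl u v w : edot (u + v) w = edot u w + edot v w.
Proof. by rewrite -big_split; apply: eq_bigr => i _; rewrite mxE mulrDl. Qed.

Lemma edotZl a v w : edot (a *: v) w = a * edot v w.
Proof. by rewrite mulr_sumr; apply: eq_bigr => i _; rewrite mxE mulrA. Qed.

Lemma edotDr u v w : edot w (u + v) = edot w u + edot w v.
Proof. by rewrite edotC edotDl !(edotC w). Qed.

Lemma edotZr a v w : edot w (a *: v) = a * edot w v.
Proof. by rewrite edotC edotZl (edotC w). Qed.

Lemma edotNl v w : edot (- v) w = - edot v w.
Proof. by rewrite -scaleN1r edotZl mulN1r. Qed.

Lemma edotNr v w : edot w (- v) = - edot w v.
Proof. by rewrite edotC edotNl (edotC w). Qed.

Lemma edot0l v : edot 0 v = 0.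
Proof. by rewrite -(scale0r 0) edotZl mul0r. Qed.

Lemma edot0r v : edot v 0 = 0.
Proof. by rewrite edotC edot0l. Qed.

Definition edotE := (edotDl, edotDr, edotNl, edotNr, edotZl, edotZr).

Lemma edot_ge0 v : 0 <= edot v v.
Proof. by apply: sumr_ge0 => i _; rewrite -expr2 sqr_ge0. Qed.

Lemma edot_eq0 v : (edot v v == 0) = (v == 0).
Proof.
apply/eqP/eqP => [h|->]; last by rewrite edot0l.
apply/rowP => i; rewrite mxE; apply/eqP; rewrite -sqrf_eq0 expr2; apply/eqP.
by move/psumr_eq0P: h; apply => // j _; rewrite -expr2 sqr_ge0.
Qed.

Lemma edot_gt0 v : v != 0 -> 0 < edot v v.
Proof. by move=> v0; rewrite lt_def edot_eq0 v0 edot_ge0. Qed.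

Lemma enorm_ge0 v : 0 <= enorm v.
Proof. exact: sqrtr_ge0. Qed.

Lemma sqr_enorm v : enorm v ^+ 2 = edot v v.
Proof. by rewrite sqr_sqrtr // edot_ge0. Qed.

Lemma enorm0 : enorm (0 : 'rV[R]_n) = 0.
Proof. by rewrite /enorm edot0l sqrtr0. Qed.

Lemma enorm_eq0 v : (enorm v == 0) = (v == 0).
Proof. by rewrite -sqrf_eq0 sqr_enorm edot_eq0. Qed.

Lemma enorm_gt0 v : (0 < enorm v) = (v != 0).
Proof. by rewrite lt_def enorm_ge0 andbT enorm_eq0. Qed.

Lemma enormZ a v : enorm (a *: v) = `|a| * enorm v.
Proof.
by rewrite /enorm edotZl edotZr mulrA -expr2 sqrtrM ?sqr_ge0 // sqrtr_sqr.
Qed.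

Lemma enormN v : enorm (- v) = enorm v.
Proof. by rewrite -scaleN1r enormZ normrN1 mul1r. Qed.

Lemma enormBC v w : enorm (v - w) = enorm (w - v).
Proof. by rewrite -enormN opprB. Qed.

Lemma edot_sqr_le v w : edot v w ^+ 2 <= edot v v * edot w w.
Proof.
have [->|w0] := eqVneq w 0; first by rewrite !edot0r expr0n mulr0.
have hw := edot_gt0 w0.
have := edot_ge0 (edot w w *: v - edot v w *: w).
rewrite !edotE (edotC w v) => h.
have {}h : 0 <= edot w w * (edot v v * edot w w - edot v w ^+ 2).
  by apply: le_trans h _; rewrite le_eqVlt; apply/orP; left; apply/eqP; ring.
by rewrite pmulr_rge0 // subr_ge0 in h.
Qed.

Lemma edot_le v w : `|edot v w| <= enorm v * enorm w.
Proof.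
rewrite -(@ler_pXn2r _ 2) ?nnegrE ?mulr_ge0 ?enorm_ge0 //.
by rewrite exprMn !sqr_enorm real_normK ?num_real // edot_sqr_le.
Qed.

Lemma edot_le' v w : edot v w <= enorm v * enorm w.
Proof. exact: le_trans (ler_norm _) (edot_le v w). Qed.

Lemma edot_ge' v w : - (enorm v * enorm w) <= edot v w.
Proof. by have := edot_le v w; rewrite ler_norml => /andP[]. Qed.

Lemma enormD v w : enorm (v + w) <= enorm v + enorm w.
Proof.
rewrite -(@ler_pXn2r _ 2) ?nnegrE ?addr_ge0 ?enorm_ge0 //.
rewrite sqr_enorm !edotE (edotC w v) sqrrD !sqr_enorm.
by have := edot_le' v w; lra.
Qed.

Lemma enormB v w : enorm (v - w) <= enorm v + enorm w.
Proof. by rewrite (le_trans (enormD _ _)) // enormN. Qed.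

Lemma enorm_dist z x y : enorm (x - y) <= enorm (x - z) + enorm (z - y).
Proof. by rewrite -[x - y](subrKA z) enormD. Qed.

Lemma enorm_triB v w : enorm v - enorm w <= enorm (v - w).
Proof. by rewrite lerBlDr -[in X in X <= _](subrK w v) enormD. Qed.

Lemma enorm_ltE v a : 0 < a -> (enorm v < a) = (edot v v < a ^+ 2).
Proof. by move=> a0; rewrite -sqr_enorm ltr_pXn2r ?nnegrE ?enorm_ge0 ?ltW. Qed.

Lemma enorm_leE v a : 0 <= a -> (enorm v <= a) = (edot v v <= a ^+ 2).
Proof. by move=> a0; rewrite -sqr_enorm ler_pXn2r ?nnegrE ?enorm_ge0. Qed.

Lemma coord_le_enorm v (i : 'I_n) : `|v 0 i| <= enorm v.
Proof.
rewrite -(@ler_pXn2r _ 2) ?nnegrE ?enorm_ge0 // sqr_enorm real_normK ?num_real //.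
rewrite /edot (bigD1 i) //= -expr2 lerDl.
by apply: sumr_ge0 => j _; rewrite -expr2 sqr_ge0.
Qed.

Lemma norm_le_enorm v : `|v| <= enorm v.
Proof.
have [->|v0] := eqVneq v 0; first by rewrite normr0 enorm_ge0.
have /mx_norm_neq0[[i j] /= hij] : mx_norm v != 0.
  by apply: contra_neq v0 => /mx_norm_eq0.
by rewrite /Num.norm /= hij ord1 coord_le_enorm.
Qed.

Lemma coord_le_norm v (i : 'I_n) : `|v 0 i| <= `|v|.
Proof.
rewrite [leRHS]/Num.norm /= mx_normrE; apply/bigmax_geP; right => /=.
by exists (0, i).
Qed.

Lemma enorm_le_sum v a : (forall i, `|v 0 i| <= a) -> enorm v <= n%:R * a.
Proof.
move=> h; have [n0|n0] := posnP n.
  rewrite /enorm /edot big1 ?sqrtr0 => [|i _].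
    by rewrite n0 mul0r.
  by have := ltn_ord i; rewrite {2}n0.
have a0 : 0 <= a by apply: le_trans (h (Ordinal n0)); exact: normr_ge0.
rewrite -(@ler_pXn2r _ 2) ?nnegrE ?mulr_ge0 ?enorm_ge0 // sqr_enorm.
apply: (@le_trans _ _ (n%:R * a ^+ 2)).
  rewrite mulr_natl -[X in _ *+ X](card_ord n) -sumr_const; apply: ler_sum => i _.
  by rewrite -expr2 -real_normK ?num_real // ler_pXn2r ?nnegrE.
rewrite exprMn ler_wpM2r ?sqr_ge0 // -natrX ler_nat.
by rewrite expnS expn1 leq_pmulr.
Qed.

Lemma enorm_le_norm v : enorm v <= n%:R * `|v|.
Proof. by apply: enorm_le_sum => i; exact: coord_le_norm. Qed.

Lemma nbhs_enormP x A :
  nbhs x A <-> exists2 d, 0 < d & forall y, enorm (y - x) < d -> A y.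
Proof.
split=> [/nbhs_ballP[d /= d0]|[d d0 h]].
  rewrite -ball_normE => h; exists d => // y hy; apply: h; rewrite /ball_ /= distrC.
  exact: le_lt_trans (norm_le_enorm _) hy.
apply/nbhs_ballP; exists (d / n.+1%:R) => /=; first by rewrite divr_gt0.
rewrite -ball_normE => y; rewrite /ball_ /= distrC => hy; apply: h.
apply: le_lt_trans (enorm_le_norm _) _.
apply: (@le_lt_trans _ _ (n.+1%:R * `|y - x|)).
  by rewrite ler_wpM2r // ler_nat.
by rewrite mulrC -ltr_pdivlMr.
Qed.

Lemma open_enormP A :
  open A <-> forall x, A x -> exists2 d, 0 < d & forall y, enorm (y - x) < d -> A y.
Proof.
rewrite openE; split=> h x Ax; first exact/nbhs_enormP/h.
by apply/nbhs_enormP/h.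
Qed.

Lemma closure_enormP A x :
  closure A x <-> forall d, 0 < d -> exists2 y, A y & enorm (y - x) < d.
Proof.
split=> [h d d0|h B /nbhs_enormP[d d0 hB]].
  have [|y [Ay yd]] := h [set y | enorm (y - x) < d]; last by exists y.
  by apply/nbhs_enormP; exists d.
by have [y Ay yd] := h d d0; exists y; split => //; exact: hB.
Qed.

Lemma enorm_bounded_compact A z b :
  closed A -> (forall y, A y -> enorm (y - z) <= b) -> compact A.
Proof.
move=> cA h; apply: bounded_closed_compact => //.
exists (enorm z + b); split; first exact: num_real.
move=> c hc y Ay; apply: le_trans (norm_le_enorm _) _; apply: ltW.
apply: le_lt_trans hc; rewrite addrC.
by rewrite -[y](subrK z) (le_trans (enormD _ _)) // lerD2r h.
Qed.

(** Continuity within [A] in epsilon-delta form for the Euclidean norm, pointwise, so that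
    restrictions to smaller sets and algebraic combinations are immediate. *)
Definition cont_at A (f : 'rV[R]_n -> R) x :=
  forall e, 0 < e -> exists2 d, 0 < d &
    forall y, A y -> enorm (y - x) < d -> `|f y - f x| < e.

Lemma cont_atP A (f : 'rV[R]_n -> R) :
  {within A, continuous f} <-> forall x, A x -> cont_at A f x.
Proof.
split=> [/subspace_continuousP h x Ax e e0|h].
  have /cvgrPdist_lt /(_ e e0) := h x Ax.
  move=> /nbhs_enormP[d d0 hd].
  by exists d => // y Ay yd; rewrite distrC; exact: (hd y yd Ay).
apply/subspace_continuousP => x Ax.
apply/cvgrPdist_lt => e e0; have [d d0 hd] := h x Ax e e0.
by apply/nbhs_enormP; exists d => // y yd Ay; rewrite distrC hd.
Qed.

Lemma compact_min K (f : 'rV[R]_n -> R) : K !=set0 -> compact K ->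
  (forall x, K x -> cont_at K f x) ->
  exists2 x, K x & forall y, K y -> f x <= f y.
Proof.
move=> K0 cK /cont_atP h; have [x xK hx] := EVT_min_rV K0 cK h.
by exists x; [exact: set_mem|move=> y Ky; apply: hx; exact: mem_set].
Qed.

End EuclideanSpace.

(** Takes the place of extracting a convergent subsequence: the sets [Q e] shrink with [e], so their
    traces on [K] generate a proper filter, and a cluster point is approached by points of every
    [Q e]. *)
Lemma compact_accum {R : realType} (T : topologicalType) (K : set T)
    (Q : R -> set T) : compact K ->
    (forall e, 0 < e -> exists2 x, K x & Q e x) ->
    (forall e e' x, e <= e' -> Q e x -> Q e' x) ->
  exists2 x, K x & forall e U, 0 < e -> nbhs x U ->
    exists x', [/\ K x', Q e x' & U x'].
Proof.
move=> cK hQ mQ.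
pose F : set_system T :=
  filter_from [set e : R | 0 < e] (fun e => K `&` Q e).
have FF : Filter F.
  apply: filter_from_filter; first by exists 1 => /=.
  move=> i j /= i0 j0; exists (Num.min i j); first by rewrite lt_min i0.
  by move=> x [Kx qx]; split; split => //; apply: mQ qx; rewrite ge_min lexx ?orbT.
have PF : ProperFilter F.
  apply: filter_from_proper => // e /= e0.
  by have [x Kx qx] := hQ e e0; exists x.
have FK : F K by exists 1 => //= x [].
have [x [Kx clx]] := cK F PF FK; exists x => // e U e0 Ux.
have [|x' [[Kx' qx'] Ux']] := clx (K `&` Q e) U _ Ux; last by exists x'.
by exists e.
Qed.


(** * Eigenvalues and admissible functions *)

From mathcomp Require Import complex.

(** Turns the comparison of ordered entries into a comparison of counts, the form in which the
    min-max principle for eigenvalues is used below. *)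
Lemma sorted_nth_gt (R : realType) (xs : seq R) (t : R) i : sorted >=%R xs -> (i < size xs)%N ->
  (t < xs`_i) = (i < count (fun x => t < x)%R xs)%N.
Proof.
elim: xs i => // x xs IH i /= pxs; rewrite ltnS => isz.
have sx := path_sorted pxs; case: i isz => [_|i isz] /=.
  rewrite addn_gt0 lt0b; case: ltP => //= le; symmetry; apply/negbTE.
  rewrite -leqNgt leqn0 -leqn0 leqNgt -has_count; apply/hasPn => y yxs.
  rewrite -leNgt (le_trans _ le) //.
  by move: pxs; rewrite path_sortedE => [/andP[/allP/(_ _ yxs)]//|];
    exact: (rev_trans le_trans).
rewrite IH //; case: ltP => [_|le] /=; first by rewrite add1n ltnS.
rewrite add0n; have -> : count (fun x0 => (t < x0)%R) xs = 0%N.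
  apply/eqP; rewrite -leqn0 leqNgt -has_count; apply/hasPn => y yxs.
  rewrite -leNgt (le_trans _ le) //.
  by move: pxs; rewrite path_sortedE => [/andP[/allP/(_ _ yxs)]//|];
    exact: (rev_trans le_trans).
by [].
Qed.

(** * Ordered eigenvalues of symmetric matrices *)

Section SpectralOrder.
Context {R : realType} {n : nat}.
Implicit Types (A B : 'M[R]_n) (v x y : 'rV[R]_n).

Definition qform A v : R := edot (v *m A) v.

Local Notation C := (R[i]).
Local Notation toC := (real_complex R).

Definition hform (A : 'M[C]_n) (p : 'rV[C]_n) : C :=
  (p *m A *m (map_mx Num.conj p)^T) 0 0.

(** Links the diagonalization, which is taken over the complex numbers, to the real quadratic
    form. *)
Lemma Re_hform A (p : 'rV[C]_n) :
  complex.Re (hform (map_mx toC A) p) =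
  qform A (map_mx (@complex.Re R) p) + qform A (map_mx (@complex.Im R) p).
Proof.
rewrite /hform /qform /edot -big_split mxE raddf_sum.
apply: eq_bigr => j _; rewrite !mxE !mulr_suml -big_split raddf_sum.
apply: eq_bigr => i _; rewrite !mxE.
by case: (p 0 i) => a b; case: (p 0 j) => c d /=; ring.
Qed.

Lemma hform_diag (U : 'M[C]_n) (d c : 'rV[C]_n) (u := c *m U) :
    U *m (map_mx Num.conj U)^T = 1%:M ->
  hform ((map_mx Num.conj U)^T *m diag_mx d *m U) u =
  \sum_i d 0 i * `|c 0 i| ^+ 2.
Proof.
move=> h; rewrite /hform /u map_mxM trmx_mul !mulmxA -(mulmxA c) h mulmx1.
rewrite -(mulmxA _ U) h mulmx1 mul_mx_diag mxE; apply: eq_bigr => i _.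
by rewrite !mxE normCK; ring.
Qed.

Lemma Re_norm_sqr (c : C) : complex.Re (`|c| ^+ 2) = complex.Re c ^+ 2 + complex.Im c ^+ 2.
Proof. by rewrite normCK; case: c => a b /=; ring. Qed.

Lemma hform_rect A (U : 'M[C]_n) (l : 'rV[R]_n) (c : 'rV[C]_n) :
    U *m (map_mx Num.conj U)^T = 1%:M ->
    map_mx toC A = (map_mx Num.conj U)^T *m diag_mx (map_mx toC l) *m U ->
  complex.Re (hform (map_mx toC A) (c *m U)) =
  \sum_i l 0 i * (complex.Re (c 0 i) ^+ 2 + complex.Im (c 0 i) ^+ 2).
Proof.
move=> h ->; rewrite hform_diag // raddf_sum; apply: eq_bigr => i _.
by rewrite mxE -Re_norm_sqr; case: (`|c 0 i| ^+ 2) => a b /=; ring.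
Qed.


Definition diagonalizes A (U : 'M[C]_n) (l : 'rV[R]_n) : Prop :=
  U *m (map_mx Num.conj U)^T = 1%:M /\
  map_mx toC A = (map_mx Num.conj U)^T *m diag_mx (map_mx toC l) *m U.

Lemma exists_diagonalizes A : A^T = A -> exists U l, diagonalizes A U l.
Proof.
move=> sA; have hA : map_mx toC A \is hermsymmx.
  apply: realsym_hermsym.
    apply/is_hermitianmxP; rewrite expr0 scale1r.
    by apply/matrixP => i j; rewrite !mxE -[in RHS]sA mxE.
  by apply/mxOverP => i j; rewrite mxE; apply/complex_realP; exists (A i j).
have /hermitian_normalmx /orthomx_spectralP eA := hA.
have /mxOverP rd := hermitian_spectral_diag_real hA.
exists (spectralmx (map_mx toC A)), (map_mx (@complex.Re R) (spectral_diag (map_mx toC A))).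
have uU := spectral_unitarymx (map_mx toC A).
have eT (M : 'M[C]_n) : (map_mx Num.conj M)^T = map_mx Num.conj M^T.
  by apply/matrixP => i j; rewrite !mxE.
split; first by rewrite eT; apply/unitarymxP.
have dE : map_mx toC (map_mx (@complex.Re R) (spectral_diag (map_mx toC A))) =
    spectral_diag (map_mx toC A).
  by apply/rowP => i; rewrite !mxE; have /complex_realP[k ->] := rd 0 i.
by rewrite {1}eA (invmx_unitary uU) eT dE.
Qed.

Lemma char_poly_similar (F : comNzRingType) (P Q D : 'M[F]_n) : Q *m P = 1%:M ->
  char_poly (Q *m D *m P) = char_poly D.
Proof.
move=> h; rewrite /char_poly /char_poly_mx !map_mxM.
have h' : map_mx polyC Q *m map_mx polyC P = 1%:M by rewrite -map_mxM h map_mx1.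
have -> : 'X%:M - map_mx polyC Q *m map_mx polyC D *m map_mx polyC P =
    map_mx polyC Q *m ('X%:M - map_mx polyC D) *m map_mx polyC P.
  by rewrite mulmxBr mulmxBl scalar_mxC -(mulmxA _ (map_mx polyC Q)) h' mulmx1.
by rewrite !det_mulmx mulrAC -det_mulmx h' det1 mul1r.
Qed.

Lemma diagonalizes_char_poly A U l : diagonalizes A U l ->
  char_poly A = \prod_(i < n) ('X - (l 0 i)%:P).
Proof.
move=> [hU hA]; apply: (map_inj_poly (@complexI R) (raddf0 _)) => /=.
rewrite map_char_poly rmorph_prod /= hA char_poly_similar; last exact: mulmx1C.
rewrite char_poly_trig ?diag_mx_is_trig //; apply: eq_bigr => i _.
by rewrite !mxE eqxx rmorphB /= map_polyX map_polyC.
Qed.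

(** Courant-Fischer by a dimension count. If the inequality failed, the span of the eigenvectors of
    [A] with [l > t] would meet the span of those of [B] with [m + s <= t]; on a common vector the
    two forms contradict their comparison. *)
Lemma eig_count A B U V l m (s t : R) :
    diagonalizes A U l -> diagonalizes B V m ->
    (forall v, qform A v <= qform B v + s * edot v v) ->
  (#|[pred i : 'I_n | (t < l 0 i)%R]| <= #|[pred i : 'I_n | (t < m 0 i + s)%R]|)%N.
Proof.
move=> [hU hA] [hV hB] hAB.
set SA := [pred i | t < l 0 i]; set SB := [pred i | t < m 0 i + s].
pose XA := \matrix_(i < #|SA|) row (enum_val i) U.
pose XB := \matrix_(i < #|[predC SB]|) row (enum_val i) V.
have eT m' (M : 'M[C]_(m', n)) : (map_mx Num.conj M)^T = map_mx Num.conj M^T.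
  by apply/matrixP => i j; rewrite !mxE.
have un (W : 'M[C]_n) (S : pred 'I_n) : W *m (map_mx Num.conj W)^T = 1%:M ->
    \rank (\matrix_(i < #|S|) row (enum_val i) W) = #|S|.
  move=> hW; apply: mxrank_unitary; apply/row_unitarymxP => i j.
  have /row_unitarymxP hw : W \is unitarymx by apply/unitarymxP; rewrite -eT.
  by rewrite !rowK hw (inj_eq enum_val_inj).
have rA : \rank XA = #|SA| := un U SA hU.
have rB : \rank XB = #|[predC SB]| := un V [predC SB] hV.
rewrite leqNgt; apply/negP => lt.
have : (XA :&: XB)%MS != 0.
  rewrite -mxrank_eq0 -lt0n; have := mxrank_sum_cap XA XB; rewrite rA rB => e.
  rewrite -(ltn_add2l (\rank (XA + XB)%MS)) e addn0.
  apply: leq_ltn_trans (rank_leq_col _) _.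
  rewrite -[X in (X < _)%N]card_ord -[X in (X < _)%N](cardC SB).
  by rewrite ltn_add2r.
case/rowV0Pn => u; rewrite sub_capmx => /andP[/submxP[a ea] /submxP[b eb]] u0.
(* A combination of selected rows is a combination of all rows whose remaining coefficients
   vanish. *)
have ext (W : 'M[C]_n) (S : pred 'I_n) (c : 'rV[C]_#|S|) :
    W *m (map_mx Num.conj W)^T = 1%:M ->
    u = c *m (\matrix_(i < #|S|) row (enum_val i) W) ->
    exists2 c' : 'rV[C]_n, u = c' *m W & forall j, j \notin S -> c' 0 j = 0.
  move=> hW eu; exists (c *m (\matrix_(i < #|S|, j < n) (enum_val i == j)%:R)).
    rewrite eu -mulmxA; congr (_ *m _); apply/matrixP => i j; rewrite !mxE.
    rewrite (bigD1 (enum_val i)) //= !mxE eqxx mul1r big1 ?addr0 // => k ki.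
    by rewrite mxE eq_sym (negbTE ki) mul0r.
  move=> j jS; rewrite mxE big1 // => i _; rewrite mxE.
  have [ij|] := eqVneq (enum_val i) j; last by rewrite mulr0.
  by rewrite -ij enum_valP in jS.
have [ca eca ha] := ext U SA a hU ea.
have [cb ecb hb] := ext V [predC SB] b hV eb.
pose nr (c : C) := complex.Re c ^+ 2 + complex.Im c ^+ 2.
have nr0 (c : C) : 0 <= nr c by rewrite addr_ge0 ?sqr_ge0.
pose x := map_mx (@complex.Re R) u; pose y := map_mx (@complex.Im R) u.
(* The identity matrix is diagonalized by the same unitary matrix; this expresses the squared norm
   of [u] by its coefficients. *)
have one (W : 'M[C]_n) (c : 'rV[C]_n) : W *m (map_mx Num.conj W)^T = 1%:M ->
    u = c *m W -> \sum_i nr (c 0 i) = edot x x + edot y y.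
  move=> hW eu; have := Re_hform 1%:M u; rewrite {1}eu.
  rewrite (@hform_rect _ _ (const_mx 1) c hW) //; last first.
    rewrite map_mx1.
    have -> : diag_mx (map_mx toC (const_mx 1 : 'rV_n)) = 1%:M.
      by apply/matrixP => i j; rewrite !mxE.
    by rewrite mulmx1 (mulmx1C hW).
  rewrite /qform !mulmx1 => <-; apply: eq_bigr => i _.
  by rewrite mxE mul1r.
have e1 := Re_hform A u; have e2 := Re_hform B u.
rewrite {1}eca (hform_rect ca hU hA) in e1.
rewrite {1}ecb (hform_rect cb hV hB) in e2.
have n1 := one _ _ hU eca; have n2 := one _ _ hV ecb.
have ca0 : 0 < \sum_i (l 0 i - t) * nr (ca 0 i).
  have ge i : 0 <= (l 0 i - t) * nr (ca 0 i).
    have [iS|/ha ->] := boolP (i \in SA); last by rewrite /nr /= expr0n addr0 mulr0.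
    by rewrite mulr_ge0 // subr_ge0 ltW.
  rewrite lt_def sumr_ge0 // andbT; apply/eqP => /psumr_eq0P z.
  case/eqP: u0; rewrite eca; suff -> : ca = 0 by rewrite mul0mx.
  apply/rowP => i; rewrite mxE.
  have [iS|/ha //] := boolP (i \in SA).
  have /eqP := z (fun i _ => ge i) i isT.
  rewrite mulf_eq0 subr_eq0 gt_eqF //= /nr paddr_eq0 ?sqr_ge0 // !sqrf_eq0.
  by case: (ca 0 i) => p q /= /andP[/eqP -> /eqP ->].
have cb0 : \sum_i (m 0 i + s - t) * nr (cb 0 i) <= 0.
  apply: sumr_le0 => i _.
  have [iS|/hb ->] := boolP (i \in [predC SB]).
    2: by rewrite /nr /= expr0n addr0 mulr0.
  by rewrite mulr_le0_ge0 // subr_le0 leNgt.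
have d1 : \sum_i (l 0 i - t) * nr (ca 0 i) =
    qform A x + qform A y - t * (edot x x + edot y y).
  rewrite -e1 -n1 mulr_sumr -sumrB; apply: eq_bigr => i _; rewrite -/(nr _).
  by ring.
have d2 : \sum_i (m 0 i + s - t) * nr (cb 0 i) =
    qform B x + qform B y + s * (edot x x + edot y y) - t * (edot x x + edot y y).
  rewrite -e2 -n2 !mulr_sumr -big_split -sumrB; apply: eq_bigr => i _.
  by rewrite -/(nr _) /=; ring.
by have := hAB x; have := hAB y; lra.
Qed.

(** Sorting makes each eigenvalue a monotone and Lipschitz function of the matrix, which the
    unspecified order of [eigvals] need not do. *)
Definition evseq A : seq R := sort >=%R [seq eigvals A 0 i | i <- enum 'I_n].

Definition evs A : 'rV[R]_n := \row_i (evseq A)`_i.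

Lemma size_evseq A : size (evseq A) = n.
Proof. by rewrite size_sort size_map size_enum_ord. Qed.

Lemma evs_perm A : exists s : 'S_n, evs A = col_perm s (eigvals A).
Proof.
pose t1 := [tuple (evs A) 0 i | i < n]; pose t2 := [tuple (eigvals A) 0 i | i < n].
have : perm_eq t1 t2.
  rewrite /= (_ : [seq evs A 0 i | i <- enum 'I_n] = evseq A).
    by rewrite perm_sort.
  apply: (@eq_from_nth _ 0); rewrite size_map size_enum_ord ?size_evseq // => i iN.
  rewrite (nth_map (Ordinal iN)) ?size_enum_ord // mxE.
  by congr (_ `_ _); rewrite nth_enum_ord.
case/tuple_permP => s es; exists s; apply/rowP => i; rewrite mxE.
have : tnth t1 i = tnth (map_tuple (tnth t2) [tuple s i | i < n]) i.
  congr (tnth _ _); apply/val_inj => /=; rewrite [LHS]es /=.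
  by rewrite -map_comp; apply: eq_map => j.
by rewrite (tnth_map (tnth t2)) /t1 /t2 !tnth_mktuple !mxE.
Qed.

Lemma sym_char_poly A : A^T = A ->
  char_poly A = \prod_(i < n) ('X - (eigvals A 0 i)%:P).
Proof.
move=> /exists_diagonalizes[U [l /diagonalizes_char_poly h]].
have := @xgetPex _ 0 [set l : 'rV[R]_n | char_poly A = \prod_(i < n) ('X - (l 0 i)%:P)].
by rewrite -/(eigvals A) => /(_ (ex_intro _ l h)).
Qed.

Lemma evs_count A U l (t : R) : A^T = A -> diagonalizes A U l ->
  count (fun b => t < b)%R (evseq A) = #|[pred i : 'I_n | (t < l 0 i)%R]|.
Proof.
move=> sA dA; have := sym_char_poly sA; rewrite (diagonalizes_char_poly dA).
have e (g : 'I_n -> R) : \prod_(i < n) ('X - (g i)%:P) =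
    \prod_(b <- [seq g i | i <- enum 'I_n]) ('X - b%:P).
  by rewrite big_map big_enum.
rewrite !e => /prod_XsubC_eq /seq.permP h.
by rewrite count_sort -h count_map cardE enumT size_filter.
Qed.

(** Weyl's monotonicity. For [t = evs B 0 i + s], [eig_count] bounds the number of eigenvalues of
    [A] above [t] by the number of those of [B] above [evs B 0 i], which is at most [i]. *)
Lemma evs_le A B (s : R) : A^T = A -> B^T = B ->
    (forall v, qform A v <= qform B v + s * edot v v) ->
  forall i, evs A 0 i <= evs B 0 i + s.
Proof.
move=> sA sB h i; rewrite leNgt; apply/negP => lt.
have [U [l dA]] := exists_diagonalizes sA; have [V [m dB]] := exists_diagonalizes sB.
have := eig_count (evs B 0 i + s) dA dB h.
have -> : #|[pred j : 'I_n | (evs B 0 i + s < m 0 j + s)%R]| =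
    #|[pred j : 'I_n | (evs B 0 i < m 0 j)%R]|.
  by apply: eq_card => j; rewrite !inE ltrD2r.
rewrite -(evs_count _ sA dA) -(evs_count _ sB dB).
have srt M : sorted >=%R (evseq M) by apply: sort_sorted => a b; exact: ge_total.
have iA : (i < size (evseq A))%N by rewrite size_evseq.
have iB : (i < size (evseq B))%N by rewrite size_evseq.
have := lt; rewrite !mxE (sorted_nth_gt _ (srt A)) // => h1 h2.
have := leq_trans h1 h2; rewrite -(sorted_nth_gt _ (srt B)) //.
by rewrite ltxx.
Qed.

Lemma evs_trace A : A^T = A -> \sum_i evs A 0 i = \tr A.
Proof.
move=> sA; have [s ->] := evs_perm A.
under eq_bigr do rewrite mxE.
rewrite -(reindex_inj (@perm_inj _ s) (P := xpredT)
  (F := fun i => eigvals A 0 i)) /=.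
have [n0|n0] := posnP n.
  by rewrite /mxtrace !big1 // => i; have := ltn_ord i; rewrite {2}n0.
apply: oppr_inj; rewrite -char_poly_trace // sym_char_poly //.
have -> : \prod_(i < n) ('X - (eigvals A 0 i)%:P) =
    \prod_(b <- [seq eigvals A 0 i | i <- enum 'I_n]) ('X - b%:P).
  by rewrite big_map big_enum.
have e : size [seq eigvals A 0 i | i <- enum 'I_n] = n.
  by rewrite size_map size_enum_ord.
have := @coefPn_prod_XsubC _ [seq eigvals A 0 i | i <- enum 'I_n].
rewrite e -lt0n => /(_ n0) ->.
by rewrite big_map big_enum.
Qed.

End SpectralOrder.

(** * Restriction to lines and coordinatewise paths *)

Section OneVariable.
Context {R : realType} {n : nat}.
Implicit Types (x v : 'rV[R]_n) (g : 'rV[R]_n -> R).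

Lemma line_is_derive g x v (t : R) : derivable g (x + t *: v) v ->
  is_derive t 1 (fun s => g (x + s *: v)) ('D_v g (x + t *: v)).
Proof.
move=> dg.
have e : (fun h : R => h^-1 *: (((fun s => g (x + s *: v)) \o shift t) (h *: 1) -
    g (x + t *: v))) =
  (fun h : R => h^-1 *: ((g \o shift (x + t *: v)) (h *: v) - g (x + t *: v))).
  apply/funext => h /=; congr (_ *: (g _ - _)).
  by rewrite scalerDl [h *: 1]mulr1 addrCA.
split; first by rewrite /derivable e; exact: dg.
by rewrite /derive e.
Qed.

Lemma fin_choose (P : 'I_n -> R -> Prop) :
    (forall i, exists2 d, 0 < d & forall d', 0 < d' -> d' <= d -> P i d') ->
  exists2 d, 0 < d & forall i, P i d.
Proof.
move=> h; have /boolp.choice[d hd] : forall i, exists d, 0 < d /\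
    forall d', 0 < d' -> d' <= d -> P i d'.
  by move=> i; have [d d0 hd] := h i; exists d.
pose e := \big[Num.min/1]_i d i.
have e0 : 0 < e.
  by rewrite /e; elim/big_rec: _ => // i a _ a0; rewrite lt_min a0 (hd i).1.
by exists e => // i; apply: (hd i).2 => //; apply: bigmin_le_cond.
Qed.

(** Intermediate points of a path from [x] to [v] parallel to the axes; they reduce increments in
    several variables to partial derivatives. *)
Definition mixrow x v (k : nat) : 'rV[R]_n :=
  \row_i (if (i < k)%N then v 0 i else x 0 i).

Lemma mixrow0 x v : mixrow x v 0 = x.
Proof. by apply/rowP => i; rewrite mxE. Qed.

Lemma mixrow_n x v : mixrow x v n = v.
Proof. by apply/rowP => i; rewrite mxE ltn_ord. Qed.

Lemma mixrowS x v (k : 'I_n) :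
  mixrow x v k.+1 = mixrow x v k + (v 0 k - x 0 k) *: delta_mx 0 k.
Proof.
apply/rowP => i; rewrite !mxE eqxx ltnS leq_eqVlt /=.
have [->|ik] := eqVneq i k; first by rewrite eqxx ltnn /= mulr1 addrC subrK.
by rewrite (_ : (nat_of_ord i == k) = false) ?mulr0 ?addr0 //; exact/negbTE.
Qed.

Lemma mixrow_ind x v (P : 'rV[R]_n -> Prop) : P x ->
    (forall k : 'I_n, P (mixrow x v k) -> P (mixrow x v k.+1)) -> P v.
Proof.
move=> p0 pS; rewrite -(mixrow_n x v).
have : (n <= n)%N by []; elim: {1 3}n => [_|k IH kn]; first by rewrite mixrow0.
by apply: (pS (Ordinal kn)); apply: IH; exact: ltnW.
Qed.

Lemma partial_mvt g x (i : 'I_n) (t : R) : 0 <= t ->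
    (forall s, 0 <= s <= t -> derivable g (x + s *: delta_mx 0 i) (delta_mx 0 i)) ->
  exists2 c, 0 <= c <= t &
    g (x + t *: delta_mx 0 i) - g x = partial i g (x + c *: delta_mx 0 i) * t.
Proof.
move=> t0 h.
pose G := fun s : R => g (x + s *: delta_mx 0 i).
have dG s : 0 <= s <= t -> is_derive s 1 G (partial i g (x + s *: delta_mx 0 i)).
  by move=> /h d; exact: line_is_derive.
have [||c cI] := @MVT_segment R G (fun s => partial i g (x + s *: delta_mx 0 i)) 0 t t0.
- by move=> s /andP[s0 st]; apply: dG; rewrite !ltW.
- apply: derivable_within_continuous => s; rewrite in_itv /= => /dG dGs.
  exact: ex_derive.
by rewrite /G scale0r addr0 subr0 => ->; exists c => //; rewrite in_itv in cI.
Qed.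

End OneVariable.

(** * Monotonicity and local ellipticity of f *)

Section AdmissibleFunctions.
Context {R : realType} {n : nat} {Gam : set 'rV[R]_n} {f : 'rV[R]_n -> R}.
Hypotheses (hGam : admissible_cone Gam) (hf : admissible_function Gam f).
Implicit Types (l d : 'rV[R]_n).

Lemma cone_add l d : Gam l -> Gam d -> Gam (l + d).
Proof.
move=> hl hd.
have h2 : (0 <= (2^-1 : R) <= 1) by apply/andP; split; lra.
have := (cone_convex hGam) l d (Itv01 (andP h2).1 (andP h2).2) (mem_set hl) (mem_set hd).
rewrite inE => /(cone_scale hGam (ltr0n R 2)).
congr (Gam _); rewrite /conv /= scalerDr !scalerA.
by rewrite divff // /unstable.onem mulrBr mulr1 divff // scale1r (_ : 2 - 1 = 1) ?scale1r //; lra.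
Qed.

Lemma Gamma_n_sub l : (forall i, 0 < l 0 i) -> Gam l.
Proof. exact: (cone_sup hGam). Qed.

Lemma cone_open_enorm l : Gam l ->
  exists2 d, 0 < d & forall y, enorm (y - l) < d -> Gam y.
Proof. by move: l; apply/open_enormP; exact: cone_open hGam. Qed.

(** Openness allows [l] to be lowered by a small constant vector within the cone; what is then
    missing to [l'] lies in the open positive cone. *)
Lemma cone_up l l' : Gam l -> (forall i, l 0 i <= l' 0 i) -> Gam l'.
Proof.
move=> hl le; have [d d0 hd] := cone_open_enorm hl.
pose e := d / (n.+1%:R * 2).
have e0 : 0 < e by rewrite divr_gt0.
have -> : l' = (l - const_mx e) + (l' - l + const_mx e).
  by apply/rowP => i; rewrite !mxE; ring.
apply: cone_add; last first.
  by apply: Gamma_n_sub => i; rewrite !mxE ltr_wpDl // subr_ge0.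
apply: hd; rewrite addrAC subrr add0r enormN.
apply: (@le_lt_trans _ _ (n%:R * e)).
  by apply: enorm_le_sum => i; rewrite mxE gtr0_norm.
apply: (@le_lt_trans _ _ (n.+1%:R * e)); first by rewrite ler_pM2r // ler_nat.
have -> : n.+1%:R * e = d / 2.
  have N0 : n.+1%:R != 0 :> R by rewrite pnatr_eq0.
  by rewrite /e; set N := n.+1%:R in N0 *; field.
by lra.
Qed.

Lemma f_derivable l (i : 'I_n) : Gam l -> derivable f l (delta_mx 0 i).
Proof. by move=> hl; have [_ /(_ isT i)] := (fun_smooth hf) 1%N [::] isT l hl. Qed.

Lemma f_mono l l' : Gam l -> (forall i, l 0 i <= l' 0 i) -> f l <= f l'.
Proof.
move=> hl le; suff [] : Gam l' /\ f l <= f l' by [].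
apply: (@mixrow_ind _ _ l l' (fun v => Gam v /\ f l <= f v)) => // k [gk fk].
have d0 : 0 <= l' 0 k - l 0 k by rewrite subr_ge0.
have gup s : 0 <= s -> Gam (mixrow l l' k + s *: delta_mx 0 k).
  by move=> s0; apply: cone_up gk _ => i; rewrite !mxE lerDl mulr_ge0 ?ler0n.
rewrite mixrowS; split; first exact: gup.
have [s s0t|c /andP[c0 _] e] := partial_mvt d0 (g := f) (x := mixrow l l' k) (i := k).
  by apply: f_derivable; apply: gup; case/andP: s0t.
apply: le_trans fk _; rewrite -subr_ge0 e mulr_ge0 // ltW //.
by apply: (fun_partial_gt0 hf); exact: gup.
Qed.

Lemma f_local l0 : Gam l0 -> exists d c C : R,
  [/\ 0 < d, 0 < c, 0 < C & forall l, enorm (l - l0) < d ->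
     Gam l /\ forall k, c <= partial k f l <= C].
Proof.
move=> h0; have [d d0 hd] := cone_open_enorm h0.
have [e e0 he] : exists2 e, 0 < e & forall k : 'I_n,
    (forall l, enorm (l - l0) < e -> e <= partial k f l <= e^-1).
  apply: fin_choose => k.
  have p0 := fun_partial_gt0 hf k h0; set p := partial k f l0 in p0.
  have [+ _] := (fun_smooth hf) 1%N [:: k] isT l0 h0.
  move=> /cvgrPdist_lt /(_ (p / 2)); rewrite divr_gt0 // => /(_ isT).
  case/nbhs_enormP => e e0 he.
  exists (Num.min e (Num.min (p / 2) (p * 2)^-1)).
    by rewrite !lt_min e0 divr_gt0 // invr_gt0 mulr_gt0.
  move=> e' e'0; rewrite !le_min => /and3P[h1 h2 h3] l ll0.
  have := he l (lt_le_trans ll0 h1); rewrite /= -/p /partials /= => hl.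
  have : `|p - partial k f l| < p / 2 by [].
  rewrite ltr_norml => /andP[h4 h5]; apply/andP; split; first by lra.
  rewrite -[_ <= _]lef_pV2 ?posrE ?invrK ?invr_gt0 //; last by lra.
  apply: le_trans h3 _; rewrite lef_pV2 ?posrE ?mulr_gt0 //; lra.
exists (Num.min d e), e, e^-1; split; rewrite ?lt_min ?d0 ?invr_gt0 //.
move=> l; rewrite lt_min => /andP[h1 h2]; split; first exact: hd.
by move=> k; exact: he.
Qed.

(** Quantitative ellipticity near [l0]: raising all eigenvalues by [s] costs at most [C * s],
    lowering one of them by [t] gains at least [c * t]. Only [l] has to be close to [l0];
    monotonicity replaces [l'], which may be far away, by a nearby vector. *)
Lemma f_local_bounds l0 : Gam l0 -> exists eta c C : R,
  [/\ 0 < eta, 0 < c, 0 < C &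
   forall l l' (s t : R), (forall i, `|l 0 i - l0 0 i| <= eta) ->
     0 <= s <= eta -> 0 <= t <= eta -> Gam l' ->
     (forall i, l' 0 i <= l 0 i + s) -> (exists i, l' 0 i <= l 0 i + s - t) ->
     f l' <= f l + C * s - c * t].
Proof.
move=> h0; have [d [c [C [d0 c0 C0 hd]]]] := f_local h0.
(* The vectors met below differ from [l0] by at most [eta * 3] in each coordinate, one [eta] each
   for [l], [s] and [t]. *)
pose eta := d / (n.+1%:R * 4).
have eta0 : 0 < eta by rewrite divr_gt0.
have near l : (forall i, `|l 0 i - l0 0 i| <= eta * 3) -> enorm (l - l0) < d.
  move=> hl; apply: (@le_lt_trans _ _ (n%:R * (eta * 3))).
    by apply: enorm_le_sum => i; rewrite !mxE.
  apply: (@le_lt_trans _ _ (n.+1%:R * (eta * 3))).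
    by rewrite ler_pM2r ?mulr_gt0 // ler_nat.
  have -> : n.+1%:R * (eta * 3) = d * (3 / 4).
    have N0 : n.+1%:R != 0 :> R by rewrite pnatr_eq0.
    by rewrite /eta; set N := n.+1%:R in N0 *; field.
  by lra.
exists eta, c, (n.+1%:R * C); split; rewrite ?mulr_gt0 //.
move=> l l' s t hl /andP[s0 s1] /andP[t0 t1] gl' le [i lei].
pose ka : 'rV[R]_n := l + const_mx s.
pose la : 'rV[R]_n := ka - t *: delta_mx 0 i.
have hk j : `|l 0 j - l0 0 j| <= eta := hl j.
have step1 : f l' <= f la.
  apply: f_mono => // j; rewrite !mxE eqxx /=.
  by case: eqP => [->|_]; rewrite ?mulr1 ?mulr0 ?subr0.
have step2 : f la <= f ka - c * t.
  have [r r0t|r /andP[r0 rt] e] := partial_mvt t0 (g := f) (x := la) (i := i).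
    apply: f_derivable; apply: (hd _ (near _ _)).1 => j.
    move: (hl j); rewrite !mxE !ler_norml => /andP[h1 h2].
    case/andP: r0t => r0 rt; rewrite eqxx /=.
    by case: (j == i); rewrite ?mulr1 ?mulr0; lra.
  have [_ /(_ i)/andP[+ _]] : Gam (la + r *: delta_mx 0 i) /\
      forall k, c <= partial k f (la + r *: delta_mx 0 i) <= C.
    apply: hd; apply: near => j.
    move: (hl j); rewrite !mxE !ler_norml => /andP[h1 h2].
    by rewrite eqxx /=; case: (j == i); rewrite ?mulr1 ?mulr0; lra.
  move=> hc; rewrite -subr_ge0 -(@pmulr_rge0 _ 1) // mul1r.
  have -> : ka = la + t *: delta_mx 0 i by rewrite subrK.
  have := ler_wpM2r t0 hc; rewrite -e; lra.
have step3 : f ka <= f l + n.+1%:R * C * s.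
  suff [j] : exists j : nat, (j <= n)%N /\ f ka <= f l + j%:R * (C * s).
    case=> jn h; apply: le_trans h _; rewrite lerD2l -mulrA ler_wpM2r //.
      by rewrite mulr_ge0 // ltW.
    by rewrite ler_nat ltnW.
  pose P v := exists j : nat, (j <= n)%N /\ f v <= f l + j%:R * (C * s).
  suff Q k : (k <= n)%N -> f (mixrow l ka k) <= f l + k%:R * (C * s).
    by exists n; split => //; rewrite -{1}(mixrow_n l ka); exact: Q.
  elim: k => [_|k IH kn]; first by rewrite mixrow0 mul0r addr0.
  have := IH (ltnW kn); rewrite (mixrowS l ka (Ordinal kn)) /= => {}IH.
  have -> : ka 0 (Ordinal kn) - l 0 (Ordinal kn) = s by rewrite !mxE; ring.
  have nn r : 0 <= r <= s -> enorm (mixrow l ka k + r *: delta_mx 0 (Ordinal kn) - l0) < d.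
    move=> /andP[r0 rs]; apply: near => j.
    move: (hl j); rewrite !mxE !ler_norml => /andP[h1 h2].
    rewrite eqxx /=; case: (j == _); case: (ltnP j k) => _;
      by rewrite ?mulr1 ?mulr0; lra.
  have [r r0t|r r0t e] := partial_mvt s0 (g := f) (x := mixrow l ka k) (i := Ordinal kn).
    by apply: f_derivable; apply: (hd _ (nn _ r0t)).1.
  have [_ /(_ (Ordinal kn))/andP[_ +]] := hd _ (nn _ r0t).
  move=> hc; have := ler_wpM2r s0 hc; rewrite -e -natr1; lra.
by lra.
Qed.

(** The origin is a boundary point of the cone, since [Gamma_1] excludes it; [f] vanishes there and
    is continuous up to it. *)
Lemma f_small : (0 < n)%N -> exists2 s0 : R, 0 < s0 &
  forall s, 0 < s -> s <= s0 -> f (const_mx s) < 1.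
Proof.
move=> n0; have gc s : 0 < s -> Gam (const_mx s).
  by move=> s0; apply: Gamma_n_sub => i; rewrite mxE.
have b0 : bdry Gam 0.
  split; last first.
    move=> /interior_subset /(cone_sub hGam); rewrite /Gamma_1 /= big1 ?ltxx // => i _.
    by rewrite mxE.
  apply/closure_enormP => d d0; exists (const_mx (d / n.+1%:R)).
    by apply: gc; rewrite divr_gt0.
  rewrite subr0; apply: (@le_lt_trans _ _ (n%:R * (d / n.+1%:R))).
    by apply: enorm_le_sum => i; rewrite mxE gtr0_norm // divr_gt0.
  by rewrite mulrCA -{2}[d]mulr1 ltr_pM2l // ltr_pdivrMr // mul1r ltr_nat.
have := (cont_atP _ _).1 (fun_continuous hf) 0 b0.1 1 ltr01.
rewrite (fun_bdry hf b0) => -[d d0 hd].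
exists (d / (n.+1%:R * 2)); first by rewrite divr_gt0.
move=> s s0 hs; have : `|f (const_mx s) - 0| < 1.
  apply: hd; first by apply: subset_closure; exact: gc.
  rewrite subr0; apply: (@le_lt_trans _ _ (n%:R * s)).
    by apply: enorm_le_sum => i; rewrite mxE gtr0_norm.
  apply: (@le_lt_trans _ _ (n.+1%:R * s)); first by rewrite ler_pM2r // ler_nat.
  apply: (@le_lt_trans _ _ (n.+1%:R * (d / (n.+1%:R * 2)))); first by rewrite ler_pM2l.
  have -> : n.+1%:R * (d / (n.+1%:R * 2)) = d / 2.
    have N0 : n.+1%:R != 0 :> R by rewrite pnatr_eq0.
    by set N := n.+1%:R in N0 *; field.
  by lra.
by rewrite subr0; apply: le_lt_trans; exact: ler_norm.
Qed.

Lemma f_eigvals A : A^T = A -> Gam (eigvals A) ->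
  Gam (evs A) /\ f (evs A) = f (eigvals A).
Proof.
move=> sA gA; have [s ->] := evs_perm A; split; first exact: (cone_sym hGam).
by rewrite (fun_sym hf) //; exact: subset_closure.
Qed.

End AdmissibleFunctions.

(** * First and second order expansions of functions of class C^k *)

Section Calculus.
Context {R : realType} {n : nat}.
Implicit Types (x y v p : 'rV[R]_n) (g : 'rV[R]_n -> R) (H : 'M[R]_n).
Implicit Types (E U : set 'rV[R]_n).

Local Notation e_ k := (delta_mx 0 k : 'rV[R]_n).

Definition pderiv g (k : 'I_n) x (d : R) : Prop :=
  is_derive (0 : R) 1 (fun s => g (x + s *: e_ k)) d.

Lemma derivable_pderiv g k x : derivable g x (e_ k) -> pderiv g k x (partial k g x).
Proof.
move=> dg; have dg0 : derivable g (x + 0 *: e_ k) (e_ k) by rewrite scale0r addr0.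
have := line_is_derive dg0; rewrite /pderiv -/(partial k g _).
by have -> : x + 0 *: e_ k = x by rewrite scale0r addr0.
Qed.

Lemma pderiv_mvt g k x (t : R) (dg : 'rV[R]_n -> R) :
    (forall c : R, 0 <= c <= 1 -> pderiv g k (x + (c * t) *: e_ k) (dg (x + (c * t) *: e_ k))) ->
  exists2 c : R, 0 <= c <= 1 & g (x + t *: e_ k) - g x = dg (x + (c * t) *: e_ k) * t.
Proof.
move=> h; pose G := fun s : R => g (x + (s * t) *: e_ k).
have dG (s : R) : 0 <= s <= 1 -> is_derive s 1 G (dg (x + (s * t) *: e_ k) * t).
  move=> /h; rewrite /pderiv; set F := (fun r => _) => dF.
  have -> : G = F \o (fun r => (r - s) * t).
    by apply/funext => r; rewrite /G /F /= -addrA -scalerDl; congr (g (x + _ *: _)); ring.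
  have dA : is_derive s 1 (fun r : R => (r - s) * t) t.
    by apply: is_derive_eq; rewrite /GRing.scale /=; ring.
  apply: is_derive1_comp; rewrite subrr mul0r; exact: dF.
have [||c cI] := @MVT_segment R G (fun s => dg (x + (s * t) *: e_ k) * t) 0 1 ler01.
- by move=> s /andP[s0 st]; apply: dG; rewrite !ltW.
- apply: derivable_within_continuous => s; rewrite in_itv /= => /dG dGs.
  exact: ex_derive.
rewrite /G mul0r scale0r addr0 mul1r subr0 mulr1 => ->.
by exists c => //; rewrite in_itv in cI.
Qed.

(** Telescopes along the path of [mixrow], which stays in the box because a box is a product of
    intervals; each leg is one use of the mean value theorem. *)
Lemma box_estimate g x0 (d e : R) (dg : 'I_n -> 'rV[R]_n -> R) p : 0 <= e ->
    (forall y, (forall i, `|y 0 i - x0 0 i| <= d) ->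
       forall k, pderiv g k y (dg k y) /\ `|dg k y - p 0 k| <= e) ->
  forall x y, (forall i, `|x 0 i - x0 0 i| <= d) -> (forall i, `|y 0 i - x0 0 i| <= d) ->
    `|g y - g x - edot p (y - x)| <= n%:R * e * enorm (y - x).
Proof.
move=> e0 h x y hx hy.
have hm k (r : R) (c : R) (kn : (k < n)%N) : 0 <= c <= 1 -> r = y 0 (Ordinal kn) - x 0 (Ordinal kn) ->
    forall i, `|(mixrow x y k + (c * r) *: e_ (Ordinal kn)) 0 i - x0 0 i| <= d.
  move=> /andP[c0 c1] -> i; rewrite !mxE eqxx /=.
  move: (hx i) (hy i); rewrite !ler_norml => /andP[a1 a2] /andP[b1 b2].
  have [ik|_] := eqVneq i (Ordinal kn).
    by rewrite ik /= ltnn mulr1 -ik; apply/andP; split; nra.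
  by rewrite mulr0 addr0; case: ifP => _; apply/andP.
suff Q k : (k <= n)%N -> `|g (mixrow x y k) - g x - edot p (mixrow x y k - x)| <=
    k%:R * (e * enorm (y - x)).
  by have := Q n (leqnn n); rewrite mixrow_n mulrA.
elim: k => [_|k IH kn].
  by rewrite mixrow0 !subrr edot0r subr0 normr0 mul0r.
have {}IH := IH (ltnW kn).
pose K := Ordinal kn; pose t := y 0 K - x 0 K.
have [c c01|c c01 ec] := @pderiv_mvt g K (mixrow x y k) t (dg K).
  exact: (h _ (hm _ _ _ kn c01 erefl) K).1.
have [_ hd] := h _ (hm _ t _ kn c01 erefl) K.
rewrite (mixrowS x y K) -/t -/K /=.
have -> : g (mixrow x y k + t *: e_ K) - g x - edot p (mixrow x y k + t *: e_ K - x) =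
   (g (mixrow x y k) - g x - edot p (mixrow x y k - x)) +
   (dg K (mixrow x y k + (c * t) *: e_ K) - p 0 K) * t.
  rewrite mulrBl -ec !edotE.
  have -> : edot p (e_ K) = p 0 K.
    rewrite /edot (bigD1 K) //= big1 ?addr0 => [|i iK]; rewrite !mxE ?eqxx ?mulr1 //.
    by rewrite (negbTE iK) mulr0.
  by ring.
apply: le_trans (ler_normD _ _) _.
rewrite (_ : k.+1%:R * (e * enorm (y - x)) =
  k%:R * (e * enorm (y - x)) + e * enorm (y - x)); last by rewrite -natr1; ring.
apply: lerD => //; rewrite normrM ler_pM //.
by have := coord_le_enorm (y - x) K; rewrite !mxE.
Qed.

(** Strict differentiability: both ends of the increment vary. At a boundary point it compares two
    nearby points with each other, with an error proportional to their mutual distance rather than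
    to their distance from [x]. *)
Definition sdiff E g x p : Prop := forall e, 0 < e -> exists2 d, 0 < d &
  forall y z, E y -> E z -> enorm (y - x) < d -> enorm (z - x) < d ->
    `|g z - g y - edot p (z - y)| <= e * enorm (z - y).

Definition jet2 g x p H : Prop := forall e, 0 < e -> exists2 d, 0 < d &
  forall v, enorm v < d ->
    `|g (x + v) - g x - edot p v - 2^-1 * qform H v| <= e * edot v v.

Definition grad g x : 'rV[R]_n := \row_i partial i g x.

Definition hess g x : 'M[R]_n := \matrix_(i, j) partials [:: i; j] g x.

Lemma Ck_partial k U g i : Ck_on k.+1 U g -> Ck_on k U (partial i g).
Proof.
move=> h s sk x Ux; have := h (rcons s i); rewrite size_rcons !ltnS => /(_ sk x Ux).
by rewrite /partials foldr_rcons.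
Qed.

Lemma C1_near U g x (e : R) : open U -> Ck_on 1 U g -> U x -> 0 < e ->
  exists2 d, 0 < d & forall y, enorm (y - x) < d -> U y /\
    forall k, `|partial k g y - partial k g x| < e.
Proof.
move=> /open_enormP oU h Ux e0; have [d d0 hd] := oU x Ux.
have [d' d'0 hd'] : exists2 d', 0 < d' & forall k : 'I_n,
    (forall y, enorm (y - x) < d' -> `|partial k g y - partial k g x| < e).
  apply: fin_choose => k.
  have [+ _] := h [:: k] isT x Ux.
  move=> /cvgrPdist_lt /(_ e e0) /nbhs_enormP[r r0 hr].
  exists r => // r' _ rr' y yr; rewrite distrC.
  by apply: hr; exact: lt_le_trans yr rr'.
exists (Num.min d d'); first by rewrite lt_min d0.
by move=> y; rewrite lt_min => /andP[y1 y2]; split; [exact: hd|move=> k; exact: hd'].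
Qed.

Lemma C1_sdiff U g x : open U -> Ck_on 1 U g -> U x -> sdiff setT g x (grad g x).
Proof.
move=> oU h Ux e e0; have e'0 : 0 < e / n.+1%:R by rewrite divr_gt0.
have [d d0 hd] := C1_near oU h Ux e'0.
exists (d / n.+1%:R); first by rewrite divr_gt0.
have inb y : (forall i, `|y 0 i - x 0 i| <= d / n.+1%:R) -> enorm (y - x) < d.
  move=> hy; apply: (@le_lt_trans _ _ (n%:R * (d / n.+1%:R))).
    by apply: enorm_le_sum => i; rewrite !mxE.
  by rewrite mulrCA -{2}[d]mulr1 ltr_pM2l // ltr_pdivrMr // mul1r ltr_nat.
have co y : enorm (y - x) < d / n.+1%:R -> forall i, `|y 0 i - x 0 i| <= d / n.+1%:R.
  by move=> hy i; apply: le_trans (ltW hy); have := coord_le_enorm (y - x) i; rewrite !mxE.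
move=> y z _ _ /co hy /co hz.
have := @box_estimate g x (d / n.+1%:R) (e / n.+1%:R) (fun k => partial k g) (grad g x)
  (ltW e'0) _ y z hy hz.
move=> hh; apply: le_trans (hh _) _ => [w /inb hw k|].
  have [Uw hwk] := hd w hw; split; last by rewrite mxE ltW.
  by apply: derivable_pderiv; have [_ /(_ isT k)] := h [::] isT w Uw.
rewrite ler_wpM2r ?enorm_ge0 // mulrCA -{2}[e]mulr1 ler_pM2l // ler_pdivrMr //.
by rewrite mul1r ler_nat.
Qed.

Lemma edot_delta p k : edot p (e_ k) = p 0 k.
Proof.
rewrite /edot (bigD1 k) //= big1 ?addr0 => [|i iK]; rewrite !mxE ?eqxx ?mulr1 //.
by rewrite (negbTE iK) mulr0.
Qed.

Lemma enorm_delta k : enorm (e_ k) = 1.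
Proof. by rewrite /enorm edot_delta mxE !eqxx sqrtr1. Qed.

(** Schwarz's argument: the mean value theorem in direction [j], then strict differentiability of
    the j-th partial derivative across the step in direction [i]. The second difference is symmetric
    in [i] and [j]. *)
Lemma second_difference U g x i j (e : R) : open U -> Ck_on 2 U g -> U x -> 0 < e ->
  exists2 d, 0 < d & forall t : R, 0 < t < d ->
    `|g (x + t *: e_ i + t *: e_ j) - g (x + t *: e_ i) - g (x + t *: e_ j) + g x
      - hess g x i j * t ^+ 2| <= e * t ^+ 2.
Proof.
move=> oU h Ux e0; have hj : Ck_on 1 U (partial j g) by exact: Ck_partial.
have [d d0 hd] := C1_sdiff oU hj Ux e0.
have [r r0 hr] := (open_enormP U).1 oU x Ux.
exists (Num.min d r / 3); first by rewrite divr_gt0 // lt_min d0.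
move=> t /andP[t0 td].
have small (a b : R) : 0 <= a <= t -> 0 <= b <= t ->
    enorm (x + a *: e_ i + b *: e_ j - x) < Num.min d r.
  move=> /andP[a0 a1] /andP[b0 b1].
  rewrite addrAC (addrAC x) subrr add0r; apply: le_lt_trans (enormD _ _) _.
  rewrite !enormZ !enorm_delta !ger0_norm // !mulr1.
  by move: td; rewrite ltr_pdivlMr //; lra.
have inU a b : 0 <= a <= t -> 0 <= b <= t -> U (x + a *: e_ i + b *: e_ j).
  move=> ha hb; apply: hr; apply: lt_le_trans (small a b ha hb) _.
  by rewrite ge_min lexx orbT.
have ind a b : 0 <= a <= t -> 0 <= b <= t -> enorm (x + a *: e_ i + b *: e_ j - x) < d.
  by move=> ha hb; apply: lt_le_trans (small a b ha hb) _; rewrite ge_min lexx.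
have z0 : (0 : R) <= 0 <= t by apply/andP; split => //; exact: ltW.
have tt : 0 <= t <= t by apply/andP; split => //; exact: ltW.
pose F (s : R) := g (x + t *: e_ i + s *: e_ j) - g (x + 0 *: e_ i + s *: e_ j).
have dg a b : 0 <= a <= t -> 0 <= b <= t -> derivable g (x + a *: e_ i + b *: e_ j) (e_ j).
  by move=> ha hb; have [_ /(_ isT j)] := h [::] isT _ (inU a b ha hb).
have dF (s : R) : 0 <= s <= t -> is_derive s 1 F
   (partial j g (x + t *: e_ i + s *: e_ j) - partial j g (x + 0 *: e_ i + s *: e_ j)).
  move=> hs; have d1 := line_is_derive (dg t s tt hs).
  have d2 := line_is_derive (dg 0 s z0 hs).
  exact: (is_deriveB d1 d2).
have [||c cI] := @MVT_segment R F (fun s => partial j g (x + t *: e_ i + s *: e_ j) -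
    partial j g (x + 0 *: e_ i + s *: e_ j)) 0 t (ltW t0).
- by move=> s /andP[s0 st]; apply: dF; rewrite !ltW.
- apply: derivable_within_continuous => s; rewrite in_itv /= => /dF dGs.
  exact: ex_derive.
have c0t : 0 <= c <= t by rewrite in_itv in cI.
rewrite /F !scale0r !addr0 subr0 => eF.
have -> : g (x + t *: e_ i + t *: e_ j) - g (x + t *: e_ i) - g (x + t *: e_ j) + g x =
  g (x + t *: e_ i + t *: e_ j) - g (x + t *: e_ j) - (g (x + t *: e_ i) - g x) by ring.
rewrite eF.
have := hd (x + 0 *: e_ i + c *: e_ j) (x + t *: e_ i + c *: e_ j) I I
  (ind _ _ z0 c0t) (ind _ _ tt c0t).
have -> : x + t *: e_ i + c *: e_ j - (x + 0 *: e_ i + c *: e_ j) = t *: e_ i.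
  by rewrite scale0r addr0 opprD addrACA subrr addr0 addrAC subrr add0r.
rewrite edotZr edot_delta enormZ enorm_delta mulr1 (gtr0_norm t0) scale0r addr0.
rewrite !mxE -[partial i (partial j g) x]/(partials [:: i; j] g x).
set A := partial j g _; set B := partial j g _; set C := partials _ _ _ => h1.
have -> : (A - B) * t - C * t ^+ 2 = (A - B - t * C) * t by ring.
by rewrite normrM (gtr0_norm t0) expr2 mulrA ler_pM2r.
Qed.

Lemma hess_sym U g x : open U -> Ck_on 2 U g -> U x -> (hess g x)^T = hess g x.
Proof.
move=> oU h Ux; apply/matrixP => i j; rewrite mxE; apply/eqP.
rewrite -subr_eq0 -normr_le0; apply/ler_addgt0Pl => e e0; rewrite addr0.
have e2 : 0 < e / 2 by rewrite divr_gt0.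
have [d1 d10 h1] := second_difference i j oU h Ux e2.
have [d2 d20 h2] := second_difference j i oU h Ux e2.
pose t := Num.min d1 d2 / 2.
have m0 : 0 < Num.min d1 d2 by rewrite lt_min d10.
have t0 : 0 < t by rewrite divr_gt0.
have tm : t < Num.min d1 d2 by rewrite /t; lra.
have := h1 t; rewrite t0 (lt_le_trans tm) ?ge_min ?lexx // => /(_ isT) a1.
have := h2 t; rewrite t0 (lt_le_trans tm) ?ge_min ?lexx ?orbT // => /(_ isT).
rewrite (addrAC x) => a2.
rewrite -(@ler_pM2r _ (t ^+ 2)) ?exprn_gt0 // -[X in _ * X <= _]gtr0_norm ?exprn_gt0 //.
rewrite -normrM.
move: a1 a2; set G := g _; set G1 := g _; set G2 := g _; set G0 := g _.
rewrite !ler_norml => /andP[b1 b2] /andP[b3 b4].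
by apply/andP; split; lra.
Qed.

Lemma qform_add H x v : H^T = H -> qform H (x + v) = qform H x + 2 * edot (x *m H) v + qform H v.
Proof.
move=> sH; rewrite /qform mulmxDl !edotE.
have -> : edot (v *m H) x = edot (x *m H) v.
  rewrite /edot; under eq_bigr do rewrite mxE mulr_suml.
  rewrite exchange_big; apply: eq_bigr => i _ /=; rewrite mxE mulr_suml.
  by apply: eq_bigr => j _; rewrite -{1}sH mxE; ring.
by ring.
Qed.

Lemma qformZ H (t : R) v : qform H (t *: v) = t ^+ 2 * qform H v.
Proof. by rewrite /qform -scalemxAl !edotE; ring. Qed.

(** The Taylor remainder [phi] has first derivatives of size o(|y|), by the expansion of each first
    derivative of [g]; [box_estimate] then bounds its increment by o(|v|^2). *)
Lemma C2_jet2 U g x : open U -> Ck_on 2 U g -> U x -> jet2 g x (grad g x) (hess g x).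
Proof.
move=> oU h Ux e e0; have sH := hess_sym oU h Ux; set H := hess g x in sH *.
have N0 : 0 < n.+1%:R :> R by [].
have e'0 : 0 < e / n.+1%:R by rewrite divr_gt0.
have [d d0 hd] : exists2 d, 0 < d & forall k : 'I_n, forall y, enorm y < d ->
    `|partial k g (x + y) - grad g x 0 k - (y *m H) 0 k| <= e / n.+1%:R ^+ 2 * enorm y.
  apply: fin_choose => k.
  have hk : Ck_on 1 U (partial k g) by exact: Ck_partial.
  have e''0 : 0 < e / n.+1%:R ^+ 2 by rewrite divr_gt0 // exprn_gt0.
  have [r r0 hr] := C1_sdiff oU hk Ux e''0.
  exists r => // r' r'0 rr' y yr; have yr' := lt_le_trans yr rr'.
  have := hr x (x + y) I I; rewrite subrr enorm0 => /(_ r0).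
  rewrite addrAC subrr add0r => /(_ yr').
  have -> : edot (grad (partial k g) x) y = (y *m H) 0 k.
    rewrite /edot mxE; apply: eq_bigr => i _.
    have -> : grad (partial k g) x 0 i = H i k by rewrite /H 2!mxE.
    by rewrite mulrC.
  by have -> : grad g x 0 k = partial k g x by rewrite mxE.
have [r r0 hr] := (open_enormP U).1 oU x Ux.
pose D := Num.min d r.
have D0 : 0 < D by rewrite lt_min d0.
exists (D / n.+1%:R); first by rewrite divr_gt0.
move=> v vD.
pose phi y := g (x + y) - edot (grad g x) y - 2^-1 * qform H y.
pose dphi k y := partial k g (x + y) - grad g x 0 k - (y *m H) 0 k.
have nv0 := enorm_ge0 v.
have vbox y : (forall i, `|y 0 i - (0 : 'rV[R]_n) 0 i| <= enorm v) -> enorm y <= n.+1%:R * enorm v.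
  move=> hy; apply: (@le_trans _ _ (n%:R * enorm v)).
    by apply: enorm_le_sum => i; have := hy i; rewrite mxE subr0.
  by rewrite ler_wpM2r // ler_nat.
have := @box_estimate phi 0 (enorm v) (e / n.+1%:R * enorm v) dphi 0.
rewrite mulr_ge0 ?(ltW e'0) // => /(_ isT) hb.
have phi0 : phi 0 = g x.
  by rewrite /phi addr0 edot0r /qform mul0mx edot0l mulr0 !subr0.
have phiv : phi v - g x = g (x + v) - g x - edot (grad g x) v - 2^-1 * qform H v.
  by rewrite /phi; ring.
have hb' := hb _ 0 v _ _; rewrite phi0 subr0 edot0l subr0 phiv in hb'.
apply: le_trans (hb' _ _ _) _.
- move=> y /vbox hy k.
  have yD : enorm y < D.
    by apply: le_lt_trans hy _; rewrite mulrC -ltr_pdivlMr.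
  split; last first.
    rewrite mxE subr0; apply: le_trans (hd k y _) _.
      by apply: lt_le_trans yD _; rewrite ge_min lexx.
    apply: (@le_trans _ _ (e / n.+1%:R ^+ 2 * (n.+1%:R * enorm v))).
      by rewrite ler_wpM2l // divr_ge0 ?exprn_ge0 // ltW.
    by rewrite mulrA expr2 invfM mulrA mulrVK // unitfE gt_eqF.
  have Uy : U (x + y).
    apply: hr; rewrite addrAC subrr add0r; apply: lt_le_trans yD _.
    by rewrite ge_min lexx orbT.
  have dg : derivable g (x + y) (e_ k) by have [_ /(_ isT k)] := h [::] isT _ Uy.
  have d1 := derivable_pderiv dg.
  rewrite /pderiv /phi.
  have -> : (fun s => g (x + (y + s *: e_ k)) - edot (grad g x) (y + s *: e_ k) -
       2^-1 * qform H (y + s *: e_ k)) =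
     (fun s => g (x + y + s *: e_ k)) - (fun s : R => edot (grad g x) y + 2^-1 * qform H y +
       s * (grad g x 0 k + (y *m H) 0 k) + s ^+ 2 * (2^-1 * qform H (e_ k))).
    apply/funext => s /=; rewrite addrA !fctE.
    by rewrite qform_add // qformZ !edotE !edot_delta; field.
  have d2 : is_derive (0 : R) 1 (fun s : R => edot (grad g x) y + 2^-1 * qform H y +
       s * (grad g x 0 k + (y *m H) 0 k) + s ^+ 2 * (2^-1 * qform H (e_ k)))
       (grad g x 0 k + (y *m H) 0 k).
    by apply: is_derive_eq; rewrite /GRing.scale /=; ring.
  have := is_deriveB d1 d2; congr (is_derive _ _ _ _).
  by rewrite /dphi; ring.
- by move=> i; rewrite subrr normr0.
- by move=> i; rewrite mxE subr0 coord_le_enorm.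
rewrite -sqr_enorm; have -> : n%:R * (e / n.+1%:R * enorm v) * enorm v =
  n%:R / n.+1%:R * (e * enorm v ^+ 2) by ring.
rewrite -[leRHS]mul1r ler_wpM2r ?mulr_ge0 ?exprn_ge0 ?(ltW e0) //.
by rewrite ler_pdivrMr // mul1r ler_nat.
Qed.

End Calculus.

(** * Second order expansions and inversions *)

Section Jets.
Context {R : realType} {n : nat}.
Implicit Types (x y v p q : 'rV[R]_n) (g h : 'rV[R]_n -> R) (H K : 'M[R]_n).

Definition mxsize H : R := \sum_i \sum_j `|H i j|.

Lemma mxsize_ge0 H : 0 <= mxsize H.
Proof. by apply: sumr_ge0 => i _; apply: sumr_ge0 => j _. Qed.

Lemma enorm_mulmx v H : enorm (v *m H) <= mxsize H * enorm v.
Proof.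
have esum (I : finType) (F : I -> 'rV[R]_n) : enorm (\sum_i F i) <= \sum_i enorm (F i).
  elim/big_rec2: _ => [|i a b _ le]; first by rewrite enorm0.
  by apply: le_trans (enormD _ _) _; rewrite lerD2l.
rewrite mulmx_sum_row; apply: le_trans (esum _ _) _.
rewrite /mxsize mulr_suml; apply: ler_sum => i _; rewrite enormZ mulrC.
apply: ler_pM; rewrite ?enorm_ge0 ?coord_le_enorm //.
rewrite [row i H]row_sum_delta; apply: le_trans (esum _ _) _.
by apply: ler_sum => j _; rewrite enormZ enorm_delta mulr1 mxE.
Qed.

Lemma qform_le H v : `|qform H v| <= mxsize H * edot v v.
Proof.
apply: le_trans (edot_le _ _) _; rewrite -sqr_enorm expr2 mulrA.
by rewrite ler_wpM2r ?enorm_ge0 // enorm_mulmx.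
Qed.

Lemma qformD H K v : qform (H + K) v = qform H v + qform K v.
Proof. by rewrite /qform mulmxDr edotDl. Qed.

Lemma qformN H v : qform (- H) v = - qform H v.
Proof. by rewrite /qform mulmxN edotNl. Qed.

Lemma qformZl (a : R) H v : qform (a *: H) v = a * qform H v.
Proof. by rewrite /qform -scalemxAr edotZl. Qed.

Lemma qform_scalar (a : R) v : qform a%:M v = a * edot v v.
Proof. by rewrite /qform mul_mx_scalar edotZl. Qed.

Lemma qform_outer p v : qform (p^T *m p) v = edot p v ^+ 2.
Proof.
rewrite /qform mulmxA.
have -> : v *m p^T = (edot p v)%:M.
  by apply/matrixP => i j; rewrite !ord1 !mxE eqxx mulr1n; apply: eq_bigr => k _;
     rewrite !mxE mulrC.
by rewrite mul_scalar_mx edotZl expr2.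
Qed.

Definition qformE := (qformD, qformN, qformZl, qform_scalar, qform_outer).

Lemma jet2_eq g h x p H q K : g =1 h -> p = q -> H = K -> jet2 h x q K -> jet2 g x p H.
Proof.
move=> gh -> -> hj e e0; have [d d0 hd] := hj e e0; exists d => // v vd.
by rewrite !gh; exact: hd.
Qed.

Lemma jet2D g h x p q H K : jet2 g x p H -> jet2 h x q K ->
  jet2 (fun y => g y + h y) x (p + q) (H + K).
Proof.
move=> jg jh e e0; have e2 : 0 < e / 2 by rewrite divr_gt0.
have [d d0 hd] := jg _ e2; have [d' d'0 hd'] := jh _ e2.
exists (Num.min d d'); first by rewrite lt_min d0.
move=> v; rewrite lt_min => /andP[/hd h1 /hd' h2].
rewrite qformD edotDl; have := lerD h1 h2.
rewrite -mulrDl -splitr; apply: le_trans; apply: le_trans (ler_normD _ _).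
by rewrite le_eqVlt; apply/orP; left; apply/eqP; congr `|_|; ring.
Qed.

Lemma jet2Z (a : R) g x p H : jet2 g x p H -> jet2 (fun y => a * g y) x (a *: p) (a *: H).
Proof.
move=> jg e e0; have ea : 0 < e / (`|a| + 1) by rewrite divr_gt0 // ltr_wpDl.
have [d d0 hd] := jg _ ea; exists d => // v /hd h1.
rewrite qformZl edotZl.
have -> : a * g (x + v) - a * g x - a * edot p v - 2^-1 * (a * qform H v) =
  a * (g (x + v) - g x - edot p v - 2^-1 * qform H v) by ring.
rewrite normrM; apply: le_trans (ler_wpM2l (normr_ge0 a) h1) _.
rewrite mulrA ler_wpM2r ?edot_ge0 // mulrCA -[leRHS]mulr1 ler_pM2l //.
by rewrite ler_pdivrMr ?ltr_wpDl // mul1r lerDl.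
Qed.

Lemma jet2N g x p H : jet2 g x p H -> jet2 (fun y => - g y) x (- p) (- H).
Proof.
by move=> /(jet2Z (-1)); apply: jet2_eq => [y||]; rewrite ?mulN1r ?scaleN1r.
Qed.

Lemma jet2B g h x p q H K : jet2 g x p H -> jet2 h x q K ->
  jet2 (fun y => g y - h y) x (p - q) (H - K).
Proof. by move=> jg /jet2N; exact: jet2D. Qed.

Definition taylor2 (phi : R -> R) (t a b : R) : Prop := forall e, 0 < e -> exists2 d, 0 < d &
  forall s, `|s| < d -> `|phi (t + s) - phi t - a * s - 2^-1 * b * s ^+ 2| <= e * s ^+ 2.

Lemma jet2_comp phi (a b : R) g x p H : jet2 g x p H -> taylor2 phi (g x) a b ->
  jet2 (fun y => phi (g y)) x (a *: p) (a *: H + b *: (p^T *m p)).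
Proof.
move=> jg tp.
pose M := mxsize H + 1.
have M0 : 0 < M by rewrite ltr_wpDl ?mxsize_ge0.
pose P := enorm p + M.
have P0 : 0 < P by rewrite ltr_wpDl ?enorm_ge0.
have [d1 d10 hd1] := jg 2^-1 ltac:(by rewrite invr_gt0).
(* the increment s = g (x + v) - g x satisfies |s| <= P |v| and |s - p.v| <= M |v|^2 *)
have inc v : enorm v < Num.min d1 1 -> `|g (x + v) - g x| <= P * enorm v /\
    `|g (x + v) - g x - edot p v| <= M * edot v v.
  rewrite lt_min => /andP[/hd1 h1 v1].
  have h2 := qform_le H v; have nv := enorm_ge0 v.
  have h3 : `|g (x + v) - g x - edot p v| <= M * edot v v.
    rewrite -[_ - edot p v](subrK (2^-1 * qform H v)).
    apply: le_trans (ler_normD _ _) _; rewrite normrM.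
    have := edot_ge0 v; have := mulr_ge0 (mxsize_ge0 H) (edot_ge0 v); rewrite /M.
    by rewrite (@ger0_norm _ 2^-1) ?invr_ge0 //; lra.
  split => //; rewrite -[_ - g x](subrK (edot p v)).
  apply: le_trans (ler_normD _ _) _; rewrite /P mulrDl addrC.
  apply: lerD; first exact: edot_le.
  apply: le_trans h3 _; rewrite -sqr_enorm ler_pM2l // expr2.
  by rewrite -[leRHS]mulr1 ler_wpM2l // ltW.
move=> e e0.
have [d2 d20 hd2] := jg (e / (`|a| + 1) / 3) ltac:(by rewrite !divr_gt0 // ltr_wpDl).
have [d3 d30 hd3] := tp (e / P ^+ 2 / 3) ltac:(by rewrite !divr_gt0 // exprn_gt0).
pose D := Num.min (Num.min d1 1) (Num.min d2 (Num.min (d3 / P) (e / 3 / ((`|b| + 1) * M * (P + enorm p + 1))))).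
have b1 : 0 < `|b| + 1 by rewrite ltr_wpDl.
have a1 : 0 < `|a| + 1 by rewrite ltr_wpDl.
have Q0 : 0 < P + enorm p + 1 by rewrite ltr_wpDl // addr_ge0 ?enorm_ge0 // ltW.
exists D; first by rewrite !lt_min d10 ltr01 d20 !divr_gt0 // !mulr_gt0.
move=> v; rewrite /D !lt_min => /andP[vd1 /andP[vd2 /andP[vd3 vd4]]].
have [i1 i2] := inc v ltac:(by rewrite lt_min).
have nv := enorm_ge0 v.
set s := g (x + v) - g x in i1 i2.
have gs : g (x + v) = g x + s by rewrite /s; ring.
have h3 := hd3 s; rewrite gs.
have {}h3 : `|phi (g x + s) - phi (g x) - a * s - 2^-1 * b * s ^+ 2| <= e / 3 * edot v v.
  apply: le_trans (h3 _) _.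
    by apply: le_lt_trans i1 _; rewrite mulrC -ltr_pdivlMr.
  rewrite -sqr_enorm; have : s ^+ 2 <= P ^+ 2 * enorm v ^+ 2.
    by rewrite -exprMn -real_normK ?num_real // ler_pXn2r ?nnegrE // mulr_ge0 // ltW.
  have -> : e / P ^+ 2 / 3 * s ^+ 2 = e / 3 * (s ^+ 2 / P ^+ 2) by ring.
  by move=> le; rewrite ler_pM2l ?divr_gt0 // ler_pdivrMr ?exprn_gt0 // mulrC.
have h2 : `|a * (s - edot p v - 2^-1 * qform H v)| <= e / 3 * edot v v.
  rewrite normrM; apply: le_trans (ler_wpM2l (normr_ge0 a) (hd2 v vd2)) _.
  have -> : `|a| * (e / (`|a| + 1) / 3 * edot v v) = `|a| / (`|a| + 1) * (e / 3 * edot v v).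
    by ring.
  rewrite -[leRHS]mul1r ler_wpM2r ?mulr_ge0 ?edot_ge0 ?invr_ge0 // ?ltW //.
  by rewrite ltr_pdivrMr // mul1r ltrDl.
have h4 : `|2^-1 * b * (s ^+ 2 - edot p v ^+ 2)| <= e / 3 * edot v v.
  have -> : s ^+ 2 - edot p v ^+ 2 = (s - edot p v) * (s + edot p v) by ring.
  have i3 : `|s + edot p v| <= (P + enorm p + 1) * enorm v.
    apply: le_trans (ler_normD _ _) _; have := edot_le p v; lra.
  rewrite !normrM (@ger0_norm _ 2^-1) ?invr_ge0 //.
  have i4 : `|s - edot p v| * `|s + edot p v| <=
      (M * edot v v) * ((P + enorm p + 1) * enorm v) by apply: ler_pM.
  have i5 : enorm v * ((`|b| + 1) * M * (P + enorm p + 1)) <= e / 3.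
    by rewrite -ler_pdivlMr ?mulr_gt0 // ltW.
  have ev := edot_ge0 v; have bb := normr_ge0 b.
  apply: (@le_trans _ _ ((`|b| + 1) * ((M * edot v v) * ((P + enorm p + 1) * enorm v)))).
    apply: ler_pM => //; rewrite ?mulr_ge0 //; lra.
  have -> : (`|b| + 1) * ((M * edot v v) * ((P + enorm p + 1) * enorm v)) =
    enorm v * ((`|b| + 1) * M * (P + enorm p + 1)) * edot v v by ring.
  by rewrite ler_wpM2r.
rewrite qformD !qformZl qform_outer edotZl.
have -> : phi (g x + s) - phi (g x) - a * edot p v -
    2^-1 * (a * qform H v + b * edot p v ^+ 2) =
  (phi (g x + s) - phi (g x) - a * s - 2^-1 * b * s ^+ 2) +
  a * (s - edot p v - 2^-1 * qform H v) + 2^-1 * b * (s ^+ 2 - edot p v ^+ 2) by ring.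
apply: le_trans (ler_normD _ _) _; apply: le_trans (lerD (ler_normD _ _) (lexx _)) _.
by have := lerD (lerD h3 h2) h4; lra.
Qed.

(** The expansion is nonnegative along every short ray: the ray in direction [- p] shows that the
    gradient vanishes, after which the quadratic term decides. *)
Lemma jet2_min g x p H (d : R) : jet2 g x p H -> 0 < d ->
    (forall v, enorm v < d -> g x <= g (x + v)) ->
  p = 0 /\ forall v, 0 <= qform H v.
Proof.
move=> jg d0 hd.
have key v : forall e, 0 < e -> exists2 t0 : R, 0 < t0 & forall t, 0 < t < t0 ->
    0 <= t * edot p v + t ^+ 2 * (2^-1 * qform H v + e).
  move=> e e0; have ev := edot_ge0 v; have nv := enorm_ge0 v.
  have [r r0 hr] := jg (e / (edot v v + 1)) ltac:(by rewrite divr_gt0 // ltr_wpDl).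
  exists (Num.min d r / (enorm v + 1)); first by rewrite divr_gt0 ?lt_min ?d0 // ltr_wpDl.
  move=> t /andP[t0 tt].
  have tv : enorm (t *: v) < Num.min d r.
    rewrite enormZ gtr0_norm //; move: tt; rewrite ltr_pdivlMr ?ltr_wpDl //.
    by apply: le_lt_trans; rewrite ler_pM2l // lerDl.
  move: tv; rewrite lt_min => /andP[/hd h1 /hr].
  rewrite ler_norml !edotE qformZ => /andP[_ h2].
  have h3 : e / (edot v v + 1) * (t * (t * edot v v)) <= t ^+ 2 * e.
    have -> : e / (edot v v + 1) * (t * (t * edot v v)) =
      t ^+ 2 * e * (edot v v / (edot v v + 1)) by ring.
    rewrite -[leRHS]mulr1 ler_wpM2l ?mulr_ge0 ?exprn_ge0 ?(ltW e0) ?(ltW t0) //.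
    by rewrite ler_pdivrMr ?ltr_wpDl // mul1r lerDl.
  lra.
have p0 : p = 0.
  apply/eqP; rewrite -edot_eq0; apply/negPn/negP => pn.
  have pp : 0 < edot p p by rewrite lt_def pn edot_ge0.
  have [t0 t00 ht] := key (- p) 1 ltr01.
  pose c := `|2^-1 * qform H (- p) + 1| + 1.
  have c0 : 0 < c by rewrite ltr_wpDl.
  pose t := Num.min t0 (edot p p / c) / 2.
  have m0 : 0 < Num.min t0 (edot p p / c) by rewrite lt_min t00 divr_gt0.
  have tp : 0 < t by rewrite divr_gt0.
  have tm : t < Num.min t0 (edot p p / c) by rewrite /t; lra.
  move: tm; rewrite lt_min ltr_pdivlMr // => /andP[tt0 tc].
  have := ht t; rewrite tp tt0 => /(_ isT); rewrite edotNr => h.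
  have : 2^-1 * qform H (- p) + 1 <= c.
    by apply: le_trans (ler_norm _) _; rewrite /c lerDl.
  by nra.
split => // v; rewrite leNgt; apply/negP => neg.
have [|t0 t00 ht] := key v (- (4^-1 * qform H v)); first by lra.
have := ht (t0 / 2); rewrite p0 edot0l mulr0 add0r => h.
have h2 : 0 < t0 / 2 < t0 by apply/andP; split; lra.
have := h h2; have : 0 < (t0 / 2) ^+ 2 by rewrite exprn_gt0 // divr_gt0.
by nra.
Qed.

End Jets.

(** * Kelvin transform and conformal invariance *)

Section ConformalMatrix.
Context {R : realType} {n : nat}.
Implicit Types (x y z v p q : 'rV[R]_n) (g h w : 'rV[R]_n -> R) (H K M : 'M[R]_n).
Implicit Types (E : set 'rV[R]_n) (L t : R).

Lemma edot_mulmx v q M : edot (v *m M) q = edot v (q *m M^T).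
Proof.
rewrite /edot; under eq_bigr do rewrite mxE mulr_suml.
rewrite exchange_big; apply: eq_bigr => i _ /=; rewrite mxE mulr_sumr.
by apply: eq_bigr => j _; rewrite mxE; ring.
Qed.

(* The Schouten matrix of the metric w^-2 |dx|^2, given the 2-jet of w. *)
Definition confA t p H : 'M[R]_n := t *: H - (2^-1 * edot p p)%:M.

Lemma confA_sym t p H : H^T = H -> (confA t p H)^T = confA t p H.
Proof. by move=> sH; rewrite /confA linearB /= linearZ /= sH tr_scalar_mx. Qed.

Lemma qform_confA t p H v :
  qform (confA t p H) v = t * qform H v - 2^-1 * edot p p * edot v v.
Proof. by rewrite /confA !qformE. Qed.

Lemma jet2_touch g h x p q H K (d : R) : jet2 g x p H -> jet2 h x q K -> 0 < d ->
    (forall v, enorm v < d -> h x - g x <= h (x + v) - g (x + v)) ->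
  p = q /\ forall v, qform H v <= qform K v.
Proof.
move=> jg jh d0 hd; have [pq hk] := jet2_min (jet2B jh jg) d0 hd.
split; first by apply/esym/eqP; rewrite -subr_eq0 pq.
by move=> v; have := hk v; rewrite !qformE subr_ge0.
Qed.

(** The Householder reflection in the hyperplane orthogonal to [z]. Up to the dilation factor it is
    the derivative of the inversion at a point with position vector [z] from the center. *)
Definition reflmx z : 'M[R]_n := 1%:M - (2 / edot z z) *: (z^T *m z).

Lemma mul_reflmx z v : v *m reflmx z = v - (2 * edot z v / edot z z) *: z.
Proof.
rewrite /reflmx mulmxBr mulmx1 -scalemxAr mulmxA.
have -> : v *m z^T = (edot z v)%:M.
  by apply/matrixP => i j; rewrite !ord1 !mxE eqxx mulr1n; apply: eq_bigr => k _;
     rewrite !mxE mulrC.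
by rewrite mul_scalar_mx scalerA; congr (_ - _ *: _); ring.
Qed.

Lemma reflmx_sym z : (reflmx z)^T = reflmx z.
Proof. by rewrite /reflmx linearB /= linearZ /= trmx1 trmx_mul trmxK. Qed.

Lemma reflmx_reflmx z : z != 0 -> reflmx z *m reflmx z = 1%:M.
Proof.
move=> z0; have zz := edot_gt0 z0; apply/row_matrixP => i.
rewrite row_mul mul_reflmx rowE mul_reflmx !edotE.
have -> : row i (1%:M : 'M[R]_n) = delta_mx 0 i by rewrite rowE mulmx1.
set a := edot z (delta_mx 0 i).
rewrite -addrA -opprD -scalerDl; set c := (X in X *: z).
have -> : c = 0 by rewrite /c; field; exact: lt0r_neq0.
by rewrite scale0r subr0.
Qed.

Lemma edot_reflmx z v q : z != 0 -> edot (v *m reflmx z) (q *m reflmx z) = edot v q.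
Proof. by move=> z0; rewrite edot_mulmx reflmx_sym -mulmxA reflmx_reflmx ?mulmx1. Qed.

Lemma enorm_reflmx z v : z != 0 -> enorm (v *m reflmx z) = enorm v.
Proof. by move=> z0; rewrite /enorm edot_reflmx. Qed.

Lemma qform_reflmx z M v : qform (reflmx z *m M *m reflmx z) v = qform M (v *m reflmx z).
Proof. by rewrite /qform !mulmxA edot_mulmx reflmx_sym. Qed.

Lemma evs_reflmx z M : z != 0 -> evs (reflmx z *m M *m reflmx z) = evs M.
Proof.
move=> z0; rewrite /evs /evseq /eigvals char_poly_similar //.
exact: reflmx_reflmx.
Qed.

Lemma edot_comb (a : R) p q :
  edot (a *: p + q) (a *: p + q) = a ^+ 2 * edot p p + 2 * a * edot p q + edot q q.
Proof. by rewrite !edotE (edotC q p); ring. Qed.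

Lemma edot_sqrD p q : edot (p + q) (p + q) = edot p p + 2 * edot p q + edot q q.
Proof. by rewrite !edotE (edotC q p); ring. Qed.

Definition sphinv z L y := z + (L / edot (y - z) (y - z)) *: (y - z).

Lemma sphinvE z L p : sphinv z L (z + p) = z + (L / edot p p) *: p.
Proof. by rewrite /sphinv addrAC subrr add0r. Qed.

(** The usual factor (sqrt L/|y-z|)^(n-2) for [u], raised to the power -2/(n-2), becomes |y-z|^2/L,
    in which the dimension no longer appears. *)
Definition kelvin z L w y := edot (y - z) (y - z) / L * w (sphinv z L y).

Section KelvinJet.
Variables (z zeta : 'rV[R]_n) (L : R).
Hypotheses (L0 : 0 < L) (yz : zeta != 0).

(** With [kelvin_hess], the first and second derivatives of the Kelvin transform at [z + zeta],
    where [t], [p] and [H] are the value, gradient and Hessian of [w] at the image point. *)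
Definition kelvin_grad (t : R) p := (2 * t / L) *: zeta + p *m reflmx zeta.

Definition kelvin_hess (t : R) p H : 'M[R]_n :=
  (2 * (t / L - edot p zeta / edot zeta zeta))%:M
  + (L / edot zeta zeta) *: (reflmx zeta *m H *m reflmx zeta).

Let D0 : edot zeta zeta != 0. Proof. by rewrite lt0r_neq0 ?edot_gt0. Qed.

Let Ln0 : L != 0. Proof. by rewrite lt0r_neq0. Qed.

Lemma edot_reflmx_self p : edot (p *m reflmx zeta) zeta = - edot p zeta.
Proof. by rewrite mul_reflmx !edotE (edotC zeta p); field. Qed.

(** Conformal invariance: the Schouten matrix of the Kelvin transform is the one of [w] at the image
    point, conjugated by an orthogonal reflection, so the eigenvalues agree. *)
Lemma kelvin_confA t p H :
  confA (edot zeta zeta / L * t) (kelvin_grad t p) (kelvin_hess t p H) =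
  reflmx zeta *m confA t p H *m reflmx zeta.
Proof.
have [OO er eo] : [/\ reflmx zeta *m reflmx zeta = 1%:M,
  edot (p *m reflmx zeta) zeta = - edot p zeta &
  edot (p *m reflmx zeta) (p *m reflmx zeta) = edot p p].
  by rewrite reflmx_reflmx // edot_reflmx // edot_reflmx_self.
rewrite /kelvin_grad /kelvin_hess.
move: (reflmx zeta) OO er eo => O OO er eo.
have -> : O *m confA t p H *m O = t *: (O *m H *m O) - (2^-1 * edot p p)%:M.
  rewrite /confA mulmxBr mulmxBl -scalemxAr -scalemxAl; congr (_ - _).
  by rewrite mul_mx_scalar -scalemxAl OO scalemx1.
rewrite /confA scalerDr scale_scalar_mx scalerA.
have -> : edot zeta zeta / L * t * (L / edot zeta zeta) = t.
  by field; rewrite D0 Ln0.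
rewrite addrAC -raddfB addrC -raddfN; congr (_ + _%:M).
rewrite edot_comb (edotC zeta) er eo.
by field; rewrite D0 Ln0.
Qed.

(* The increment of the inversion, exact up to the factor [L / edot (zeta + v) (zeta + v)]. *)
Lemma sphinv_incr v (QQ := edot (zeta + v) (zeta + v)) : QQ != 0 ->
  sphinv z L (z + zeta + v) - sphinv z L (z + zeta) =
  (L / QQ) *: (v *m reflmx zeta - (edot v v / edot zeta zeta) *: zeta).
Proof.
move=> Q0; rewrite -(addrA z zeta v) !sphinvE -/QQ.
transitivity ((L / QQ) *: (zeta + v) - (L / edot zeta zeta) *: zeta).
  by rewrite opprD addrACA subrr add0r.
have eQ : QQ = edot zeta zeta + 2 * edot zeta v + edot v v by rewrite /QQ edot_sqrD.
move: QQ eQ Q0 => QQ eQ Q0; rewrite mul_reflmx -[v - _ - _]addrA -opprD -scalerDl.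
rewrite scalerBr scalerDr scalerA [_ + (L / QQ) *: v]addrC -addrA -scalerBl.
rewrite -[in RHS]scaleNr; congr (_ + _ *: _).
by field: eQ; rewrite D0.
Qed.

(** The conformal factor cancels the denominator in the increment of the inversion, so the first
    order part of [w] contributes a polynomial in [v] exactly, and all errors sit in the term with
    [r]. *)
Lemma kelvin_expand t p v (r : R) (QQ := edot (zeta + v) (zeta + v)) : QQ != 0 ->
  let d := sphinv z L (z + zeta + v) - sphinv z L (z + zeta) in
  QQ / L * (t + edot p d + r) =
  edot zeta zeta / L * t + edot (kelvin_grad t p) v
   + (t / L - edot p zeta / edot zeta zeta) * edot v v + QQ / L * r.
Proof.
move=> Q0 /=; rewrite sphinv_incr // -/QQ edotZr /kelvin_grad.
have eQ : QQ = edot zeta zeta + 2 * edot zeta v + edot v v by rewrite /QQ edot_sqrD.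
move: QQ eQ Q0 => QQ eQ Q0.
rewrite edotDl edotZl.
have -> : edot (p *m reflmx zeta) v = edot p (v *m reflmx zeta).
  by rewrite edot_mulmx reflmx_sym.
set a := edot p (_ - _).
have -> : a = edot p (v *m reflmx zeta) - edot v v / edot zeta zeta * edot p zeta.
  by rewrite /a !edotE.
set b := edot p (_ *m _).
have -> : QQ / L * (t + L / QQ * (b - edot v v / edot zeta zeta * edot p zeta) + r) =
  QQ / L * t + (b - edot v v / edot zeta zeta * edot p zeta) + QQ / L * r.
  by field; rewrite Q0 Ln0 D0.
by rewrite eQ; field; rewrite D0 Ln0.
Qed.

End KelvinJet.
End ConformalMatrix.

(** * Differentiating the Kelvin transform *)

Section KelvinDifferentiation.
Context {R : realType} {n : nat}.
Implicit Types (x y z v p q : 'rV[R]_n) (w : 'rV[R]_n -> R) (H : 'M[R]_n).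
Implicit Types (E : set 'rV[R]_n).

Lemma qformNv H v : qform H (- v) = qform H v.
Proof. by rewrite /qform mulNmx edotNl edotNr opprK. Qed.

Definition fdiff E w x p : Prop := forall e, 0 < e -> exists2 d, 0 < d &
  forall y, E y -> enorm (y - x) < d -> `|w y - w x - edot p (y - x)| <= e * enorm (y - x).

Lemma sdiff_fdiff E w x p : E x -> sdiff E w x p -> fdiff E w x p.
Proof.
move=> Ex h e e0; have [d d0 hd] := h e e0; exists d => // y Ey yd.
by apply: hd => //; rewrite subrr enorm0.
Qed.

Lemma fdiff_sub E F w x p : F `<=` E -> fdiff E w x p -> fdiff F w x p.
Proof.
by move=> FE h e e0; have [d d0 hd] := h e e0; exists d => // y /FE Ey; exact: hd.
Qed.

Lemma fdiffB E w w' x p q : fdiff E w x p -> fdiff E w' x q ->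
  fdiff E (fun y => w y - w' y) x (p - q).
Proof.
move=> h h' e e0; have e2 : 0 < e / 2 by rewrite divr_gt0.
have [d d0 hd] := h _ e2; have [d' d'0 hd'] := h' _ e2.
exists (Num.min d d'); first by rewrite lt_min d0.
move=> y Ey; rewrite lt_min => /andP[/(hd y Ey) h1 /(hd' y Ey) h2].
have -> : w y - w' y - (w x - w' x) - edot (p - q) (y - x) =
  (w y - w x - edot p (y - x)) - (w' y - w' x - edot q (y - x)).
  by rewrite edotDl edotNl; ring.
by apply: le_trans (ler_normB _ _) _; have := lerD h1 h2; rewrite -mulrDl -splitr.
Qed.

Lemma fdiff_cont E w x p : fdiff E w x p -> cont_at E w x.
Proof.
move=> h e e0; have [d d0 hd] := h 1 ltr01.
pose C := enorm p + 1; have C0 : 0 < C by rewrite ltr_wpDl ?enorm_ge0.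
exists (Num.min d (e / C)); first by rewrite lt_min d0 divr_gt0.
move=> y Ey; rewrite lt_min => /andP[/(hd y Ey) h1 h2].
rewrite -[_ - _](subrK (edot p (y - x))).
apply: le_lt_trans (ler_normD _ _) _; have := edot_le p (y - x).
by move: h2; rewrite ltr_pdivlMr // /C; lra.
Qed.

Section AtPoint.
Variables (z zeta : 'rV[R]_n) (L : R).
Hypotheses (L0 : 0 < L) (yz : zeta != 0).
Let N0 : 0 < enorm zeta. Proof. by rewrite enorm_gt0. Qed.
Let D0 : edot zeta zeta != 0. Proof. by rewrite lt0r_neq0 ?edot_gt0. Qed.
Let Ln0 : L != 0. Proof. by rewrite lt0r_neq0. Qed.

Lemma sphinv_den_bounds v : enorm v <= enorm zeta / 2 ->
  4^-1 * enorm zeta ^+ 2 <= edot (zeta + v) (zeta + v) <= 9 / 4 * enorm zeta ^+ 2.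
Proof.
move=> hv; have h1 := enormD zeta v; have h2 := enorm_triB zeta (- v).
rewrite enormN opprK in h2; rewrite -sqr_enorm.
have := enorm_ge0 (zeta + v); have := enorm_ge0 v.
by move=> a b; apply/andP; split; nra.
Qed.

Lemma sphinv_incr_le v (d := sphinv z L (z + zeta + v) - sphinv z L (z + zeta)) :
  enorm v <= enorm zeta / 2 ->
  enorm d <= L / edot (zeta + v) (zeta + v) * (3 / 2 * enorm v) /\
  enorm d <= 6 * L / enorm zeta ^+ 2 * enorm v.
Proof.
move=> hv; have /andP[h1 h2] := sphinv_den_bounds hv.
have nz2 : 0 < enorm zeta ^+ 2 by rewrite exprn_gt0.
have Q0 : 0 < edot (zeta + v) (zeta + v) by lra.
rewrite /d sphinv_incr ?lt0r_neq0 // enormZ gtr0_norm ?divr_gt0 //.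
have v0 := enorm_ge0 v.
have h3 : enorm (v *m reflmx zeta - (edot v v / edot zeta zeta) *: zeta) <= 3 / 2 * enorm v.
  apply: le_trans (enormB _ _) _; rewrite enorm_reflmx // enormZ.
  rewrite ger0_norm ?divr_ge0 ?edot_ge0 // -!sqr_enorm.
  have -> : enorm v ^+ 2 / enorm zeta ^+ 2 * enorm zeta = enorm v * (enorm v / enorm zeta).
    by field; rewrite lt0r_neq0.
  have : enorm v / enorm zeta <= 2^-1 by rewrite ler_pdivrMr //; lra.
  by move=> /(ler_wpM2l v0); lra.
split; first by rewrite ler_wpM2l // divr_ge0 // ltW.
apply: le_trans (ler_wpM2l _ h3) _; first by rewrite divr_ge0 // ltW.
have -> : 6 * L / enorm zeta ^+ 2 * enorm v = L / (4^-1 * enorm zeta ^+ 2) * (3 / 2 * enorm v).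
  by field; rewrite lt0r_neq0.
rewrite ler_wpM2r ?mulr_ge0 // ler_wpM2l ?(ltW L0) //.
by rewrite lef_pV2 ?posrE // mulr_gt0.
Qed.

Let dE v : z + zeta + v - (z + zeta) = v.
Proof. by rewrite addrAC subrr add0r. Qed.

Lemma kelvinE w v : kelvin z L w (z + zeta + v) =
  edot (zeta + v) (zeta + v) / L * w (sphinv z L (z + zeta + v)).
Proof.
rewrite /kelvin; have -> : z + zeta + v - z = zeta + v.
  by rewrite addrAC (addrAC z) subrr add0r.
by [].
Qed.

Lemma kelvinE0 w : kelvin z L w (z + zeta) = edot zeta zeta / L * w (sphinv z L (z + zeta)).
Proof. by rewrite -[z + zeta]addr0 kelvinE !addr0. Qed.

(** The first order version is relative to sets, so that it applies at points of the boundary, where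
    no [jet2] is assumed. *)
Lemma kelvin_fdiff E F w p (x := sphinv z L (z + zeta)) : fdiff E w x p ->
    (forall y, F y -> E (sphinv z L y)) ->
  fdiff F (kelvin z L w) (z + zeta) (kelvin_grad zeta L (w x) p).
Proof.
move=> hw FE e e0.
have [d d0 hd] := hw (e / 30) ltac:(by rewrite divr_gt0).
have nz2 : 0 < enorm zeta ^+ 2 by rewrite exprn_gt0.
pose C := `|w x / L - edot p zeta / edot zeta zeta|.
have C1 : 0 < C + 1 by rewrite ltr_wpDl ?normr_ge0.
exists (Num.min (enorm zeta / 2) (Num.min (d / (6 * L / enorm zeta ^+ 2)) (e / 2 / (C + 1)))).
  by rewrite !lt_min !divr_gt0 // ?mulr_gt0.
move=> y Fy; rewrite !lt_min; set v := y - (z + zeta).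
have yE : y = z + zeta + v by rewrite addrC subrK.
move=> /andP[/ltW v1 /andP[v2 v3]].
have /andP[q1 q2] := sphinv_den_bounds v1; have [i1 i2] := sphinv_incr_le v1.
have Q0 : 0 < edot (zeta + v) (zeta + v) by lra.
have v0 := enorm_ge0 v.
have Ex := FE y Fy; rewrite yE in Ex.
pose di := sphinv z L (z + zeta + v) - x.
have dsmall : enorm di < d.
  by apply: le_lt_trans i2 _; rewrite mulrC -ltr_pdivlMr // divr_gt0 // mulr_gt0.
have hr := hd _ Ex dsmall; set r := (X in `|X|) in hr.
have wE : w (sphinv z L (z + zeta + v)) = w x + edot p di + r by rewrite /r /di; ring.
rewrite yE kelvinE kelvinE0 wE kelvin_expand ?lt0r_neq0 //.
set a := edot (kelvin_grad _ _ _ _) v.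
set QL := edot (zeta + v) (zeta + v) / L.
have -> : edot zeta zeta / L * w x + a + (w x / L - edot p zeta / edot zeta zeta) * edot v v
   + QL * r - edot zeta zeta / L * w x - a =
  (w x / L - edot p zeta / edot zeta zeta) * edot v v + QL * r by ring.
apply: le_trans (ler_normD _ _) _; rewrite (normrM QL) (normrM (_ - _)) -/C.
have QL0 : 0 < QL by rewrite divr_gt0.
rewrite (gtr0_norm QL0) (ger0_norm (edot_ge0 v)) -sqr_enorm.
have h1 : C * enorm v ^+ 2 <= e / 2 * enorm v.
  rewrite expr2 mulrA ler_wpM2r //.
  have := ltW v3; rewrite ler_pdivlMr // mulrC; apply: le_trans.
  by rewrite ler_wpM2r // lerDl.
have h2 : QL * `|r| <= e / 20 * enorm v.
  apply: (@le_trans _ _ (QL * (e / 30 * (L / edot (zeta + v) (zeta + v) * (3 / 2 * enorm v))))).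
    rewrite ler_pM2l //; apply: le_trans hr _; rewrite ler_wpM2l ?divr_ge0 ?(ltW e0) //.
  rewrite le_eqVlt; apply/orP; left; apply/eqP; rewrite /QL.
  by field; rewrite lt0r_neq0.
by have : 0 <= e * enorm v; [rewrite mulr_ge0 // ltW|lra].
Qed.

Lemma kelvin_jet2 w p H (x := sphinv z L (z + zeta)) : H^T = H -> jet2 w x p H ->
  jet2 (kelvin z L w) (z + zeta) (kelvin_grad zeta L (w x) p) (kelvin_hess zeta L (w x) p H).
Proof.
move=> sH hw e e0.
have nz2 : 0 < enorm zeta ^+ 2 by rewrite exprn_gt0.
have [d d0 hd] := hw (e * enorm zeta ^+ 2 / (18 * L)) ltac:(by rewrite divr_gt0 ?mulr_gt0).
pose h := mxsize H; have h0 : 0 <= h by exact: mxsize_ge0.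
pose C := 10 * L * h / enorm zeta ^+ 3.
have C0 : 0 <= C by rewrite divr_ge0 ?exprn_ge0 ?mulr_ge0 ?(ltW L0) // ltW.
have C1 : 0 < C + 1 by rewrite ltr_wpDl.
exists (Num.min (enorm zeta / 2) (Num.min (d / (6 * L / enorm zeta ^+ 2)) (e / 2 / (C + 1)))).
  by rewrite !lt_min !divr_gt0 // ?mulr_gt0.
move=> v; rewrite !lt_min => /andP[/ltW v1 /andP[v2 v3]].
have /andP[q1 q2] := sphinv_den_bounds v1; have [i1 i2] := sphinv_incr_le v1.
set Q := edot (zeta + v) (zeta + v) in q1 q2 i1.
have Q0 : 0 < Q by lra.
have v0 := enorm_ge0 v.
pose di := sphinv z L (z + zeta + v) - x.
have dsmall : enorm di < d.
  by apply: le_lt_trans i2 _; rewrite mulrC -ltr_pdivlMr // divr_gt0 // mulr_gt0.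
have hr := hd di dsmall; set r := (X in `|X|) in hr.
have wE : w (sphinv z L (z + zeta + v)) = w x + edot p di + (2^-1 * qform H di + r).
  have xdi : x + di = sphinv z L (z + zeta + v) by rewrite /di addrC subrK.
  by rewrite -xdi /r; ring.
rewrite kelvinE kelvinE0 wE kelvin_expand ?lt0r_neq0 // -/Q -/x -/di.
set a := edot (kelvin_grad _ _ _ _) v.
pose b := v *m reflmx zeta; pose be := (edot v v / edot zeta zeta) *: zeta.
have diE : di = (L / Q) *: (b - be) by rewrite /di /x sphinv_incr // lt0r_neq0.
rewrite /kelvin_hess !qformE qform_reflmx -/b.
have -> : edot zeta zeta / L * w x + a + (w x / L - edot p zeta / edot zeta zeta) * edot v v
   + Q / L * (2^-1 * qform H di + r) - edot zeta zeta / L * w x - a -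
   2^-1 * (2 * (w x / L - edot p zeta / edot zeta zeta) * edot v v +
     L / edot zeta zeta * qform H b) =
  (Q / L * (2^-1 * qform H di) - 2^-1 * (L / edot zeta zeta * qform H b)) + Q / L * r.
  by field; rewrite D0 Ln0.
have nb : enorm b = enorm v by rewrite enorm_reflmx.
have nbe : enorm be = enorm v ^+ 2 / enorm zeta.
  rewrite enormZ ger0_norm ?divr_ge0 ?edot_ge0 // -!sqr_enorm.
  by field; rewrite lt0r_neq0.
have nbe2 : enorm be <= enorm v / 2.
  by rewrite nbe expr2 -mulrA ler_wpM2l // ler_pdivrMr //; lra.
have hbe : `|qform H (b - be) - qform H b| <= h * (5 / 2 * enorm v ^+ 3 / enorm zeta).
  rewrite qform_add // qformNv.
  have -> : qform H b + 2 * edot (b *m H) (- be) + qform H be - qform H b =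
    2 * edot (b *m H) (- be) + qform H be by ring.
  apply: le_trans (ler_normD _ _) _; rewrite normrM (@ger0_norm _ 2) //.
  have a1 : `|edot (b *m H) (- be)| <= h * (enorm v * enorm be).
    apply: le_trans (edot_le _ _) _; rewrite enormN mulrA ler_wpM2r ?enorm_ge0 //.
    by rewrite -nb enorm_mulmx.
  have a2 : `|qform H be| <= h * (enorm v / 2 * enorm be).
    apply: le_trans (qform_le _ _) _; rewrite -/h ler_wpM2l // -sqr_enorm expr2.
    by rewrite ler_wpM2r ?enorm_ge0.
  have -> : h * (5 / 2 * enorm v ^+ 3 / enorm zeta) =
    2 * (h * (enorm v * enorm be)) + h * (enorm v / 2 * enorm be).
    by rewrite nbe; field; rewrite lt0r_neq0.
  by lra.
have hb : `|qform H b| <= h * enorm v ^+ 2.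
  by apply: le_trans (qform_le _ _) _; rewrite -sqr_enorm nb.
have hQ : `|edot zeta zeta - Q| <= 5 / 2 * (enorm zeta * enorm v).
  rewrite /Q edot_sqrD.
  have -> : edot zeta zeta - (edot zeta zeta + 2 * edot zeta v + edot v v) =
    - (2 * edot zeta v + edot v v) by ring.
  rewrite normrN; apply: le_trans (ler_normD _ _) _.
  rewrite normrM (@ger0_norm _ 2) // (ger0_norm (edot_ge0 v)) -sqr_enorm.
  have := edot_le zeta v; have : enorm v ^+ 2 <= enorm zeta / 2 * enorm v.
    by rewrite expr2 ler_wpM2r.
  by lra.
have main : `|Q / L * (2^-1 * qform H di) - 2^-1 * (L / edot zeta zeta * qform H b)| <=
    C * enorm v ^+ 3.
  have -> : Q / L * (2^-1 * qform H di) - 2^-1 * (L / edot zeta zeta * qform H b) =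
     2^-1 * L / Q * ((qform H (b - be) - qform H b) +
       qform H b * ((edot zeta zeta - Q) / edot zeta zeta)).
    by rewrite diE qformZ; field; rewrite D0 Ln0 lt0r_neq0.
  rewrite normrM (@ger0_norm _ (2^-1 * L / Q)); last first.
    by rewrite divr_ge0 ?mulr_ge0 // ltW.
  have a1 : `|qform H (b - be) - qform H b + qform H b * ((edot zeta zeta - Q) / edot zeta zeta)|
      <= 5 * (h * enorm v ^+ 3 / enorm zeta).
    apply: le_trans (ler_normD _ _) _.
    rewrite normrM normrM normfV (ger0_norm (edot_ge0 zeta)).
    have : `|qform H b| * (`|edot zeta zeta - Q| / edot zeta zeta) <=
       (h * enorm v ^+ 2) * ((5 / 2 * (enorm zeta * enorm v)) / enorm zeta ^+ 2).
      rewrite (sqr_enorm zeta); apply: ler_pM => //; first by rewrite divr_ge0 ?edot_ge0.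
      by rewrite ler_wpM2r // invr_ge0 edot_ge0.
    have -> : (h * enorm v ^+ 2) * ((5 / 2 * (enorm zeta * enorm v)) / enorm zeta ^+ 2) =
      5 / 2 * (h * enorm v ^+ 3 / enorm zeta) by field; rewrite lt0r_neq0.
    have -> : 5 * (h * enorm v ^+ 3 / enorm zeta) =
      h * (5 / 2 * enorm v ^+ 3 / enorm zeta) + 5 / 2 * (h * enorm v ^+ 3 / enorm zeta).
      by field; rewrite lt0r_neq0.
    by lra.
  have a2 : 2^-1 * L / Q <= 2 * L / enorm zeta ^+ 2.
    have -> : 2 * L / enorm zeta ^+ 2 = 2^-1 * L / (4^-1 * enorm zeta ^+ 2).
      by field; rewrite lt0r_neq0.
    rewrite ler_wpM2l ?mulr_ge0 ?(ltW L0) // lef_pV2 ?posrE // mulr_gt0 //.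
  have -> : C * enorm v ^+ 3 =
    2 * L / enorm zeta ^+ 2 * (5 * (h * enorm v ^+ 3 / enorm zeta)).
    by rewrite /C; field; rewrite lt0r_neq0.
  by apply: ler_pM => //; rewrite divr_ge0 ?mulr_ge0 // ltW.
have rest : `|Q / L * r| <= e / 2 * enorm v ^+ 2.
  have QL0 : 0 < Q / L by rewrite divr_gt0.
  rewrite normrM (gtr0_norm QL0).
  have : edot di di <= (L / Q * (3 / 2 * enorm v)) ^+ 2.
    have ge : 0 <= L / Q * (3 / 2 * enorm v) := le_trans (enorm_ge0 _) i1.
    by rewrite -sqr_enorm ler_pXn2r ?nnegrE ?enorm_ge0.
  move=> b1; have b2 : `|r| <= e * enorm zeta ^+ 2 / (18 * L) * (L / Q * (3 / 2 * enorm v)) ^+ 2.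
    by apply: le_trans hr _; rewrite ler_wpM2l // divr_ge0 ?mulr_ge0 // ltW.
  apply: (@le_trans _ _ (Q / L * (e * enorm zeta ^+ 2 / (18 * L) * (L / Q * (3 / 2 * enorm v)) ^+ 2))).
    by rewrite ler_pM2l.
  have -> : Q / L * (e * enorm zeta ^+ 2 / (18 * L) * (L / Q * (3 / 2 * enorm v)) ^+ 2) =
    e / 2 * enorm v ^+ 2 * ((4^-1 * enorm zeta ^+ 2) / Q).
    by field; rewrite lt0r_neq0 // Ln0.
  rewrite -[leRHS]mulr1 ler_wpM2l ?mulr_ge0 ?exprn_ge0 ?divr_ge0 ?(ltW e0) //.
  by rewrite ler_pdivrMr // mul1r.
apply: le_trans (ler_normD _ _) _; rewrite -[edot v v]sqr_enorm.
have cv : C * enorm v ^+ 3 <= e / 2 * enorm v ^+ 2.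
  have -> : C * enorm v ^+ 3 = (enorm v * C) * enorm v ^+ 2 by ring.
  rewrite ler_wpM2r ?exprn_ge0 //.
  have := ltW v3; rewrite ler_pdivlMr //; apply: le_trans.
  by rewrite ler_wpM2l // lerDl.
by lra.
Qed.

End AtPoint.
End KelvinDifferentiation.

(** * Continuity relative to a set *)

Section Continuity.
Context {R : realType} {n : nat}.
Implicit Types (x y z v p q : 'rV[R]_n) (g h : 'rV[R]_n -> R) (E F K : set 'rV[R]_n).

Lemma cont_at_sub E F g x : F `<=` E -> cont_at E g x -> cont_at F g x.
Proof. by move=> FE h e e0; have [d d0 hd] := h e e0; exists d => // y /FE; exact: hd. Qed.

Lemma cont_at_cst E (a : R) x : cont_at E (fun=> a) x.
Proof. by move=> e e0; exists 1 => // y _ _; rewrite subrr normr0. Qed.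

Lemma cont_atD E g h x : cont_at E g x -> cont_at E h x -> cont_at E (fun y => g y + h y) x.
Proof.
move=> cg ch e e0; have e2 : 0 < e / 2 by rewrite divr_gt0.
have [d d0 hd] := cg _ e2; have [d' d'0 hd'] := ch _ e2.
exists (Num.min d d'); first by rewrite lt_min d0.
move=> y Ey; rewrite lt_min => /andP[/(hd y Ey) h1 /(hd' y Ey) h2].
rewrite opprD addrACA; apply: le_lt_trans (ler_normD _ _) _.
by have := ltrD h1 h2; rewrite -splitr.
Qed.

Lemma cont_atM E g h x : cont_at E g x -> cont_at E h x -> cont_at E (fun y => g y * h y) x.
Proof.
move=> cg ch e e0.
pose C := `|g x| + `|h x| + 1; have C0 : 0 < C by rewrite ltr_wpDl // addr_ge0.
have m0 : 0 < Num.min 1 (e / C) by rewrite lt_min ltr01 divr_gt0.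
have [d d0 hd] := cg _ m0; have [d' d'0 hd'] := ch _ m0.
exists (Num.min d d'); first by rewrite lt_min d0.
move=> y Ey; rewrite lt_min => /andP[/(hd y Ey) + /(hd' y Ey)].
rewrite !lt_min => /andP[h1 h2] /andP[h3 h4].
have -> : g y * h y - g x * h x =
  (g y - g x) * (h y - h x) + (g x * (h y - h x) + (g y - g x) * h x) by ring.
apply: le_lt_trans (ler_normD _ _) _.
apply: le_lt_trans (lerD (lexx _) (ler_normD _ _)) _; rewrite !normrM.
have a0 := normr_ge0 (g x); have b0 := normr_ge0 (h x).
have c0 := normr_ge0 (g y - g x); have k0 := normr_ge0 (h y - h x).
move: h2 h4; rewrite !ltr_pdivlMr // /C.
by set A := `|g x| in a0 *; set B := `|h x| in b0 *; nra.
Qed.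

Lemma cont_atZ E (a : R) g x : cont_at E g x -> cont_at E (fun y => a * g y) x.
Proof. by apply: cont_atM; exact: cont_at_cst. Qed.

Lemma cont_atN E g x : cont_at E g x -> cont_at E (fun y => - g y) x.
Proof.
move=> cg e e0; have [d d0 hd] := cg e e0; exists d => // y Ey yd.
by rewrite -opprD normrN hd.
Qed.

Lemma cont_atB E g h x : cont_at E g x -> cont_at E h x -> cont_at E (fun y => g y - h y) x.
Proof. by move=> cg /cont_atN; exact: cont_atD. Qed.

Lemma cont_at_sum E (I : finType) (g : I -> 'rV[R]_n -> R) x :
  (forall i, cont_at E (g i) x) -> cont_at E (fun y => \sum_i g i y) x.
Proof.
move=> hg; suff h (s : seq I) : cont_at E (fun y => \sum_(i <- s) g i y) x by exact: h.
elim: s => [|i s IH].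
  have -> : (fun y => \sum_(i <- [::]) g i y) = (fun=> 0 : R).
    by apply/funext => y; rewrite big_nil.
  exact: cont_at_cst.
have -> : (fun y => \sum_(j <- i :: s) g j y) = (fun y => g i y + \sum_(j <- s) g j y).
  by apply/funext => y; rewrite big_cons.
exact: cont_atD.
Qed.

Lemma cont_at_norm E g x : cont_at E g x -> cont_at E (fun y => `|g y|) x.
Proof.
move=> cg e e0; have [d d0 hd] := cg e e0; exists d => // y Ey yd.
by apply: le_lt_trans (ler_dist_dist _ _) _; exact: hd.
Qed.

Lemma cont_at_bound E g x : cont_at E g x -> exists2 d, 0 < d &
  forall y, E y -> enorm (y - x) < d -> `|g y| < `|g x| + 1.
Proof.
move=> cg; have [d d0 hd] := cg 1 ltr01; exists d => // y Ey yd.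
rewrite -[g y](subrK (g x)) addrC; apply: le_lt_trans (ler_normD _ _) _.
by rewrite ltrD2l hd.
Qed.

Lemma cont_at_pos E g x : cont_at E g x -> 0 < g x -> exists2 d, 0 < d &
  forall y, E y -> enorm (y - x) < d -> g x / 2 < g y < 2 * g x.
Proof.
move=> cg g0; have [d d0 hd] := cg (g x / 2) ltac:(by rewrite divr_gt0).
exists d => // y Ey yd; have := hd y Ey yd; rewrite ltr_norml => /andP[h1 h2].
by apply/andP; split; lra.
Qed.

Lemma cont_at_dist E z x : cont_at E (fun y => edot (y - z) (y - z)) x.
Proof.
move=> e e0; pose C := 2 * enorm (x - z) + 1.
have C0 : 0 < C by rewrite ltr_wpDl // mulr_ge0 // enorm_ge0.
exists (Num.min 1 (e / C)); first by rewrite lt_min ltr01 divr_gt0.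
move=> y _; rewrite lt_min ltr_pdivlMr // => /andP[h1 h2].
have -> : y - z = (y - x) + (x - z) by rewrite addrA subrK.
rewrite edot_sqrD addrK -sqr_enorm.
have := edot_le (y - x) (x - z); have := enorm_ge0 (y - x); have := enorm_ge0 (x - z).
move=> a b c; apply: le_lt_trans (ler_normD _ _) _.
rewrite (normrM 2) (@ger0_norm _ 2) // (@ger0_norm _ (_ ^+ 2)) ?exprn_ge0 //.
have c2 : enorm (y - x) ^+ 2 <= enorm (y - x).
  by rewrite expr2 -[leRHS]mulr1 ler_wpM2l // ltW.
by move: h2; rewrite /C; lra.
Qed.

Lemma closed_superlevel g (a : R) : (forall x, cont_at setT g x) -> closed [set y | a <= g y].
Proof.
move=> cg x /closure_enormP h /=; rewrite leNgt; apply/negP => lt.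
have [d d0 hd] := cg x (a - g x) ltac:(by rewrite subr_gt0).
have [y /= ay yd] := h d d0; have := hd y I yd.
by rewrite ltr_norml => /andP[_]; lra.
Qed.

Lemma closed_sublevel g (a : R) : (forall x, cont_at setT g x) -> closed [set y | g y <= a].
Proof.
move=> cg; have := @closed_superlevel (fun y => - g y) (- a) (fun x => cont_atN (cg x)).
by congr closed; apply/seteqP; split => y /=; rewrite lerN2.
Qed.

Lemma enorm_leE' x (a : R) : 0 <= a -> [set y | enorm (y - x) <= a] =
  [set y | edot (y - x) (y - x) <= a ^+ 2].
Proof. by move=> a0; apply/seteqP; split => y /=; rewrite enorm_leE. Qed.

Lemma compact_cball x (a : R) : 0 <= a -> compact [set y | enorm (y - x) <= a].
Proof.
move=> a0; apply: (@enorm_bounded_compact _ _ _ x a) => //.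
by rewrite enorm_leE' //; apply: closed_sublevel => y; exact: cont_at_dist.
Qed.

Lemma mxsize_cont E (M : 'rV[R]_n -> 'M[R]_n) x :
  (forall i j, cont_at E (fun y => M y i j) x) ->
  forall e, 0 < e -> exists2 d, 0 < d &
    forall y, E y -> enorm (y - x) < d -> mxsize (M y - M x) < e.
Proof.
move=> cM e e0.
have : cont_at E (fun y => mxsize (M y - M x)) x.
  apply: cont_at_sum => i; apply: cont_at_sum => j; apply: cont_at_norm.
  have -> : (fun y => (M y - M x) i j) = (fun y => M y i j - M x i j).
    by apply/funext => y; rewrite !mxE.
  by apply: cont_atB => //; exact: cont_at_cst.
move=> /(_ e e0)[d d0 hd]; exists d => // y Ey yd.
have := hd y Ey yd; rewrite subrr {2}/mxsize.
rewrite [X in _ - X]big1 ?subr0 => [|i _]; last by rewrite big1 // => j _; rewrite mxE normr0.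
by apply: le_lt_trans; exact: ler_norm.
Qed.

Lemma evs_dist (A B : 'M[R]_n) : A^T = A -> B^T = B ->
  forall i, `|evs A 0 i - evs B 0 i| <= mxsize (A - B).
Proof.
move=> sA sB i; rewrite ler_distl; apply/andP; split.
  rewrite lerBlDr; apply: evs_le => // v.
  have := qform_le (A - B) v; rewrite ler_norml qformD qformN => /andP[h _]; lra.
apply: evs_le => // v.
have := qform_le (A - B) v; rewrite ler_norml qformD qformN => /andP[_ h]; lra.
Qed.

Lemma sphinv_cont z (L : R) x : 0 < L -> x != z -> forall e, 0 < e -> exists2 d, 0 < d &
  forall y, enorm (y - x) < d -> enorm (sphinv z L y - sphinv z L x) < e.
Proof.
move=> L0 xz e e0.
have zn : x - z != 0 by rewrite subr_eq0.
have N0 : 0 < enorm (x - z) by rewrite enorm_gt0.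
pose C := 6 * L / enorm (x - z) ^+ 2.
have C0 : 0 < C by rewrite divr_gt0 ?mulr_gt0 ?exprn_gt0.
exists (Num.min (enorm (x - z) / 2) (e / C)); first by rewrite lt_min; apply/andP; split; rewrite divr_gt0.
move=> y; rewrite lt_min => /andP[h1 h2].
have [_] := @sphinv_incr_le R n z (x - z) L L0 zn (y - x) (ltW h1).
have -> : z + (x - z) = x by rewrite addrC subrK.
rewrite [x + (y - x)]addrC subrK => hb; apply: le_lt_trans hb _.
by rewrite mulrC -ltr_pdivlMr.
Qed.

End Continuity.

(** * Solutions up to the boundary, and the gap to the Kelvin transform *)

Section Solutions.
Context {R : realType} {n : nat}.
Implicit Types (x y z v p q : 'rV[R]_n) (E Om : set 'rV[R]_n).

(** Second order expansions and the equation are required in [Om] only. On [E], which also contains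
    boundary points, [sdiff] serves the boundary condition, and the continuity of [H] with the cone
    condition gives ellipticity bounds that are uniform near such points. *)
Record solution_on (Gam : set 'rV[R]_n) (f : 'rV[R]_n -> R) E Om
    (w : 'rV[R]_n -> R) (G : 'rV[R]_n -> 'rV[R]_n) (H : 'rV[R]_n -> 'M[R]_n) : Prop :=
  SolutionOn {
    so_sub : Om `<=` E;
    so_open : forall x, Om x -> exists2 d, 0 < d & forall y, enorm (y - x) < d -> Om y;
    so_pos : forall x, E x -> 0 < w x;
    so_sdiff : forall x, E x -> sdiff E w x (G x);
    so_jet : forall x, Om x -> jet2 w x (G x) (H x);
    so_sym : forall x, E x -> (H x)^T = H x;
    so_contG : forall x i, E x -> cont_at E (fun y => G y 0 i) x;
    so_contH : forall x i j, E x -> cont_at E (fun y => H y i j) x;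
    so_cone : forall x, E x -> Gam (evs (confA (w x) (G x) (H x)));
    so_eq : forall x, Om x -> f (evs (confA (w x) (G x) (H x))) = 1
  }.

Context {Gam : set 'rV[R]_n} {f : 'rV[R]_n -> R} {E Om : set 'rV[R]_n}.
Context {w : 'rV[R]_n -> R} {G : 'rV[R]_n -> 'rV[R]_n} {H : 'rV[R]_n -> 'M[R]_n}.
Hypotheses (hGam : admissible_cone Gam) (hf : admissible_function Gam f).
Hypothesis sol : solution_on Gam f E Om w G H.

Local Notation A x := (confA (w x) (G x) (H x)).

Lemma w_cont x : E x -> cont_at E w x.
Proof. by move=> Ex; apply: fdiff_cont; exact: sdiff_fdiff (so_sdiff sol Ex). Qed.

Lemma A_sym x : E x -> (A x)^T = A x.
Proof. by move=> Ex; apply: confA_sym; exact: (so_sym sol Ex). Qed.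

Lemma G_dot_cont x : E x -> cont_at E (fun y => edot (G y) (G y)) x.
Proof.
by move=> Ex; apply: cont_at_sum => i; apply: cont_atM; exact: (so_contG sol _ Ex).
Qed.

Lemma A_cont x i j : E x -> cont_at E (fun y => (A y) i j) x.
Proof.
move=> Ex.
have -> : (fun y => (A y) i j) =
    (fun y => w y * H y i j - (2^-1 * edot (G y) (G y)) * (i == j)%:R).
  by apply/funext => y; rewrite !mxE mulr_natr.
apply: cont_atB; first by apply: cont_atM; [exact: w_cont|exact: (so_contH sol _ _ Ex)].
by apply: cont_atM; [apply: cont_atZ; exact: G_dot_cont|exact: cont_at_cst].
Qed.

Lemma evs_cont x : E x -> forall e, 0 < e -> exists2 d, 0 < d &
  forall y, E y -> enorm (y - x) < d ->
    forall i, `|evs (A y) 0 i - evs (A x) 0 i| <= e.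
Proof.
move=> Ex e e0.
have [d d0 hd] := @mxsize_cont R n E (fun y => A y) x (fun i j => A_cont i j Ex) e e0.
exists d => // y Ey yd i; apply: le_trans (evs_dist (A_sym Ey) (A_sym Ex) i) _.
by apply: ltW; exact: hd.
Qed.

Lemma local_bounds x : E x -> exists d m C : R, [/\ 0 < d, 0 < m, 0 < C &
  forall y, E y -> enorm (y - x) < d ->
    [/\ m <= w y, w y <= C, enorm (G y) <= C & mxsize (H y) <= C]].
Proof.
move=> Ex.
have [d1 d10 h1] := cont_at_pos (w_cont Ex) (so_pos sol Ex).
have [d2 d20 h2] := cont_at_bound (G_dot_cont Ex).
have cH : cont_at E (fun y => mxsize (H y)) x.
  apply: cont_at_sum => i; apply: cont_at_sum => j; apply: cont_at_norm.
  exact: (so_contH sol _ _ Ex).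
have [d3 d30 h3] := cont_at_bound cH.
have w0 := so_pos sol Ex.
pose C := 2 * w x + (edot (G x) (G x) + 2) + (mxsize (H x) + 1).
have g0 := edot_ge0 (G x); have s0 := mxsize_ge0 (H x).
exists (Num.min d1 (Num.min d2 d3)), (w x / 2), C; split.
- by rewrite !lt_min d10 d20.
- by rewrite divr_gt0.
- by rewrite /C; lra.
move=> y Ey; rewrite !lt_min => /and3P[/(h1 y Ey)/andP[a1 a2] /(h2 y Ey) a3 /(h3 y Ey) a4].
rewrite (ger0_norm (edot_ge0 _)) (ger0_norm g0) in a3.
rewrite (ger0_norm (mxsize_ge0 _)) (ger0_norm s0) in a4.
split; rewrite /C; [lra|lra| |lra].
apply: (@le_trans _ _ (edot (G x) (G x) + 2)); last by lra.
rewrite enorm_leE; last by lra.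
by have := edot_ge0 (G y); nra.
Qed.

Section Sphere.
Variables (z : 'rV[R]_n) (L : R).
Hypothesis L0 : 0 < L.

Definition outside : set 'rV[R]_n := [set y | E y /\ L <= edot (y - z) (y - z)].

Hypothesis inv_out : forall y, outside y -> E (sphinv z L y).

Definition gap y : R := kelvin z L w y - w y.

Definition gap_grad y : 'rV[R]_n :=
  kelvin_grad (y - z) L (w (sphinv z L y)) (G (sphinv z L y)) - G y.

Lemma outside_neq y : outside y -> y - z != 0.
Proof. by move=> [_ h]; rewrite -edot_eq0 lt0r_neq0 // (lt_le_trans L0). Qed.

Let yE y : z + (y - z) = y. Proof. by rewrite addrC subrK. Qed.

Lemma gap_fdiff y : outside y -> fdiff outside gap y (gap_grad y).
Proof.
move=> oy; apply: fdiffB; last first.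
  by apply: (@fdiff_sub _ _ E) => [y' []//|]; apply: sdiff_fdiff; [case: oy|apply: (so_sdiff sol oy.1)].
have := @kelvin_fdiff R n z (y - z) L L0 (outside_neq oy) E outside w (G (sphinv z L y)).
rewrite yE; apply => //; apply: sdiff_fdiff; first exact: inv_out.
by apply: (so_sdiff sol); exact: inv_out.
Qed.

Lemma gap_cont y : outside y -> cont_at outside gap y.
Proof. by move=> /gap_fdiff /fdiff_cont. Qed.

Lemma closed_sphere : closed [set y : 'rV[R]_n | L <= edot (y - z) (y - z)].
Proof.
exact: (@closed_superlevel R n (fun y => edot (y - z) (y - z)) L
  (fun x => @cont_at_dist R n setT z x)).
Qed.

Lemma kelvin_hess_bound y (C : R) : outside y ->
    w (sphinv z L y) <= C -> enorm (G (sphinv z L y)) <= C -> mxsize (H (sphinv z L y)) <= C ->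
  let K := C * (2 / L + 2 / Num.sqrt L + 1) in
  (forall v, `|qform (kelvin_hess (y - z) L (w (sphinv z L y)) (G (sphinv z L y))
     (H (sphinv z L y))) v| <= K * edot v v).
Proof.
move=> oy wC gC hC K v; set x := sphinv z L y in wC gC hC *.
have sL : 0 < Num.sqrt L by rewrite sqrtr_gt0.
have C0 : 0 <= C by apply: le_trans (enorm_ge0 _) gC.
have Ly : L <= edot (y - z) (y - z) by case: oy.
have D0 : 0 < edot (y - z) (y - z) by exact: lt_le_trans L0 Ly.
have w0 : 0 < w x by apply: (so_pos sol); exact: inv_out.
rewrite /kelvin_hess !qformE qform_reflmx.
have z0 : 0 < enorm (y - z) by rewrite enorm_gt0; exact: outside_neq oy.
have sz : Num.sqrt L <= enorm (y - z) by rewrite ler_sqrt // ltW.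
have b1 : `|edot (G x) (y - z) / edot (y - z) (y - z)| <= C / Num.sqrt L.
  rewrite normrM normfV (gtr0_norm D0) ler_pdivrMr //.
  apply: le_trans (edot_le _ _) _; rewrite -sqr_enorm.
  have -> : C / Num.sqrt L * enorm (y - z) ^+ 2 =
    C * (enorm (y - z) / Num.sqrt L * enorm (y - z)) by ring.
  apply: ler_pM; rewrite ?enorm_ge0 // -[leLHS]mul1r ler_wpM2r ?(ltW z0) //.
  by rewrite ler_pdivlMr // mul1r.
have b2 : `|w x / L| <= C / L.
  by rewrite gtr0_norm ?divr_gt0 // ler_pM2r // invr_gt0.
have b3 : `|L / edot (y - z) (y - z) * qform (H x) (v *m reflmx (y - z))| <= C * edot v v.
  rewrite normrM (@ger0_norm _ (L / _)) ?divr_ge0 ?(ltW L0) ?(ltW D0) //.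
  apply: le_trans (_ : 1 * `|qform (H x) (v *m reflmx (y - z))| <= _).
    by rewrite ler_wpM2r // ler_pdivrMr // mul1r.
  rewrite mul1r; apply: le_trans (qform_le _ _) _.
  by rewrite edot_reflmx ?(outside_neq oy) // ler_wpM2r // edot_ge0.
apply: le_trans (ler_normD _ _) _; rewrite normrM normrM (@ger0_norm _ 2) //.
rewrite (ger0_norm (edot_ge0 v)).
have b4 := le_trans (ler_normB (w x / L) (edot (G x) (y - z) / edot (y - z) (y - z)))
  (lerD b2 b1).
have b5 := ler_wpM2r (edot_ge0 v) b4.
have -> : K * edot v v = 2 * (C / L + C / Num.sqrt L) * edot v v + C * edot v v.
  by rewrite /K; ring.
by apply: lerD b3; rewrite -!mulrA ler_pM2l.
Qed.

Lemma kelvin_grad_bound y (C M : R) : outside y -> enorm (y - z) <= M ->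
    w (sphinv z L y) <= C -> enorm (G (sphinv z L y)) <= C ->
  enorm (kelvin_grad (y - z) L (w (sphinv z L y)) (G (sphinv z L y))) <= 2 * C / L * M + C.
Proof.
move=> oy yM wC gC; have w0 : 0 < w (sphinv z L y) by apply: (so_pos sol); exact: inv_out.
apply: le_trans (enormD _ _) _; rewrite enorm_reflmx ?(outside_neq oy) //; apply: lerD => //.
rewrite enormZ gtr0_norm ?divr_gt0 ?mulr_gt0 //.
apply: ler_pM; rewrite ?enorm_ge0 ?divr_ge0 ?mulr_ge0 ?(ltW w0) ?(ltW L0) //.
by rewrite ler_pM2r ?invr_gt0 // ler_pM2l.
Qed.

(** At the minimum [w + e * h] touches the Kelvin transform from below, so the gradients agree and
    the Hessians are ordered. Inserted in [confA], this compares the matrix at [y] with the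
    reflected matrix at [x], up to the gap times a Hessian and terms with the factor [e]. *)
Lemma touching_bound y (gh : 'rV[R]_n) (Hh : 'M[R]_n) (h : 'rV[R]_n -> R) (e d : R)
    (x := sphinv z L y) (W := kelvin z L w y)
    (pW := kelvin_grad (y - z) L (w x) (G x))
    (HW := kelvin_hess (y - z) L (w x) (G x) (H x)) :
    outside y -> Om y -> Om x -> jet2 h y gh Hh -> 0 < d ->
    (forall v, enorm v < d -> gap y - e * h y <= gap (y + v) - e * h (y + v)) ->
  forall v, qform (A y) v <= qform (reflmx (y - z) *m A x *m reflmx (y - z)) v
    + (w y - W) * qform HW v - w y * e * qform Hh v
    + (e * edot pW gh - 2^-1 * e ^+ 2 * edot gh gh) * edot v v.
Proof.
move=> oy Oy Ox jh d0 hd v; have Ey : E y by case: oy.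
have Ex : E x by exact: inv_out.
have jW := @kelvin_jet2 R n z (y - z) L L0 (outside_neq oy) w (G x) (H x).
rewrite yE in jW; have {}jW := jW (so_sym sol Ex) (so_jet sol Ox).
have cmp u : enorm u < d -> kelvin z L w y - (w y + e * h y) <=
    kelvin z L w (y + u) - (w (y + u) + e * h (y + u)).
  by move=> /hd; rewrite /gap; lra.
have [pE hE] := jet2_touch (jet2D (so_jet sol Oy) (jet2Z e jh)) jW d0 cmp.
have sE : confA W pW HW = reflmx (y - z) *m A x *m reflmx (y - z).
  by rewrite -(kelvin_confA L0 (outside_neq oy)).
rewrite -sE !qform_confA.
have := hE v; rewrite -/x -/HW qformD qformZl => hv.
have wy : 0 < w y by exact: (so_pos sol).
have := ler_wpM2l (ltW wy) hv.
rewrite -/x -/pW in pE; rewrite -pE !edotE (edotC gh).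
by lra.
Qed.

End Sphere.

End Solutions.

Lemma near_one {R : realType} (t : R) : `|t| <= 2^-1 -> 0 <= 1 + 2 * t <= 2.
Proof. by rewrite ler_norml => /andP[h1 h2]; apply/andP; split; lra. Qed.

(** * The Hopf lemma *)

Section Hopf.
Context {R : realType} {n : nat}.
Implicit Types (x y z v p : 'rV[R]_n).

Lemma jet2_fdiff (g : 'rV[R]_n -> R) x p (M : 'M[R]_n) : jet2 g x p M -> fdiff setT g x p.
Proof.
move=> jg e e0; have [d d0 hd] := jg 1 ltr01.
pose C := mxsize M + 1; have C0 : 0 < C by rewrite ltr_wpDl ?mxsize_ge0.
exists (Num.min d (e / C)); first by rewrite lt_min d0 divr_gt0.
move=> y _; rewrite lt_min ltr_pdivlMr // => /andP[/hd + h2].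
rewrite [x + (y - x)]addrC subrK mul1r => h1.
have h3 := qform_le M (y - x); have s0 := mxsize_ge0 M.
rewrite -[_ - edot p (y - x)](subrK (2^-1 * qform M (y - x))).
apply: le_trans (ler_normD _ _) _; rewrite (normrM 2^-1) (@ger0_norm _ 2^-1) ?invr_ge0 //.
have h4 := ler_wpM2r (enorm_ge0 (y - x)) (ltW h2).
have h5 : 0 <= mxsize M * enorm (y - x) ^+ 2 by rewrite mulr_ge0 ?exprn_ge0 ?enorm_ge0.
move: h1 h3 h4; rewrite -!sqr_enorm /C; set N := enorm _ in h5 *.
by move=> h1 h3 h4; lra.
Qed.

Lemma trace_qform (M : 'M[R]_n) : \tr M = \sum_k qform M (delta_mx 0 k).
Proof. by apply: eq_bigr => k _; rewrite /qform edot_delta -rowE mxE. Qed.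

Lemma edot_delta_sum p : \sum_k edot p (delta_mx 0 k) ^+ 2 = edot p p.
Proof. by apply: eq_bigr => k _; rewrite edot_delta expr2. Qed.

(** Comparison of traces: the rank one term lowers the sum of the eigenvalues by [t * edot p p],
    hence at least one of them by the n-th part of it. *)
Lemma exists_evs_drop (M N : 'M[R]_n) p (s t : R) : (0 < n)%N -> M^T = M -> N^T = N ->
    (forall v, qform M v <= qform N v + s * edot v v - t * edot p v ^+ 2) ->
  exists i, evs M 0 i <= evs N 0 i + s - t * edot p p / n%:R.
Proof.
move=> n0 sM sN h; apply/existsP; rewrite -[X in is_true X]negbK negb_exists.
apply/negP => /forallP hn.
have : \sum_i evs M 0 i <= \sum_i evs N 0 i + n%:R * s - t * edot p p.
  have tq (K : 'M[R]_n) : K^T = K -> \sum_i evs K 0 i = \sum_k qform K (delta_mx 0 k).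
    by move=> sK; rewrite evs_trace // trace_qform.
  rewrite [X in X <= _](tq M sM) [X in _ <= X + _ - _](tq N sN).
  rewrite -edot_delta_sum mulr_sumr.
  have -> : n%:R * s = \sum_(k < n) s by rewrite sumr_const card_ord mulr_natl.
  rewrite -big_split -sumrB; apply: ler_sum => k _; have := h (delta_mx 0 k).
  by rewrite edot_delta mxE !eqxx mulr1.
apply/negP; rewrite -ltNge.
have cst (a : R) : \sum_(i < n) a = n%:R * a by rewrite sumr_const card_ord mulr_natl.
have -> : \sum_i evs N 0 i + n%:R * s - t * edot p p =
    \sum_i (evs N 0 i + s - t * edot p p / n%:R).
  have nn : n%:R != 0 :> R by rewrite pnatr_eq0 -lt0n.
  rewrite sumrB big_split /= !cst; congr (_ - _).
  by set m := n%:R in nn *; field.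
apply: (@ltr_sum _ 'I_n (index_enum _) xpredT) => [|i _].
  by apply/hasP; exists (Ordinal n0) => //; rewrite mem_index_enum.
by rewrite ltNge; exact: hn.
Qed.

(** Ellipticity would give [f (evs M) < f (evs N)], although both values are 1: the eigenvalue
    lowered by the rank one term outweighs the shift [s] of all of them. *)
Lemma no_touching (Gam : set 'rV[R]_n) (f : 'rV[R]_n -> R) (M N : 'M[R]_n) (lam p : 'rV[R]_n)
    (eta c' C' s t c : R) : (0 < n)%N -> M^T = M -> N^T = N ->
    (forall l s t, 0 <= s <= eta -> 0 <= t <= eta -> Gam l ->
       (forall i, l 0 i <= lam 0 i + s) -> (exists i, l 0 i <= lam 0 i + s - t) ->
       f l <= f lam + C' * s - c' * t) ->
    Gam (evs M) -> f (evs M) = 1 -> f lam = 1 -> evs N = lam ->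
    (forall v, qform M v <= qform N v + s * edot v v - t * edot p v ^+ 2) ->
    0 <= s -> s <= eta -> 0 <= t -> t * c / n%:R <= eta -> c <= edot p p ->
    C' * s < c' * (t * c / n%:R) -> 0 <= c -> False.
Proof.
move=> n0 sM sN hfl GM fM fl eN key s0 se t0 te cp st c0.
have [i hi] := exists_evs_drop n0 sM sN key.
have nR : 0 < n%:R :> R by rewrite ltr0n.
have T0 : 0 <= t * c / n%:R by rewrite divr_ge0 ?mulr_ge0.
have := hfl (evs M) s (t * c / n%:R); rewrite s0 se T0 te fM fl.
move=> /(_ isT isT GM) h; suff : 1 <= 1 + C' * s - c' * (t * c / n%:R) by rewrite -addrA lerDl subr_ge0 leNgt st.
apply: h => [j|].
- rewrite -eN; apply: evs_le => // v; apply: le_trans (key v) _.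
  by rewrite gerBl; apply: mulr_ge0 (sqr_ge0 _).
- exists i; apply: le_trans hi _; rewrite eN lerD2l lerN2.
  by rewrite ler_pM2r ?invr_gt0 // ler_wpM2l.
Qed.

Lemma taylor2_quad (al t : R) : taylor2 (fun s => s + al * s ^+ 2) t (1 + 2 * al * t) (2 * al).
Proof.
move=> e e0; exists 1 => // s _.
set u := (X in `|X|); have -> : u = 0 by rewrite /u; field.
by rewrite normr0 mulr_ge0 ?exprn_even_ge0 // ltW.
Qed.

Context {Gam : set 'rV[R]_n} {f : 'rV[R]_n -> R} {E Om : set 'rV[R]_n}.
Context {w : 'rV[R]_n -> R} {G : 'rV[R]_n -> 'rV[R]_n} {H : 'rV[R]_n -> 'M[R]_n}.
Hypotheses (n0 : (0 < n)%N) (hGam : admissible_cone Gam) (hf : admissible_function Gam f).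
Hypothesis sol : solution_on Gam f E Om w G H.
Variables (z : 'rV[R]_n) (L : R).
Hypothesis L0 : 0 < L.
Local Notation out := (@outside R n E z L).
Local Notation gp := (@gap R n w z L).
Local Notation A x := (confA (w x) (G x) (H x)).
Hypothesis inv_out : forall y, out y -> E (sphinv z L y).

(** What replaces second order information at a boundary point: along an outward vector [nu] the gap
    decays at a rate of at most [ka] times itself and the barrier at a faster one, so their
    difference has no minimum there. *)
Definition neumann_ok (q : 'rV[R]_n -> R) (gq : 'rV[R]_n -> 'rV[R]_n) y : Prop :=
  exists nu (ka : R) dV, [/\ 0 <= ka,
    exists2 t0, 0 < t0 & forall t, 0 < t < t0 -> E (y - t *: nu),
    fdiff out gp y dV, - (ka * gp y) <= edot dV nu & edot (gq y) nu < - (ka * q y)].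

Lemma compact_min' (K : set 'rV[R]_n) (g : 'rV[R]_n -> R) : compact K ->
  (forall x, K x -> cont_at K g x) -> (forall x, K x -> 0 < g x) ->
  exists2 m, 0 < m & forall x, K x -> m <= g x.
Proof.
move=> cK cg pg; have [K0|/nonemptyPn K0] := pselect (K !=set0).
  by have [x Kx hx] := compact_min K0 cK cg; exists (g x) => //; exact: pg.
by exists 1 => // x; rewrite K0.
Qed.

Lemma fdiff_dir (X : set 'rV[R]_n) (g : 'rV[R]_n -> R) y p v (k : R) : fdiff X g y p ->
    (exists2 t0, 0 < t0 & forall t, 0 < t < t0 -> X (y + t *: v) /\ g y + t * k <= g (y + t *: v)) ->
  k <= edot p v.
Proof.
move=> hg [t0 t00 ht]; rewrite leNgt; apply/negP => hk.
pose N := enorm v + 1; have N0 : 0 < N by rewrite ltr_wpDl ?enorm_ge0.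
pose e := (k - edot p v) / N; have e0 : 0 < e by rewrite divr_gt0 // subr_gt0.
have [d dd0 hd] := hg e e0.
pose t := Num.min (t0 / 2) (d / 2 / N).
have tt : 0 < t by rewrite lt_min !divr_gt0.
have [|Xt ht1] := ht t.
  by rewrite tt gt_min; apply/orP; left; lra.
have vN : enorm v < N by rewrite /N ltrDl.
have td : t * N <= d / 2 by rewrite -ler_pdivlMr // ge_min lexx orbT.
have tv : enorm (t *: v) < d.
  rewrite enormZ (gtr0_norm tt); apply: le_lt_trans (_ : t * N < d); last lra.
  by rewrite ler_pM2l // ltW.
have := hd _ Xt; rewrite [y + t *: v]addrC addrK => /(_ tv).
rewrite enormZ (gtr0_norm tt) edotZr [t *: v + y]addrC => /(le_trans (ler_norm _)).
have -> : e * (t * enorm v) = t * (e * enorm v) by ring.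
have h1 : e * enorm v < k - edot p v.
  have -> : k - edot p v = e * N by rewrite /e; field; rewrite lt0r_neq0.
  by rewrite ltr_pM2l.
have := ltr_pM2l tt (e * enorm v) (k - edot p v); rewrite h1 => h2.
by rewrite mulrBr in h2; lra.
Qed.

(* At a point where gap - e (q + al q^2) has a local minimum, the ellipticity of f is violated. *)
Lemma hopf_interior y0 (q : 'rV[R]_n -> R) (gq : 'rV[R]_n -> 'rV[R]_n)
    (Hq : 'rV[R]_n -> 'M[R]_n) (c C d0 : R) :
    out y0 -> 0 < c -> 0 < d0 ->
    (forall y, enorm (y - y0) < d0 -> [/\ jet2 q y (gq y) (Hq y), enorm (gq y) <= C,
       (forall v, `|qform (Hq y) v| <= C * edot v v) & c <= edot (gq y) (gq y)]) ->
  exists r al e0 : R, [/\ 0 < r, 0 < al, 0 < e0 & forall y e d, 0 < e -> e < e0 -> 0 < d ->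
    out y -> enorm (y - y0) < r -> Om y -> Om (sphinv z L y) ->
    0 <= gp y -> gp y <= e -> `|al * q y| <= 2^-1 ->
    ~ (forall v, enorm v < d -> gp y - e * (q y + al * q y ^+ 2) <=
        gp (y + v) - e * (q (y + v) + al * q (y + v) ^+ 2))].
Proof.
move=> oy0 c0 d00 hq; pose x0 := sphinv z L y0.
have Ex0 : E x0 by exact: inv_out.
have Ey0 : E y0 by case: oy0.
have y0z : y0 != z by rewrite -subr_eq0; exact: outside_neq L0 _ oy0.
have [d1 [m1 [C1 [d10 m10 C10 hb1]]]] := local_bounds sol Ex0.
have [d2 [m2 [C2 [d20 m20 C20 hb2]]]] := local_bounds sol Ey0.
have [eta [c' [C' [eta0 c'0 C'0 hfl]]]] := f_local_bounds hGam hf (so_cone sol Ex0).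
have [d3 d30 hev] := evs_cont sol Ex0 eta0.
have [r1 r10 hr1] := @sphinv_cont R n z L y0 L0 y0z (Num.min d1 d3) ltac:(by rewrite lt_min d10).
have C0 : 0 <= C.
  have [|_ hC _ _] := hq y0; first by rewrite subrr enorm0.
  exact: le_trans (enorm_ge0 _) hC.
pose K := C1 * (2 / L + 2 / Num.sqrt L + 1).
pose M := enorm (y0 - z) + 1.
pose Kg := 2 * C1 / L * M + C1.
(* Collects the factors of [e]: the Hessian of the Kelvin transform against a gap of at most [e],
   the Hessian of [q] against [w], and the product of the gradients. *)
pose D1 := K + 2 * C2 * C + 2 * Kg * C.
have sL : 0 < Num.sqrt L by rewrite sqrtr_gt0.
have K0 : 0 < K by rewrite mulr_gt0 // addr_gt0 // addr_gt0 // divr_gt0.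
have M0 : 0 < M by rewrite ltr_wpDl ?enorm_ge0.
have Kg0 : 0 < Kg by rewrite addr_gt0 // mulr_gt0 // divr_gt0 // mulr_gt0.
have D10 : 0 < D1.
  by rewrite ltr_wpDr ?mulr_ge0 ?(ltW Kg0) // ltr_wpDr // !mulr_ge0 // ltW.
have nR : 0 < n%:R :> R by rewrite ltr0n.
(* With this [al] the gain from the rank one term of [al * q ^+ 2] is twice the loss [C' * s], for
   every [e]. The quadratic correction thus works for any [q] with nonvanishing gradient. *)
pose al := C' * D1 * n%:R / (c' * m2 * c).
have al0 : 0 < al by rewrite divr_gt0 ?mulr_gt0.
pose T := 2 * al * m2 * c / n%:R.
have T0 : 0 < T by rewrite divr_gt0 // mulr_gt0 // mulr_gt0 // mulr_gt0.
exists (Num.min r1 (Num.min d2 (Num.min d0 1))), al, (Num.min (eta / D1) (eta / T)).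
split; [by rewrite !lt_min r10 d20 d00 ltr01 | exact: al0 | by rewrite lt_min (divr_gt0 eta0 D10) (divr_gt0 eta0 T0) | ].
move=> y e d e0; rewrite !lt_min (ltr_pdivlMr _ _ D10) (ltr_pdivlMr _ _ T0) => /andP[e1 e2] dd0 oy.
move=> /and4P[yr1 yd2 yd0 y1] Oy Ox gy0 gye hq1 hmin.
have Ey : E y by case: oy.
set x := sphinv z L y in Ox.
have Ex : E x by exact: inv_out.
have := hr1 y yr1; rewrite -/x -/x0 lt_min => /andP[xd1 xd3].
have [_ wxC gxC hxC] := hb1 x Ex xd1.
have [mwy wyC _ _] := hb2 y Ey yd2.
have [jq gqC HqC cgq] := hq y yd0.
pose gh := (1 + 2 * al * q y) *: gq y.
pose Hh := (1 + 2 * al * q y) *: Hq y + (2 * al) *: ((gq y)^T *m gq y).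
have jh : jet2 (fun y => q y + al * q y ^+ 2) y gh Hh.
  exact: (jet2_comp jq (taylor2_quad al (q y))).
have tb := touching_bound sol L0 inv_out oy Oy Ox jh dd0 hmin.
pose s := e * D1; pose N := reflmx (y - z) *m A x *m reflmx (y - z).
have sA : (A y)^T = A y by exact: (A_sym sol).
have sN : N^T = N.
  by rewrite /N !trmx_mul reflmx_sym (A_sym sol Ex) mulmxA.
have yM : enorm (y - z) <= M.
  rewrite -[y - z](subrKA y0); apply: le_trans (enormD _ _) _; rewrite addrC /M.
  by rewrite lerD2l ltW.
have key v : qform (A y) v <= qform N v + s * edot v v - 2 * al * e * m2 * edot (gq y) v ^+ 2.
  have := tb v; rewrite -/N; set W := kelvin z L w y; set HW := kelvin_hess _ _ _ _ _.
  set pW := kelvin_grad _ _ _ _ => tv; apply: le_trans tv _.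
  have hK : `|qform HW v| <= K * edot v v.
    exact: (kelvin_hess_bound sol L0 inv_out oy wxC gxC hxC).
  have hKg : enorm pW <= Kg by exact: (kelvin_grad_bound sol L0 inv_out oy yM wxC gxC).
  have v0 := edot_ge0 v.
  have b1 : (w y - W) * qform HW v <= e * K * edot v v.
    apply: le_trans (ler_norm _) _; rewrite normrM -mulrA; apply: ler_pM => //.
    have -> : w y - W = - gp y by rewrite /gap opprB.
    by rewrite normrN ger0_norm.
  have a2 : 0 <= 1 + 2 * al * q y <= 2.
    by rewrite -(mulrA 2); exact: near_one.
  have b2 : - (w y * e * qform Hh v) <=
      e * (2 * C2 * C) * edot v v - 2 * al * e * m2 * edot (gq y) v ^+ 2.
    rewrite /Hh qformD !qformZl qform_outer.
    have h1 : - (w y * e * ((1 + 2 * al * q y) * qform (Hq y) v)) <= e * (2 * C2 * C) * edot v v.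
      apply: le_trans (ler_norm _) _; rewrite normrN !normrM (gtr0_norm e0).
      have -> : e * (2 * C2 * C) * edot v v = C2 * e * (2 * (C * edot v v)) by ring.
      have wy0 : 0 < w y by exact: (so_pos sol).
      case/andP: a2 => a2 a3.
      rewrite (gtr0_norm wy0) (ger0_norm a2); apply: ler_pM => //.
      - by rewrite mulr_ge0 ?(ltW wy0) ?(ltW e0).
      - by rewrite mulr_ge0.
      - by rewrite ler_pM2r.
      - by apply: ler_pM.
    have h2 : m2 * (2 * al * e * edot (gq y) v ^+ 2) <= w y * (2 * al * e * edot (gq y) v ^+ 2).
      apply: ler_wpM2r => //; apply: mulr_ge0; last exact: sqr_ge0.
      by apply: mulr_ge0 (ltW e0); apply: mulr_ge0 (ltW al0).
    by lra.
  have b3 : (e * edot pW gh - 2^-1 * e ^+ 2 * edot gh gh) * edot v v <= e * (2 * Kg * C) * edot v v.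
    rewrite ler_wpM2r // lerBlDr ler_wpDr //.
      apply: mulr_ge0 (edot_ge0 _); apply: mulr_ge0 (sqr_ge0 _).
      by rewrite invr_ge0.
    rewrite ler_pM2l //; apply: le_trans (edot_le' _ _) _.
    case/andP: a2 => a2 a3; rewrite /gh enormZ ger0_norm //.
    have -> : 2 * Kg * C = Kg * (2 * C) by ring.
    apply: ler_pM; rewrite ?mulr_ge0 ?enorm_ge0 //.
    by apply: ler_pM; rewrite ?enorm_ge0.
  by rewrite /s /D1; lra.
have eN : evs N = evs (A x) by apply: evs_reflmx; exact: outside_neq L0 _ oy.
have ete : 0 <= 2 * al * e * m2.
  by apply: mulr_ge0 (ltW m20); apply: mulr_ge0 (ltW e0); exact: mulr_ge0 _ (ltW al0).
have nn0 : n%:R != 0 :> R by rewrite lt0r_neq0.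
have tE : 2 * al * e * m2 * c / n%:R = e * T by rewrite /T; field.
have sl : C' * s < c' * (2 * al * e * m2 * c / n%:R).
  have -> : c' * (2 * al * e * m2 * c / n%:R) = 2 * (C' * s).
    by rewrite /s /al; field; rewrite nn0 !lt0r_neq0.
  by rewrite (ltr_pMl _ (mulr_gt0 C'0 (mulr_gt0 e0 D10))) ltr1n.
apply: (no_touching n0 sA sN (fun l a b => hfl _ l a b (hev x Ex xd3)) (so_cone sol Ey) (so_eq sol Oy)
  (so_eq sol Ox) eN key _ _ ete _ cgq sl).
- exact: mulr_ge0 (ltW e0) (ltW D10).
- exact: ltW e1.
- by rewrite tE ltW.
- exact: ltW c0.
Qed.

(** The gap minus [e * (q + al * q ^+ 2)] is minimized over a small ball. A negative minimum lies
    where [q > 0], off the sphere of inversion and inside the ball, where [hopf_interior] or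
    [neumann_ok] excludes it. Otherwise the gap grows at least linearly along [v], so its gradient
    at [y0] is not zero. *)
Lemma hopf y0 (q : 'rV[R]_n -> R) (gq : 'rV[R]_n -> 'rV[R]_n)
    (Hq : 'rV[R]_n -> 'M[R]_n) (c C d0 : R) v :
    out y0 -> 0 < c -> 0 < d0 ->
    (forall y, enorm (y - y0) < d0 -> [/\ jet2 q y (gq y) (Hq y), enorm (gq y) <= C,
       (forall v, `|qform (Hq y) v| <= C * edot v v) & c <= edot (gq y) (gq y)]) ->
    q y0 = 0 -> gp y0 = 0 ->
    (forall r, 0 < r -> r < d0 -> compact (E `&` [set y | enorm (y - y0) <= r])) ->
    (forall y, out y -> enorm (y - y0) < d0 -> 0 <= gp y) ->
    (forall y, out y -> enorm (y - y0) < d0 -> y != y0 -> 0 <= q y -> 0 < gp y) ->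
    (forall y, out y -> enorm (y - y0) < d0 -> 0 < q y -> L < edot (y - z) (y - z) /\
       ((Om y /\ Om (sphinv z L y)) \/ neumann_ok q gq y)) ->
    0 < edot (gq y0) v ->
    (exists2 t0, 0 < t0 & forall t, 0 < t < t0 -> out (y0 + t *: v)) ->
  ~ fdiff out gp y0 0.
Proof.
move=> oy0 c0 d00 hq q0 gp0 hc hge hgt hpos gv [t0 t00 hv] hfd.
have [r1 [al [e0 [r10 al0 e00 hint]]]] := hopf_interior oy0 c0 d00 hq.
have jq0 : jet2 q y0 (gq y0) (Hq y0) by have [] := hq y0; rewrite ?subrr ?enorm0.
have qc y : enorm (y - y0) < d0 -> cont_at setT q y.
  by move=> /hq[jq _ _ _]; exact: fdiff_cont (jet2_fdiff jq).
pose ka : R := Num.min 2^-1 (2^-1 / al).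
have ka0 : 0 < ka by rewrite lt_min invr_gt0 divr_gt0 ?invr_gt0 ?ltr0n.
have [r2 r20 hr2] := qc y0 ltac:(by rewrite subrr enorm0) ka ka0.
pose r := Num.min r1 (Num.min r2 d0); pose r' := r / 2.
have r0 : 0 < r by rewrite !lt_min r10 r20 d00.
have r'0 : 0 < r' by rewrite divr_gt0.
have r'r : r' < r by rewrite /r'; lra.
have rr1 : r <= r1 by rewrite ge_min lexx.
have rr2 : r <= r2 by rewrite !ge_min lexx orbT.
have rd0 : r <= d0 by rewrite !ge_min lexx !orbT.
move: r r' r0 r'0 r'r rr1 rr2 rd0 => r r' r0 r'0 r'r rr1 rr2 rd0.
have qb y : enorm (y - y0) < r -> `|q y| < 2^-1 /\ `|al * q y| <= 2^-1.
  move=> yr; have := hr2 y I (lt_le_trans yr rr2); rewrite q0 subr0 lt_min => /andP[-> h].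
  by rewrite normrM (gtr0_norm al0) mulrC -ler_pdivlMr // ltW.
pose X' := out `&` [set y | enorm (y - y0) <= r'].
have cX : compact X'.
  have -> : X' = (E `&` [set y | enorm (y - y0) <= r']) `&` [set y | L <= edot (y - z) (y - z)].
    by apply/seteqP; split => y /= [[h1 h2] h3].
  by apply: compact_closedI; [apply: hc => //; exact: lt_le_trans r'r rd0|exact: closed_sphere].
have Xd y : X' y -> enorm (y - y0) < d0 by move=> [_ /= h]; apply: le_lt_trans h (lt_le_trans r'r rd0).
have gc y : X' y -> cont_at X' gp y.
  by move=> [oy _]; apply: cont_at_sub (gap_cont sol L0 inv_out oy) => ? [].
pose K1 := X' `&` [set y | r' ^+ 2 <= edot (y - y0) (y - y0)].
have cK1 : compact K1.
  apply: compact_closedI => //; apply: closed_superlevel => y; exact: cont_at_dist.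
(* On the sphere of radius [r'] the gap is positive where [q >= 0]; the summand [|q| - q] takes care
   of the points with [q < 0], so that one compactness argument suffices. *)
have [m1 m10 hm1] : exists2 m, 0 < m & forall y, K1 y -> m <= gp y + (`|q y| - q y).
  apply: compact_min' => // y [Xy yr].
    apply: cont_atD; first by apply: cont_at_sub (gc y Xy) => ? [].
    have cq : cont_at K1 q y by apply: cont_at_sub (qc y (Xd y Xy)).
    by apply: cont_atB => //; exact: cont_at_norm.
  have [qn|qn] := lerP 0 (q y).
    rewrite ger0_norm // subrr addr0; apply: hgt => //; [by case: Xy|exact: Xd|].
    apply/eqP => yE; move: yr; rewrite /= yE subrr edot0l; apply/negP.
    by rewrite -ltNge exprn_gt0.
  have := hge y (proj1 Xy) (Xd y Xy); rewrite ltr0_norm //; lra.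
pose e := Num.min (e0 / 2) (m1 / 2).
have ee0 : 0 < e by rewrite lt_min !divr_gt0.
have ee : e < e0 by rewrite gt_min; apply/orP; left; lra.
have em : e < m1 by rewrite gt_min; apply/orP; right; lra.
move: e ee0 ee em => e ee0 ee em.
pose h y := q y + al * q y ^+ 2.
have jh y : enorm (y - y0) < d0 -> fdiff setT (fun y => e * h y) y ((e * (1 + 2 * al * q y)) *: gq y).
  move=> /hq[jq _ _ _]; rewrite -scalerA.
  exact: jet2_fdiff (jet2Z e (jet2_comp jq (taylor2_quad al (q y)))).
have nX : X' !=set0 by exists y0; split => //=; rewrite subrr enorm0 ltW.
have [y Xy ymin] : exists2 y, X' y & forall y', X' y' -> gp y - e * h y <= gp y' - e * h y'.
  apply: (compact_min (f := fun y => gp y - e * h y) nX cX) => y Xy.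
  apply: cont_atB; first exact: gc.
  by apply: cont_at_sub (fdiff_cont (jh y (Xd y Xy))).
have [yneg|ypos] := ltrP (gp y - e * h y) 0; last first.
  (* Nonnegative minimum: the gap dominates [e * h] with equality at [y0], and the derivative along
     [v] contradicts the vanishing gradient. *)
  have fd0 : fdiff out (fun y => gp y - e * h y) y0 (0 - (e * (1 + 2 * al * q y0)) *: gq y0).
    apply: fdiffB hfd _; apply: fdiff_sub (jh y0 _) => //; by rewrite subrr enorm0.
  have : 0 <= edot (0 - (e * (1 + 2 * al * q y0)) *: gq y0) v.
    apply: fdiff_dir fd0 _; exists (Num.min t0 (r' / (enorm v + 1))).
      by rewrite lt_min t00 divr_gt0 // ltr_wpDl ?enorm_ge0.
    move=> t /andP[tt]; rewrite lt_min => /andP[tt0].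
    rewrite ltr_pdivlMr ?ltr_wpDl ?enorm_ge0 // => tr.
    have ot : out (y0 + t *: v) by apply: hv; rewrite tt.
    split => //; rewrite mulr0 addr0 gp0 /h q0.
    have -> : 0 - e * (0 + al * 0 ^+ 2) = 0 by ring.
    apply: le_trans ypos (ymin _ _); split => //=.
    rewrite addrC addKr enormZ (gtr0_norm tt); apply: ltW (le_lt_trans _ tr).
    by rewrite ler_pM2l // lerDl.
  rewrite q0 mulr0 addr0 mulr1 sub0r edotNl edotZl oppr_ge0; apply/negP; rewrite -ltNge.
  exact: mulr_gt0.
have [oy /= yr'] := Xy; have yr := le_lt_trans yr' r'r; have yd := Xd y Xy.
have [qh qa] := qb y yr.
have gy0 := hge y oy yd.
have h0 : 0 < h y.
  have : 0 < e * h y by lra.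
  by rewrite pmulr_rgt0.
have a2 : 2^-1 <= 1 + al * q y <= 3 / 2 by move: qa; rewrite ler_norml => /andP[? ?]; apply/andP; split; lra.
have hE : h y = q y * (1 + al * q y) by rewrite /h; ring.
have qp : 0 < q y.
  have [a3 _] := andP a2; move: h0; rewrite hE pmulr_lgt0 //; lra.
have h1 : h y <= 1.
  rewrite hE -[1]/(1 : R); have [_ a3] := andP a2.
  have := ltr_norml (q y) 2^-1; rewrite qh => /esym/andP[_ q2].
  have a0 : 0 <= 1 + al * q y by case/andP: a2 => a0 _; apply: le_trans a0; rewrite invr_ge0 ler0n.
  apply: le_trans (ler_wpM2r a0 (ltW q2)) _; move: a3; move: (al * q y) => t; lra.
have ge : gp y <= e.
  have : e * h y <= e by rewrite -[leRHS]mulr1 ler_pM2l.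
  by lra.
have yin : enorm (y - y0) < r'.
  rewrite lt_neqAle yr' andbT; apply/eqP => yE.
  have : m1 <= gp y + (`|q y| - q y).
    by apply: hm1; split => //=; rewrite -sqr_enorm yE.
  by rewrite gtr0_norm // subrr; lra.
have [Ly hcase] := hpos y oy yd qp.
have near_y : exists2 d, 0 < d & forall u, enorm u < d -> E (y + u) -> X' (y + u).
  have [d1 d10 hd1] := @cont_at_dist R n setT z y _ ltac:(by rewrite -subr_gt0 in Ly; exact: Ly).
  exists (Num.min d1 (r' - enorm (y - y0))); first by rewrite lt_min d10 subr_gt0.
  move=> u; rewrite lt_min => /andP[u1 u2] Eu; split; first split => //.
    have := hd1 (y + u) I; rewrite addrC addKr addrC => /(_ u1).
    by rewrite ltr_norml => /andP[? _]; lra.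
  rewrite /= addrAC; apply: le_trans (enormD _ _) _; lra.
have [d1 d10 hd1] := near_y.
case: hcase => [[Oy Ox]|[nu [kk [dV [kk0 [t1 t10 ht1] fV hV hg]]]]].
  have [d2 d20 hd2] := so_open sol Oy.
  apply: (hint y e (Num.min d1 d2)) => //; rewrite ?lt_min ?d10 //.
    exact: lt_le_trans yr rr1.
  move=> u; rewrite lt_min => /andP[u1 u2]; apply: ymin; apply: hd1 => //.
  by apply: (so_sub sol); apply: hd2; rewrite addrC addKr.
have : 0 <= edot (dV - (e * (1 + 2 * al * q y)) *: gq y) (- nu).
  apply: (@fdiff_dir out (fun y => gp y - e * h y) y).
    by apply: fdiffB fV _; apply: fdiff_sub (jh y yd).
  exists (Num.min t1 (d1 / (enorm nu + 1))).
    by rewrite lt_min t10 divr_gt0 // ltr_wpDl ?enorm_ge0.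
  move=> t /andP[tt]; rewrite lt_min => /andP[tt1].
  rewrite ltr_pdivlMr ?ltr_wpDl ?enorm_ge0 // => tr.
  have Et : E (y + t *: - nu) by rewrite scalerN; apply: ht1; rewrite tt.
  have Xt : X' (y + t *: - nu).
    apply: hd1 => //; rewrite enormZ enormN (gtr0_norm tt); apply: le_lt_trans tr.
    by rewrite ler_pM2l // lerDl.
  by split; [case: Xt|rewrite mulr0 addr0; exact: ymin].
rewrite edotNr edotDl edotNl edotZl oppr_ge0 subr_le0 => hx.
(* The barrier decays with the factor [1 + 2 * al * q y], while the gap, at most [e * h y], carries
   only [1 + al * q y]: the correction has the favorable sign here as well. *)
have a4 : 0 < e * (1 + 2 * al * q y).
  by rewrite mulr_gt0 //; have : 0 < al * q y by [exact: mulr_gt0]; lra.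
have b1 : e * (1 + 2 * al * q y) * edot (gq y) nu < e * (1 + 2 * al * q y) * - (kk * q y).
  by rewrite ltr_pM2l.
have b2 : kk * gp y <= kk * (e * h y) by rewrite ler_wpM2l //; lra.
have b3 : 0 <= kk * e * al * q y ^+ 2.
  by apply: mulr_ge0 (sqr_ge0 _); rewrite !mulr_ge0 // ltW.
by rewrite hE in b2; move: b1 b2 b3 hx hV; rewrite -mulr_natl; lra.
Qed.

End Hopf.

(** Induction along the unit interval, used to follow contact points on a segment. *)
Lemma real_induction (R : realType) (P : R -> Prop) : P 0 ->
    (forall t, 0 <= t < 1 -> (forall s, 0 <= s <= t -> P s) ->
       exists2 d, 0 < d & forall s, t < s < t + d -> P s) ->
    (forall t, 0 < t <= 1 -> (forall s, 0 <= s < t -> P s) -> P t) -> P 1.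
Proof.
move=> P0 hop hcl; pose A := [set t : R | 0 <= t <= 1 /\ forall s, 0 <= s <= t -> P s].
have A0 : A 0.
  by split => [|s]; [rewrite lexx ler01|rewrite -eq_le => /eqP <-].
have sA : has_sup A by split; [exists 0|exists 1 => t [/andP[]]].
pose T := sup A.
have T0 : 0 <= T by exact: (sup_upper_bound sA).
have T1 : T <= 1 by apply: ge_sup => [|t [/andP[]]//]; exists 0.
have hlt s : 0 <= s < T -> P s.
  move=> /andP[s0 sT]; have [t [_ ht]] := @sup_adherent _ A (T - s) ltac:(by rewrite subr_gt0) sA.
  by rewrite opprB addrC subrK => st; apply: ht; rewrite s0 ltW.
have PT : P T.
  have [<-//|T0'] := eqVneq 0 T; apply: hcl => //; by rewrite lt_neqAle T0' T0.
have hle s : 0 <= s <= T -> P s.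
  by move=> /andP[s0]; rewrite le_eqVlt => /orP[/eqP ->//|sT]; apply: hlt; rewrite s0.
have [T1'|] := ltrP T 1; last by move=> h; have <- : T = 1 by apply/le_anti; rewrite T1.
have [d d0 hd] := hop T ltac:(by rewrite T0) hle.
pose t := Num.min (T + d / 2) 1.
have Tt : T < t by rewrite lt_min T1' andbT; lra.
have td : t < T + d by rewrite gt_min; apply/orP; left; lra.
have t1 : t <= 1 by rewrite ge_min lexx orbT.
suff At : A t by have := sup_upper_bound sA At; rewrite leNgt Tt.
split => [|s /andP[s0 st]]; first by rewrite t1 (le_trans T0 (ltW Tt)).
have [sT|sT] := lerP s T; first by apply: hle; rewrite s0.
by apply: hd; rewrite sT (le_lt_trans st td).
Qed.

(** * Barriers for the Hopf lemma *)

Section Barriers.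
Context {R : realType} {n : nat}.
Implicit Types (x y z v p c : 'rV[R]_n).

Local Notation sqd z y := (edot (y - z) (y - z)).

Lemma jet2_exact (g : 'rV[R]_n -> R) x p (M : 'M[R]_n) :
  (forall v, g (x + v) = g x + edot p v + 2^-1 * qform M v) -> jet2 g x p M.
Proof.
move=> h e e0; exists 1 => // v _; rewrite h.
set a := edot p v; set b := _ * qform M v.
have -> : g x + a + b - g x - a - b = 0 by ring.
by rewrite normr0 mulr_ge0 ?edot_ge0 ?ltW.
Qed.

Lemma jet2_sqd z x : jet2 (fun y => sqd z y) x (2 *: (x - z)) 2%:M.
Proof.
apply: jet2_exact => v; rewrite addrAC (edot_sqrD (x - z) v) qform_scalar edotZl.
by move: (edot (x - z) (x - z)) (edot _ v) (edot v v) => a b d; field.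
Qed.

Lemma taylor2_sqr (t : R) : taylor2 (fun s => s ^+ 2) t (2 * t) 2.
Proof.
move=> e e0; exists 1 => // s _.
set u := (X in `|X|); have -> : u = 0 by rewrite /u; field.
by rewrite normr0 mulr_ge0 ?sqr_ge0 // ltW.
Qed.

(** Polarization: the product is a quarter of a difference of two squares, and squares are covered
    by the chain rule. *)
Lemma jet2M (g h : 'rV[R]_n -> R) x p q (M K : 'M[R]_n) : jet2 g x p M -> jet2 h x q K ->
  jet2 (fun y => g y * h y) x (g x *: q + h x *: p)
    (g x *: K + h x *: M + (p^T *m q + q^T *m p)).
Proof.
move=> jg jh.
have j1 := jet2_comp (jet2D jg jh) (taylor2_sqr (g x + h x)).
have j2 := jet2_comp (jet2B jg jh) (taylor2_sqr (g x - h x)).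
apply: (jet2_eq _ _ _ (jet2Z 4^-1 (jet2B j1 j2))) => [y||].
- by move: (g y) (h y) => a b; field.
- by apply/rowP => i; rewrite !mxE; field.
- by apply/matrixP => i j; rewrite !mxE !big_ord1 !mxE; field.
Qed.

(** One family for all uses of the Hopf lemma: a function vanishing on a sphere about [z] (squared
    radius [- g0]), times a factor that tunes the normal derivative on a sphere about [c], minus
    |y-y0|^2, which shrinks the region of nonnegativity so that it touches the first sphere at [y0]
    only. *)
Definition barrier z c y0 (g0 b0 b1 : R) y : R :=
  (sqd z y + g0) * (b0 + b1 * sqd c y) - sqd y0 y.

Definition barrier_grad z c y0 (g0 b0 b1 : R) y : 'rV[R]_n :=
  (2 * (b0 + b1 * sqd c y)) *: (y - z) + (2 * b1 * (sqd z y + g0)) *: (y - c) - 2 *: (y - y0).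

Definition barrier_hess z c (g0 b0 b1 : R) y : 'M[R]_n :=
  (2 * b1 * (sqd z y + g0) + 2 * (b0 + b1 * sqd c y) - 2)%:M
  + (4 * b1) *: ((y - z)^T *m (y - c) + (y - c)^T *m (y - z)).

Lemma barrier_self z c y0 (g0 b0 b1 : R) :
  barrier z c y0 g0 b0 b1 y0 = (sqd z y0 + g0) * (b0 + b1 * sqd c y0).
Proof. by rewrite /barrier (subrr y0) edot0l subr0. Qed.

Lemma barrier_grad_self z c y0 (g0 b0 b1 : R) : barrier_grad z c y0 g0 b0 b1 y0 =
  (2 * (b0 + b1 * sqd c y0)) *: (y0 - z) + (2 * b1 * (sqd z y0 + g0)) *: (y0 - c).
Proof. by rewrite /barrier_grad (subrr y0) scaler0 subr0. Qed.

Lemma edot_barrier_grad z c y0 (g0 b0 b1 : R) y v : edot (barrier_grad z c y0 g0 b0 b1 y) v =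
  2 * (b0 + b1 * sqd c y) * edot (y - z) v + 2 * b1 * (sqd z y + g0) * edot (y - c) v
  - 2 * edot (y - y0) v.
Proof. by rewrite /barrier_grad; move: (y - z) (y - c) (y - y0) => a b d; rewrite !edotE. Qed.

Lemma jet2_barrier z c y0 (g0 b0 b1 : R) y :
  jet2 (barrier z c y0 g0 b0 b1) y (barrier_grad z c y0 g0 b0 b1 y) (barrier_hess z c g0 b0 b1 y).
Proof.
have jc (a : R) x : jet2 (fun=> a) x 0 0.
  by apply: jet2_exact => v; rewrite edot0l /qform mulmx0 edot0l mulr0 !addr0.
have jg := jet2D (jet2_sqd z y) (jc g0 y).
have jh := jet2D (jc b0 y) (jet2Z b1 (jet2_sqd c y)).
apply: (jet2_eq _ _ _ (jet2B (jet2M jg jh) (jet2_sqd y0 y))) => [//||].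
  by apply/rowP => i; rewrite !mxE; move: (edot _ _) (edot _ _) => a b; ring.
apply/matrixP => i j; rewrite !mxE !big_ord1 !mxE.
move: (edot _ _) (edot _ _) (y ord0 i - z ord0 i) (y ord0 j - z ord0 j) => A B a b.
by move: (y ord0 i - c ord0 i) (y ord0 j - c ord0 j) => a' b'; case: (i == j);
  rewrite ?mulr1n ?mulr0n; ring.
Qed.

Lemma cont_at_coord (E : set 'rV[R]_n) z x (i : 'I_n) : cont_at E (fun y => (y - z) 0 i) x.
Proof.
move=> e e0; exists e => // y _ yx; apply: le_lt_trans yx; apply: le_trans (coord_le_enorm _ i).
by rewrite !mxE opprB addrA subrK.
Qed.

Lemma barrier_grad_cont z c y0 (g0 b0 b1 : R) i x :
  cont_at setT (fun y => barrier_grad z c y0 g0 b0 b1 y 0 i) x.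
Proof.
have -> : (fun y => barrier_grad z c y0 g0 b0 b1 y 0 i) = (fun y =>
   2 * (b0 + b1 * sqd c y) * (y - z) 0 i + 2 * b1 * (sqd z y + g0) * (y - c) 0 i
   - 2 * (y - y0) 0 i) by apply/funext => y; rewrite !mxE.
have cD q : cont_at setT (fun y => sqd q y) x by exact: cont_at_dist.
have cC q : cont_at setT (fun y => (y - q) 0 i) x by exact: cont_at_coord.
apply: cont_atB; last by apply: cont_atM => //; exact: cont_at_cst.
apply: cont_atD; apply: cont_atM => //.
  by apply: cont_atZ; apply: cont_atD; [exact: cont_at_cst|exact: cont_atZ].
by apply: cont_atZ; apply: cont_atD; [|exact: cont_at_cst].
Qed.

Lemma barrier_hess_cont z c (g0 b0 b1 : R) i j x :
  cont_at setT (fun y => barrier_hess z c g0 b0 b1 y i j) x.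
Proof.
have -> : (fun y => barrier_hess z c g0 b0 b1 y i j) = (fun y =>
   (2 * b1 * (sqd z y + g0) + 2 * (b0 + b1 * sqd c y) - 2) * (i == j)%:R
   + 4 * b1 * ((y - z) 0 i * (y - c) 0 j + (y - c) 0 i * (y - z) 0 j)).
  by apply/funext => y; rewrite !mxE !big_ord1 !mxE mulr_natr.
have cD q : cont_at setT (fun y => sqd q y) x by exact: cont_at_dist.
have cC q k : cont_at setT (fun y => (y - q) 0 k) x by exact: cont_at_coord.
have cc (a : R) : cont_at setT (fun=> a) x by exact: cont_at_cst.
apply: cont_atD; last first.
  by apply: cont_atM => //; apply: cont_atD; apply: cont_atM.
apply: cont_atM => //; apply: cont_atB => //; apply: cont_atD; apply: cont_atM => //; apply: cont_atD => //.
by apply: cont_atM.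
Qed.

Lemma closed_zero (X : set 'rV[R]_n) (g : 'rV[R]_n -> R) : closed X ->
  (forall x, X x -> cont_at X g x) -> closed (X `&` [set y | g y = 0]).
Proof.
move=> cX cg x cx; have Xx : X x by apply: cX; apply: closure_subset cx => y [].
split => //=; apply/eqP; rewrite -normr_le0 leNgt; apply/negP => g0.
have [d d0 hd] := cg x Xx _ g0.
have [y [Xy /= gy] yd] := (closure_enormP _ _).1 cx d d0.
by have := hd y Xy yd; rewrite gy sub0r normrN ltxx.
Qed.

End Barriers.

(** * Depth with respect to a sphere of signed radius *)

Section Depth.
Context {R : realType} {n : nat}.
Implicit Types (x y z v p c : 'rV[R]_n).

(* R is a signed radius: positive for the outer sphere, negative for the removed balls, so that
   the depth is nonnegative in the domain and its gradient on the sphere is the inner unit normal. *)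
Definition depth c (r : R) y : R := (r ^+ 2 - edot (y - c) (y - c)) / (2 * r).

Lemma depth_line c (r t : R) y v : r != 0 ->
  depth c r (y + t *: v) = depth c r y - t * (edot (y - c) v / r) - t ^+ 2 * (edot v v / (2 * r)).
Proof.
move=> r0; rewrite /depth addrAC; move: (y - c) => u; rewrite edot_sqrD !edotE.
move: (edot u u) (edot u v) (edot v v) => a b d.
by field.
Qed.

(** For a point outside the sphere of inversion the depth of the image is a convex combination of
    the depth of the point and of a number attached to the inversion alone. If that number is
    nonnegative the inner side is preserved; it is zero exactly when the two spheres are
    orthogonal. *)
Lemma depth_sphinv c (r : R) z (L : R) y (t := L / edot (y - z) (y - z)) : r != 0 -> y - z != 0 ->
  depth c r (sphinv z L y) =
    (1 - t) * ((2 * depth c r z + L / r) / 2) + t * depth c r y.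
Proof.
move=> r0 yz; have D0 : edot (y - z) (y - z) != 0 by rewrite edot_eq0.
have sE : sphinv z L y - c = t *: (y - z) + (z - c).
  by rewrite /sphinv -/t addrAC addrC.
have yE : y - c = (y - z) + (z - c) by rewrite addrA subrK.
rewrite /depth sE yE edot_comb /t.
move: (y - z) (z - c) D0 => u v; rewrite (edot_sqrD u v); move: (edot u u) (edot u v) (edot v v) => D a b D0.
by field; rewrite r0.
Qed.

Lemma depth0 c (r : R) y : r != 0 -> depth c r y = 0 <-> edot (y - c) (y - c) = r ^+ 2.
Proof.
move=> r0; rewrite /depth; split => [/eqP|->]; last by rewrite subrr mul0r.
by rewrite mulf_eq0 invr_eq0 mulf_eq0 (negbTE r0) pnatr_eq0 /= orbF subr_eq0 => /eqP.
Qed.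

Lemma depth_gt0_outer c (r : R) y : 0 < r -> (0 < depth c r y) = (edot (y - c) (y - c) < r ^+ 2).
Proof. by move=> r0; rewrite /depth pmulr_lgt0 ?subr_gt0 // invr_gt0 mulr_gt0. Qed.

Lemma depth_ge0_outer c (r : R) y : 0 < r -> (0 <= depth c r y) = (edot (y - c) (y - c) <= r ^+ 2).
Proof. by move=> r0; rewrite /depth pmulr_lge0 ?subr_ge0 // invr_gt0 mulr_gt0. Qed.

Lemma depth_gt0_inner c (r : R) y : r < 0 -> (0 < depth c r y) = (r ^+ 2 < edot (y - c) (y - c)).
Proof. by move=> r0; rewrite /depth nmulr_lgt0 ?subr_lt0 // invr_lt0 pmulr_rlt0. Qed.

(* [rad] is a signed radius, [jo] the outer sphere and [bh] = 2 beta / (n - 2).  In [ss_apart] the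
   bound holds for the boundaries of disjoint balls, and also for the outer sphere and the boundary
   of a ball inside it, where both signs change. *)
Record sphere_setting (J : Type) (cen : J -> 'rV[R]_n) (rad : J -> R) (jo : J) (ch : J -> R)
    (bh : R) (E Om : set 'rV[R]_n) (w : 'rV[R]_n -> R) (G : 'rV[R]_n -> 'rV[R]_n) : Prop :=
  SphereSetting {
    ss_rad : forall j, rad j != 0;
    ss_outer : forall j, 0 < rad j <-> j = jo;
    ss_bh : 0 < bh;
    ss_ch : forall j, - bh < ch j;
    ss_ge0 : forall j y, E y -> 0 <= depth (cen j) (rad j) y;
    ss_gt0 : forall j y, Om y -> 0 < depth (cen j) (rad j) y;
    ss_bdry : forall y, E y -> ~ Om y -> exists j, depth (cen j) (rad j) y = 0;
    ss_local : forall j y, E y -> depth (cen j) (rad j) y = 0 -> exists2 d, 0 < d &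
      forall y', enorm (y' - y) < d -> (0 < depth (cen j) (rad j) y' -> Om y') /\
        (0 <= depth (cen j) (rad j) y' -> E y');
    ss_compact : forall m : R, 0 < m -> compact (E `&` [set y | m <= w y]);
    ss_hole : exists2 o, 0 <= depth (cen jo) (rad jo) o & ~ E o;
    ss_apart : forall b s, b <> s ->
      2 <= (edot (cen s - cen b) (cen s - cen b) - rad s ^+ 2 - rad b ^+ 2) / (rad s * rad b);
    ss_bc : forall j y, E y -> depth (cen j) (rad j) y = 0 ->
      edot (G y) ((rad j)^-1 *: (y - cen j)) = w y / rad j - ch j
  }.

End Depth.

(** * Comparison with a single reflection *)

Section OneSphere.
Context {R : realType} {n : nat}.
Implicit Types (x y v p c : 'rV[R]_n).
Context {Gam : set 'rV[R]_n} {f : 'rV[R]_n -> R} {E Om : set 'rV[R]_n}.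
Context {w : 'rV[R]_n -> R} {G : 'rV[R]_n -> 'rV[R]_n} {H : 'rV[R]_n -> 'M[R]_n}.
Hypotheses (n0 : (0 < n)%N) (hGam : admissible_cone Gam) (hf : admissible_function Gam f).
Hypothesis sol : solution_on Gam f E Om w G H.
Context {J : Type} {cen : J -> 'rV[R]_n} {rad : J -> R} {jo : J} {ch : J -> R} {bh : R}.
Hypothesis st : sphere_setting cen rad jo ch bh E Om w G.
Local Notation rho j := (depth (cen j) (rad j)).
Local Notation sqd z y := (edot (y - z) (y - z)).
(** In the ball of radius [2 * N] about [a] only the sphere [s] bounds the domain, and [w >= m].
    Centers [z] stay within [N] of [a] and radii below [N / 4], so the ball of inversion lies in
    that region. *)
Variables (s : J) (a : 'rV[R]_n) (N m : R).
Hypotheses (N0 : 0 < N) (m0 : 0 < m).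
Hypothesis hR : forall y, enorm (y - a) < 2 * N -> 0 <= rho s y -> E y /\ m <= w y.
Hypothesis hR' : forall y, enorm (y - a) < 2 * N -> 0 < rho s y -> Om y.
Variables (z : 'rV[R]_n) (L : R).
Hypotheses (L0 : 0 < L) (LN : L <= 16^-1 * N ^+ 2) (za : sqd a z < N ^+ 2).
Local Notation p0 := (2 * rho s z + L / rad s).
Hypothesis pp : 0 <= p0.
Local Notation out := (@outside R n E z L).
Local Notation gp := (@gap R n w z L).

Lemma ball_near y : sqd z y <= L -> enorm (y - a) < 2 * N.
Proof.
move=> h; have h1 : enorm (z - a) < N by rewrite enorm_ltE.
have h2 : enorm (y - z) <= N / 4.
  by rewrite enorm_leE ?divr_ge0 ?(ltW N0) // (le_trans h) // (le_trans LN) // expr_div_n; lra.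
have := enorm_dist z y a; move: N0 => h3; lra.
Qed.

Lemma sphinv_sqd y : out y -> sqd z (sphinv z L y) = L * (L / sqd z y).
Proof.
move=> oy; have D0 : edot (y - z) (y - z) != 0 by rewrite edot_eq0; exact: outside_neq L0 _ oy.
have -> : sphinv z L y - z = (L / sqd z y) *: (y - z) by rewrite /sphinv addrC addKr.
by rewrite edotZl edotZr; move: (edot _ _) D0 => D D0; field.
Qed.

Lemma out_tau y : out y -> 0 < L / sqd z y <= 1.
Proof.
move=> [_ h]; have h' := lt_le_trans L0 h.
by rewrite divr_gt0 // ler_pdivrMr // mul1r.
Qed.

Lemma inv_near y : out y -> enorm (sphinv z L y - a) < 2 * N.
Proof.
move=> oy; apply: ball_near; rewrite sphinv_sqd //; have /andP[h1 h2] := out_tau oy.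
by rewrite -[leRHS]mulr1 ler_pM2l.
Qed.

Lemma inv_E y : out y -> E (sphinv z L y) /\ m <= w (sphinv z L y).
Proof.
move=> oy; apply: hR; first exact: inv_near.
rewrite depth_sphinv ?(ss_rad st) ?(outside_neq L0 oy) //; have /andP[h1 h2] := out_tau oy.
by apply: addr_ge0; apply: mulr_ge0; [rewrite subr_ge0|rewrite divr_ge0|exact: ltW|apply: (ss_ge0 st); case: oy].
Qed.

Lemma inv_Om y : out y -> 0 < rho s y -> Om (sphinv z L y).
Proof.
move=> oy ry; apply: hR'; first exact: inv_near.
rewrite depth_sphinv ?(ss_rad st) ?(outside_neq L0 oy) //; have /andP[h1 h2] := out_tau oy.
apply: ltr_wpDl; last exact: mulr_gt0.
by apply: mulr_ge0; rewrite ?subr_ge0 ?divr_ge0.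
Qed.

Lemma inv_E' y : out y -> E (sphinv z L y). Proof. by move=> /inv_E[]. Qed.

Lemma kelvin_ge y : out y -> m <= kelvin z L w y.
Proof.
move=> oy; have [_ h] := inv_E oy; rewrite /kelvin -[m]mul1r; apply: ler_pM => //.
  exact: ltW.
by rewrite ler_pdivlMr // mul1r; case: oy.
Qed.

Hypothesis good : forall y, out y -> 0 <= gp y.

(** Compactness is available for superlevel sets of [w] only; near a point of [E], continuity bounds
    [w] from below and such a set takes over. *)
Lemma compact_near y0 : E y0 -> exists2 d, 0 < d &
  forall r, 0 < r -> r < d -> compact (E `&` [set y | enorm (y - y0) <= r]).
Proof.
move=> Ey; have wp := so_pos sol Ey.
have [d d0 hd] := cont_at_pos (w_cont sol Ey) wp; exists d => // r r0 rd.
have -> : E `&` [set y | enorm (y - y0) <= r] =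
    (E `&` [set y | w y0 / 2 <= w y]) `&` [set y | enorm (y - y0) <= r].
  apply/seteqP; split => y /= => [[E1 h]|[[E1 _] h]] //; split => //; split => //.
  by have /andP[/ltW] := hd y E1 (le_lt_trans h rd).
apply: compact_closedI; first by apply: (ss_compact st); rewrite divr_gt0.
by rewrite enorm_leE' ?(ltW r0) //; apply: closed_sublevel => x; exact: cont_at_dist.
Qed.

Lemma hopf_barrier z1 c1 (g0 b0 b1 : R) y0 v (q := barrier z1 c1 y0 g0 b0 b1)
    (gq := barrier_grad z1 c1 y0 g0 b0 b1) : out y0 -> q y0 = 0 -> gp y0 = 0 ->
    (exists2 d, 0 < d & forall y, out y -> enorm (y - y0) < d -> y != y0 -> 0 <= q y ->
      [/\ 0 < gp y, L < sqd z y &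
        (Om y /\ Om (sphinv z L y)) \/ @neumann_ok R n E w z L q gq y]) ->
    0 < edot (gq y0) v ->
    (exists2 t0, 0 < t0 & forall t, 0 < t < t0 -> out (y0 + t *: v)) ->
  ~ fdiff out gp y0 0.
Proof.
move=> oy0 q0 gp0 [d d0 hd] gv hv.
pose Hq := barrier_hess z1 c1 g0 b0 b1.
have cg : cont_at setT (fun y => edot (gq y) (gq y)) y0.
  by apply: cont_at_sum => i; apply: cont_atM; exact: barrier_grad_cont.
have ch1 : cont_at setT (fun y => mxsize (Hq y)) y0.
  by apply: cont_at_sum => i; apply: cont_at_sum => j; apply: cont_at_norm; exact: barrier_hess_cont.
have g1 : 0 < edot (gq y0) (gq y0).
  apply: edot_gt0; apply/eqP => gE; move: gv; rewrite gE edot0l ltxx //.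
have [d1 d10 h1] := cont_at_pos cg g1.
have [d2 d20 h2] := cont_at_bound ch1.
have [d3 d30 h3] := compact_near (proj1 oy0).
pose C := (2 * edot (gq y0) (gq y0) + 1) + (mxsize (Hq y0) + 1).
have s0 := mxsize_ge0 (Hq y0).
pose d' := Num.min (Num.min d d1) (Num.min d2 d3).
have d'0 : 0 < d' by rewrite !lt_min d0 d10 d20 d30.
apply: (@hopf R n Gam f E Om w G H n0 hGam hf sol z L L0 inv_E' y0 q gq Hq
  (edot (gq y0) (gq y0) / 2) C d' v) => //.
- by rewrite divr_gt0.
- move=> y; rewrite !lt_min => /andP[/andP[_ yd1] /andP[yd2 _]].
  have /andP[a1 a2] := h1 y I yd1; have := h2 y I yd2.
  rewrite (ger0_norm (mxsize_ge0 _)) (ger0_norm s0) => a3.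
  split; [exact: jet2_barrier | | |exact: ltW].
    rewrite enorm_leE /C; last lra.
    by have := edot_ge0 (gq y); nra.
  move=> u; apply: le_trans (qform_le _ _) _; rewrite ler_wpM2r ?edot_ge0 // /C; lra.
- move=> r r0; rewrite !lt_min => /andP[_ /andP[_ rd]]; exact: h3.
- by move=> y oy _; exact: good.
- move=> y oy; rewrite !lt_min => /andP[/andP[yd _] _] yy qy.
  by have [] := hd y oy yd yy qy.
- move=> y oy; rewrite !lt_min => /andP[/andP[yd _] _] qy.
  have yy : y != y0 by apply/eqP => yE; move: qy; rewrite yE q0 ltxx.
  by have [] := hd y oy yd yy (ltW qy).
Qed.

Lemma gap_dir y v : out y -> gp y = 0 ->
    (exists2 t0, 0 < t0 & forall t, 0 < t < t0 -> out (y + t *: v)) ->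
  0 <= edot (@gap_grad R n w G z L y) v.
Proof.
move=> oy gy [t0 t00 ht]; apply: (fdiff_dir (gap_fdiff sol L0 inv_E' oy)).
exists t0 => // t /ht o; split=> //; by rewrite gy mulr0 addr0; exact: good.
Qed.

Lemma ball_dir (X : set 'rV[R]_n) y v d : 0 < d -> (forall y', enorm (y' - y) < d -> X y') ->
  exists2 t0 : R, 0 < t0 & forall t, 0 < t < t0 -> X (y + t *: v).
Proof.
move=> d0 h; exists (d / (enorm v + 1)); first by rewrite divr_gt0 // ltr_wpDl ?enorm_ge0.
move=> t /andP[t0]; rewrite ltr_pdivlMr ?ltr_wpDl ?enorm_ge0 // => td; apply: h.
rewrite addrC addKr enormZ (gtr0_norm t0); apply: le_lt_trans td.
by rewrite ler_pM2l // lerDl.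
Qed.

Lemma out_ball y0 : Om y0 -> L < sqd z y0 -> exists2 d, 0 < d &
  forall y, enorm (y - y0) < d -> [/\ Om y, L < sqd z y & out y].
Proof.
move=> Oy Ly; have [d1 d10 h1] := so_open sol Oy.
have [d2 d20 h2] := @cont_at_dist R n setT z y0 _ ltac:(by rewrite -subr_gt0 in Ly; exact: Ly).
exists (Num.min d1 d2); first by rewrite lt_min d10.
move=> y; rewrite lt_min => /andP[y1 y2].
have Oy' := h1 y y1; have L' : L < sqd z y.
  by have := h2 y I y2; rewrite ltr_norml => /andP[? _]; lra.
by split => //; split; [exact: (so_sub sol)|exact: ltW].
Qed.

(** Hopf's proof of the strong maximum principle: about a nearby point [q0] where the gap is not
    zero a ball is grown up to the nearest zero [y1]. The gap has an interior minimum at [y1], hence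
    zero gradient, against the Hopf lemma. *)
Lemma smp_local y0 : Om y0 -> L < sqd z y0 -> gp y0 = 0 ->
  exists2 d, 0 < d & forall y, enorm (y - y0) < d -> gp y = 0.
Proof.
move=> Oy0 Ly0 gy0; have [d0 d00 hd] := out_ball Oy0 Ly0.
exists (d0 / 2); first by rewrite divr_gt0.
move=> q0 q0d; apply: contrapT => gq0.
pose rr := enorm (y0 - q0).
have rd : rr < d0 / 2 by rewrite /rr enormBC.
have inK y : enorm (y - q0) <= rr -> [/\ Om y, L < sqd z y & out y].
  move=> h; apply: hd; have := enorm_dist q0 y y0; lra.
pose K := [set y | enorm (y - q0) <= rr].
have clK : closed K.
  rewrite /K enorm_leE' ?enorm_ge0 //; apply: closed_sublevel => x; exact: cont_at_dist.
have cZ : compact (K `&` [set y | gp y = 0]).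
  apply: (@enorm_bounded_compact _ _ _ q0 rr); last by move=> y [].
  apply: closed_zero => // x Kx; have [_ _ ox] := inK x Kx.
  apply: cont_at_sub (gap_cont sol L0 inv_E' ox) => y Ky; by have [] := inK y Ky.
have [y1 [Ky1 /= g1] ymin] : exists2 x, (K `&` [set y | gp y = 0]) x &
    forall y, (K `&` [set y | gp y = 0]) y -> sqd q0 x <= sqd q0 y.
  by apply: (compact_min (f := fun y => sqd q0 y)) => // [|x _]; [exists y0; split; rewrite /K /rr //= lexx|exact: cont_at_dist].
have [Oy1 Ly1 oy1] := inK y1 Ky1.
have t0 : 0 < sqd q0 y1.
  by apply: edot_gt0; rewrite subr_eq0; apply/eqP => yE; apply: gq0; rewrite -yE.
have gg0 : @gap_grad R n w G z L y1 = 0.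
  have [d1 d10 h1] := out_ball Oy1 Ly1.
  have := @gap_dir y1 (- @gap_grad R n w G z L y1) oy1 g1.
  rewrite edotNr oppr_ge0 => h; apply/eqP; rewrite -edot_eq0 eq_le edot_ge0 andbT.
  apply: h; apply: (ball_dir _ d10) => y' /h1[] //.
(* The barrier is |y1-q0|^2 - |y-q0|^2 - |y-y1|^2, which away from [y1] is nonnegative only inside
   the ball about [q0]. *)
apply: (@hopf_barrier q0 0 (- sqd q0 y1) (-1) 0 y1 (q0 - y1)) => //.
- by rewrite barrier_self subrr mul0r.
- exists 1 => // y oy _ yy1; rewrite /barrier mul0r addr0 mulrN1 opprB => hq.
  have s1 : 0 < sqd y1 y by apply: edot_gt0; rewrite subr_eq0.
  have s2 : sqd q0 y < sqd q0 y1 by lra.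
  have yK : K y.
    rewrite /K /= enorm_leE ?enorm_ge0 //; apply: ltW (lt_le_trans s2 _).
    by rewrite -enorm_leE ?enorm_ge0.
  have [Oy Ly _] := inK y yK; split => //; last by left; split => //; apply: inv_Om; [|apply: (ss_gt0 st)].
  rewrite lt_neqAle good // andbT; apply/eqP => g0; have := ymin y; rewrite leNgt s2 => h.
  by have := h (conj yK (esym g0)).
- rewrite barrier_grad_self mul0r addr0 mulr0 mul0r scale0r addr0 edotZl.
  have -> : q0 - y1 = - (y1 - q0) by rewrite opprB.
  by rewrite edotNr mulrN mulrN1 mulNr opprK mulr_gt0.
- exists 1 => // t /andP[t1 t2]; have [] // := inK (y1 + t *: (q0 - y1)).
  have -> : y1 + t *: (q0 - y1) - q0 = (1 - t) *: (y1 - q0).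
    by apply/rowP => i; rewrite !mxE; ring.
  rewrite enormZ ger0_norm ?subr_ge0 ?(ltW t2) //; apply: le_trans Ky1.
  rewrite -[leRHS]mul1r ler_wpM2r ?enorm_ge0 //; lra.
- have := gap_fdiff sol L0 inv_E' oy1; by rewrite gg0.
Qed.

Lemma closed_superE y (e : R) : 0 < e ->
  (forall d, 0 < d -> exists y', [/\ E y', e <= w y' & enorm (y' - y) < d]) -> E y.
Proof.
move=> e0 h; have c1 : closed (E `&` [set y | e <= w y]).
  by apply: compact_closed; [exact: norm_hausdorff|exact: (ss_compact st)].
suff [] : (E `&` [set y | e <= w y]) y by [].
by apply: c1; apply/closure_enormP => d /h[y' [? ? ?]]; exists y'.
Qed.

(** Zeros of the gap propagate along the segment by [smp_local]. Where the gap vanishes, [w] equals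
    its Kelvin transform and is at least [m], so limits of such points stay in [E], and the
    propagation can stop only at a contact on the boundary. *)
Lemma seg_touch y y1 : Om y -> gp y = 0 ->
    (forall t, 0 <= t < 1 -> L < sqd z (y + t *: (y1 - y))) -> (E y1 -> L < sqd z y1) ->
  (E y1 /\ gp y1 = 0) \/ exists t, [/\ 0 < t <= 1, out (y + t *: (y1 - y)),
    L < sqd z (y + t *: (y1 - y)), gp (y + t *: (y1 - y)) = 0 & ~ Om (y + t *: (y1 - y))].
Proof.
move=> Oy gy hs hs1; pose ga t := y + t *: (y1 - y).
have [?|nex] := pselect (exists t, [/\ 0 < t <= 1, out (ga t), L < sqd z (ga t), gp (ga t) = 0 &
  ~ Om (ga t)]); first by right.
have ga0 : ga 0 = y by rewrite /ga scale0r addr0.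
have ga1 : ga 1 = y1 by rewrite /ga scale1r addrC subrK.
left; suff [Oy1 g1] : Om (ga 1) /\ gp (ga 1) = 0 by rewrite -ga1; split=> //; exact: (so_sub sol).
pose NN := enorm (y1 - y) + 1; have NN0 : 0 < NN by rewrite ltr_wpDl ?enorm_ge0.
have gaB t t' : enorm (ga t' - ga t) <= `|t' - t| * NN.
  have -> : ga t' - ga t = (t' - t) *: (y1 - y) by apply/rowP => i; rewrite !mxE; ring.
  by rewrite enormZ ler_wpM2l // lerDl.
apply: (real_induction (P := fun t => Om (ga t) /\ gp (ga t) = 0)).
- by rewrite ga0.
- move=> t /andP[t0 t1] hP; have [|Ot gt] := hP t; first by rewrite t0 lexx.
  have Lt := hs t ltac:(by rewrite t0); have [d1 d10 h1] := smp_local Ot Lt gt.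
  have [d2 d20 h2] := so_open sol Ot.
  exists (Num.min d1 d2 / NN); first by rewrite divr_gt0 // lt_min d10.
  move=> s' /andP[ts]; rewrite addrC -ltrBlDr ltr_pdivlMr // => hs'.
  have : enorm (ga s' - ga t) < Num.min d1 d2.
    by apply: le_lt_trans (gaB t s') _; rewrite gtr0_norm ?subr_gt0.
  by rewrite lt_min => /andP[/h1 ? /h2].
- move=> t /andP[t0 t1] hP.
  have app d : 0 < d -> exists s', [/\ 0 <= s' < t & enorm (ga s' - ga t) < d].
    move=> d0; exists (t - Num.min (t / 2) (d / 2 / NN)).
    have m1 : 0 < Num.min (t / 2) (d / 2 / NN) by rewrite lt_min !divr_gt0.
    have m2 : Num.min (t / 2) (d / 2 / NN) <= t / 2 by rewrite ge_min lexx.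
    have m3 : Num.min (t / 2) (d / 2 / NN) <= d / 2 / NN by rewrite ge_min lexx orbT.
    split; first by apply/andP; split; lra.
    apply: le_lt_trans (gaB _ _) _; rewrite addrAC subrr sub0r normrN (gtr0_norm m1).
    by move: m3; rewrite ler_pdivlMr // => m3; lra.
  have os s' : 0 <= s' < t -> out (ga s').
    move=> h; have [Os _] := hP s' h; split; first exact: (so_sub sol).
    by apply: ltW; apply: hs; case/andP: h => -> h; apply: lt_le_trans h t1.
  have Et : E (ga t).
    apply: (@closed_superE _ m) => // d /app[s' [hs' sd]]; exists (ga s').
    have o := os s' hs'; have [_ g0] := hP s' hs'.
    split => //; first by case: o.
    by have := kelvin_ge o; move: g0; rewrite /gap => /eqP; rewrite subr_eq0 => /eqP ->.
  have Lt : L < sqd z (ga t).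
    have [t1'|t1'] := ltrP t 1; first by apply: hs; rewrite (ltW t0).
    have tE : t = 1 by apply/le_anti; rewrite t1.
    by rewrite tE ga1; apply: hs1; rewrite -ga1 -tE.
  have ot : out (ga t) by split => //; exact: ltW.
  have gt : gp (ga t) = 0.
    apply/eqP; rewrite -normr_le0 leNgt; apply/negP => gt0.
    have [d d0 hd] := gap_cont sol L0 inv_E' ot gt0.
    have [s' [hs' sd]] := app d d0; have [_ g0] := hP s' hs'.
    by have := hd _ (os s' hs') sd; rewrite g0 sub0r normrN ltxx.
  split => //; apply: contrapT => nO; apply: nex; exists t; split => //; by rewrite t0.
Qed.

Local Notation gg := (@gap_grad R n w G z L).
Local Notation c := (cen s).
Local Notation r := (rad s).
Let rad0 : r != 0 := ss_rad st s.

(** [p0 = 0] is orthogonality of the sphere of inversion and [s]. *)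
Lemma orth_center : p0 = 0 -> sqd c z = r ^+ 2 + L.
Proof.
rewrite /depth; move: (sqd c z) => D h; have : r * (2 * ((r ^+ 2 - D) / (2 * r)) + L / r) = 0 by rewrite h mulr0.
have -> : r * (2 * ((r ^+ 2 - D) / (2 * r)) + L / r) = r ^+ 2 - D + L by field.
by lra.
Qed.

Lemma orth_edot y : p0 = 0 -> rho s y = 0 -> edot (y - z) (y - c) = (sqd z y - L) / 2.
Proof.
move=> /orth_center h1 /(depth0 _ _ rad0) h2.
have h3 : z - c = (y - c) - (y - z) by apply/rowP => i; rewrite !mxE; ring.
move: h1; rewrite h3; move: (y - c) (y - z) h2 => u v; rewrite !edotE (edotC u v) => h2 h.
by lra.
Qed.

(** An orthogonal inversion maps [s] to itself, so a point and its image obey the boundary condition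
    with the same constant. The constants cancel and the gap satisfies a homogeneous condition. *)
Lemma gap_normal y : p0 = 0 -> out y -> rho s y = 0 ->
  edot (gg y) (r^-1 *: (y - c)) = gp y / r.
Proof.
move=> p00 oy ry; have yz := outside_neq L0 oy; have D0 := edot_gt0 yz.
have rx : rho s (sphinv z L y) = 0 by rewrite depth_sphinv // p00 ry mul0r !mulr0 addr0.
have [Ex _] := inv_E oy; have bx := ss_bc st Ex rx.
have by' := ss_bc st (proj1 oy) ry.
have e1 := orth_edot p00 ry.
have e2 : (y - c) *m reflmx (y - z) = sphinv z L y - c.
  rewrite mul_reflmx e1.
  have -> : sphinv z L y - c = (L / sqd z y) *: (y - z) + (z - c).
    by rewrite /sphinv addrAC addrC.
  have -> : y - c = (y - z) + (z - c) by rewrite addrA subrK.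
  move: (y - z) (z - c) D0 => u v D0; rewrite addrAC -[X in X - _]scale1r -scalerBl; congr (_ *: _ + _).
  by move: D0; move: (edot u u) => D D0; field; rewrite lt0r_neq0.
rewrite /gap_grad /kelvin_grad edotDl edotNl by' edotDl edotZl edotZr e1.
have -> : edot (G (sphinv z L y) *m reflmx (y - z)) (r^-1 *: (y - c)) =
    edot (G (sphinv z L y)) (r^-1 *: (sphinv z L y - c)).
  by rewrite edot_mulmx reflmx_sym -scalemxAl e2.
rewrite bx /gap /kelvin; move: D0; move: (sqd z y) (w y) (w _) => D W W' D0.
by field; rewrite rad0 lt0r_neq0.
Qed.

Lemma inward_dir j y v : E y -> rho j y = 0 -> edot (y - cen j) v / rad j < 0 ->
  exists2 t0, 0 < t0 & forall t, 0 < t < t0 -> E (y + t *: v) /\ 0 < rho j (y + t *: v).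
Proof.
move=> Ey ry hv; have [d d0 hd] := ss_local st Ey ry.
have [t1 t10 h1] := @ball_dir [set y' | enorm (y' - y) < d] y v d d0 (fun _ => id).
pose k := - (edot (y - cen j) v / rad j); have k0 : 0 < k by rewrite oppr_gt0.
pose b := `|edot v v / (2 * rad j)| + 1.
have b0 : 0 < b by rewrite ltr_wpDl.
exists (Num.min t1 (k / b)); first by rewrite lt_min t10 divr_gt0.
move=> t /andP[tt]; rewrite lt_min => /andP[tt1]; rewrite ltr_pdivlMr // => tb.
have rp : 0 < rho j (y + t *: v).
  rewrite depth_line ?(ss_rad st) // ry sub0r.
  have -> : - (t * (edot (y - cen j) v / rad j)) = t * k by rewrite mulrN.
  have -> : t * k - t ^+ 2 * (edot v v / (2 * rad j)) = t * (k - t * (edot v v / (2 * rad j))) by ring.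
  rewrite mulr_gt0 // subr_gt0; apply: le_lt_trans tb; rewrite ler_pM2l // /b.
  by apply: le_trans (ler_norm _) _; rewrite lerDl.
by split => //; have [_] := hd _ (h1 t ltac:(by rewrite tt)); apply; exact: ltW.
Qed.

Lemma far_dir y v : L < sqd z y \/ L <= sqd z y /\ 0 < edot (y - z) v ->
  exists2 t0 : R, 0 < t0 & forall t, 0 < t < t0 -> L <= sqd z (y + t *: v).
Proof.
case=> [h|[h1 h2]].
  have [d d0 hd] := @cont_at_dist R n setT z y _ ltac:(by rewrite -subr_gt0 in h; exact: h).
  apply: (@ball_dir [set y' | L <= sqd z y'] y v d d0) => y' /(hd y' I).
  by rewrite ltr_norml /= => /andP[? _]; lra.
exists 1 => // t /andP[t0 _]; rewrite addrAC (edot_sqrD (y - z)) !edotZr edotZl.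
have := edot_ge0 v; move: (edot v v) => a' a0.
have b0 : 0 <= t * (t * a') by rewrite !mulr_ge0 // ltW.
have c0 : 0 < t * edot (y - z) v by rewrite mulr_gt0.
by lra.
Qed.

Lemma dirI (P Q : R -> Prop) : (exists2 t0 : R, 0 < t0 & forall t, 0 < t < t0 -> P t) ->
  (exists2 t0 : R, 0 < t0 & forall t, 0 < t < t0 -> Q t) ->
  exists2 t0 : R, 0 < t0 & forall t, 0 < t < t0 -> P t /\ Q t.
Proof.
move=> [t1 t10 h1] [t2 t20 h2]; exists (Num.min t1 t2); first by rewrite lt_min t10.
by move=> t /andP[t0]; rewrite lt_min => /andP[a1 a2]; split; [apply: h1|apply: h2]; rewrite t0.
Qed.

Lemma out_dir j y v : E y -> rho j y = 0 -> edot (y - cen j) v / rad j < 0 ->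
  L < sqd z y \/ L <= sqd z y /\ 0 < edot (y - z) v ->
  exists2 t0, 0 < t0 & forall t, 0 < t < t0 -> out (y + t *: v).
Proof.
move=> Ey ry h1 h2; have [t0 t00 h] := dirI (inward_dir Ey ry h1) (far_dir h2).
by exists t0 => // t /h[[]].
Qed.

Lemma normal_unit j y : rho j y = 0 -> edot (y - cen j) ((rad j)^-1 *: (y - cen j)) / rad j = 1.
Proof.
have rj := ss_rad st j; move=> /(depth0 _ _ rj) h; rewrite edotZr h; by field.
Qed.

(** At a contact on [s] the gradient of the gap vanishes, by [gap_normal] and minimality. Without
    any interior contact the gap would be positive inside, and the Hopf lemma with the barrier
    [rho s y - |y-y0|^2] would apply. *)
Lemma touch_orth y0 : p0 = 0 -> out y0 -> L < sqd z y0 -> gp y0 = 0 -> rho s y0 = 0 ->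
  exists y, [/\ out y, Om y, L < sqd z y & gp y = 0].
Proof.
move=> p00 oy Ly gy ry; apply: contrapT => hex.
have gn : edot (gg y0) (r^-1 *: (y0 - c)) = 0 by rewrite gap_normal // gy mul0r.
have nn := normal_unit ry.
have gg0 : gg y0 = 0.
  have := @gap_dir y0 (- gg y0 - r^-1 *: (y0 - c)) oy gy.
  rewrite edotDr !edotNr gn subr0 oppr_ge0 => h; apply/eqP.
  rewrite -edot_eq0 eq_le edot_ge0 andbT; apply: h; apply: (out_dir (j := s)) => //; [by case: oy| |by left].
  rewrite edotDr !edotNr mulrDl mulNr mulNr nn edotC.
  have -> : edot (gg y0) (y0 - c) / r = 0 by move: gn; rewrite edotZr mulrC.
  by rewrite oppr0 sub0r oppr_lt0.
have [d d0 hd] := ss_local st (proj1 oy) ry.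
have [d2 d20 hd2] := @cont_at_dist R n setT z y0 _ ltac:(by rewrite -subr_gt0 in Ly; exact: Ly).
have qE y : barrier c 0 y0 (- r ^+ 2) (- (2 * r)^-1) 0 y = rho s y - sqd y0 y.
  by rewrite /barrier /depth mul0r addr0; congr (_ - _); field.
apply: (@hopf_barrier c 0 (- r ^+ 2) (- (2 * r)^-1) 0 y0 (- (r^-1 *: (y0 - c)))) => //.
- by rewrite qE ry subrr edot0l subr0.
- exists (Num.min d d2); first by rewrite lt_min d0.
  move=> y oy'; rewrite lt_min => /andP[yd yd2] yy; rewrite qE => hq.
  have s1 : 0 < sqd y0 y by apply: edot_gt0; rewrite subr_eq0.
  have rp : 0 < rho s y by lra.
  have [/(_ rp) Oy _] := hd y yd.
  have Ly' : L < sqd z y by have := hd2 y I yd2; rewrite ltr_norml => /andP[? _]; lra.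
  split => //; last by left; split => //; exact: inv_Om.
  rewrite lt_neqAle good // andbT; apply/eqP => g0; apply: hex; exists y; split => //.
- rewrite barrier_grad_self mul0r addr0 mulr0 mul0r scale0r addr0 edotZl edotNr edotZr.
  have -> : edot (y0 - c) (y0 - c) = r ^+ 2 by apply/depth0.
  have -> : 2 * - (2 * r)^-1 * - (r^-1 * r ^+ 2) = 1 by field.
  exact: ltr01.
- apply: (out_dir (j := s)) => //; [by case: oy| |by left].
  by rewrite edotNr mulNr nn oppr_lt0.
- by have := gap_fdiff sol L0 inv_E' oy; rewrite gg0.
Qed.

Lemma far_point y v : v != 0 -> exists2 T : R, 0 < T & ~ E (y + T *: v).
Proof.
move=> v0; have vp : 0 < enorm v by rewrite enorm_gt0.
have ro : 0 < rad jo by apply/(ss_outer st).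
pose T := (enorm (y - cen jo) + rad jo + 1) / enorm v.
exists T; first by rewrite divr_gt0 // ltr_wpDl // addr_ge0 ?enorm_ge0 ?ltW.
move=> /(ss_ge0 st jo); rewrite depth_ge0_outer // -enorm_leE; last exact: ltW.
have -> : y + T *: v - cen jo = T *: v - (cen jo - y).
  by apply/rowP => i; rewrite !mxE; ring.
have := enorm_triB (T *: v) (cen jo - y); rewrite enormZ gtr0_norm; last first.
  by rewrite divr_gt0 // ltr_wpDl // addr_ge0 ?enorm_ge0 ?ltW.
rewrite /T divfK ?lt0r_neq0 // enormBC; lra.
Qed.

(** By convexity of the ball, a ray from a point of the ball that has left it does not return. *)
Lemma star_out q mm y (Q la : R) : sqd q mm <= Q -> Q < sqd q y -> 1 <= la ->
  Q < sqd q (mm + la *: (y - mm)).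
Proof.
move=> h1 h2 h3.
have e1 : y - q = (mm - q) + (y - mm) by apply/rowP => i; rewrite !mxE; ring.
have e2 : mm + la *: (y - mm) - q = la *: (y - mm) + (mm - q) by rewrite addrAC addrC.
move: h2; rewrite e1 e2 edot_comb (edot_sqrD (mm - q)) (edotC (mm - q)) => h2.
have := edot_ge0 (y - mm); move: (y - mm) (mm - q) h1 h2 => v u h1 h2 h4.
have h5 : 0 <= (la ^+ 2 - la) * edot v v.
  by apply: mulr_ge0 => //; rewrite expr2 -[X in _ - X]mul1r -mulrBl mulr_ge0; lra.
have h6 : la * Q < la * (edot u u + 2 * edot v u + edot v v) by rewrite ltr_pM2l //; lra.
have h7 : (la - 1) * edot u u <= (la - 1) * Q by rewrite ler_wpM2l //; lra.
by lra.
Qed.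

Lemma edot_conv u v (t : R) : edot ((1 - t) *: u + t *: v) ((1 - t) *: u + t *: v) =
  (1 - t) * edot u u + t * edot v v - t * (1 - t) * edot (u - v) (u - v).
Proof. by rewrite !edotE (edotC v u); ring. Qed.

Lemma seg_sub (q y y1 : 'rV[R]_n) (t : R) : y + t *: (y1 - y) - q = (1 - t) *: (y - q) + t *: (y1 - q).
Proof. by apply/rowP => i; rewrite !mxE; ring. Qed.

Hypothesis no_bdry : forall y b, out y -> L < sqd z y -> gp y = 0 -> rho b y = 0 ->
  b <> s \/ 0 < p0 -> False.

Lemma no_bdry_s y : out y -> L < sqd z y -> gp y = 0 -> ~ Om y -> 0 < rho s y -> False.
Proof.
move=> oy Ly gy nO ry; have [b rb] := ss_bdry st (proj1 oy) nO.
by apply: (no_bdry oy Ly gy rb); left => bs; move: ry; rewrite -bs rb ltxx.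
Qed.

(** [seg_touch] carries an interior contact towards a point outside [E], so it has to become a
    boundary contact on the way. The segments avoid the ball of inversion and, in the orthogonal
    case, also [s], so that this contact is one that [no_bdry] excludes. Their choice depends on
    [p0] and on the sign of the radius. *)
Lemma no_touch_int y : Om y -> L < sqd z y -> gp y = 0 -> False.
Proof.
move=> Oy Ly gy.
have yz : y - z != 0 by apply/eqP => h; move: Ly; rewrite h edot0l ltNge ltW.
have [pz|pz] := ltrP 0 p0.
  have [T T0 nE] := far_point y yz.
  have e t : y + t *: (y + T *: (y - z) - y) = z + (1 + t * T) *: (y - z).
    by apply/rowP => i; rewrite !mxE; ring.
  have hL t : 0 <= t -> L < sqd z (y + t *: (y + T *: (y - z) - y)).
    move=> t0; rewrite e addrC addKr edotZl edotZr mulrA; apply: lt_le_trans Ly _.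
    rewrite -[leLHS]mul1r ler_wpM2r ?edot_ge0 //.
    by have := mulr_ge0 t0 (ltW T0); nra.
  have [t /andP[t0 _]|//|[//]|[t [tt o Lt gt nO]]] := seg_touch Oy gy (y1 := y + T *: (y - z)).
    exact: hL.
  have [b rb] := ss_bdry st (proj1 o) nO; by apply: (no_bdry o Lt gt rb); right.
have p00 : p0 = 0 by apply/le_anti; rewrite pz.
have cz := orth_center p00; have rs := ss_gt0 st s Oy.
have r2 : 0 < r ^+ 2 by rewrite exprn_even_gt0.
have [rp|rn] := ltrP 0 r; last first.
  have {}rn : r < 0 by rewrite lt_neqAle rad0.
  (* [mm] is the inverse of [z] in the sphere [s]. By orthogonality it lies in both balls, so the
     ray from [mm] through [y] stays outside both of them. *)
  pose k := r ^+ 2 / sqd c z; pose mm := c + k *: (z - c).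
  have cz0 : 0 < sqd c z by rewrite cz addr_gt0.
  have m1 : sqd c mm <= r ^+ 2.
    have kc : k * sqd c z = r ^+ 2 by rewrite divfK // lt0r_neq0.
    rewrite /mm addrC addKr edotZl edotZr kc -[leRHS]mul1r ler_pM2r //.
    by rewrite ler_pdivrMr // mul1r cz lerDl ltW.
  have m2 : sqd z mm <= L.
    have -> : mm - z = (k - 1) *: (z - c) by apply/rowP => i; rewrite !mxE; ring.
    rewrite edotZl edotZr /k cz.
    have -> : (r ^+ 2 / (r ^+ 2 + L) - 1) * ((r ^+ 2 / (r ^+ 2 + L) - 1) * (r ^+ 2 + L)) =
      L * (L / (r ^+ 2 + L)) by field; rewrite lt0r_neq0 // addr_gt0.
    rewrite -[leRHS]mulr1 ler_pM2l // ler_pdivrMr ?addr_gt0 //; lra.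
  have ym : y - mm != 0 by rewrite subr_eq0; apply/eqP => h; move: Ly; rewrite h ltNge m2.
  have [T T0 nE] := far_point y ym.
  have e t : y + t *: (y + T *: (y - mm) - y) = mm + (1 + t * T) *: (y - mm).
    by apply/rowP => i; rewrite !mxE; ring.
  have la t : 0 <= t -> 1 <= 1 + t * T by move=> t0; rewrite lerDl mulr_ge0 // ltW.
  have [t /andP[t0 _]|//|[//]|[t [/andP[t0 t1] o Lt gt nO]]] := seg_touch Oy gy (y1 := y + T *: (y - mm)).
    by rewrite e; apply: star_out => //; exact: la.
  apply: (no_bdry_s o Lt gt nO); rewrite depth_gt0_inner // e; apply: star_out => //.
    by rewrite -depth_gt0_inner.
  exact/la/ltW.
have sjo : s = jo by apply/(ss_outer st).
(* For the outer sphere the contact is moved to the center [c] and from there to a point of the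
   closed ball outside [E]. Orthogonality keeps both segments away from the ball of inversion, and
   [s] can be met only at the very end. *)
have nbc : gp c = 0 -> Om c -> False.
  move=> gc Oc; have [oo ro nE] := ss_hole st; rewrite -sjo in ro.
  have oL : L <= sqd z oo.
    rewrite leNgt; apply/negP => h; apply: nE; by have [] := hR (ball_near (ltW h)) ro.
  have oc : sqd c oo <= r ^+ 2 by rewrite -depth_ge0_outer.
  have hL t : 0 <= t < 1 -> L < sqd z (c + t *: (oo - c)).
    move=> /andP[t0 t1]; rewrite seg_sub edot_conv.
    have -> : c - z - (oo - z) = - (oo - c) by rewrite !opprB addrA subrK.
    rewrite edotNl edotNr opprK -(opprB z c) edotNl edotNr opprK cz.
    have a1 : t * L <= t * sqd z oo by rewrite ler_wpM2l.
    have a2 : t * (1 - t) * sqd c oo <= t * (1 - t) * r ^+ 2.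
      by rewrite ler_wpM2l // mulr_ge0 // subr_ge0 ltW.
    have a3 : 0 < (1 - t) ^+ 2 * r ^+ 2 by rewrite mulr_gt0 // exprn_gt0 // subr_gt0.
    by lra.
  have [/nE //|[/nE //]|[t [/andP[t0 t1] ot Lt gt nO]]] := seg_touch Oc gc (y1 := oo) hL.
  move: t1; rewrite le_eqVlt => /orP[/eqP tE|t1].
    by case: ot; rewrite tE scale1r addrC subrK.
  apply: (no_bdry_s ot Lt gt nO); rewrite depth_gt0_outer // addrC addKr edotZl edotZr mulrA.
  apply: le_lt_trans (_ : t * t * r ^+ 2 < _); first by rewrite ler_wpM2l // mulr_ge0 // ltW.
  by rewrite -[ltRHS]mul1r ltr_pM2r //; nra.
have yc : sqd c y < r ^+ 2 by rewrite -depth_gt0_outer.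
have hL t : 0 <= t <= 1 -> L < sqd z (y + t *: (c - y)).
  move=> /andP[t0 t1]; rewrite seg_sub edot_conv.
  have -> : y - z - (c - z) = y - c by rewrite opprB addrA subrK.
  rewrite -(opprB z c) edotNl edotNr opprK cz.
  have a2 : t * (1 - t) * sqd c y <= t * (1 - t) * r ^+ 2.
    by rewrite ler_wpM2l ?mulr_ge0 ?subr_ge0 // ltW.
  have [->|t1'] := eqVneq t 1; first by rewrite subrr; lra.
  have a1 : (1 - t) * L < (1 - t) * sqd z y by rewrite ltr_pM2l // subr_gt0 lt_neqAle t1'.
  have a3 : 0 <= t ^+ 2 * r ^+ 2 by rewrite mulr_ge0 ?sqr_ge0.
  by lra.
have yc1 : y + 1 *: (c - y) = c by rewrite scale1r addrC subrK.
have Lc : L < sqd z c by rewrite -yc1; apply: hL; rewrite ler01 lexx.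
have rc : 0 < rho s c by rewrite depth_gt0_outer // subrr edot0l.
have [t /andP[t0 t1]|//|[Ec gc]|[t [/andP[t0 t1] o Lt gt nO]]] := seg_touch Oy gy (y1 := c).
- by apply: hL; rewrite t0 ltW.
- have [Oc|nO] := pselect (Om c); first exact: nbc.
  by apply: (@no_bdry_s c) => //; split => //; exact: ltW.
apply: (no_bdry_s o Lt gt nO); rewrite depth_gt0_outer // seg_sub subrr scaler0 addr0 edotZl edotZr mulrA.
apply: le_lt_trans yc; rewrite -[leRHS]mul1r ler_wpM2r ?edot_ge0 //; nra.
Qed.

Lemma no_touch y : out y -> L < sqd z y -> gp y <> 0.
Proof.
move=> oy Ly gy; have [Oy|nO] := pselect (Om y); first exact: (no_touch_int Oy).
have [b rb] := ss_bdry st (proj1 oy) nO.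
have [bs|bs] := pselect (b = s); last by apply: (no_bdry oy Ly gy rb); left.
have [pz|pz] := ltrP 0 p0; first by apply: (no_bdry oy Ly gy rb); right.
have p00 : p0 = 0 by apply/le_anti; rewrite pz.
have [y' [oy' Oy' L' g']] := touch_orth p00 oy Ly gy ltac:(by rewrite -bs).
exact: (no_touch_int Oy').
Qed.

(** On the sphere of inversion the gap is identically zero and a contact shows in the normal
    derivative: minimality and the assumption on [G] make the whole gradient of the gap vanish,
    against the Hopf lemma for the exterior of that sphere. *)
Lemma no_diag y0 : E y0 -> sqd z y0 = L -> w y0 <= edot (G y0) (y0 - z) ->
  Om y0 \/ (rho s y0 = 0 /\ p0 = 0) -> False.
Proof.
move=> Ey Ly hG hcase; have oy : out y0 by split => //; rewrite Ly.
have L0' : L != 0 by rewrite lt0r_neq0.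
have Sy : sphinv z L y0 = y0 by rewrite /sphinv Ly divff // scale1r addrC subrK.
have gy : gp y0 = 0 by rewrite /gap /kelvin Sy Ly divff // mul1r subrr.
have gE : gg y0 = (2 / L * (w y0 - edot (G y0) (y0 - z))) *: (y0 - z).
  rewrite /gap_grad /kelvin_grad Sy mul_reflmx Ly edotC.
  by apply/rowP => i; rewrite !mxE; field.
have hq y b0 b1 : out y -> y != y0 -> 0 < b0 + b1 * sqd c y ->
    0 <= barrier z c y0 (- L) b0 b1 y -> L < sqd z y.
  move=> oy' yy bp; rewrite /barrier subr_ge0 => h.
  have s1 : 0 < sqd y0 y by apply: edot_gt0; rewrite subr_eq0.
  have := lt_le_trans s1 h; rewrite pmulr_lgt0 // subr_gt0 //.
have gpos y : out y -> L < sqd z y -> 0 < gp y.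
  move=> o h; rewrite lt_neqAle good // andbT; apply/eqP => g0.
  exact: (no_touch o h (esym g0)).
have key v b0 b1 : 0 < edot (y0 - z) v -> 0 < b0 + b1 * sqd c y0 ->
    (exists2 t0, 0 < t0 & forall t, 0 < t < t0 -> out (y0 + t *: v)) ->
    (exists2 d, 0 < d & forall y, out y -> enorm (y - y0) < d -> L < sqd z y ->
       0 < b0 + b1 * sqd c y /\ ((Om y /\ Om (sphinv z L y)) \/
       @neumann_ok R n E w z L (barrier z c y0 (- L) b0 b1) (barrier_grad z c y0 (- L) b0 b1) y)) ->
    (forall y, out y -> 0 < b0 + b1 * sqd c y) -> False.
  move=> vp bp hdir [d d0 hd] hb.
  have gg0 : gg y0 = 0.
    have := gap_dir oy gy hdir; rewrite gE edotZl pmulr_lge0 // pmulr_rge0 ?divr_gt0 // subr_ge0 => h.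
    have -> : edot (G y0) (y0 - z) = w y0 by apply/le_anti; rewrite h hG.
    by rewrite subrr mulr0 scale0r.
  apply: (@hopf_barrier z c (- L) b0 b1 y0 v) => //.
  - by rewrite barrier_self Ly subrr mul0r.
  - exists d => // y o yd yy qy; have L' := hq y b0 b1 o yy (hb y o) qy.
    by split => //; [exact: gpos|have [_] := hd y o yd L'].
  - rewrite barrier_grad_self Ly subrr mulr0 scale0r addr0 edotZl.
    by rewrite mulr_gt0 // mulr_gt0.
  - by have := gap_fdiff sol L0 inv_E' oy; rewrite gg0.
case: hcase => [Oy|[ry p00]].
  apply: (key (y0 - z) 1 0); rewrite ?Ly ?mul0r ?addr0 //.
  - have [d1 d10 h1] := so_open sol Oy.
    have [t0 t00 h] := dirI (ball_dir (y0 - z) d10 h1) (far_dir (y := y0) (v := y0 - z) ltac:(by right; rewrite Ly)).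
    by exists t0 => // t /h[/(so_sub sol)].
  - have [d1 d10 h1] := so_open sol Oy; exists d1 => // y o /h1 Oy' _.
    by rewrite mul0r addr0; split => //; left; split => //; apply: inv_Om => //; exact: (ss_gt0 st).
  - by move=> y _; rewrite mul0r addr0.
have nn := normal_unit ry; have rabs : 0 < `|r| by rewrite normr_gt0.
have e0 : edot (y0 - z) (y0 - c) = 0 by rewrite (orth_edot p00 ry) Ly subrr mul0r.
(* At a corner of the two orthogonal spheres the barrier gets the factor [1 + 3 / |r| * rho s y]. On
   [s] its normal derivative is then less than [- q / |r|], while [gap_normal] gives at least
   [- gap / |r|] for the gap. Any constant above 2 would do in place of 3. *)
pose b1 := - (3 / (2 * r * `|r|)); pose b0 := 1 - b1 * r ^+ 2.
have bE y : b0 + b1 * sqd c y = 1 + 3 / `|r| * rho s y.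
  rewrite /b0 /b1 /depth; move: (sqd c y) => D; field; by rewrite rad0 lt0r_neq0.
have bp y : out y -> 0 < b0 + b1 * sqd c y.
  move=> o; rewrite bE ltr_wpDr //; apply: mulr_ge0; first by rewrite divr_ge0.
  by apply: (ss_ge0 st); case: o.
have e3 : edot (y0 - z) (y0 - z - r^-1 *: (y0 - c)) = L.
  by rewrite (edotDr (y0 - z)) edotNr edotZr e0 mulr0 subr0 Ly.
apply: (key (y0 - z - r^-1 *: (y0 - c)) b0 b1) => //.
- by rewrite e3.
- exact: bp.
- apply: (out_dir (j := s)) => //.
    by rewrite edotDr edotNr mulrDl mulNr nn edotC e0 mul0r sub0r oppr_lt0.
  by right; rewrite e3 Ly.
have [d d0 hd] := ss_local st Ey ry; exists d => // y o yd Ly'; split; first exact: bp.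
have ry' : 0 <= rho s y by apply: (ss_ge0 st); case: o.
move: ry'; rewrite le_eqVlt => /orP[/eqP/esym ry'|ry']; last first.
  by left; split; [have [h _] := hd y yd; exact: h|exact: inv_Om].
right; exists (r^-1 *: (y - c)), (`|r|^-1), (gg y); have nn' := normal_unit ry'.
have i1 : - `|r|^-1 <= r^-1 by rewrite -normfV lerNl; apply: le_trans (ler_norm _) _; rewrite normrN.
have i2 : r^-1 <= `|r|^-1 by rewrite -normfV ler_norm.
have i0 : 0 < `|r|^-1 by rewrite invr_gt0.
split; first exact: ltW.
- have [t0 t00 h] := @inward_dir s y (- (r^-1 *: (y - c))) (proj1 o) ry' ltac:(by rewrite edotNr mulNr nn' oppr_lt0).
  by exists t0 => // t /h[]; rewrite scalerN.
- exact: (gap_fdiff sol L0 inv_E' o).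
- rewrite gap_normal // mulrC -mulNr mulrC -[leRHS]mulrC mulrN -mulNr.
  by apply: ler_wpM2r => //; exact: good.
have c1 : sqd c y = r ^+ 2 by apply/depth0.
have c0 : sqd c y0 = r ^+ 2 by apply/depth0.
have e1 := orth_edot p00 ry'.
have e2 : edot (y - y0) (y - c) = sqd y0 y / 2.
  have h3 : y0 - c = (y - c) - (y - y0) by apply/rowP => i; rewrite !mxE; ring.
  move: c0; rewrite h3; move: (y - c) (y - y0) c1 => u v; rewrite !edotE (edotC u v) => h2 h.
  by lra.
rewrite edot_barrier_grad !edotZr e1 e2 c1 /barrier c1.
have -> : b0 + b1 * r ^+ 2 = 1 by rewrite /b0 subrK.
have -> : r^-1 * r ^+ 2 = r by field.
have -> : 2 * b1 * (sqd z y - L) * r = - (3 * (sqd z y - L) * `|r|^-1).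
  by rewrite /b1; move: (sqd z y) => D; field; rewrite rad0 lt0r_neq0.
have := edot_ge0 (y - y0); move: (sqd y0 y) => K K0.
have : 0 < sqd z y - L by rewrite subr_gt0.
move: (sqd z y - L) (r^-1) (`|r|^-1) i0 i1 i2 => g i j i0 i1 i2 g0.
have h1 : g * (i - 2 * j) < 0 by rewrite pmulr_rlt0 //; lra.
have h2 : 0 <= K * (i + j) by rewrite mulr_ge0 //; lra.
by lra.
Qed.

End OneSphere.

(** * One-sided germs at zero *)

Section Small.
Context {R : realType}.

Definition small : set_system R := [set P | exists2 t0 : R, 0 < t0 & forall t, 0 < t < t0 -> P t].

Global Instance small_filter : Filter small.
Proof.
split => [|P Q|P Q PQ [t0 t00 h]]; first by exists 1.
  exact: dirI.
by exists t0 => // t /h /PQ.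
Qed.

Lemma smallS (P Q : R -> Prop) : small P -> (forall t, P t -> Q t) -> small Q.
Proof. by move=> hP PQ; exact: filterS PQ hP. Qed.

Lemma smallI (P Q : R -> Prop) : small P -> small Q -> small (fun t => P t /\ Q t).
Proof. exact: dirI. Qed.

Lemma small_ex (P : R -> Prop) : small P -> exists t, 0 < t /\ P t.
Proof.
move=> [t0 t00 h]; exists (t0 / 2); split; first by rewrite divr_gt0.
by apply: h; rewrite divr_gt0 //=; lra.
Qed.

Lemma small_pos : small (fun t => 0 < t).
Proof. by exists 1 => // t /andP[]. Qed.

Lemma small_lt (a : R) : 0 < a -> small (fun t => t < a).
Proof. by move=> a0; exists a => // t /andP[]. Qed.

Lemma small_cvg : (t @[t --> small] --> (0 : R)).
Proof.
apply/cvgrPdist_lt => e e0; exists e => // t /andP[t0 te].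
by rewrite sub0r normrN gtr0_norm.
Qed.

(** Degree four is that of the level along a family of pairs: two linear factors times the squared
    distance of a moving point. *)
Lemma small_poly (a b c d e : R) : 0 < a \/ 0 <= a /\ 0 < b ->
  small (fun t => 0 < a + t * (b + t * (c + t * (d + t * e)))).
Proof.
move=> h; pose g t := b + t * (c + t * (d + t * e)).
have cg : g t @[t --> small] --> b + 0 * (c + 0 * (d + 0 * e)).
  by repeat (apply: cvgD; [exact: cvg_cst|apply: cvgM; [exact: small_cvg|]]); exact: cvg_cst.
case: h => [a0|[a0 b0]].
  have : a + t * g t @[t --> small] --> a + 0 * (b + 0 * (c + 0 * (d + 0 * e))).
    apply: cvgD; first exact: cvg_cst.
    by apply: cvgM => //; exact: small_cvg.
  rewrite mul0r addr0 => /cvgrPdist_lt/(_ _ a0); apply: filterS => t.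
  by rewrite ltr_norml => /andP[_]; rewrite /g; lra.
move: cg; rewrite mul0r addr0 => /cvgrPdist_lt/(_ _ b0) h.
apply: filterS (filterI small_pos h) => t [t0]; rewrite ltr_norml => /andP[_ h2].
have g0 : 0 < g t by lra.
by rewrite ltr_wpDl // mulr_gt0.
Qed.

Lemma small_poly0 (a b c d e : R) : 0 < a ->
  small (fun t => 0 < a + t * (b + t * (c + t * (d + t * e)))).
Proof. by move=> a0; apply: small_poly; left. Qed.

End Small.

(** * Limits of spheres and gaps along a filter *)

Section Limits.
Context {R : realType} {n : nat}.
Implicit Types (x y z v p : 'rV[R]_n).
Local Notation sqd z y := (edot (y - z) (y - z)).

Context {T : Type} {F : set_system T} {FF : Filter F}.

Definition vcvg (v : T -> 'rV[R]_n) x := forall i, v t 0 i @[t --> F] --> x 0 i.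

Lemma vcvgD (u v : T -> 'rV[R]_n) x y : vcvg u x -> vcvg v y -> vcvg (fun t => u t + v t) (x + y).
Proof. by move=> hu hv i; rewrite mxE; under eq_cvg do rewrite mxE; exact: cvgD. Qed.

Lemma vcvgB (u v : T -> 'rV[R]_n) x y : vcvg u x -> vcvg v y -> vcvg (fun t => u t - v t) (x - y).
Proof.
move=> hu hv i; rewrite !mxE; under eq_cvg do rewrite !mxE.
by apply: cvgB; [exact: hu|exact: hv].
Qed.

Lemma vcvg_cst x : vcvg (fun=> x) x. Proof. by move=> i; exact: cvg_cst. Qed.

Lemma vcvgZ (a : T -> R) u (b : R) x : a t @[t --> F] --> b -> vcvg u x ->
  vcvg (fun t => a t *: u t) (b *: x).
Proof.
move=> ha hu i; rewrite !mxE; under eq_cvg do rewrite !mxE.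
by apply: cvgM => //; exact: hu.
Qed.

Lemma edot_cvg (u v : T -> 'rV[R]_n) x y : vcvg u x -> vcvg v y -> edot (u t) (v t) @[t --> F] --> edot x y.
Proof.
move=> hu hv; rewrite /edot; apply: cvg_big => [|i _]; first exact: add_continuous.
by apply: cvgM; [exact: hu|exact: hv].
Qed.

Lemma vcvg_near u x (e : R) : vcvg u x -> 0 < e -> \forall t \near F, enorm (u t - x) < e.
Proof.
move=> hu e0; have := edot_cvg (vcvgB hu (@vcvg_cst x)) (vcvgB hu (@vcvg_cst x)).
rewrite subrr edot0l => /cvgrPdist_lt/(_ _ (exprn_gt0 2 e0)); apply: filterS => t.
by rewrite sub0r normrN ger0_norm ?edot_ge0 // enorm_ltE.
Qed.

Lemma cont_cvg (X : set 'rV[R]_n) g u x : cont_at X g x -> vcvg u x -> (\forall t \near F, X (u t)) ->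
  g (u t) @[t --> F] --> g x.
Proof.
move=> cg hu hX; apply/cvgrPdist_lt => e e0; have [d d0 hd] := cg e e0.
apply: filterS (filterI hX (vcvg_near hu d0)) => t [Xt ut].
by rewrite distrC; exact: hd.
Qed.

Lemma cvg_gt0 (g : T -> R) (l : R) : g t @[t --> F] --> l -> 0 < l -> \forall t \near F, l / 2 < g t.
Proof.
move=> /cvgrPdist_lt hg l0; have := hg (l / 2) ltac:(by rewrite divr_gt0).
by apply: filterS => t; rewrite ltr_norml => /andP[_ ?]; lra.
Qed.

Lemma sphinv_cvg (zf yf : T -> 'rV[R]_n) (Lf : T -> R) z y (L : R) :
  vcvg zf z -> vcvg yf y -> Lf t @[t --> F] --> L -> y - z != 0 ->
  vcvg (fun t => sphinv (zf t) (Lf t) (yf t)) (sphinv z L y).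
Proof.
move=> hz hy hL yz; apply: vcvgD => //; apply: vcvgZ; last exact: vcvgB.
apply: cvgM => //; apply: cvgV; first by rewrite edot_eq0.
by apply: edot_cvg; exact: vcvgB.
Qed.

Lemma gap_cvg (E : set 'rV[R]_n) w (zf yf : T -> 'rV[R]_n) (Lf : T -> R) z y (L : R) :
  vcvg zf z -> vcvg yf y -> Lf t @[t --> F] --> L -> y - z != 0 -> L != 0 ->
  cont_at E w y -> cont_at E w (sphinv z L y) ->
  (\forall t \near F, E (yf t)) -> (\forall t \near F, E (sphinv (zf t) (Lf t) (yf t))) ->
  @gap R n w (zf t) (Lf t) (yf t) @[t --> F] --> @gap R n w z L y.
Proof.
move=> hz hy hL yz LN cy cS Ey ES; apply: cvgB; last exact: cont_cvg cy hy Ey.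
apply: cvgM; last exact: cont_cvg cS (sphinv_cvg hz hy hL yz) ES.
by apply: cvgM; [apply: edot_cvg; exact: vcvgB|exact: cvgV].
Qed.

End Limits.

(** * Moving spheres *)

Section MovingSpheres.
Context {R : realType} {n : nat}.
Implicit Types (x y z v p c : 'rV[R]_n).
Context {Gam : set 'rV[R]_n} {f : 'rV[R]_n -> R} {E Om : set 'rV[R]_n}.
Context {w : 'rV[R]_n -> R} {G : 'rV[R]_n -> 'rV[R]_n} {H : 'rV[R]_n -> 'M[R]_n}.
Hypotheses (n0 : (0 < n)%N) (hGam : admissible_cone Gam) (hf : admissible_function Gam f).
Hypothesis sol : solution_on Gam f E Om w G H.
Context {J : Type} {cen : J -> 'rV[R]_n} {rad : J -> R} {jo : J} {ch : J -> R} {bh : R}.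
Hypothesis st : sphere_setting cen rad jo ch bh E Om w G.
Local Notation rho j := (depth (cen j) (rad j)).
Local Notation sqd z y := (edot (y - z) (y - z)).
Variables (s : J) (a : 'rV[R]_n) (N m k1 : R).
Hypotheses (N0 : 0 < N) (m0 : 0 < m) (k10 : 0 < k1) (k116 : k1 <= 16^-1) (Nr : N <= `|rad s|).
Hypothesis hR : forall y, enorm (y - a) < 2 * N -> 0 <= rho s y -> E y /\ m <= w y.
Hypothesis hR' : forall y, enorm (y - a) < 2 * N -> 0 < rho s y -> Om y.
Local Notation nr y := (N ^+ 2 - sqd a y).
Local Notation pw z L := (2 * rho s z + L / rad s).
(** [hS] and [hF] are the sign conditions that make perturbed spheres strictly admissible near a
    boundary contact: [hS] concerns the derivative of the level, see [level_derivative], and [hF]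
    that of [pw] at a sphere orthogonal to [s] when the contact is on another sphere. *)
Hypothesis hS : forall (k : R) z b y, 0 < k -> k <= k1 -> 0 < nr z -> 0 <= pw z (k * nr z) ->
  E y -> rho b y = 0 -> k * nr z <= sqd z y ->
  bh * k * ((1 + k) * nr z + k * nr z / sqd z y * nr y) <
  m * (2 * (1 + k) * rho b z - 2 * k * rho b a - k * N ^+ 2 / rad b).
Hypothesis hF : forall z (L : R) b y, 0 < L -> L <= k1 * nr z -> pw z L = 0 -> b <> s ->
  E y -> rho b y = 0 -> L <= sqd z y -> bh * L * rho s y < m * sqd z y.

(* [pw z L >= 0] says that the inversion in the sphere of center [z] and squared radius [L] maps
   the points outside that sphere with nonnegative depth to points of nonnegative depth, see
   [depth_sphinv]. *)
Definition feasible (k : R) z (L : R) := [/\ 0 < L, L <= k * nr z & 0 <= pw z L].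

Definition is_good z (L : R) := forall y, outside (E := E) z L y -> 0 <= @gap R n w z L y.

Local Notation out z L := (@outside R n E z L).
Local Notation gp z L := (@gap R n w z L).
Let rads j : rad j != 0 := ss_rad st j.

Lemma feas_N (k : R) z L : 0 < k -> k <= k1 -> feasible k z L ->
  [/\ 0 < nr z, L <= 16^-1 * N ^+ 2, sqd a z < N ^+ 2 & L <= k1 * nr z].
Proof.
move=> k0 kk [L0 Lk _]; have nz : 0 < nr z by rewrite -(pmulr_rgt0 _ k0); exact: lt_le_trans Lk.
have Lk1 : L <= k1 * nr z by apply: le_trans Lk _; rewrite ler_pM2r.
split => //; last by rewrite -subr_gt0.
apply: le_trans Lk1 _; apply: ler_pM; rewrite ?(ltW k10) ?(ltW nz) //.
by rewrite gerBl edot_ge0.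
Qed.

Lemma good_out_E (k : R) z L y : 0 < k -> k <= k1 -> feasible k z L -> out z L y ->
  E (sphinv z L y) /\ m <= w (sphinv z L y).
Proof.
move=> k0 kk fz oy; have [nz LN za _] := feas_N k0 kk fz; case: fz => L0 _ pp.
exact: (inv_E st N0 hR L0 LN za pp oy).
Qed.

(* The sphere through which y is reflected to x with dilation factor t. *)
Definition pcen (t : R) x y : 'rV[R]_n := (1 - t)^-1 *: (x - t *: y).
Definition prad (t : R) x y : R := t * sqd x y / (1 - t) ^+ 2.

Lemma pair_sqd (t : R) x y : t != 1 -> sqd (pcen t x y) y = sqd x y / (1 - t) ^+ 2.
Proof.
move=> t1; have t1' : 1 - t != 0 by rewrite subr_eq0 eq_sym.
have -> : y - pcen t x y = (1 - t)^-1 *: (y - x).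
  by apply/rowP => i; rewrite !mxE; field.
by rewrite edotZl edotZr; field.
Qed.

Lemma pair_sphinv (t : R) x y : t != 1 -> y - x != 0 -> sphinv (pcen t x y) (prad t x y) y = x.
Proof.
move=> t1 yx; have t1' : 1 - t != 0 by rewrite subr_eq0 eq_sym.
have D0 : sqd x y != 0 by rewrite edot_eq0.
rewrite /sphinv pair_sqd // /prad.
have -> : t * sqd x y / (1 - t) ^+ 2 / (sqd x y / (1 - t) ^+ 2) = t.
  by move: D0; move: (sqd x y) => D D0; field; rewrite t1'.
by apply/rowP => i; rewrite !mxE; field.
Qed.

Lemma pair_good (t : R) x y : 0 < t < 1 -> y - x != 0 -> E y ->
  is_good (pcen t x y) (prad t x y) -> t * w y <= w x.
Proof.
move=> /andP[t0 t1] yx Ey gd; have tn : t != 1 by rewrite lt_eqF.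
have t1' : 0 < 1 - t by rewrite subr_gt0.
have D0 := edot_gt0 yx.
have := gd y; rewrite /gap /kelvin pair_sphinv // pair_sqd // /prad.
have -> : sqd x y / (1 - t) ^+ 2 / (t * sqd x y / (1 - t) ^+ 2) = t^-1.
  by move: D0; move: (sqd x y) => D D0; field; rewrite !lt0r_neq0.
rewrite subr_ge0 => h; have /h : out (pcen t x y) (prad t x y) y.
  split => //; rewrite pair_sqd // /prad ler_pM2r ?invr_gt0 ?exprn_gt0 //.
  by rewrite -[leRHS]mul1r ler_wpM2r ?(ltW D0) ?(ltW t1).
by rewrite mulrC ler_pdivlMr // mulrC.
Qed.

Lemma pair_prad_gt0 (t : R) x y : 0 < t < 1 -> y - x != 0 -> 0 < prad t x y.
Proof.
move=> /andP[t0 t1] yx.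
by rewrite /prad divr_gt0 ?mulr_gt0 ?exprn_gt0 ?subr_gt0 // edot_gt0.
Qed.

(** Clearing denominators turns the level condition for the sphere of a pair into a polynomial
    inequality in the pair. *)
Lemma pair_level (k t : R) x y : t != 1 -> (1 - t) ^+ 2 * (k * nr (pcen t x y) - prad t x y) =
  k * (1 - t) * (nr x - t * nr y) - (1 + k) * t * sqd x y.
Proof.
move=> t1; have t1' : 1 - t != 0 by rewrite subr_eq0 eq_sym.
have -> : pcen t x y - a = (1 - t)^-1 *: ((x - a) - t *: (y - a)).
  by apply/rowP => i; rewrite !mxE; field.
have -> : y - x = (y - a) - (x - a) by rewrite opprB addrA subrK.
rewrite /prad (_ : y - x = (y - a) - (x - a)); last by rewrite opprB addrA subrK.
move: (y - a) (x - a) => v u; rewrite !edotE (edotC v u).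
by move: (edot u u) (edot u v) (edot v v) => A B C; field.
Qed.

(** The sphere of a pair respects [s] exactly when [rho s x >= t * rho s y], for [t < 1]. *)
Lemma pair_pw (t : R) x y : t != 1 -> y - x != 0 ->
  (1 - t) * (pw (pcen t x y) (prad t x y) / 2) = rho s x - t * rho s y.
Proof.
move=> t1 yx; have t1' : 1 - t != 0 by rewrite subr_eq0 eq_sym.
have D0 : sqd x y != 0 by rewrite edot_eq0.
have yz : y - pcen t x y != 0.
  by rewrite -edot_eq0 pair_sqd // mulf_neq0 // invr_eq0 expf_eq0.
have := @depth_sphinv R n (cen s) (rad s) (pcen t x y) (prad t x y) y (rads s) yz.
rewrite pair_sphinv // pair_sqd // {1 2}/prad.
have -> : t * sqd x y / (1 - t) ^+ 2 / (sqd x y / (1 - t) ^+ 2) = t.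
  by move: D0; move: (sqd x y) => D D0; field; rewrite t1'.
by move=> ->; rewrite addrK.
Qed.

Lemma pair_sphere (z y : 'rV[R]_n) (L : R) (t := L / sqd z y) (x := sphinv z L y) :
  0 < L -> L < sqd z y -> [/\ pcen t x y = z, prad t x y = L, 0 < t < 1 & y - x = (1 - t) *: (y - z)].
Proof.
move=> L0 Ly; have D0 := lt_trans L0 Ly.
have t01 : 0 < t < 1 by rewrite divr_gt0 // ltr_pdivrMr // mul1r.
have [_ t1] := andP t01; have t1' : 1 - t != 0 by rewrite subr_eq0 eq_sym lt_eqF.
have yx : y - x = (1 - t) *: (y - z).
  by rewrite /x /sphinv -/t; apply/rowP => i; rewrite !mxE; ring.
split => //.
  by rewrite /pcen /x /sphinv -/t; apply/rowP => i; rewrite !mxE; field.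
rewrite /prad yx edotZl edotZr.
have -> : t * ((1 - t) * ((1 - t) * sqd z y)) / (1 - t) ^+ 2 = t * sqd z y by field.
by rewrite /t divfK // lt0r_neq0.
Qed.

(* The derivative of the level along the family used at a boundary contact point. *)
Lemma level_derivative (k t uu uA AA uv Av r N2 e sg rz ra : R) : r != 0 -> t != 0 ->
  t * uu = k * (N2 - AA) -> rz = uv - uu / (2 * r) ->
  ra = uv + Av - (uu + 2 * uA + AA) / (2 * r) -> e = t * (r^-1 + sg) ->
  let al := N2 - (t ^+ 2 * uu + 2 * t * uA + AA) in
  let n0 := N2 - (uu + 2 * uA + AA) in
  let n1 := 2 * (uv + Av) in
  let d0 := (1 - t) ^+ 2 * uu in
  let d1 := - (2 * (1 - t) * uv) in
  k * ((1 - t) * (- e * n0 - t * n1) - e * (al - t * n0)) - (1 + k) * (t * d1 + e * d0) =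
  (1 - t) * (t * (2 * (1 + k) * rz - 2 * k * ra - k * N2 / r)
    - sg * (k * ((1 + k) * (N2 - AA) + t * n0))).
Proof.
move=> r0 t0 h -> -> -> /=.
have uuE : uu = k * (N2 - AA) / t by rewrite -h; field.
by rewrite uuE; field; rewrite ?r0 ?t0.
Qed.

Lemma depth_from b z y : rho b y = 0 ->
  rho b z = edot (y - z) ((rad b)^-1 *: (y - cen b)) - sqd z y / (2 * rad b).
Proof.
move=> /(depth0 _ _ (rads b)) h; have := rads b; rewrite /depth edotZr.
have -> : z - cen b = (y - cen b) - (y - z) by apply/rowP => i; rewrite !mxE; ring.
move: h; move: (y - cen b) (y - z) (rad b) => u v r; rewrite !edotE (edotC u v) => h r0.
by rewrite -h; field.
Qed.

Lemma sqd_line q z v (t : R) : sqd q (z + t *: v) = sqd q z + 2 * t * edot (z - q) v + t ^+ 2 * edot v v.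
Proof. by rewrite addrAC; move: (z - q) => u; rewrite edot_sqrD !edotE; ring. Qed.

Definition below (k : R) := forall z (L : R), 0 < L -> L < k * nr z -> 0 <= pw z L -> is_good z L.

(** The image [x] is kept while [y] moves inward at unit speed and the dilation factor grows at the
    rate [e]. The spheres of these pairs are strictly below level [k], hence good, and [pair_good]
    forces [w] to decrease inward at a rate of at least [eta * w y]; the boundary condition, with a
    constant above [- bh], allows only less. *)
Lemma strict_bdry (k : R) z L b y : 0 < k -> k <= k1 -> feasible k z L -> below k ->
  E y -> L < sqd z y -> rho b y = 0 -> gp z L y = 0 -> b <> s \/ 0 < pw z L -> False.
Proof.
move=> k0 kk fz hb Ey Ly rb gy hcase; have [L0 Lk pp] := fz.
have [nz LN za Lk1] := feas_N k0 kk fz.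
pose t := L / sqd z y; pose x := sphinv z L y.
have [zE LE /andP[t0 t1] yxE] := pair_sphere L0 Ly.
rewrite -/t -/x in zE LE t0 t1 yxE.
have oy : out z L y by split => //; exact: ltW.
have [Ex mx] := good_out_E k0 kk fz oy; rewrite -/x in Ex mx.
have D0 : 0 < sqd z y := lt_trans L0 Ly.
have tn : t != 1 by rewrite lt_eqF.
have t1' : 0 < 1 - t by rewrite subr_gt0.
have twx : t * w y = w x.
  move: gy; rewrite /gap /kelvin -/x => /eqP; rewrite subr_eq0 => /eqP <-.
  by rewrite /t mulrA; move: L0 D0; move: (sqd z y) => D L0' D0'; field; rewrite !lt0r_neq0.
pose r := rad b; have r0 : r != 0 := rads b.
(* [sg] makes [sg * w y >= bh], because [t * w y = w x >= m]; thus [eta * w y] exceeds the normal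
   derivative [w y / r - ch b]. *)
pose nu := r^-1 *: (y - cen b); pose sg := bh * t / m; pose eta := r^-1 + sg; pose e := t * eta.
have bh0 := ss_bh st; have sg0 : 0 < sg by apply: divr_gt0 => //; exact: mulr_gt0.
have yx0 : 0 < sqd x y by rewrite yxE edotZl edotZr !mulr_gt0.
have vv : edot nu nu = 1.
  by rewrite /nu edotZl mulrC; exact: (normal_unit st rb).
have bcy := ss_bc st Ey rb; rewrite -/r -/nu in bcy.
have chb := ss_ch st b.
have wy : 0 < w y by exact: (so_pos sol).
have key : edot (G y) nu < eta * w y.
  rewrite bcy /eta mulrDl (mulrC r^-1) ltrD2l.
  apply: (@lt_le_trans _ _ bh); first by rewrite ltrNl.
  have -> : sg * w y = bh * (t * w y / m) by rewrite /sg; ring.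
  by rewrite twx -[leLHS]mulr1 ler_pM2l // ler_pdivlMr // mul1r.
have [t2 t20 hE] : small (fun h => E (y + h *: - nu)).
  have [t2 t20 h] := inward_dir st (v := - nu) Ey rb ltac:(by rewrite edotNr mulNr (normal_unit st rb) oppr_lt0).
  by exists t2 => // h' /h[].
pose yt (h : R) := y + h *: - nu; pose tt (h : R) := t + h * e.
have ytsq q h : sqd q (yt h) = sqd q y + h * (- (2 * edot (y - q) nu) + h * 1).
  by rewrite /yt sqd_line !(edotNr nu) (edotNl nu) vv; ring.
have s1 : small (fun h => 0 < tt h).
  apply: smallS (@small_poly0 R t e 0 0 0 t0) _ => h.
  by rewrite /tt !(mulr0, addr0).
have s2 : small (fun h => tt h < 1).
  apply: smallS (@small_poly0 R (1 - t) (- e) 0 0 0 t1') _ => h.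
  by rewrite /tt !(mulr0, addr0); lra.
have s3 : small (fun h => 0 < sqd x (yt h)).
  apply: smallS (@small_poly0 R (sqd x y) (- (2 * edot (y - x) nu)) 1 0 0 yx0) _ => h.
  by rewrite ytsq !(mulr0, addr0).
have s4 : small (fun h => 0 < k * (1 - tt h) * (nr x - tt h * nr (yt h)) - (1 + k) * tt h * sqd x (yt h)).
  (* The level condition along the family is a quartic in the step. At level exactly [k] its
     constant term vanishes and its linear term is positive by [hS]. *)
  pose al := nr x; pose b0 := nr y; pose b1 := 2 * edot (y - a) nu.
  pose d0 := sqd x y; pose d1 := - (2 * edot (y - x) nu).
  pose f0 := k * (1 - t) * (al - t * b0) - (1 + k) * t * d0.
  pose f1 := k * ((1 - t) * (- e * b0 - t * b1) - e * (al - t * b0)) - (1 + k) * (t * d1 + e * d0).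
  pose f2 := k * ((1 - t) * (- e * b1 + t) - e * (- e * b0 - t * b1)) - (1 + k) * (t + e * d1).
  pose f3 := k * ((1 - t) * e - e * (- e * b1 + t)) - (1 + k) * e.
  pose f4 := - (k * e * e).
  have f0E : f0 = (1 - t) ^+ 2 * (k * nr z - L).
    by rewrite /f0 /al /b0 /d0 -pair_level // zE LE.
  have hf01 : 0 < f0 \/ 0 <= f0 /\ 0 < f1.
    have [Leq|Lne] := eqVneq L (k * nr z); last first.
      by left; rewrite f0E mulr_gt0 ?exprn_gt0 // subr_gt0 lt_neqAle Lne.
    right; split; first by rewrite f0E Leq subrr mulr0.
    have tL : t * sqd z y = L by rewrite /t divfK // lt0r_neq0.
    have := hS (z := z) (b := b) (y := y) k0 kk nz ltac:(by rewrite -Leq) Ey rb ltac:(by rewrite -Leq ltW).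
    rewrite -Leq -/t => hSS.
    have rz := depth_from z rb; have ra := depth_from a rb; rewrite -/nu -/r in rz ra.
    have yaE : y - a = (y - z) + (z - a) by rewrite addrA subrK.
    have xaE : x - a = t *: (y - z) + (z - a) by rewrite /x /sphinv -/t addrAC addrC.
    have := @level_derivative k t (sqd z y) (edot (y - z) (z - a)) (sqd a z) (edot (y - z) nu)
      (edot (z - a) nu) r (N ^+ 2) e sg (rho b z) (rho b a) r0 (lt0r_neq0 t0).
    rewrite tL => /(_ Leq rz).
    have e1 : sqd a y = sqd z y + 2 * edot (y - z) (z - a) + sqd a z by rewrite yaE edot_sqrD.
    have e2 : edot (y - a) nu = edot (y - z) nu + edot (z - a) nu by rewrite yaE edotDl.
    rewrite -e1 -e2 => /(_ ra erefl) /=.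
    have e3 : sqd a x = t ^+ 2 * sqd z y + 2 * t * edot (y - z) (z - a) + sqd a z by rewrite xaE edot_comb.
    have e4 : d0 = (1 - t) ^+ 2 * sqd z y by rewrite /d0 yxE edotZl edotZr expr2 mulrA.
    have e5 : d1 = - (2 * (1 - t) * edot (y - z) nu) by rewrite /d1 yxE edotZl; ring.
    rewrite -e3 -e4 -e5 -/al -/b0 -/b1 -/f1 => ->.
    rewrite mulr_gt0 // subr_gt0 /sg.
    have -> : bh * t / m * (k * ((1 + k) * nr z + t * nr y)) =
      t * (bh * k * ((1 + k) * nr z + t * nr y) / m) by ring.
    by rewrite ltr_pM2l // ltr_pdivrMr // [ltRHS]mulrC; exact: hSS.
  apply: smallS (small_poly f2 f3 f4 hf01) _ => h; rewrite !ytsq /tt /f0 /f1 /f2 /f3 /f4 /al /b0 /b1 /d0 /d1.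
  by congr (0 < _); ring.
(* Likewise for [pw]: if it vanishes the contact is on a sphere other than [s], and [ss_apart]
   together with [hF] makes the linear term positive. *)
have s5 : small (fun h => 0 < rho s x - tt h * rho s (yt h)).
  pose V := edot nu nu / (2 * rad s); pose D := edot (y - cen s) nu / rad s; pose rr := rho s y.
  have g0E : rho s x - t * rr = (1 - t) * (pw z L / 2).
    by rewrite -pair_pw // ?zE ?LE // -edot_eq0 lt0r_neq0.
  have hg : 0 < rho s x - t * rr \/ 0 <= rho s x - t * rr /\ 0 < - t * D - e * rr.
    have [p0|p0] := ltrP 0 (pw z L); first by left; rewrite g0E mulr_gt0 // divr_gt0.
    have pz : pw z L = 0 by apply/le_anti; rewrite p0.
    right; split; first by rewrite g0E pz mul0r mulr0.
    have bs : b <> s by case: hcase => //; rewrite pz ltxx.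
    have hFF := hF L0 Lk1 pz bs Ey rb (ltW Ly).
    have ap := ss_apart st bs.
    have DE : D <= - 1 - rr / r.
      have h1 := rads s; have h2 : sqd (cen b) y = r ^+ 2 by exact/depth0.
      have h3 : cen s - cen b = (y - cen b) - (y - cen s) by apply/rowP => i; rewrite !mxE; ring.
      move: ap; rewrite /D /rr /nu /depth edotZr h3 -/r; move: h2.
      move: (y - cen b) (y - cen s) (rad s) h1 => u v q q0; rewrite !edotE (edotC v u) => -> ap.
      have := ap; rewrite (_ : _ / (q * r) = - 2 * (r^-1 * edot u v / q) - 2 * ((q ^+ 2 - edot v v) / (2 * q) / r)); first lra.
      by field; rewrite ?q0 ?r0.
    have -> : - t * D - e * rr = t * (- D - eta * rr) by rewrite /e; ring.
    rewrite mulr_gt0 //; have : sg * rr < 1.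
      rewrite /sg /t /rr (_ : _ * _ = bh * L * rho s y / (m * sqd z y)); last first.
        by move: D0; move: (sqd z y) => D' D0; field; rewrite !lt0r_neq0.
      by rewrite ltr_pdivrMr ?mulr_gt0 // mul1r.
    by rewrite /eta; lra.
  apply: smallS (small_poly (t * V - e * D) (e * V) 0 hg) _ => h.
  have rE : rho s (yt h) = rr + h * D - h ^+ 2 * V.
    by rewrite /yt depth_line // edotNr edotNl edotNr opprK -/V -/rr mulNr -/D mulrN opprK.
  by rewrite rE /tt; congr (0 < _); ring.
pose dl := (eta * w y - edot (G y) nu) / 2.
have dl0 : 0 < dl by rewrite divr_gt0 // subr_gt0.
have s6 : small (fun h => 0 < dl + h * (eta * dl - eta ^+ 2 * w y)).
  apply: smallS (@small_poly0 R dl (eta * dl - eta ^+ 2 * w y) 0 0 0 dl0) _ => h.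
  by rewrite !(mulr0, addr0).
have fw : fdiff E (fun y => 0 - w y) y (0 - G y).
  apply: fdiffB; last exact: sdiff_fdiff (so_sdiff sol Ey).
  by move=> q q0; exists 1 => // y' _ _; rewrite edot0l !subr0 normr0 mulr_ge0 ?enorm_ge0 ?ltW.
have hE' : small (fun h => E (yt h)) by exists t2.
have hall := smallI (smallI (smallI hE' s1) (smallI s2 s3)) (smallI (smallI s4 s5) (smallI s6 small_pos)).
have : eta * w y - dl <= edot (0 - G y) (- nu).
  apply: (fdiff_dir fw); case: hall => q q0 hq; exists q => // h /hq [[[Et a1] [a2 a3]] [[a4 a5] [a6 a7]]].
  split => //; rewrite -/(yt h).
  have tn' : tt h != 1 by rewrite lt_eqF.
  have y0 : yt h - x != 0 by rewrite -edot_eq0 lt0r_neq0.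
  have t01 : 0 < tt h < 1 by rewrite a1.
  have t1h : 0 < 1 - tt h by rewrite subr_gt0.
  have gd : is_good (pcen (tt h) x (yt h)) (prad (tt h) x (yt h)).
    apply: hb; first exact: pair_prad_gt0.
      by rewrite -subr_gt0 -(pmulr_rgt0 _ (exprn_gt0 2 t1h)) pair_level.
    have := pair_pw tn' y0 => hp; apply: ltW.
    have : 0 < (1 - tt h) * (pw (pcen (tt h) x (yt h)) (prad (tt h) x (yt h)) / 2) by rewrite hp.
    by rewrite pmulr_rgt0 // pmulr_lgt0 // invr_gt0.
  have := pair_good t01 y0 Et gd; rewrite -twx /tt /e.
  have -> : (t + h * (t * eta)) * w (yt h) = t * ((1 + h * eta) * w (yt h)) by ring.
  rewrite ler_pM2l // => hw.
  have c0 : 0 < 1 + h * eta.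
    rewrite -(pmulr_rgt0 _ t0); have -> : t * (1 + h * eta) = tt h by rewrite /tt /e; ring.
    by [].
  have hw2 : (1 + h * eta) * w (yt h) <= (1 + h * eta) * (w y - h * (eta * w y - dl)).
    apply: le_trans hw _; rewrite -subr_ge0.
    have -> : (1 + h * eta) * (w y - h * (eta * w y - dl)) - w y =
      h * (dl + h * (eta * dl - eta ^+ 2 * w y)) by ring.
    by rewrite mulr_ge0 // ltW.
  by move: hw2; rewrite ler_pM2l //; lra.
rewrite edotDl edot0l add0r edotNl edotNr opprK /dl; lra.
Qed.

Lemma line_vcvg z v : vcvg (F := small) (fun t : R => z + t *: v) z.
Proof.
have h : vcvg (F := small) (fun t : R => z + t *: v) (z + 0 *: v).
  apply: vcvgD; first exact: vcvg_cst.
  by apply: vcvgZ; [exact: small_cvg|exact: vcvg_cst].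
by move: h; rewrite scale0r addr0.
Qed.

Lemma small_near z v (e : R) : 0 < e -> small (fun t => enorm (z + t *: v - z) < e).
Proof. move=> e0; have h : \forall t \near small, enorm (z + t *: v - z) < e.
  by apply: vcvg_near => //; exact: line_vcvg.
exact: h. Qed.

Lemma small_cont (X : set 'rV[R]_n) g z v (e : R) : cont_at X g z -> small (fun t => X (z + t *: v)) ->
  0 < e -> small (fun t => `|g z - g (z + t *: v)| < e).
Proof.
move=> cg hX e0.
have h : g (z + t *: v) @[t --> small] --> g z by apply: (cont_cvg cg) => //; exact: line_vcvg.
by move/cvgrPdist_lt: h => /(_ _ e0).
Qed.

Lemma diag_derivative (k uu uA AA uv Av r N2 sg : R) : r != 0 -> uu = k * (N2 - AA) ->
  - (2 * k * (Av - (r^-1 + sg) * uA)) + 2 * (uv - (r^-1 + sg) * uu) =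
  (2 * (1 + k) * (uv - uu / (2 * r)) - 2 * k * (uv + Av - (uu + 2 * uA + AA) / (2 * r)) - k * N2 / r)
  - sg * (k * ((1 + k) * (N2 - AA) + (N2 - (uu + 2 * uA + AA)))).
Proof. by move=> r0 ->; field. Qed.

(** The infinitesimal form of goodness on the sphere of inversion, from reflected pairs shrinking to
    [y0]. As [y0] lies on [s], center and pair are shifted by [- 2 t nu], and the pair is spread by
    [th] along the radius, with [th] so small that both points enter the domain. Strict
    differentiability compares [w] at the two points. *)
Lemma diag_pass (k : R) z y0 : 0 < k -> below k -> E y0 -> rho s y0 = 0 -> 0 < sqd z y0 ->
  sqd z y0 < k * nr z -> 0 < pw z (sqd z y0) -> edot (G y0) (y0 - z) <= w y0.
Proof.
move=> k0 hb Ey ry D0 lv pp; rewrite leNgt; apply/negP => hlt.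
pose r := rad s; have r0 : r != 0 := rads s.
pose nu := r^-1 *: (y0 - cen s); pose D := sqd z y0.
have nn : edot (y0 - cen s) nu / r = 1 := normal_unit st ry.
have vv : edot nu nu = 1 by rewrite {1}/nu edotZl mulrC.
pose q := edot (y0 - z) nu; pose th := (1 + `|q|)^-1.
have q1 : 0 < 1 + `|q| by rewrite ltr_wpDr.
have th0 : 0 < th by rewrite invr_gt0.
have thq : `|th * q| < 1 by rewrite normrM gtr0_norm // /th mulrC ltr_pdivrMr // mul1r ltrDr.
pose v1 := (- 2) *: nu + th *: (y0 - z); pose v2 := (- 2) *: nu - th *: (y0 - z).
have qE : edot (y0 - cen s) (y0 - z) / r = q by rewrite /q /nu edotZr edotC mulrC.
have v1E : edot (y0 - cen s) v1 / r = - 2 + th * q.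
  rewrite /v1 edotDr (edotZr (- 2)) (edotZr th) mulrDl -!mulrA.
  by rewrite nn qE mulr1.
have v2E : edot (y0 - cen s) v2 / r = - 2 - th * q.
  rewrite /v2 edotDr (edotNr (th *: _)) (edotZr (- 2)) (edotZr th) mulrBl -!mulrA.
  by rewrite nn qE mulr1.
have [q2 q3] : - 1 < th * q /\ th * q < 1 by apply/andP; rewrite -ltr_norml.
have i1 : small (fun t => E (y0 + t *: v1)).
  have [t2 t20 h] := inward_dir st (v := v1) Ey ry ltac:(by rewrite v1E; lra).
  by exists t2 => // h' /h[].
have i2 : small (fun t => E (y0 + t *: v2)).
  have [t2 t20 h] := inward_dir st (v := v2) Ey ry ltac:(by rewrite v2E; lra).
  by exists t2 => // h' /h[].
pose v3 := (- 2) *: nu; pose zt (t : R) := z + t *: v3; pose Lt (t : R) := (1 - t ^+ 2 * th ^+ 2) * D.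
have i3 : small (fun t => 0 < k * nr (zt t) - Lt t).
  have h : 0 < k * nr z - D by rewrite subr_gt0.
  apply: smallS (small_poly0 (- (2 * k * edot (z - a) v3)) (- (k * edot v3 v3) + th ^+ 2 * D) 0 0 h) _ => t.
  by rewrite /zt sqd_line /Lt; congr (0 < _); ring.
have i4 : small (fun t => 0 < pw (zt t) (Lt t)).
  apply: smallS (small_poly0 (- (2 * (edot (z - cen s) v3 / r)))
    (- (edot v3 v3 / r) - th ^+ 2 * D / r) 0 0 pp) _ => t.
  rewrite /zt depth_line // /Lt -/r -/D; congr (0 < _); field; exact: r0.
have i5 : small (fun t => t * th < 1).
  by apply: smallS (small_lt (a := th^-1) _) _ => [|t]; rewrite ?invr_gt0 // -[_^-1]mul1r ltr_pdivlMr.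
pose de := edot (G y0) (y0 - z) - w y0; have de0 : 0 < de by rewrite subr_gt0.
pose zz := enorm (y0 - z) + 1; have zz0 : 0 < zz by rewrite ltr_wpDl ?enorm_ge0.
have e0 : 0 < de / (4 * zz) by rewrite divr_gt0 // mulr_gt0.
have [d dd0 hd] := so_sdiff sol Ey e0.
have i6 := smallI (small_near y0 v1 dd0) (small_near y0 v2 dd0).
have de4 : 0 < de / 4 by rewrite divr_gt0.
have i7 := smallI (small_cont (w_cont sol Ey) i1 de4) (small_cont (w_cont sol Ey) i2 de4).
have := smallI (smallI (smallI i1 i2) (smallI i3 i4)) (smallI (smallI i5 i6) (smallI i7 small_pos)).
move=> /small_ex[t [t0 [[[E1 E2] [a3 a4]] [[a5 [a6 a6']] [[a7 a7'] _]]]]].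
have th1 : 0 < t * th by rewrite mulr_gt0.
have u0 : 0 < 1 - t * th by rewrite subr_gt0.
have u1 : 0 < 1 + t * th by rewrite addr_gt0.
have LtE : Lt t = (1 - t * th) * (1 + t * th) * D by rewrite /Lt; ring.
have Lt0 : 0 < Lt t by rewrite LtE mulr_gt0 // mulr_gt0.
have gd : is_good (zt t) (Lt t) by apply: hb => //; [rewrite -subr_gt0|exact: ltW].
have yE : y0 + t *: v1 - zt t = (1 + t * th) *: (y0 - z).
  by apply/rowP => i; rewrite !mxE; ring.
have sE : sqd (zt t) (y0 + t *: v1) = (1 + t * th) ^+ 2 * D.
  by rewrite yE edotZl edotZr expr2 mulrA.
have oE : out (zt t) (Lt t) (y0 + t *: v1).
  split => //; rewrite sE LtE expr2 ler_pM2r // ler_pM2r //; lra.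
have xE : sphinv (zt t) (Lt t) (y0 + t *: v1) = y0 + t *: v2.
  rewrite /sphinv sE yE scalerA.
  have -> : Lt t / ((1 + t * th) ^+ 2 * D) * (1 + t * th) = 1 - t * th.
    by rewrite LtE; field; rewrite !lt0r_neq0.
  by apply/rowP => i; rewrite !mxE; ring.
have := gd _ oE; rewrite /gap /kelvin xE sE.
have -> : (1 + t * th) ^+ 2 * D / Lt t = (1 + t * th) / (1 - t * th).
  by rewrite LtE; field; rewrite !lt0r_neq0.
rewrite subr_ge0 mulrAC ler_pdivlMr // => hg.
have := hd _ _ E2 E1 a6' a6.
have -> : y0 + t *: v1 - (y0 + t *: v2) = (2 * (t * th)) *: (y0 - z).
  by apply/rowP => i; rewrite !mxE; ring.
have aux (u v : R) : `|u| <= v -> - v <= u.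
  by move=> h; rewrite lerNl; apply: le_trans h; rewrite -normrN ler_norm.
move=> /aux; rewrite enormZ gtr0_norm ?mulr_gt0 // edotZr => hs1.
have hs2 : de / (4 * zz) * (2 * (t * th) * enorm (y0 - z)) <= t * th * (de / 2).
  have -> : de / (4 * zz) * (2 * (t * th) * enorm (y0 - z)) = t * th * (de / 2) * (enorm (y0 - z) / zz).
    by field; rewrite lt0r_neq0.
  rewrite -[leRHS]mulr1; apply: ler_wpM2l; last by rewrite ler_pdivrMr // mul1r lerDl.
  by apply: mulr_ge0; [exact: ltW th1|rewrite divr_ge0 // ltW].
move: a7 a7' hs1 hs2 hg; rewrite !ltr_norml => /andP[b1 b2] /andP[b3 b4].
move: (w (y0 + t *: v1)) (w (y0 + t *: v2)) b1 b2 b3 b4 => W1 W2 b1 b2 b3 b4 hs1 hs2 hg.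
have c1 : t * th * (W1 + W2) < t * th * (2 * w y0 + de / 2) by rewrite ltr_pM2l //; lra.
have gE : edot (G y0) (y0 - z) = w y0 + de by rewrite /de; ring.
rewrite gE in hs1.
have c2 : 0 < t * th * de by rewrite mulr_gt0.
by move: (t * th) (w y0) c1 c2 hs1 hs2 hg => A B *; lra.
Qed.

(** The center moves along [xi] while the sphere keeps passing through [y0]; [eta] is the one of
    [strict_bdry] with dilation factor 1. The moved spheres are strictly below level [k] by [hS],
    and [diag_pass] for them contradicts the boundary condition. *)
Lemma diag_bdry (k : R) z L y0 : 0 < k -> k <= k1 -> feasible k z L -> below k -> E y0 ->
  sqd z y0 = L -> w y0 <= edot (G y0) (y0 - z) -> rho s y0 = 0 -> 0 < pw z L -> False.
Proof.
move=> k0 kk fz hb Ey Dy hG ry pp; have [L0 Lk _] := fz.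
have [nz LN za Lk1] := feas_N k0 kk fz.
pose r := rad s; have r0 : r != 0 := rads s; have bh0 := ss_bh st.
pose nu := r^-1 *: (y0 - cen s); pose eta := r^-1 + bh / m; pose xi := nu - eta *: (y0 - z).
have bcy := ss_bc st Ey ry; rewrite -/r -/nu in bcy.
have chb := ss_ch st s; have wy : 0 < w y0 by exact: (so_pos sol).
have mw : m <= w y0.
  have [] // := hR (y := y0); last by rewrite ry.
  by apply: (ball_near N0 LN za); rewrite Dy.
have key : edot (G y0) nu < eta * w y0.
  rewrite bcy /eta mulrDl (mulrC r^-1) ltrD2l.
  apply: (@lt_le_trans _ _ bh); first by rewrite ltrNl.
  by rewrite -[leLHS]mulr1 -mulrA ler_pM2l // mulrC ler_pdivlMr // mul1r.
have sE (t : R) : sqd (z + t *: xi) y0 = L + t * (- (2 * edot (y0 - z) xi) + t * edot xi xi).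
  have -> : y0 - (z + t *: xi) = (y0 - z) - t *: xi by rewrite opprD addrA.
  by rewrite -Dy; move: (y0 - z) => u; rewrite edot_sqrD !edotE; ring.
have i1 : small (fun t => 0 < sqd (z + t *: xi) y0).
  by apply: smallS (small_poly0 (- (2 * edot (y0 - z) xi)) (edot xi xi) 0 0 L0) _ => t;
    rewrite sE !(mulr0, addr0).
have i2 : small (fun t => 0 < k * nr (z + t *: xi) - sqd (z + t *: xi) y0).
  have h : 0 < k * nr z - L \/ 0 <= k * nr z - L /\ 0 < - (2 * k * edot (z - a) xi) + 2 * edot (y0 - z) xi.
    have [Leq|Lne] := eqVneq L (k * nr z); last by left; rewrite subr_gt0 lt_neqAle Lne.
    right; split; first by rewrite Leq subrr.
    have := hS (z := z) (b := s) (y := y0) k0 kk nz ltac:(by rewrite -Leq ltW) Ey ry ltac:(by rewrite -Leq Dy).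
    rewrite -Leq Dy divff ?lt0r_neq0 // mul1r.
    have rz := depth_from z ry; have ra := depth_from a ry; rewrite -/nu -/r in rz ra.
    rewrite rz ra; have yaE : y0 - a = (y0 - z) + (z - a) by rewrite addrA subrK.
    have e1 : edot (z - a) xi = edot (z - a) nu - eta * edot (y0 - z) (z - a).
      by rewrite /xi (edotDr nu) (edotNr (eta *: _)) (edotZr eta) (edotC (z - a) (y0 - z)).
    have e2 : edot (y0 - z) xi = edot (y0 - z) nu - eta * sqd z y0.
      by rewrite /xi (edotDr nu) (edotNr (eta *: _)) (edotZr eta).
    have e3 : sqd a y0 = sqd z y0 + 2 * edot (y0 - z) (z - a) + sqd a z by rewrite yaE edot_sqrD.
    have e4 : edot (y0 - a) nu = edot (y0 - z) nu + edot (z - a) nu by rewrite yaE edotDl.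
    have := @diag_derivative k (sqd z y0) (edot (y0 - z) (z - a)) (sqd a z) (edot (y0 - z) nu)
      (edot (z - a) nu) r (N ^+ 2) (bh / m) r0 ltac:(by rewrite Dy).
    rewrite -e3 -e4 e1 e2 => -> hh; rewrite subr_gt0.
    have -> : bh / m * (k * ((1 + k) * nr z + nr y0)) = bh * k * ((1 + k) * nr z + nr y0) / m by ring.
    by rewrite ltr_pdivrMr // [ltRHS]mulrC.
  apply: smallS (small_poly (- (k * edot xi xi) - edot xi xi) 0 0 h) _ => t.
  by rewrite sE sqd_line; congr (0 < _); ring.
have i3 : small (fun t => 0 < pw (z + t *: xi) (sqd (z + t *: xi) y0)).
  apply: smallS (small_poly0 (- (2 * (edot (z - cen s) xi / r)) - 2 * edot (y0 - z) xi / r) 0 0 0 pp) _ => t.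
  by rewrite sE depth_line // -/r; congr (0 < _); field.
have i4 : small (fun t => 0 < 1 + t * eta).
  by apply: smallS (small_poly0 eta 0 0 0 ltr01) _ => t; rewrite !(mulr0, addr0).
have := smallI (smallI i1 i2) (smallI (smallI i3 i4) small_pos).
move=> /small_ex[t [t0 [[a1 a2] [[a3 a4] _]]]].
have := diag_pass k0 hb Ey ry a1 ltac:(by rewrite -subr_gt0) a3.
have -> : y0 - (z + t *: xi) = (1 + t * eta) *: (y0 - z) - t *: nu.
  by rewrite /xi; apply/rowP => i; rewrite !mxE; ring.
rewrite edotDr edotNr (edotZr (1 + t * eta)) (edotZr t); apply/negP; rewrite -ltNge.
have h1 := ler_wpM2l (ltW a4) hG; have h2 : t * edot (G y0) nu < t * (eta * w y0) by rewrite ltr_pM2l.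
by lra.
Qed.

(** Goodness is a closed condition: at a fixed point strictly outside the sphere the gap depends
    continuously on center and radius. *)
Lemma curve_good (k : R) z L xi (l : R) y : 0 < k -> k <= k1 -> feasible k z L ->
  small (fun t => feasible k (z + t *: xi) (L + t * l) /\ is_good (z + t *: xi) (L + t * l)) ->
  E y -> L < sqd z y -> 0 <= gp z L y.
Proof.
move=> k0 kk fz hs Ey Ly; have [L0 _ _] := fz; rewrite leNgt; apply/negP => g0.
have oy : out z L y by split => //; exact: ltW.
have [ES _] := good_out_E k0 kk fz oy.
have yz := outside_neq L0 oy.
have so : small (fun t => out (z + t *: xi) (L + t * l) y).
  have h : 0 < sqd z y - L by rewrite subr_gt0.
  apply: smallS (small_poly0 (- (2 * edot (y - z) xi) - l) (edot xi xi) 0 0 h) _ => t ht.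
  split => //; rewrite -subr_ge0; apply: ltW.
  have -> : y - (z + t *: xi) = (y - z) - t *: xi by rewrite opprD addrA.
  move: ht; move: (y - z) => u; rewrite edot_sqrD !edotE => ht.
  by apply: lt_le_trans ht _; rewrite le_eqVlt; apply/orP; left; apply/eqP; ring.
have cL : L + t * l @[t --> small] --> L.
  rewrite -[X in _ --> X]addr0 -[X in _ + X](mul0r l).
  by apply: cvgD; [exact: cvg_cst|apply: cvgM; [exact: small_cvg|exact: cvg_cst]].
have cg : gp (z + t *: xi) (L + t * l) y @[t --> small] --> gp z L y.
  apply: gap_cvg; [exact: line_vcvg|exact: vcvg_cst|exact: cL|exact: yz|exact: lt0r_neq0
    |exact: (w_cont sol Ey)|exact: (w_cont sol ES)|exact: (smallS small_pos (fun _ _ => Ey))|].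
  exact: (smallS (smallI so hs) (fun t ht => proj1 (good_out_E k0 kk (proj1 (proj2 ht)) (proj1 ht)))).
have ng : 0 < - gp z L y by rewrite oppr_gt0.
have h : small (fun t => `|gp z L y - gp (z + t *: xi) (L + t * l) y| < - gp z L y).
  by move/cvgrPdist_lt: cg => /(_ _ ng).
have [t [t0 [[ot [_ gt]] ht]]] := small_ex (smallI (smallI so hs) h).
by have := gt _ ot; move: ht; rewrite ltr_norml => /andP[? ?]; lra.
Qed.

(** A feasible sphere at level [k] is a limit of feasible ones strictly below. Shrinking [L]
    suffices when [pw] stays nonnegative. If the sphere is orthogonal to [s] and the radius of [s]
    is positive, the center is pulled towards [cen s] at the same time, and [N <= |rad s|] makes the
    level drop. *)
Lemma approx_good (k : R) z L : 0 < k -> k <= k1 -> feasible k z L -> below k -> is_good z L.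
Proof.
move=> k0 kk fz hb y [Ey Ly0]; have [L0 Lk pp] := fz.
have [nz LN za Lk1] := feas_N k0 kk fz; have r0 := rads s.
move: Ly0; rewrite le_eqVlt => /orP[/eqP Ly|Ly].
  have Sy : sphinv z L y = y by rewrite /sphinv -Ly divff ?lt0r_neq0 // scale1r addrC subrK.
  by rewrite /gap /kelvin Sy -Ly divff ?lt0r_neq0 // mul1r subrr.
have fin xi l : small (fun t => [/\ 0 < L + t * l, 0 < k * nr (z + t *: xi) - (L + t * l) &
    0 <= pw (z + t *: xi) (L + t * l)]) -> 0 <= gp z L y.
  move=> hs; apply: (curve_good (xi := xi) (l := l) k0 kk fz) => //.
  apply: smallS hs _ => t [h1 h2 h3]; rewrite subr_gt0 in h2.
  by split; [split => //; exact: ltW|exact: hb].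
have i1 : small (fun t => 0 < L + t * - L).
  by apply: smallS (small_poly0 (- L) 0 0 0 L0) _ => t; rewrite !(mulr0, addr0).
have caseA : small (fun t => 0 <= pw z (L + t * - L)) -> 0 <= gp z L y.
  move=> h; apply: (fin 0 (- L)).
  apply: smallS (smallI (smallI i1 h) small_pos) _ => t [[h1 h2] t0].
  rewrite scaler0 addr0; split => //; have : 0 < t * L by rewrite mulr_gt0.
  by lra.
have [p0|p0] := ltrP 0 (pw z L).
  apply: caseA; apply: smallS (small_poly0 (- (L / rad s)) 0 0 0 p0) _ => t ht.
  by apply/ltW/(lt_le_trans ht); rewrite le_eqVlt; apply/orP; left; apply/eqP; ring.
have pz : pw z L = 0 by apply/le_anti; rewrite p0.
have [rp|rn] := ltrP 0 (rad s); last first.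
  have {}rn : rad s < 0 by rewrite lt_neqAle r0.
  apply: caseA; apply: smallS small_pos _ => t t0.
  have -> : pw z (L + t * - L) = pw z L - t * L / rad s by ring.
  rewrite pz sub0r oppr_ge0 nmulr_lle0 ?invr_lt0 //.
  by rewrite mulr_ge0 // ltW.
pose C := sqd (cen s) z; have CE : C = rad s ^+ 2 + L := orth_center st pz.
have C0 : 0 < C by rewrite CE addr_gt0 // exprn_gt0.
apply: (fin (- (z - cen s)) (- C)).
have j1 : small (fun t => 0 < L + t * - C).
  by apply: smallS (small_poly0 (- C) 0 0 0 L0) _ => t; rewrite !(mulr0, addr0).
have j2 : small (fun t => 0 < k * nr (z + t *: - (z - cen s)) - (L + t * - C)).
  have h : 0 < k * nr z - L \/ 0 <= k * nr z - L /\ 0 < 2 * k * edot (z - a) (z - cen s) + C.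
    right; split; first by rewrite subr_ge0.
    have h1 : - C <= edot (z - a) (z - cen s).
      apply: le_trans (edot_ge' _ _); rewrite lerN2 /C -sqr_enorm expr2 ler_wpM2r ?enorm_ge0 //.
      have h2 : enorm (z - a) < N by rewrite enorm_ltE.
      have h3 : rad s <= enorm (z - cen s).
        by rewrite leNgt (enorm_ltE _ rp) -leNgt -/C CE lerDl ltW.
      by move: Nr; rewrite gtr0_norm // => h4; lra.
    have h5 : 2 * k <= 8^-1 by move: kk k116; lra.
    have h6 : 2 * k * - C <= 2 * k * edot (z - a) (z - cen s) by rewrite ler_wpM2l // mulr_ge0 // ltW.
    have h7 : 2 * k * C <= 8^-1 * C by rewrite ler_wpM2r // ltW.
    by lra.
  apply: smallS (small_poly (- (k * C)) 0 0 h) _ => t.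
  by rewrite sqd_line !edotNr edotNl -/C; congr (0 < _); ring.
apply: smallS (smallI (smallI j1 j2) (smallI small_pos (small_lt ltr01))) _ => t [[h1 h2] [t0 t1]].
split => //; rewrite depth_line // !edotNr edotNl -/C.
have -> : 2 * (rho s z - t * (- C / rad s) - t ^+ 2 * (- - C / (2 * rad s))) + (L + t * - C) / rad s =
   pw z L + C / rad s * (t * (1 - t)) by field.
by rewrite pz add0r mulr_ge0 ?divr_ge0 ?mulr_ge0 ?subr_ge0 // ltW.
Qed.


Definition bad z (L : R) y := [/\ feasible k1 z L, out z L y & gp z L y < 0].

Lemma bad_facts z L y : bad z L y ->
  [/\ 0 < L, E y, m < w y, sqd a z < N ^+ 2 & L < sqd z y].
Proof.
move=> [fz oy gy]; have [nz LN za Lk1] := feas_N k10 (lexx _) fz; have [L0 _ pp] := fz.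
split => //; first by case: oy.
  have := kelvin_ge st N0 m0 hR L0 LN za pp oy; move: gy; rewrite /gap subr_lt0 => h1 h2.
  exact: le_lt_trans h2 h1.
rewrite lt_neqAle; have [_ ->] := oy; rewrite andbT; apply/eqP => Ly.
have Sy : sphinv z L y = y by rewrite /sphinv -Ly divff ?lt0r_neq0 // scale1r addrC subrK.
by move: gy; rewrite /gap /kelvin Sy -Ly divff ?lt0r_neq0 // mul1r subrr ltxx.
Qed.

(** [k] is the infimum of the levels of bad spheres, and the triple is a limit of bad ones of nearly
    minimal level, found for [z], [y] and [L] in turn. The points [y] remain in a compact set
    because [w > m] at a bad point. *)
Lemma bad_limit : (exists z L y, bad z L y) -> exists k z L y, [/\ 0 <= k <= k1, below k, E y, m <= w y & 0 <= L] /\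
  forall e, 0 < e -> exists z' L' y', [/\ bad z' L' y', L' <= (k + e) * nr z',
    enorm (z' - z) < e, `|L' - L| < e & enorm (y' - y) < e].
Proof.
move=> [z0 [L0 [y0 bad0]]].
pose S := [set k : R | 0 <= k /\ exists z L y, bad z L y /\ L <= k * nr z].
have Sk1 : S k1.
  by split; [exact: ltW|exists z0, L0, y0; split => //; case: bad0 => [[]]].
have lb0 : lbound S 0 by move=> k [].
have iS : has_inf S by split; [exists k1|exists 0].
pose ks := inf S.
have ks0 : 0 <= ks by apply: lb_le_inf => //; exists k1.
have ksk : ks <= k1 by apply: (ge_inf (proj2 iS)).
have hb : below ks.
  move=> z L L1 Lk pz y oy; rewrite leNgt; apply/negP => gy.
  have nz : 0 < nr z.
    have h : 0 < ks * nr z by exact: lt_trans L1 Lk.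
    by rewrite ltNge; apply/negP => hn; move: h; rewrite ltNge mulr_ge0_le0.
  have Sk : S (L / nr z).
    split; first by rewrite divr_ge0 ?(ltW L1) ?(ltW nz).
    exists z, L, y; split; last by rewrite divfK // lt0r_neq0.
    split => //; split => //; apply: (ltW (lt_le_trans Lk _)); by rewrite ler_pM2r.
  have := ge_inf (proj2 iS) Sk; rewrite -/ks ler_pdivlMr // => h.
  by move: (lt_le_trans Lk h); rewrite ltxx.
pose Q (e : R) z L y := bad z L y /\ L <= (ks + e) * nr z.
have Qmono e e' z L y : e <= e' -> Q e z L y -> Q e' z L y.
  move=> ee [b h]; split => //; apply: le_trans h _; apply: ler_wpM2r; last by rewrite lerD2l.
  by have [_ _ _ za _] := bad_facts b; rewrite subr_ge0 ltW.
have Qex e : 0 < e -> exists z L y, Q e z L y.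
  move=> e0; have [k [_ [z [L [y [b h]]]]] ke] := inf_adherent e0 iS.
  exists z, L, y; split => //; apply: le_trans h _; apply: ler_wpM2r; last exact: ltW.
  by have [_ _ _ za _] := bad_facts b; rewrite subr_ge0 ltW.
have cK1 : compact [set z | enorm (z - a) <= N] by apply: compact_cball; exact: ltW.
have Qex' e : 0 < e -> exists z, [set z | enorm (z - a) <= N] z /\ exists L y, Q e z L y.
  move=> /Qex[z [L [y q]]]; exists z; split; last by exists L, y.
  by have [_ _ _ za _] := bad_facts q.1; apply: ltW; rewrite enorm_ltE.
have [z Kz hz] := @compact_accum R _ _ (fun e z => exists L y, Q e z L y) cK1
  (fun e e0 => let: ex_intro z (conj h1 h2) := Qex' e e0 in ex_intro2 _ _ z h1 h2)
  (fun e e' z ee '(ex_intro L (ex_intro y q)) => ex_intro _ L (ex_intro _ y (Qmono _ _ _ _ _ ee q))).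
have hz' e : 0 < e -> exists y, (E `&` [set y | m <= w y]) y /\ exists z' L', enorm (z' - z) < e /\ Q e z' L' y.
  move=> e0; have U : nbhs z [set z' | enorm (z' - z) < e] by apply/nbhs_enormP; exists e.
  have [z' [_ [L [y q]] zz]] := hz e _ e0 U; exists y; split; last by exists z', L.
  by have [_ Ey my _ _] := bad_facts q.1; split => //=; exact: ltW.
have [y [Ey my] hy] := @compact_accum R _ _ (fun e y => exists z' L', enorm (z' - z) < e /\ Q e z' L' y)
  (ss_compact st m0) (fun e e0 => let: ex_intro y (conj h1 h2) := hz' e e0 in ex_intro2 _ _ y h1 h2)
  (fun e e' y ee '(ex_intro z' (ex_intro L (conj h q))) =>
     ex_intro _ z' (ex_intro _ L (conj (lt_le_trans h ee) (Qmono _ _ _ _ _ ee q)))).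
have hy' e : 0 < e -> exists L, `[0, k1 * N ^+ 2]%classic L /\ exists z' y', [/\ enorm (z' - z) < e, enorm (y' - y) < e & Q e z' L y'].
  move=> e0; have U : nbhs y [set y' | enorm (y' - y) < e] by apply/nbhs_enormP; exists e.
  have [y' [_ [z' [L [zz q]]] yy]] := hy e _ e0 U; exists L; split; last by exists z', y'.
  have [L1 _ _ _ _] := bad_facts q.1; rewrite /= in_itv /= (ltW L1) /=.
  case: q => [[[_ Lk _] _ _] _]; apply: le_trans Lk _; rewrite ler_pM2l // gerBl; exact: edot_ge0.
have [L KL hL] := @compact_accum R _ _ (fun e L => exists z' y', [/\ enorm (z' - z) < e, enorm (y' - y) < e & Q e z' L y'])
  (@segment_compact R 0 (k1 * N ^+ 2)) (fun e e0 => let: ex_intro L (conj h1 h2) := hy' e e0 in ex_intro2 _ _ L h1 h2)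
  (fun e e' L ee '(ex_intro z' (ex_intro y' (And3 h1 h2 q))) =>
     ex_intro _ z' (ex_intro _ y' (And3 (lt_le_trans h1 ee) (lt_le_trans h2 ee) (Qmono _ _ _ _ _ ee q)))).
exists ks, z, L, y; split.
  by split => //; [rewrite ks0|move: KL; rewrite /= in_itv => /andP[]].
move=> e e0; have U : nbhs L [set L' | `|L' - L| < e].
  by apply/nbhs_ballP; exists e => //= L'; rewrite /ball /= distrC.
have [L' [_ [z' [y' [h1 h2 [b hl]]]] h3]] := hL e _ e0 U.
by exists z', L', y'.
Qed.


(** A negative gap is a lower bound for the mean slope of [w] between the image and [y], which lie
    on one ray from the center. *)
Lemma bad_slope z L y g (e : R) : bad z L y -> (forall x, x = sphinv z L y ->
    `|w y - w x - edot g (y - x)| <= e * enorm (y - x)) ->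
  w y < edot g (y - z) + e * enorm (y - z).
Proof.
move=> b hs; have [L0 Ey my za Ly] := bad_facts b; case: b => fz oy gy.
have D0 := lt_trans L0 Ly.
have [_ _ /andP[t0 t1] yx] := pair_sphere L0 Ly.
have := hs _ erefl; move: gy; rewrite /gap /kelvin yx.
have -> : sqd z y / L = (L / sqd z y)^-1 by rewrite invf_div.
move: (L / sqd z y) t0 t1 (w (sphinv z L y)) => t t0 t1 W.
rewrite subr_lt0 mulrC ltr_pdivrMr // => h1.
have u0 : 0 < 1 - t by rewrite subr_gt0.
rewrite edotZr enormZ (gtr0_norm u0) => h; have h2 := le_trans (ler_norm _) h.
rewrite -(ltr_pM2l u0); lra.
Qed.

(** At the triple of [bad_limit] the gap is zero, being nonnegative by [approx_good] and a limit of
    negative values. A contact off the sphere of inversion contradicts [no_touch]; on that sphere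
    the slopes pass to the limit and [no_diag] or [diag_bdry] applies. *)
Lemma moving_spheres z L : 0 < L -> L <= k1 * nr z -> 0 <= pw z L -> is_good z L.
Proof.
move=> L0 Lk pz y oy; rewrite leNgt; apply/negP => gy.
have [|ks [z1 [L1 [y1 [[/andP[ks0 ksk] hb Ey my L1p] hacc]]]]] := bad_limit.
  by exists z, L, y; split.
move=> {z L L0 Lk pz y oy gy}.
pose T := ('rV[R]_n * R * 'rV[R]_n)%type.
(* The filter of bad triples tending to the limit triple, with levels at most [ks] in the limit. *)
pose F : set_system T := [set A | exists2 e : R, 0 < e & forall z' L' y', bad z' L' y' ->
  L' <= (ks + e) * nr z' -> enorm (z' - z1) < e -> `|L' - L1| < e -> enorm (y' - y1) < e -> A (z', L', y')].
have lev_mono (e e' : R) z' L' y' : bad z' L' y' -> e <= e' -> L' <= (ks + e) * nr z' -> L' <= (ks + e') * nr z'.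
  move=> b ee h; apply: le_trans h _; apply: ler_wpM2r; last by rewrite lerD2l.
  by have [_ _ _ za _] := bad_facts b; rewrite subr_ge0 ltW.
have FF : Filter F.
  split=> [|A B [e e0 hA] [e' e'0 hB]|A B AB [e e0 hA]]; first by exists 1.
    exists (Num.min e e'); first by rewrite lt_min e0.
    move=> z' L' y' b hl; rewrite !lt_min => /andP[a1 a2] /andP[a3 a4] /andP[a5 a6].
    split; [apply: hA => //|apply: hB => //]; apply: lev_mono b _ hl; by rewrite ge_min lexx ?orbT.
  by exists e => // z' L' y' *; apply: AB; exact: hA.
have Fex A : F A -> exists t, A t.
  by move=> [e e0 hA]; have [z' [L' [y' [b h1 h2 h3 h4]]]] := hacc e e0; exists (z', L', y'); exact: hA.
pose zf (t : T) := t.1.1; pose Lf (t : T) := t.1.2; pose yf (t : T) := t.2.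
have cz : vcvg (F := F) zf z1.
  move=> i; apply/cvgrPdist_lt => e e0; exists e => // z' L' y' _ _ h _ _.
  rewrite distrC; apply: le_lt_trans h; apply: le_trans (coord_le_enorm _ i); by rewrite !mxE.
have cy : vcvg (F := F) yf y1.
  move=> i; apply/cvgrPdist_lt => e e0; exists e => // z' L' y' _ _ _ _ h.
  rewrite distrC; apply: le_lt_trans h; apply: le_trans (coord_le_enorm _ i); by rewrite !mxE.
have cL : Lf t @[t --> F] --> L1.
  by apply/cvgrPdist_lt => e e0; exists e => // z' L' y' _ _ _ h _; rewrite distrC.
have Fb : F [set t | bad (zf t) (Lf t) (yf t)] by exists 1.
have Fle (g : T -> R) l : g t @[t --> F] --> l -> F [set t | g t <= 0] -> l <= 0.
  move=> hg hF'; rewrite leNgt; apply/negP => l0.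
  have [t [/= h1 h2]] := Fex _ (filterI hF' (cvg_gt0 hg l0)).
  by have : 0 < l / 2 by [rewrite divr_gt0]; lra.
have cD q : sqd q (zf t) @[t --> F] --> sqd q z1.
  by apply: edot_cvg; apply: vcvgB => //; exact: vcvg_cst.
have cDy : sqd (zf t) (yf t) @[t --> F] --> sqd z1 y1 by apply: edot_cvg; exact: vcvgB.
have cst (c : R) : c @[t --> F] --> c by exact: cvg_cst.
have hlev : L1 <= ks * nr z1.
  rewrite -subr_le0 leNgt; apply/negP => l0.
  have cg : Lf t - ks * nr (zf t) @[t --> F] --> L1 - ks * nr z1.
    by apply: cvgB => //; apply: cvgM => //; apply: cvgB.
  have e0 : 0 < (L1 - ks * nr z1) / (4 * N ^+ 2) by rewrite divr_gt0 // mulr_gt0 // exprn_gt0.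
  have Fl : F [set t | Lf t <= (ks + (L1 - ks * nr z1) / (4 * N ^+ 2)) * nr (zf t)] by eexists; [exact: e0|].
  have [[[z' L'] y'] [[/= b hl] h2]] := Fex _ (filterI (filterI Fb Fl) (cvg_gt0 cg l0)).
  have [_ _ _ za _] := bad_facts b.
  have h3 : (L1 - ks * nr z1) / (4 * N ^+ 2) * nr z' <= (L1 - ks * nr z1) / 4.
    have -> : (L1 - ks * nr z1) / 4 = (L1 - ks * nr z1) / (4 * N ^+ 2) * N ^+ 2 by field; rewrite lt0r_neq0.
    by rewrite ler_pM2l // gerBl edot_ge0.
  move: hl h2; rewrite /Lf /zf /= mulrDl => hl h2; lra.
have FEy : F [set t | E (yf t)] by apply: filterS Fb => t /bad_facts[].
have FES : F [set t | E (sphinv (zf t) (Lf t) (yf t))].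
  by apply: filterS Fb => t [fz o _]; have [] := good_out_E k10 (lexx _) fz o.
(* Radii tending to zero: a negative gap gives [|y'-z'|^2 < L' * C / m], so point, image and center
   merge, while [bad_slope] bounds the distance of the point from the center from below by
   [m / Kc]. *)
move: L1p; rewrite le_eqVlt => /orP[/eqP L10|L1p].
  have [d1 [m1 [C [d10 m10 C0 hb1]]]] := local_bounds sol Ey.
  have [d2 d20 hd] := so_sdiff sol Ey ltr01.
  pose Kc := enorm (G y1) + 1; have Kc0 : 0 < Kc by rewrite ltr_wpDl ?enorm_ge0.
  pose ep := Num.min ((d2 / 2) ^+ 2) (m ^+ 2 / Kc ^+ 2).
  have ep0 : 0 < ep by rewrite lt_min exprn_gt0 ?divr_gt0 ?exprn_gt0.
  have ep1 : 0 < ep * m / C by rewrite divr_gt0 // mulr_gt0.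
  have FL : F [set t | Lf t < ep * m / C].
    have := (@cvgrPdist_lt _ _ _ F FF Lf L1).1 cL _ ep1; apply: filterS => t; rewrite -L10 sub0r normrN.
    by apply: le_lt_trans; exact: ler_norm.
  have d22 : 0 < d2 / 2 by rewrite divr_gt0.
  have [[[z' L'] y'] [[/= b hL] [hy1 hy2]]] := Fex _ (filterI (filterI Fb FL)
    (filterI (vcvg_near cy d10) (vcvg_near cy d22))).
  rewrite /Lf /yf /= in hL hy1 hy2.
  have [L0 Ey' my' za Ly] := bad_facts b; have [fz oy gy] := b.
  have [Ex mx] := good_out_E k10 (lexx _) fz oy.
  have [_ wC _ _] := hb1 y' Ey' hy1.
  have [_ _ /andP[t0 t1] yx] := pair_sphere L0 Ly.
  have D0 := lt_trans L0 Ly.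
  have Dep : sqd z' y' < ep.
    move: gy; rewrite /gap /kelvin subr_lt0 => h1; have h2 := lt_le_trans h1 wC.
    have h3 : sqd z' y' / L' * m < C by apply: le_lt_trans h2; rewrite ler_pM2l // divr_gt0.
    move: h3; rewrite mulrAC ltr_pdivrMr // => h3.
    move: hL; rewrite ltr_pdivlMr // => h4; rewrite -(ltr_pM2r m0); lra.
  move: Dep; rewrite lt_min => /andP[De1 De2].
  have zd : enorm (y' - z') < d2 / 2 by rewrite enorm_ltE.
  have xd : enorm (sphinv z' L' y' - y1) < d2.
    have -> : sphinv z' L' y' - y1 = (y' - y1) - (y' - sphinv z' L' y').
      by move: (sphinv z' L' y') => x'; apply/rowP => i; rewrite !mxE; ring.
    apply: le_lt_trans (enormB _ _) _; rewrite yx enormZ gtr0_norm ?subr_gt0 //.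
    have := enorm_ge0 (y' - z'); move: (enorm (y' - z')) zd (L' / sqd z' y') t0 t1 hy2 => A zd t t0 t1 hy2 A0.
    have : 0 <= t * A by rewrite mulr_ge0 // ltW.
    by lra.
  have hslope : w y' < edot (G y1) (y' - z') + 1 * enorm (y' - z').
    apply: bad_slope b _ => x ->; apply: hd => //; apply: lt_trans hy2 _; lra.
  have h5 : m < Kc * enorm (y' - z').
    apply: lt_trans my' _; apply: lt_le_trans hslope _; rewrite /Kc mulrDl lerD2r; exact: edot_le'.
  have h6 : m ^+ 2 < (Kc * enorm (y' - z')) ^+ 2 by rewrite ltr_pXn2r // ?nnegrE ?(ltW m0) // (ltW (lt_trans m0 h5)).
  move: h6 De2; rewrite exprMn sqr_enorm ltr_pdivlMr ?exprn_gt0 // mulrC => h6 h7.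
  by have := lt_trans h6 h7; rewrite ltxx.
have kpos : 0 < ks.
  rewrite lt_neqAle ks0 andbT; apply/eqP => k0; move: hlev; rewrite -k0 mul0r leNgt L1p //.
have pz1 : 0 <= pw z1 L1.
  rewrite -oppr_le0; apply: (Fle (fun t => - pw (zf t) (Lf t))); last first.
    by apply: filterS Fb => t /= [[_ _ h] _ _]; rewrite oppr_le0.
  apply: cvgN; apply: cvgD; last by apply: cvgM.
  by apply: cvgM => //; apply: cvgM => //; apply: cvgB.
have Ly : L1 <= sqd z1 y1.
  rewrite -subr_le0; apply: (Fle (fun t => Lf t - sqd (zf t) (yf t))); first exact: cvgB.
  by apply: filterS Fb => t /= /bad_facts[_ _ _ _ h]; rewrite subr_le0 ltW.
have fz : feasible ks z1 L1 by split.
have o1 : out z1 L1 y1 by split.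
have gd := approx_good kpos ksk fz hb.
have [nz LN za Lk1] := feas_N kpos ksk fz.
have yz := outside_neq L1p o1.
have [ES _] := good_out_E kpos ksk fz o1.
have g1 : gp z1 L1 y1 = 0.
  apply/le_anti; rewrite gd // andbT; apply: (Fle (fun t => gp (zf t) (Lf t) (yf t))).
    by apply: gap_cvg; [exact: cz|exact: cy|exact: cL|exact: yz|exact: lt0r_neq0|exact: (w_cont sol Ey)
      |exact: (w_cont sol ES)|exact: FEy|exact: FES].
  by apply: filterS Fb => t /= [_ _ /ltW].
have nb y b : out z1 L1 y -> L1 < sqd z1 y -> gp z1 L1 y = 0 -> rho b y = 0 -> b <> s \/ 0 < pw z1 L1 -> False.
  by move=> [Ey' _] Ly' gy rb; exact: (strict_bdry kpos ksk fz hb Ey' Ly' rb gy).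
move: Ly; rewrite le_eqVlt => /orP[/eqP Ly|Ly]; last first.
  exact: (no_touch n0 hGam hf sol st N0 m0 hR hR' L1p LN za pz1 gd nb o1 Ly g1).
have hG : w y1 <= edot (G y1) (y1 - z1).
  rewrite leNgt; apply/negP => h.
  pose de := w y1 - edot (G y1) (y1 - z1); have de0 : 0 < de by rewrite subr_gt0.
  pose M := enorm (y1 - z1) + 1; have M0 : 0 < M by rewrite ltr_wpDl ?enorm_ge0.
  have e0 : 0 < de / (4 * M) by rewrite divr_gt0 // mulr_gt0.
  have de4 : 0 < de / 4 by rewrite divr_gt0.
  have [d d0 hd] := so_sdiff sol Ey e0.
  have Sy : sphinv z1 L1 y1 = y1 by rewrite /sphinv -Ly divff ?lt0r_neq0 // scale1r addrC subrK.
  have cS : vcvg (F := F) (fun t => sphinv (zf t) (Lf t) (yf t)) (sphinv z1 L1 y1).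
    exact: sphinv_cvg.
  rewrite Sy in cS.
  have cw : w (yf t) - edot (G y1) (yf t - zf t) @[t --> F] --> de.
    apply: cvgB; first by apply: (cont_cvg (w_cont sol Ey)).
    by apply: edot_cvg; [exact: vcvg_cst|exact: vcvgB].
  have := Fex _ (filterI (filterI Fb (filterI (vcvg_near cy d0) (vcvg_near cS d0)))
    (filterI (filterI FEy FES) (filterI (cvg_gt0 cw de0) (vcvg_near (vcvgB cy cz) ltr01)))).
  move=> [[[z' L'] y'] [[/= b [a1 a2]] [[a3 a4] [a5 a6]]]].
  rewrite /zf /Lf /yf /= in a1 a2 a3 a4 a5 a6.
  have hs : w y' < edot (G y1) (y' - z') + de / (4 * M) * enorm (y' - z').
    by apply: bad_slope b _ => x ->; exact: hd.
  have zM : enorm (y' - z') <= M.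
    have := enormD (y' - z' - (y1 - z1)) (y1 - z1); rewrite subrK /M => hh; lra.
  have h8 : de / (4 * M) * enorm (y' - z') <= de / 4.
    have -> : de / 4 = de / (4 * M) * M by field; rewrite lt0r_neq0.
    by rewrite ler_pM2l.
  by lra.
have [Oy|nO] := pselect (Om y1).
  exact: (no_diag n0 hGam hf sol st N0 m0 hR hR' L1p LN za pz1 gd nb Ey (esym Ly) hG (or_introl Oy)).
have ry : rho s y1 = 0.
  apply/le_anti; rewrite (ss_ge0 st s Ey) andbT leNgt; apply/negP => rp; apply: nO.
  by apply: (hR' _ rp); apply: (ball_near N0 LN za); rewrite -Ly.
have [pp|pp] := ltrP 0 (pw z1 L1); first exact: (diag_bdry kpos ksk fz hb Ey (esym Ly) hG ry pp).
have p0 : pw z1 L1 = 0 by apply/le_anti; rewrite pp.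
exact: (no_diag n0 hGam hf sol st N0 m0 hR hR' L1p LN za pz1 gd nb Ey (esym Ly) hG (or_intror (conj ry p0))).
Qed.

End MovingSpheres.

(** * Lower bounds in the interior and near a sphere *)

Section Interior.
Context {R : realType} {n : nat}.
Implicit Types (x y z v p c : 'rV[R]_n).
Local Notation sqd z y := (edot (y - z) (y - z)).

Lemma evs0 (i : 'I_n) : evs (0 : 'M[R]_n) 0 i = 0.
Proof.
have [s ->] := evs_perm (0 : 'M[R]_n); rewrite mxE; set l := eigvals _ _ _.
have : root (char_poly (0 : 'M[R]_n)) l.
  rewrite sym_char_poly ?trmx0 // /root horner_prod; apply/prodf_eq0; exists (s i) => //.
  by rewrite hornerXsubC subrr.
rewrite -eigenvalue_root_char => /eigenvalueP[v]; rewrite mulmx0 => /esym/eqP.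
by rewrite scaler_eq0 => /orP[/eqP //|/eqP ->]; rewrite eqxx.
Qed.

Lemma cont_atV (X : set 'rV[R]_n) (g : 'rV[R]_n -> R) x : cont_at X g x -> 0 < g x ->
  cont_at X (fun y => (g y)^-1) x.
Proof.
move=> cg g0 e e0; have [d1 d10 h1] := cont_at_pos cg g0.
have e1 : 0 < e * (g x ^+ 2 / 2) by rewrite mulr_gt0 // divr_gt0 // exprn_gt0.
have [d2 d20 h2] := cg _ e1; exists (Num.min d1 d2); first by rewrite lt_min d10.
move=> y Xy; rewrite lt_min => /andP[/(h1 y Xy)/andP[a1 a2] /(h2 y Xy) a3].
have gy : 0 < g y by apply: lt_trans a1; rewrite divr_gt0.
have -> : (g y)^-1 - (g x)^-1 = (g x - g y) / (g y * g x) by field; rewrite !lt0r_neq0.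
rewrite normrM normfV (gtr0_norm (mulr_gt0 gy g0)) ltr_pdivrMr ?mulr_gt0 // distrC.
apply: lt_le_trans a3 _; rewrite ler_pM2l // expr2 -mulrA.
by rewrite mulrC ler_pM2r // ltW // mulrC; have := a1; lra.
Qed.

Lemma cont_at_enorm (X : set 'rV[R]_n) z x : cont_at X (fun y => enorm (y - z)) x.
Proof.
move=> e e0; exists e => // y _ h; apply: le_lt_trans h.
rewrite ler_norml; apply/andP; split.
  rewrite lerNl opprB lerBlDr; have := enorm_dist y x z; rewrite (enormBC x y); lra.
by rewrite lerBlDr; have := enorm_dist x y z; lra.
Qed.

Context {Gam : set 'rV[R]_n} {f : 'rV[R]_n -> R} {E Om : set 'rV[R]_n}.
Context {w : 'rV[R]_n -> R} {G : 'rV[R]_n -> 'rV[R]_n} {H : 'rV[R]_n -> 'M[R]_n}.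
Hypotheses (n0 : (0 < n)%N) (hGam : admissible_cone Gam) (hf : admissible_function Gam f).
Hypothesis sol : solution_on Gam f E Om w G H.
Context {J : Type} {cen : J -> 'rV[R]_n} {rad : J -> R} {jo : J} {ch : J -> R} {bh : R}.
Hypothesis st : sphere_setting cen rad jo ch bh E Om w G.
Local Notation rho j := (depth (cen j) (rad j)).
Variable s0 : R.
Hypotheses (s00 : 0 < s0) (hs0 : forall s, 0 < s -> s <= s0 -> f (const_mx s) < 1).

(* A solution that is small on a ball would be touched from above by a paraboloid of small
   curvature. *)
Lemma not_small_on_ball x (M r : R) : 0 < r -> (forall y, enorm (y - x) < r -> Om y) ->
  (forall y, enorm (y - x) < r -> w y <= M) -> s0 * r ^+ 2 <= 8 * M ^+ 2.
Proof.
move=> r0 hO hM; rewrite leNgt; apply/negP => hlt.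
have xx : enorm (x - x) < r by rewrite subrr enorm0.
have Ox := hO x xx; have Ex := so_sub sol Ox; have wx := so_pos sol Ex.
have M0 : 0 < M := lt_le_trans wx (hM x xx).
have r20 : 0 < r ^+ 2 by rewrite exprn_gt0.
(* The paraboloid has the value [M] at distance [r / 2], so the minimum of [g], negative at [x], is
   attained inside; there the eigenvalues are at most [2 K M], the number [t] below. *)
pose K := 4 * M / r ^+ 2; have K0 : 0 < K by rewrite divr_gt0 ?mulr_gt0.
pose g y := K * sqd x y - w y.
have r2 : 0 < r / 2 by rewrite divr_gt0.
have r2r : r / 2 < r by lra.
have inb y : enorm (y - x) <= r / 2 -> enorm (y - x) < r by move=> h; exact: le_lt_trans h r2r.
have [|||y1 hy1 ymin] := @compact_min R n [set y | enorm (y - x) <= r / 2] g.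
- by exists x; rewrite /= subrr enorm0 ltW.
- by apply: compact_cball; exact: ltW.
- move=> y hy; apply: cont_atB; first by apply: cont_atZ; exact: cont_at_dist.
  apply: cont_at_sub (w_cont sol (so_sub sol (hO y (inb y hy)))) => y' hy'.
  exact: (so_sub sol (hO y' (inb y' hy'))).
have := ymin x; rewrite /= subrr enorm0 => /(_ (ltW r2)).
rewrite {2}/g subrr edot0l mulr0 sub0r => gx.
have y1lt : enorm (y1 - x) < r / 2.
  rewrite lt_neqAle hy1 andbT; apply/eqP => yE.
  have := hM y1 (inb y1 hy1); move: gx; rewrite /g -sqr_enorm yE /K expr_div_n.
  have -> : 4 * M / r ^+ 2 * (r ^+ 2 / 2 ^+ 2) = M by field; rewrite lt0r_neq0.
  by lra.
have Oy := hO y1 (inb y1 hy1); have Ey := so_sub sol Oy; have wy := so_pos sol Ey.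
have jg := jet2B (jet2Z K (jet2_sqd x y1)) (so_jet sol Oy).
have d0 : 0 < r / 2 - enorm (y1 - x) by rewrite subr_gt0.
have [|_ hq] := jet2_min jg d0.
  move=> v hv; apply: ymin => /=; rewrite addrAC; apply: le_trans (enormD _ _) _; lra.
have sA : (confA (w y1) (G y1) (H y1))^T = confA (w y1) (G y1) (H y1) by exact: (A_sym sol).
pose t := 8 * M ^+ 2 / r ^+ 2.
have t0 : 0 < t by rewrite divr_gt0 ?mulr_gt0 ?exprn_gt0.
have ts : t <= s0 by rewrite /t ler_pdivrMr // ltW.
have hA v : qform (confA (w y1) (G y1) (H y1)) v <= qform 0 v + t * edot v v.
  have := hq v; rewrite qformD qformN qformZl qform_scalar subr_ge0 => h1.
  rewrite qform_confA /qform mulmx0 edot0l add0r.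
  have h2 : w y1 * qform (H y1) v <= w y1 * (K * (2 * edot v v)) by rewrite ler_pM2l.
  have h3 : w y1 * (K * (2 * edot v v)) <= M * (K * (2 * edot v v)).
    apply: ler_wpM2r; last by apply: hM; exact: inb.
    by apply: mulr_ge0; [exact: ltW K0|apply: mulr_ge0 => //; exact: edot_ge0].
  have h4 : 0 <= 2^-1 * edot (G y1) (G y1) * edot v v by rewrite !mulr_ge0 ?invr_ge0 ?edot_ge0.
  have -> : t * edot v v = M * (K * (2 * edot v v)) by rewrite /t /K; field; rewrite lt0r_neq0.
  by rewrite /qform in h2; lra.
have := f_mono hGam hf (so_cone sol Ey) (l' := const_mx t).
have s0T : (0 : 'M[R]_n)^T = 0 by rewrite trmx0.
rewrite (so_eq sol Oy) => h; have : 1 <= f (const_mx t).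
  apply: h => i; have hle := evs_le sA s0T hA i.
  rewrite (evs0 i) (add0r t) in hle; rewrite [X in _ <= X]mxE; exact hle.
by rewrite leNgt hs0.
Qed.

Lemma dir_exists (v : 'rV[R]_n) : exists2 e : 'rV[R]_n, enorm e = 1 & v = enorm v *: e.
Proof.
have [->|v0] := eqVneq v 0.
  by exists (delta_mx 0 (Ordinal n0)); rewrite ?enorm_delta // enorm0 scale0r.
have p : 0 < enorm v by rewrite enorm_gt0.
exists ((enorm v)^-1 *: v); last by rewrite scalerA divff ?lt0r_neq0 // scale1r.
by rewrite enormZ gtr0_norm ?invr_gt0 // mulVf // lt0r_neq0.
Qed.

Lemma enorm_scal (t : R) (e : 'rV[R]_n) : enorm e = 1 -> enorm (t *: e) = `|t|.
Proof. by move=> he; rewrite enormZ he mulr1. Qed.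

Lemma far_outer a (N r : R) c : 0 < r -> 0 < N -> (forall y, enorm (y - a) < 2 * N -> 0 < depth c r y) ->
  enorm (a - c) + 2 * N <= r.
Proof.
move=> r0 N0 h; have [e e1 ae] := dir_exists (a - c).
have ha : enorm (a - c) < r.
  by rewrite enorm_ltE // -depth_gt0_outer //; apply: h; rewrite subrr enorm0 mulr_gt0.
rewrite leNgt; apply/negP => hlt; pose th := r - enorm (a - c).
have t0 : 0 < th by rewrite subr_gt0.
have := h (a + th *: e); rewrite addrC addKr enorm_scal // gtr0_norm // depth_gt0_outer //.
have -> : a + th *: e - c = r *: e.
  by rewrite addrAC {1}ae -scalerDl /th addrC subrK.
rewrite -enorm_ltE // enorm_scal // gtr0_norm // ltxx => hf'; have : false by apply: hf'; rewrite /th; lra.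
by [].
Qed.

Lemma far_inner a (N r : R) c : r < 0 -> 0 < N -> (forall y, enorm (y - a) < 2 * N -> 0 < depth c r y) ->
  - r + 2 * N <= enorm (a - c).
Proof.
move=> r0 N0 h; have [e e1 ae] := dir_exists (a - c).
have rp : 0 < - r by rewrite oppr_gt0.
have ha : - r < enorm (a - c).
  rewrite ltNge enorm_leE ?(ltW rp) // sqrrN -ltNge -depth_gt0_inner //; apply: h.
  by rewrite subrr enorm0 mulr_gt0.
rewrite leNgt; apply/negP => hlt; pose th := - r - enorm (a - c).
have t0 : th < 0 by rewrite subr_lt0.
have := h (a + th *: e); rewrite addrC addKr enorm_scal // ltr0_norm // depth_gt0_inner //.
have -> : a + th *: e - c = (- r) *: e.
  by rewrite addrAC {1}ae -scalerDl /th addrC subrK.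
rewrite -sqr_enorm enorm_scal // gtr0_norm // sqrrN ltxx => hf'; have : false by apply: hf'; rewrite /th; lra.
by [].
Qed.

(** A sphere staying out of the ball of radius [2 * N] contributes to the derivative of the level a
    gain of order [N], uniformly in its radius, however small or large. *)
Lemma far_sphere_level c (r : R) a z (N k : R) : r != 0 -> 0 < N -> 0 <= k <= 16^-1 ->
  (forall y, enorm (y - a) < 2 * N -> 0 < depth c r y) -> enorm (z - a) < N ->
  3 / 4 * N <= 2 * (1 + k) * depth c r z - 2 * k * depth c r a - k * N ^+ 2 / r.
Proof.
move=> r0 N0 /andP[k0 k1] h hz.
have zc : enorm (z - c) <= enorm (a - c) + N.
  by have := enorm_dist a z c; lra.
have zc' : enorm (a - c) - N <= enorm (z - c).
  by have := enorm_dist z a c; rewrite (enormBC a z); lra.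
rewrite /depth -!sqr_enorm; have := enorm_ge0 (a - c); have := enorm_ge0 (z - c).
have [rp|rn] := ltrP 0 r.
  have := far_outer rp N0 h; move: (enorm (a - c)) (enorm (z - c)) zc => d q zc hd q0 d0.
  have -> : 2 * (1 + k) * ((r ^+ 2 - q ^+ 2) / (2 * r)) - 2 * k * ((r ^+ 2 - d ^+ 2) / (2 * r)) -
    k * N ^+ 2 / r = (r ^+ 2 - q ^+ 2 - k * (q ^+ 2 - d ^+ 2 + N ^+ 2)) / r by field.
  rewrite ler_pdivlMr //.
  have q2 : q ^+ 2 <= (d + N) ^+ 2 by rewrite ler_pXn2r // nnegrE addr_ge0 // ltW.
  have d2 : (d + N) ^+ 2 <= (r - N) ^+ 2 by rewrite ler_pXn2r // ?nnegrE; lra.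
  have a1 : q ^+ 2 - d ^+ 2 + N ^+ 2 <= 2 * N * r.
    have : d * N <= (r - 2 * N) * N by rewrite ler_wpM2r //; lra.
    by have : 0 < N * N by [rewrite mulr_gt0]; lra.
  have a2 : k * (q ^+ 2 - d ^+ 2 + N ^+ 2) <= k * (2 * N * r) by rewrite ler_wpM2l.
  have a3 : k * (2 * N * r) <= 16^-1 * (2 * N * r) by rewrite ler_wpM2r // !mulr_ge0 // ltW.
  have a4 : N * N <= N * (r / 2) by rewrite ler_pM2l //; lra.
  have a5 : 0 < N * r by rewrite mulr_gt0.
  by lra.
have {}rn : r < 0 by rewrite lt_neqAle r0.
have := far_inner rn N0 h; move: (enorm (a - c)) (enorm (z - c)) zc' => d q zc' hd q0 d0.
have -> : 2 * (1 + k) * ((r ^+ 2 - q ^+ 2) / (2 * r)) - 2 * k * ((r ^+ 2 - d ^+ 2) / (2 * r)) -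
    k * N ^+ 2 / r = (q ^+ 2 - r ^+ 2 + k * (q ^+ 2 - d ^+ 2 + N ^+ 2)) / (- r) by field.
have rp : 0 < - r by rewrite oppr_gt0.
rewrite ler_pdivlMr //; move: rp hd; rewrite -(sqrrN r); move: (- r) => r' rp hd.
have q2 : (d - N) ^+ 2 <= q ^+ 2 by rewrite ler_pXn2r // ?nnegrE; lra.
have a2 : k * - (2 * d * N) <= k * (q ^+ 2 - d ^+ 2 + N ^+ 2).
  by rewrite ler_wpM2l //; have : 0 < N * N by [rewrite mulr_gt0]; lra.
have dN : 0 <= 2 * d * N by rewrite !mulr_ge0 // ltW.
have a3 : k * (2 * d * N) <= 16^-1 * (2 * d * N) by rewrite ler_wpM2r.
pose e := d - r' - 2 * N; have e0 : 0 <= e by rewrite /e; lra.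
have dE : d = r' + 2 * N + e by rewrite /e; ring.
have p1 : 0 <= e * N by rewrite mulr_ge0 // ltW.
have p2 : 0 <= e * r' by rewrite mulr_ge0 // ltW.
have p3 : 0 < N * N by rewrite mulr_gt0.
have p4 : 0 < N * r' by rewrite mulr_gt0.
have p5 : 0 <= e * e by rewrite mulr_ge0.
have p6 : d * N = r' * N + 2 * (N * N) + e * N by rewrite {1}dE; ring.
have p7 : (d - N) ^+ 2 = (r' + N + e) ^+ 2 by rewrite {1}dE; ring.
by rewrite p7 in q2; lra.
Qed.

(* The usual doubling argument: a point where w is small relative to the distance to the boundary
   of a ball can be replaced by one around which w is almost minimal. *)
Lemma doubling x (r : R) : 0 < r -> E x -> compact (E `&` [set y | enorm (y - x) <= r]) ->
  exists x1, [/\ E x1, enorm (x1 - x) < r, w x1 * r <= w x * (r - enorm (x1 - x)) &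
    forall y, E y -> enorm (y - x1) < (r - enorm (x1 - x)) / 2 -> w x1 / 2 <= w y].
Proof.
move=> r0 Ex cK; pose X := E `&` [set y | enorm (y - x) <= r].
pose g y := (enorm (y - x) - r) * (w y)^-1.
have Xx : X x by split => //=; rewrite subrr enorm0 ltW.
have [|||x1 [Ex1 hx1] xmin] := @compact_min R n X g; [by exists x|exact: cK| |].
  move=> y [Ey _]; apply: cont_atM; first by apply: cont_atB; [exact: cont_at_enorm|exact: cont_at_cst].
  by apply: cont_atV; [apply: cont_at_sub (w_cont sol Ey) => ? []|exact: (so_pos sol)].
rewrite /= in hx1; have wx := so_pos sol Ex; have w1 := so_pos sol Ex1.
have h0 := xmin x Xx.
have d0 : enorm (x1 - x) < r.
  have : g x < 0 by rewrite /g subrr enorm0 sub0r pmulr_llt0 ?invr_gt0 // oppr_lt0.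
  by move=> /(le_lt_trans h0); rewrite /g pmulr_llt0 ?invr_gt0 // subr_lt0.
exists x1; split => //.
  move: h0; rewrite /g subrr enorm0 sub0r ler_pdivrMr // mulrAC ler_pdivlMr //.
  by move=> h; rewrite -lerN2; move: h; lra.
move=> y Ey hy; have wy := so_pos sol Ey.
have hyr : enorm (y - x) <= r by have := enorm_dist x1 y x; lra.
have := xmin y (conj Ey hyr); rewrite /g ler_pdivrMr // mulrAC ler_pdivlMr // => h.
have hd : (r - enorm (x1 - x)) / 2 <= r - enorm (y - x) by have := enorm_dist x1 y x; lra.
have h1 : w x1 * ((r - enorm (x1 - x)) / 2) <= w x1 * (r - enorm (y - x)) by rewrite ler_pM2l.
have dp : 0 < r - enorm (x1 - x) by rewrite subr_gt0.
rewrite -(ler_pM2r dp); lra.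
Qed.

(** Around an almost minimal point [x1] with [w x1 = 2 * m], reflecting points to [x1] with factor
    1/2 gives [w <= 4 * m] on a ball whose squared radius is [k1 * N ^+ 2 / 3]; [not_small_on_ball]
    bounds that radius by a multiple of [m]. *)
Lemma interior_bound x (c r : R) : 0 < c -> 100 * 100 * c ^+ 2 <= s0 -> 100 * 100 * bh * c <= s0 -> 0 < r ->
  r <= rad jo -> (forall y, enorm (y - x) < r -> Om y) -> c * r / 4 <= w x.
Proof.
move=> c0 hc1' hc2' r0 rj hO.
have {hc1'} hc1 t : t = c -> 100 * 100 * t ^+ 2 <= s0 by move=> ->.
have {hc2'} hc2 t : t = c -> 100 * 100 * bh * t <= s0 by move=> ->.
have r2 : 0 < r / 2 by rewrite divr_gt0.
have r2r : r / 2 < r by lra.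
have Ox : Om x by apply: hO; rewrite subrr enorm0.
have Ex := so_sub sol Ox.
have [|x1 [Ex1 d0 hw hd]] := doubling r2 Ex.
  have -> : E `&` [set y | enorm (y - x) <= r / 2] = [set y | enorm (y - x) <= r / 2].
    apply/seteqP; split => y /=; [by case|move=> h; split => //].
    by apply: (so_sub sol); apply: hO; exact: le_lt_trans h r2r.
  by apply: compact_cball; exact: ltW.
pose N := (r / 2 - enorm (x1 - x)) / 4; have N0 : 0 < N by rewrite divr_gt0 // subr_gt0.
have w1 := so_pos sol Ex1; pose m := w x1 / 2; have m0 : 0 < m by rewrite divr_gt0.
have bh0 := ss_bh st.
have ball y : enorm (y - x1) < 2 * N -> Om y /\ m <= w y.
  move=> hy; have Oy : Om y.
    by apply: hO; have := enorm_dist x1 y x; rewrite /N in hy; lra.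
  by split => //; apply: hd; [exact: (so_sub sol)|move: hy; rewrite /N; lra].
suff mN : c * N <= m.
  have h1 : w x1 * (r / 2) <= w x * (4 * N) by move: hw; rewrite /N; lra.
  have h2 : 2 * (c * N) * (r / 2) <= w x1 * (r / 2) by rewrite ler_pM2r //; move: mN; rewrite /m; lra.
  by rewrite -(ler_pM2r N0); lra.
(* The second entry keeps the boundary term in the derivative of the level, at most [3 bh k N^2],
   below [m] times the gain [3 N / 4]. *)
pose k1 := Num.min 16^-1 (m / (8 * bh * N)).
have bN : 0 < 8 * bh * N by apply: mulr_gt0 => //; exact: mulr_gt0.
have k10 : 0 < k1 by rewrite lt_min; apply/andP; split; [rewrite invr_gt0|exact: divr_gt0].
have k116 : k1 <= 16^-1 by rewrite ge_min lexx.
have k1m : k1 * (8 * bh * N) <= m by rewrite -(ler_pdivlMr _ _ bN) /k1 ge_min lexx orbT.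
have rjo : 0 < rad jo by apply/(ss_outer st).
have Nr : N <= `|rad jo|.
  by rewrite gtr0_norm //; have := enorm_ge0 (x1 - x); rewrite /N; lra.
have hR y : enorm (y - x1) < 2 * N -> 0 <= rho jo y -> E y /\ m <= w y.
  by move=> /ball[Oy my] _; split => //; exact: (so_sub sol).
have hR' y : enorm (y - x1) < 2 * N -> 0 < rho jo y -> Om y by move=> /ball[].
have N20 : 0 < N ^+ 2 by rewrite exprn_gt0.
have near z : 0 < N ^+ 2 - sqd x1 z -> enorm (z - x1) < N by rewrite subr_gt0 -enorm_ltE.
have hS (k : R) z b y : 0 < k -> k <= k1 -> 0 < N ^+ 2 - sqd x1 z ->
    0 <= 2 * rho jo z + k * (N ^+ 2 - sqd x1 z) / rad jo -> E y -> rho b y = 0 ->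
    k * (N ^+ 2 - sqd x1 z) <= sqd z y ->
    bh * k * ((1 + k) * (N ^+ 2 - sqd x1 z) + k * (N ^+ 2 - sqd x1 z) / sqd z y * (N ^+ 2 - sqd x1 y)) <
    m * (2 * (1 + k) * rho b z - 2 * k * rho b x1 - k * N ^+ 2 / rad b).
  move=> k0 kk nz _ Ey rb Ly.
  have hJ := @far_sphere_level (cen b) (rad b) x1 z N k (ss_rad st b) N0
    ltac:(by rewrite (ltW k0) (le_trans kk k116)) (fun y hy => ss_gt0 st b (proj1 (ball y hy))) (near z nz).
  have L0 : 0 < k * (N ^+ 2 - sqd x1 z) by rewrite mulr_gt0.
  have D0 := lt_le_trans L0 Ly.
  have t1 : 0 <= k * (N ^+ 2 - sqd x1 z) / sqd z y <= 1.
    by rewrite divr_ge0 ?(ltW L0) ?(ltW D0) //= ler_pdivrMr // mul1r.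
  move: t1; move: (k * (N ^+ 2 - sqd x1 z) / sqd z y) => t /andP[t0 t1].
  have b1 : t * (N ^+ 2 - sqd x1 y) <= N ^+ 2.
    have e0 := edot_ge0 (y - x1).
    have : t * (N ^+ 2 - sqd x1 y) <= t * N ^+ 2 by rewrite ler_wpM2l // gerBl.
    have : t * N ^+ 2 <= 1 * N ^+ 2 by rewrite ler_wpM2r // ltW.
    by lra.
  have b2 : (1 + k) * (N ^+ 2 - sqd x1 z) <= 2 * N ^+ 2.
    apply: ler_pM; [lra|exact: ltW| |by rewrite gerBl edot_ge0].
    by have := le_trans kk k116; lra.
  have b3 : bh * k * ((1 + k) * (N ^+ 2 - sqd x1 z) + t * (N ^+ 2 - sqd x1 y)) <= bh * k * (3 * N ^+ 2).
    by rewrite ler_pM2l ?mulr_gt0 //; lra.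
  apply: le_lt_trans b3 _; apply: lt_le_trans (_ : m * (3 / 4 * N) <= _); last by rewrite ler_pM2l.
  have b4 : k * (8 * bh * N) <= m by apply: le_trans k1m; rewrite (ler_pM2r bN).
  have b5 := ler_wpM2r (ltW N0) b4; have b6 : 0 < m * N by rewrite mulr_gt0.
  by lra.
(* Vacuous: the centers have positive depth, so none of these spheres is orthogonal to the outer
   one. *)
have hF z (L : R) b y : 0 < L -> L <= k1 * (N ^+ 2 - sqd x1 z) -> 2 * rho jo z + L / rad jo = 0 -> b <> jo ->
    E y -> rho b y = 0 -> L <= sqd z y -> bh * L * rho jo y < m * sqd z y.
  move=> L0 Lk pz; have nz : 0 < N ^+ 2 - sqd x1 z by rewrite -(pmulr_rgt0 _ k10); exact: lt_le_trans Lk.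
  have [Oz _] := ball z ltac:(by have := near z nz; lra).
  have := ss_gt0 st jo Oz; have : 0 < L / rad jo by rewrite divr_gt0.
  by lra.
have ms := moving_spheres n0 hGam hf sol st N0 m0 k10 k116 Nr hR hR' hS hF.
(* For factor 1/2 the sphere of [y] has center [2 x1 - y] and squared radius [2 |y-x1|^2]. It is
   below level [k1] once [3 |y-x1|^2] is less than [k1 N^2]. *)
pose h2 := k1 * N ^+ 2 / 3; have h20 : 0 < h2 by apply: divr_gt0 => //; exact: mulr_gt0.
have [h h0 hE] : exists2 h, 0 < h & h ^+ 2 = h2.
  by exists (Num.sqrt h2); rewrite ?sqrtr_gt0 // sqr_sqrtr // ltW.
have hN : h < N.
  rewrite -(ltr_pXn2r (n := 2)) ?nnegrE ?(ltW h0) ?(ltW N0) // hE /h2.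
  by have : k1 * N ^+ 2 <= 16^-1 * N ^+ 2 by [rewrite ler_pM2r]; lra.
have wb y : enorm (y - x1) < h -> w y <= 4 * m.
  move=> hy; have [->|yx] := eqVneq y x1; first by rewrite /m; lra.
  have [Oy _] := ball y ltac:(by lra).
  have yx0 : y - x1 != 0 by rewrite subr_eq0.
  have half : 0 < (2^-1 : R) < 1 by rewrite invr_gt0 ltr0n invf_lt1 ?ltr1n.
  have h12 : (2^-1 : R) != 1 by rewrite lt_eqF //; case/andP: half.
  have cE : pcen 2^-1 x1 y - x1 = x1 - y.
    by rewrite /pcen; apply/rowP => i; rewrite !mxE; field.
  have LE : prad 2^-1 x1 y = 2 * sqd x1 y by rewrite /prad; field.
  have cD : sqd x1 (pcen 2^-1 x1 y) = sqd x1 y by rewrite cE -opprB edotNl edotNr opprK.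
  have yh : sqd x1 y < h2 by rewrite -hE -enorm_ltE.
  have gd : is_good (E := E) (w := w) (pcen 2^-1 x1 y) (prad 2^-1 x1 y).
    apply: ms.
    - by rewrite LE mulr_gt0 // edot_gt0.
    - rewrite LE cD; have k1' : k1 * sqd x1 y <= 1 * sqd x1 y by rewrite ler_wpM2r ?edot_ge0 //; lra.
      by move: yh; rewrite /h2; lra.
    - have [Oz _] := ball (pcen 2^-1 x1 y) ltac:(by rewrite cE enormBC; lra).
      apply: addr_ge0; first by rewrite mulr_ge0 // ltW // (ss_gt0 st jo Oz).
      by rewrite divr_ge0 ?(ltW rjo) // LE mulr_ge0 ?edot_ge0.
  have := pair_good half yx0 (so_sub sol Oy) gd; rewrite /m; lra.
have := @not_small_on_ball x1 (4 * m) h h0 (fun y hy => proj1 (ball y ltac:(by lra))) wb.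
(* The resulting inequality is quadratic in [m] for [k1 = 1/16] and linear after cancelling [m]
   otherwise; each of the two smallness assumptions on [c] settles one case. *)
rewrite hE /h2 => hfin; have [k1E|k1E] : k1 = 16^-1 \/ k1 = m / (8 * bh * N).
- by rewrite /k1; case: (ltrP 16^-1 (m / (8 * bh * N))) => h'; [left|right].
- have : (c * N) ^+ 2 <= m ^+ 2.
    rewrite exprMn; have := ler_wpM2r (ltW N20) (hc1 c erefl); have := sqr_ge0 m; rewrite k1E in hfin; lra.
  by rewrite ler_pXn2r // nnegrE; [apply: mulr_ge0; exact: ltW|exact: ltW m0].
rewrite k1E in hfin.
have e1 : s0 * (m / (8 * bh * N) * N ^+ 2 / 3) = m * (s0 * N / (24 * bh)) by field; rewrite !lt0r_neq0.
move: hfin; rewrite e1 => hfin.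
have : s0 * N / (24 * bh) <= 128 * m by rewrite -(ler_pM2l m0); lra.
rewrite ler_pdivrMr ?mulr_gt0 // => h4.
have h5 := ler_wpM2r (ltW N0) (hc2 c erefl); have h6 := mulr_gt0 bh0 m0.
by rewrite -(ler_pM2l bh0); lra.
Qed.

End Interior.

(** * Numerical inequalities for the cap *)

Section CapNumerics.
Context {R : realType}.
Implicit Types (N h q om k : R).

Lemma cap_level_upper (N h nz pz q : R) : 0 < nz -> 0 < h -> 0 < N -> 0 < q -> N <= 100^-1 * q ->
  nz <= 2 * N * h + pz -> pz <= 16^-1 * nz * (N / q) -> nz <= 21 / 10 * (N * h).
Proof.
move=> nz0 h0 N0 q0 Nq h1 h2; have : N / q <= 100^-1 by rewrite ler_pdivrMr.
move=> h3; have : 16^-1 * nz * (N / q) <= 16^-1 * nz * 100^-1.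
  by rewrite ler_pM2l // mulr_gt0 // invr_gt0.
have : 0 < N * h by rewrite mulr_gt0.
by lra.
Qed.

(** [J] stands for the derivative of the level at a contact on [s] itself. The center of the cap
    beyond [s] contributes [2 k g], of order [k N], while the boundary term is [bh k] times a
    quantity of order [N h]; hence [m] is taken to be a multiple of [bh h]. *)
Lemma cap_own_sphere (bh k N h g q nz ny t J m : R) : 0 < bh -> 0 < k -> k <= 16^-1 -> 0 < N -> 0 < h ->
  h <= 100^-1 * N -> g = N - h -> 0 < q -> N <= 100^-1 * q -> 0 < nz -> nz <= 21 / 10 * (N * h) ->
  0 <= t <= 1 -> ny <= 2 * N * h -> m = 12 * bh * h ->
  k * (2 * g - (1 + k) * nz / q - (N ^+ 2 + g ^+ 2) / q) <= J ->
  bh * k * ((1 + k) * nz + t * ny) < m * J.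
Proof.
move=> bh0 k0 k1 N0 h0 hN gE q0 Nq nz0 nzu /andP[t0 t1] nyu mE hJ.
have Nh0 : 0 < N * h by rewrite mulr_gt0.
have Nq' : N / q <= 100^-1 by rewrite ler_pdivrMr.
have a1 : t * ny <= 2 * N * h.
  have : t * ny <= t * (2 * N * h) by rewrite ler_wpM2l.
  have : t * (2 * N * h) <= 1 * (2 * N * h) by rewrite ler_wpM2r // !mulr_ge0 // ltW.
  by lra.
have a2 : (1 + k) * nz <= 17 / 16 * (21 / 10 * (N * h)) by apply: ler_pM; lra.
have a3 : (1 + k) * nz / q <= 100^-1 * N.
  have : (1 + k) * nz / q <= 17 / 16 * (21 / 10 * (N * h)) / q by rewrite ler_pM2r // invr_gt0.
  have -> : 17 / 16 * (21 / 10 * (N * h)) / q = 17 / 16 * (21 / 10) * h * (N / q) by ring.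
  have : 17 / 16 * (21 / 10) * h * (N / q) <= 17 / 16 * (21 / 10) * h * 100^-1.
    by rewrite ler_pM2l // mulr_gt0 // mulr_gt0.
  by lra.
have gN : g ^+ 2 <= N ^+ 2 by rewrite ler_pXn2r // ?nnegrE; lra.
have a4 : (N ^+ 2 + g ^+ 2) / q <= 50^-1 * N.
  have : (N ^+ 2 + g ^+ 2) / q <= (2 * N ^+ 2) / q by rewrite ler_pM2r ?invr_gt0 //; lra.
  have -> : 2 * N ^+ 2 / q = 2 * N * (N / q) by ring.
  have : 2 * N * (N / q) <= 2 * N * 100^-1 by rewrite ler_pM2l // mulr_gt0.
  by lra.
have a5 : k * (3 / 2 * N) <= J by apply: le_trans hJ; rewrite ler_pM2l //; lra.
have a6 : bh * k * ((1 + k) * nz + t * ny) <= bh * k * (5 * (N * h)).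
  by rewrite ler_pM2l ?mulr_gt0 //; lra.
apply: le_lt_trans a6 _; apply: lt_le_trans (_ : m * (k * (3 / 2 * N)) <= _); last first.
  by rewrite ler_pM2l // mE !mulr_gt0.
rewrite mE; have : 0 < bh * k * (N * h) by rewrite !mulr_gt0.
by lra.
Qed.

Lemma cap_other_sphere (bh k N h nz ny t J m : R) : 0 < bh -> 0 < k -> k <= 16^-1 -> 0 < N -> 0 < h ->
  0 < nz -> nz <= 21 / 10 * (N * h) -> 0 <= t -> ny <= 0 -> m = 12 * bh * h -> 3 / 4 * N <= J ->
  bh * k * ((1 + k) * nz + t * ny) < m * J.
Proof.
move=> bh0 k0 k1 N0 h0 nz0 nzu t0 nyu mE hJ.
have a1 : t * ny <= 0 by rewrite mulr_ge0_le0.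
have a2 : (1 + k) * nz <= 17 / 16 * (21 / 10 * (N * h)) by apply: ler_pM; lra.
have Nh0 : 0 < bh * (N * h) by rewrite !mulr_gt0.
have a6 : bh * k * ((1 + k) * nz + t * ny) <= bh * 16^-1 * (5 * (N * h)).
  have : bh * k * ((1 + k) * nz + t * ny) <= bh * k * (5 * (N * h)).
    by rewrite ler_pM2l ?mulr_gt0 //; have : 0 < N * h by [rewrite mulr_gt0]; lra.
  have : bh * k * (5 * (N * h)) <= bh * 16^-1 * (5 * (N * h)).
    by rewrite ler_pM2r ?mulr_gt0 // ler_pM2l.
  by lra.
apply: le_lt_trans a6 _; apply: lt_le_trans (_ : m * (3 / 4 * N) <= _); last first.
  by rewrite ler_pM2l // mE !mulr_gt0.
by rewrite mE; lra.
Qed.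

(** The numerical content of [hF]: the depth with respect to [s] of a point on another sphere is
    bounded through its distance [Z] from the center, which is at least [N]. *)
Lemma cap_far_sphere (bh N h q nz L ry Z m : R) : 0 < bh -> 0 < N -> 0 < h -> h <= N -> 0 < q -> N <= 100^-1 * q ->
  0 < L -> L <= 16^-1 * nz -> nz <= 21 / 10 * (N * h) -> N <= Z ->
  ry <= L / (2 * q) + 2 * Z + Z ^+ 2 / (2 * q) -> m = 12 * bh * h -> bh * L * ry < m * Z ^+ 2.
Proof.
move=> bh0 N0 h0 hN q0 Nq L0 Lnz nzu NZ hry mE.
have Z0 : 0 < Z by exact: lt_le_trans NZ.
have Lh : L <= 5^-1 * (N * h) by have : 0 < N * h by [rewrite mulr_gt0]; lra.
have Nq' : N / q <= 100^-1 by rewrite ler_pdivrMr.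
have a1 : L / (2 * q) <= 1000^-1 * h.
  have : L / (2 * q) <= 5^-1 * (N * h) / (2 * q) by rewrite ler_pM2r // invr_gt0 mulr_gt0.
  have -> : 5^-1 * (N * h) / (2 * q) = 10^-1 * h * (N / q) by field; rewrite lt0r_neq0.
  have : 10^-1 * h * (N / q) <= 10^-1 * h * 100^-1 by rewrite ler_pM2l // mulr_gt0 // invr_gt0.
  by lra.
have a2 : L * ry <= L * (1000^-1 * h + 2 * Z) + L * (Z ^+ 2 / (2 * q)).
  by rewrite -mulrDr ler_pM2l //; lra.
have a3 : L * (Z ^+ 2 / (2 * q)) <= 1000^-1 * h * Z ^+ 2.
  have -> : L * (Z ^+ 2 / (2 * q)) = L / (2 * q) * Z ^+ 2 by ring.
  by rewrite ler_pM2r // exprn_gt0.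
have a4 : L * (1000^-1 * h + 2 * Z) <= 5^-1 * (N * h) * (3 * Z) by apply: ler_pM; lra.
have a5 : N * h * Z <= h * Z ^+ 2.
  have -> : h * Z ^+ 2 = h * Z * Z by ring.
  have -> : N * h * Z = h * Z * N by ring.
  by rewrite ler_pM2l // mulr_gt0.
have a6 : 0 < h * Z ^+ 2 by rewrite mulr_gt0 // exprn_gt0.
have a7 : bh * (L * ry) <= bh * (h * Z ^+ 2) by rewrite ler_pM2l //; lra.
rewrite mE -mulrA; have : 0 < bh * (h * Z ^+ 2) by rewrite mulr_gt0.
by lra.
Qed.

(** Origin of the factor 20 in the height: [N ^+ 2 - g ^+ 2] is nearly [2 N h = 40 s^2], and level
    1/16 asks for [32 s^2] besides the corrections [pz] and [Z]. *)
Lemma cap_reflection (N h g s om q nz pz Z D : R) : 0 < N -> 0 < om -> om <= 100^-1 -> h = 20 * om ^+ 2 * N ->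
  s = om * N -> g = N - h -> 0 <= D -> D <= s ^+ 2 ->
  nz = N ^+ 2 - (g ^+ 2 + pz + Z) -> pz <= 10^-1 * D -> Z <= 2 * s ^+ 2 -> 2 * D <= 16^-1 * nz.
Proof.
move=> N0 om0 om1 hE sE gE D0 Ds -> pzu Zu.
have o2 : om ^+ 2 <= 400^-1 by rewrite expr2; have : om * om <= 100^-1 * om by [rewrite ler_pM2r]; lra.
have e1 : N ^+ 2 - g ^+ 2 = (40 - 400 * om ^+ 2) * s ^+ 2 by rewrite gE hE sE; ring.
have : 39 * s ^+ 2 <= (40 - 400 * om ^+ 2) * s ^+ 2.
  by rewrite ler_wpM2r ?sqr_ge0 //; lra.
by lra.
Qed.

End CapNumerics.

(** * A subharmonic barrier for the trace inequality *)

Section TraceBarrier.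
Context {R : realType} {n : nat}.
Implicit Types (x y z v p c : 'rV[R]_n).
Local Notation sqd z y := (edot (y - z) (y - z)).
Context {Gam : set 'rV[R]_n} {f : 'rV[R]_n -> R} {E Om : set 'rV[R]_n}.
Context {w : 'rV[R]_n -> R} {G : 'rV[R]_n -> 'rV[R]_n} {H : 'rV[R]_n -> 'M[R]_n}.
Hypotheses (n3 : (3 <= n)%N) (hGam : admissible_cone Gam).
Hypothesis sol : solution_on Gam f E Om w G H.

Lemma tr_outer p q : \tr (p^T *m q) = edot p q.
Proof. by apply: eq_bigr => i _; rewrite !mxE big_ord1 mxE. Qed.

Lemma tr_neg (M : 'M[R]_n) : \tr (- M) = - \tr M. Proof. by rewrite raddfN. Qed.

Lemma tr_qform_le0 (M : 'M[R]_n) : (forall v, 0 <= qform M v) -> 0 <= \tr M.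
Proof. by move=> h; rewrite trace_qform sumr_ge0. Qed.

(* P^(-2) is a strict supersolution for the trace when P is strictly subharmonic. *)
Lemma no_max_of_product y (P : 'rV[R]_n -> R) p (M : 'M[R]_n) (d : R) : Om y -> jet2 P y p M ->
  0 < P y -> 0 < \tr M -> 0 < d ->
  ~ (forall v, enorm v < d -> w (y + v) * P (y + v) ^+ 2 <= w y * P y ^+ 2).
Proof.
move=> Oy jP P0 M0 d0 hmax; have Ey := so_sub sol Oy; have wy := so_pos sol Ey.
have j := jet2N (jet2M (so_jet sol Oy) (jet2_comp jP (taylor2_sqr (P y)))).
have [|gE hq] := jet2_min j d0; first by move=> v /hmax h; rewrite lerN2.
have := tr_qform_le0 hq; rewrite tr_neg mxtraceD mxtraceD mxtraceZ mxtraceZ mxtraceD mxtraceZ mxtraceZ mxtraceD !tr_outer.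
move/eqP: gE; rewrite oppr_eq0 => /eqP gE.
have e1 : P y * edot (G y) p = - (2 * w y * edot p p).
  have := congr1 (fun v => edot v p) gE; rewrite !edotE edot0l /= => h.
  apply: (@mulfI _ (P y)); first exact: lt0r_neq0.
  by move: h; lra.
have e2 : P y ^+ 2 * edot (G y) (G y) = 4 * w y ^+ 2 * edot p p.
  have := congr1 (fun v => edot v (G y)) gE; rewrite !edotE edot0l /= (edotC p) => h.
  have h2 : w y * (2 * (P y * edot (G y) p)) + P y ^+ 2 * edot (G y) (G y) = 0.
    by move: h; rewrite mulrA; lra.
  by move: h2; rewrite e1; lra.
rewrite !(edotZl, edotZr) (edotC p (G y)) => h1.
have trA : 0 < \tr (confA (w y) (G y) (H y)).
  rewrite -evs_trace; last exact: (A_sym sol).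
  by have := cone_sub hGam (so_cone sol Ey).
move: trA; rewrite /confA raddfB /= mxtraceZ mxtrace_scalar -(mulr_natr (2^-1 * edot (G y) (G y))).
(* In terms of [u] the function P^(-2) is P^(n-2), and in dimension at least three this power of a
   positive subharmonic function is subharmonic; in numbers, [6 <= 2 n]. *)
have nn : 3 <= n%:R :> R by rewrite ler_nat.
have pp := edot_ge0 p; have P2 : 0 < P y ^+ 2 by rewrite exprn_gt0.
apply/negP; rewrite -leNgt -(pmulr_rle0 _ P2).
have -> : P y ^+ 2 * (w y * \tr (H y) - 2^-1 * edot (G y) (G y) * n%:R) =
  w y * (P y ^+ 2 * \tr (H y)) - 2^-1 * (P y ^+ 2 * edot (G y) (G y)) * n%:R by ring.
rewrite e2.
have h3 : P y ^+ 2 * \tr (H y) <= 6 * w y * edot p p.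
  have b1 : 0 < w y * (P y * \tr M) by rewrite !mulr_gt0.
  have e3 : P y * edot (G y) p * 2 = - (4 * w y * edot p p) by rewrite e1; ring.
  by lra.
have h4 := ler_wpM2l (ltW wy) h3.
have h5 : 0 <= w y ^+ 2 * edot p p * (n%:R - 3).
  by apply: mulr_ge0; [apply: mulr_ge0 => //; exact: sqr_ge0|rewrite subr_ge0].
by lra.
Qed.

End TraceBarrier.

Section Foot.
Context {R : realType} {n : nat}.
Implicit Types (x y z v p c : 'rV[R]_n).
Local Notation sqd z y := (edot (y - z) (y - z)).
Variables (c x0 nu : 'rV[R]_n) (r : R).
Hypotheses (r0 : r != 0) (foot : x0 - c = r *: nu) (nn : edot nu nu = 1).

Lemma depth_foot y : depth c r y = - edot (y - x0) nu - sqd x0 y / (2 * r).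
Proof.
have -> : depth c r y = (r ^+ 2 - edot (y - x0 + r *: nu) (y - x0 + r *: nu)) / (2 * r).
  by rewrite /depth -foot addrA subrK.
move: (y - x0) => u; rewrite edot_sqrD !edotE nn; move: (edot u u) (edot u nu) => a b.
by field.
Qed.

(** Expressed by depth and distance to the foot, the distance to a center beyond the sphere shows
    how the ball about it is cut down to a cap where the depth is nonnegative. *)
Lemma sqd_cap (g : R) y : sqd (x0 + g *: nu) y = g ^+ 2 + 2 * g * depth c r y + (1 + g / r) * sqd x0 y.
Proof.
rewrite depth_foot; have -> : y - (x0 + g *: nu) = (y - x0) - g *: nu by rewrite opprD addrA.
move: (y - x0) => u; rewrite edot_sqrD !edotE nn; move: (edot u u) (edot u nu) => a b.
by field.
Qed.

End Foot.

(** * Contradiction in a cap at a single sphere *)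

Section Cap.
Context {R : realType} {n : nat}.
Implicit Types (x y z v p : 'rV[R]_n).
Context {Gam : set 'rV[R]_n} {f : 'rV[R]_n -> R} {E Om : set 'rV[R]_n}.
Context {w : 'rV[R]_n -> R} {G : 'rV[R]_n -> 'rV[R]_n} {H : 'rV[R]_n -> 'M[R]_n}.
Hypotheses (n3 : (3 <= n)%N) (hGam : admissible_cone Gam) (hf : admissible_function Gam f).
Hypothesis sol : solution_on Gam f E Om w G H.
Context {J : Type} {cen : J -> 'rV[R]_n} {rad : J -> R} {jo : J} {ch : J -> R} {bh : R}.
Hypothesis st : sphere_setting cen rad jo ch bh E Om w G.
Local Notation rho j := (depth (cen j) (rad j)).
Local Notation sqd z y := (edot (y - z) (y - z)).
Variable s0 : R.
Hypotheses (s00 : 0 < s0) (hs0 : forall s, 0 < s -> s <= s0 -> f (const_mx s) < 1).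
Variables (s : J) (x0 x1 nu : 'rV[R]_n) (N om D t1 : R).
Local Notation c := (cen s).
Local Notation r := (rad s).
Local Notation q := `|rad s|.
Local Notation m := (240 * bh * om ^+ 2 * N).
Local Notation h := (20 * om ^+ 2 * N).
Local Notation sc := (om * N).
Local Notation g := (N - 20 * om ^+ 2 * N).
Local Notation a := (x0 + (N - 20 * om ^+ 2 * N) *: nu).
(* Scales: [x0] is the foot of [x1] on the sphere [s], and [a] lies beyond that sphere, so that only a
   cap of height [h] of the ball of center [a] and radius [N] is in the domain.  The height is large
   compared with [m] but small compared with the square of the length [sc] divided by [N], and the
   depth of [x1] is small compared with [sc]. *)
Hypotheses (N0 : 0 < N) (om0 : 0 < om) (omn : om * n%:R <= 100^-1).
Hypotheses (Nq : N <= om ^+ 2 / 100 * q) (ND : 4 * N <= D).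
Hypotheses (foot : x0 - c = r *: nu) (nn : edot nu nu = 1) (x1E : x1 = x0 - t1 *: nu).
Hypotheses (t10 : 0 <= t1) (t1r : t1 <= 2 * rho s x1) (r1s : rho s x1 <= sc / (200 * n%:R)).
Hypotheses (Ex1 : E x1) (wx1 : w x1 = 2 * m).
Hypothesis ballE : forall y, enorm (y - x1) < D -> 0 <= rho s y -> E y /\ m <= w y.
Hypothesis ballO : forall y, enorm (y - x1) < D -> 0 < rho s y -> Om y.
Hypothesis ballF : forall b y, b <> s -> enorm (y - x1) < D -> 0 < rho b y.
Hypothesis homs : (100 * 100 * (200 * (n%:R * bh * om))) ^+ 2 < s0.

Let n0 : (0 < n)%N. Proof. by apply: leq_trans n3. Qed.
Let bh0 : 0 < bh := ss_bh st.
Let r0 : r != 0 := ss_rad st s.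
Let q0 : 0 < q. Proof. by rewrite normr_gt0. Qed.
Let nR : 3 <= n%:R :> R. Proof. by rewrite ler_nat. Qed.
Let om1 : om <= 100^-1.
Proof. by apply: le_trans omn; rewrite -[leLHS]mulr1 ler_pM2l //; apply: le_trans nR; rewrite ler1n. Qed.
Let om2 : om ^+ 2 <= 100^-1 * om. Proof. by rewrite expr2 ler_pM2r. Qed.
Let m0 : 0 < m. Proof. by rewrite !mulr_gt0 ?ltr0n ?exprn_gt0. Qed.
Let h0 : 0 < h. Proof. by rewrite !mulr_gt0 ?exprn_gt0. Qed.
Let hN : h <= 100^-1 * N. Proof. by rewrite ler_pM2r //; move: om2 om1; lra. Qed.
Let Nq1 : N <= 100^-1 * q.
Proof. by apply: le_trans Nq _; rewrite ler_pM2r //; move: om2 om1; lra. Qed.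
Let mE : m = 12 * bh * h. Proof. by ring. Qed.
Let g0 : 0 < g. Proof. by move: hN N0; lra. Qed.
Let gN : g <= N. Proof. by move: h0; lra. Qed.
Let ri1 : r^-1 <= q^-1. Proof. by rewrite -normfV ler_norm. Qed.
Let ri2 : - q^-1 <= r^-1. Proof. by rewrite -normfV lerNl -normrN ler_norm. Qed.
Let sc0 : 0 < sc. Proof. by rewrite mulr_gt0. Qed.
Let scN : sc <= 100^-1 * N. Proof. by rewrite ler_pM2r. Qed.
Let gr : - 100^-1 <= g / r <= 100^-1.
Proof.
have h1 : g / q <= 100^-1 by rewrite ler_pdivrMr //; apply: le_trans gN Nq1.
apply/andP; split; last by apply: le_trans h1; rewrite ler_pM2l.
by apply: (@le_trans _ _ (- (g / q))); [rewrite lerN2|rewrite -mulrN ler_pM2l].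
Qed.
Let n00 : 0 < n%:R :> R. Proof. by rewrite ltr0n. Qed.
Let t1sc : t1 <= 100^-1 * sc.
Proof.
apply: le_trans t1r _; have e1 : sc / (200 * n%:R) = 200^-1 * (sc / n%:R) by rewrite invfM mulrCA.
have h1 : sc / n%:R <= sc.
  by rewrite ler_pdivrMr // -[leLHS]mulr1 ler_pM2l //; move: nR; lra.
by move: r1s; rewrite e1; lra.
Qed.
Let nu1 : enorm nu = 1.
Proof. by apply/eqP; rewrite -(@eqrXn2 _ 2) ?enorm_ge0 // sqr_enorm nn expr1n. Qed.
Let caps y := sqd_cap r0 foot nn g y.
Let capd y := depth_foot r0 foot nn y.

Lemma cap_near y : enorm (y - a) < 2 * N -> enorm (y - x1) < D.
Proof.
move=> hy; have -> : y - x1 = (y - a) + (g + t1) *: nu.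
  by rewrite x1E; apply/rowP => i; rewrite !mxE; ring.
have gt : 0 < g + t1 by move: g0 t10; lra.
apply: le_lt_trans (enormD _ _) _; rewrite enormZ nu1 mulr1 (gtr0_norm gt).
by move: ND t1sc scN gN hy N0; lra.
Qed.

(** A center may lie beyond [s], but its depth is at least [- L / (2 r)]; this keeps
    [N ^+ 2 - sqd a z] of the order of the cap. *)
Lemma cap_nz z (L : R) : 0 < L -> L <= 16^-1 * (N ^+ 2 - sqd a z) -> 0 <= 2 * rho s z + L / r ->
  N ^+ 2 - sqd a z <= 21 / 10 * (N * h).
Proof.
move=> L0 Lk pz; have nz0 : 0 < N ^+ 2 - sqd a z by lra.
apply: (@cap_level_upper R N h _ (- (2 * g * rho s z)) q) => //.
  rewrite caps; have : 0 <= (1 + g / r) * sqd x0 z.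
    by rewrite mulr_ge0 ?edot_ge0 //; case/andP: gr; lra.
  by have := sqr_ge0 h; lra.
have h1 : - (2 * g * rho s z) <= g * (L / r).
  have : 0 <= g * (2 * rho s z + L / r) by rewrite mulr_ge0 // ltW.
  by lra.
apply: le_trans h1 _; apply: (@le_trans _ _ (g * (L / q))).
  by rewrite ler_pM2l // ler_pM2l.
have -> : 16^-1 * (N ^+ 2 - sqd a z) * (N / q) = N * (16^-1 * (N ^+ 2 - sqd a z) / q) by ring.
apply: ler_pM => //; [exact: ltW|by rewrite divr_ge0 // ltW|].
by rewrite ler_pM2r // invr_gt0.
Qed.

Lemma cap_ny y : 0 <= rho s y -> N ^+ 2 - sqd a y <= 2 * N * h.
Proof.
move=> ry; rewrite caps; have : 0 <= (1 + g / r) * sqd x0 y.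
  by rewrite mulr_ge0 ?edot_ge0 //; case/andP: gr; lra.
have : 0 <= 2 * g * rho s y by apply: mulr_ge0 => //; apply: mulr_ge0 => //; exact: ltW g0.
by have := sqr_ge0 h; lra.
Qed.

Lemma cap_other b y : b <> s -> rho b y = 0 -> 2 * N <= enorm (y - a).
Proof.
move=> bs ry; rewrite leNgt; apply/negP => /cap_near hy; have := ballF bs hy.
by rewrite ry ltxx.
Qed.

Lemma cap_center_dist : enorm (a - c) <= q + N.
Proof.
have -> : a - c = (r + g) *: nu by rewrite addrAC foot -scalerDl.
rewrite enormZ nu1 mulr1; apply: le_trans (ler_normD _ _) _.
by rewrite lerD2l gtr0_norm.
Qed.

(** [moving_spheres] at the full level 1/16. Contacts on [s], contacts on the other spheres and the
    orthogonal case are settled by [cap_own_sphere], [cap_other_sphere] and [cap_far_sphere]. *)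
Lemma cap_good z (L : R) : 0 < L -> L <= 16^-1 * (N ^+ 2 - sqd a z) -> 0 <= 2 * rho s z + L / r ->
  is_good (E := E) (w := w) z L.
Proof.
have k10 : 0 < (16^-1 : R) by rewrite invr_gt0.
have Nr : N <= q by move: Nq1 q0; lra.
have near z' : 0 < N ^+ 2 - sqd a z' -> enorm (z' - a) < N by rewrite subr_gt0 -enorm_ltE.
apply: (moving_spheres n0 hGam hf sol st N0 m0 k10 (lexx _) Nr) => [y hy|y hy|k z' b y k0 kk nz pz Ey rb Ly|z' L' b y L0 Lk pz bs Ey rb Ly].
- by apply: ballE; exact: cap_near.
- by apply: ballO; exact: cap_near.
- have L0 : 0 < k * (N ^+ 2 - sqd a z') by rewrite mulr_gt0.
  have nzu : N ^+ 2 - sqd a z' <= 21 / 10 * (N * h) by apply: (cap_nz L0 _ pz); rewrite ler_pM2r.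
  have D0 := lt_le_trans L0 Ly.
  have t01 : 0 <= k * (N ^+ 2 - sqd a z') / sqd z' y <= 1.
    by rewrite divr_ge0 ?(ltW L0) ?(ltW D0) //= ler_pdivrMr // mul1r.
  have [bs|bs] := pselect (b = s); last first.
    have hJ := @far_sphere_level R n n0 (cen b) (rad b) a z' N k (ss_rad st b) N0
      ltac:(by rewrite (ltW k0)) (fun y hy => ballF bs (cap_near hy)) (near z' nz).
    apply: (cap_other_sphere (N := N) (h := h)) => //; first by case/andP: t01.
    have := cap_other bs rb; rewrite leNgt enorm_ltE ?mulr_gt0 // -leNgt.
    by have := sqr_ge0 N; lra.
  rewrite bs in rb *.
  apply: (@cap_own_sphere R bh k N h g q _ _ _ _ m) => //; first by apply: cap_ny; rewrite rb.
  have -> : rho s a = - g - g ^+ 2 / (2 * r).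
    by rewrite capd addrAC subrr add0r !edotE nn mulr1; field.
  have p1 : - (k * (N ^+ 2 - sqd a z') / q) <= 2 * rho s z'.
    have : k * (N ^+ 2 - sqd a z') / r <= k * (N ^+ 2 - sqd a z') / q by rewrite ler_pM2l.
    by move: pz; lra.
  have p2 := ler_wpM2l (_ : 0 <= 1 + k) p1; have {}p2 := p2 ltac:(by rewrite addr_ge0 // ltW).
  have p3 : k * N ^+ 2 / r <= k * N ^+ 2 / q by rewrite ler_pM2l // mulr_gt0 // exprn_gt0.
  have p4 : - (k * g ^+ 2 / q) <= k * g ^+ 2 / r.
    by rewrite -mulrN ler_pM2l // mulr_gt0 // exprn_gt0.
  have -> : 2 * (1 + k) * rho s z' - 2 * k * (- g - g ^+ 2 / (2 * r)) - k * N ^+ 2 / r =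
    (1 + k) * (2 * rho s z') + 2 * k * g + k * g ^+ 2 / r - k * N ^+ 2 / r by field.
  have -> : k * (2 * g - (1 + k) * (N ^+ 2 - sqd a z') / q - (N ^+ 2 + g ^+ 2) / q) =
    (1 + k) * - (k * (N ^+ 2 - sqd a z') / q) + 2 * k * g - k * g ^+ 2 / q - k * N ^+ 2 / q by ring.
  by move: p2 p3 p4; lra.
have pz0 : 0 <= 2 * rho s z' + L' / r by rewrite pz.
have nzu := cap_nz L0 Lk pz0.
have nz : 0 < N ^+ 2 - sqd a z' by move: L0 Lk; lra.
have za := near z' nz; have ya := cap_other bs rb.
have NZ : N <= enorm (y - z') by have := enorm_dist z' y a; move: za ya; lra.
have zc : enorm (z' - c) <= 2 * q.
  have := enorm_dist a z' c; have := cap_center_dist; move: za Nq1 q0; lra.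
have hN1 : h <= N by move: hN N0; lra.
rewrite -sqr_enorm; apply: (@cap_far_sphere R bh N h q (N ^+ 2 - sqd a z') L' _ (enorm (y - z')) m bh0 N0 h0 hN1 q0 Nq1 L0 Lk nzu NZ _ mE).
have -> : rho s y = rho s (z' + 1 *: (y - z')) by rewrite scale1r addrC subrK.
rewrite depth_line // mul1r expr1n mul1r.
have e1 : rho s z' = - (L' / (2 * r)).
  apply: (@mulfI _ 2) => //; move: pz => /eqP; rewrite addr_eq0 => /eqP ->; field; exact: r0.
have e2 : - (L' / (2 * r)) <= L' / (2 * q).
  rewrite -mulrN; apply: ler_wpM2l; first exact: ltW.
  by rewrite !invfM -mulrN ler_pM2l ?invr_gt0 // lerNl.
have e3 : - (edot (z' - c) (y - z') / r) <= 2 * enorm (y - z').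
  apply: le_trans (ler_norm _) _; rewrite normrN normrM normfV ler_pdivrMr //.
  apply: le_trans (edot_le _ _) _; rewrite mulrC mulrAC -[leRHS]mulrA mulrC.
  by rewrite [leRHS]mulrA mulrC [leRHS]mulrC ler_wpM2l ?enorm_ge0 // mulrC.
have e4 : - (edot (y - z') (y - z') / (2 * r)) <= enorm (y - z') ^+ 2 / (2 * q).
  rewrite sqr_enorm -mulrN; apply: ler_wpM2l; first exact: edot_ge0.
  by rewrite !invfM -mulrN ler_pM2l ?invr_gt0 // lerNl.
by rewrite e1; lra.
Qed.

(** With factor 1/2, a source twice as deep as its target gives a sphere orthogonal to [s], the
    borderline of feasibility by [pair_pw]. *)
Lemma cap_reflect y : E y -> rho s y = 2 * rho s x1 -> enorm (y - x1) <= sc -> w y <= 4 * m.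
Proof.
move=> Ey ry ys; have [->|yx] := eqVneq y x1; first by rewrite wx1; move: m0; lra.
have yx0 : y - x1 != 0 by rewrite subr_eq0.
have half : 0 < (2^-1 : R) < 1 by rewrite invr_gt0 ltr0n invf_lt1 ?ltr1n.
have h12 : (2^-1 : R) != 1 by rewrite lt_eqF //; case/andP: half.
have zE : pcen 2^-1 x1 y - x1 = x1 - y by rewrite /pcen; apply/rowP => i; rewrite !mxE; field.
have LE : prad 2^-1 x1 y = 2 * sqd x1 y by rewrite /prad; field.
have pz : 2 * rho s (pcen 2^-1 x1 y) + prad 2^-1 x1 y / r = 0.
  have := pair_pw st s h12 yx0; rewrite ry.
  have -> : rho s x1 - 2^-1 * (2 * rho s x1) = 0 by field.
  move/eqP; rewrite mulf_eq0 subr_eq0 eq_sym (negbTE h12) /= mulf_eq0 invr_eq0 (pnatr_eq0 _ 2) orbF.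
  by move/eqP.
have D0 := edot_gt0 yx0.
have Ds : sqd x1 y <= sc ^+ 2 by rewrite -enorm_leE // ltW.
have gd : is_good (E := E) (w := w) (pcen 2^-1 x1 y) (prad 2^-1 x1 y).
  apply: cap_good; [by rewrite LE mulr_gt0| |by rewrite pz].
  rewrite LE; set z := pcen 2^-1 x1 y in zE pz *.
  apply: (@cap_reflection R N h g sc om q _ (2 * g * rho s z) ((1 + g / r) * sqd x0 z) (sqd x1 y)) => //.
  - exact: ltW.
  - by rewrite caps.
  - have -> : 2 * g * rho s z = - (g / r) * (2 * sqd x1 y).
      have : rho s z = - (prad 2^-1 x1 y / r / 2).
        by apply: (@mulfI _ 2) => //; move: pz => /eqP; rewrite addr_eq0 => /eqP ->; field; exact: r0.
      by rewrite LE => ->; field; exact: r0.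
    have [q1 q2] := andP gr.
    have u : - (g / r) <= 100^-1 by lra.
    have : - (g / r) * (2 * sqd x1 y) <= 100^-1 * (2 * sqd x1 y) by rewrite ler_pM2r ?mulr_gt0.
    by lra.
  have zx : enorm (z - x0) <= sc + 100^-1 * sc.
    have -> : z - x0 = (x1 - y) - t1 *: nu by rewrite -zE x1E; apply/rowP => i; rewrite !mxE; ring.
    apply: le_trans (enormB _ _) _; rewrite enormZ nu1 mulr1 ger0_norm // enormBC.
    by move: t1sc ys; lra.
  have zp : 0 <= sc + 100^-1 * sc by move: sc0; lra.
  have zx2 : sqd x0 z <= (sc + 100^-1 * sc) ^+ 2 by rewrite -(enorm_leE _ zp).
  have [q1 q2] := andP gr.
  have q3 : 1 + g / r <= 101 / 100 by lra.
  have zz0 := edot_ge0 (z - x0).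
  have : (1 + g / r) * sqd x0 z <= 101 / 100 * sqd x0 z by rewrite ler_wpM2r.
  have := sqr_ge0 sc; lra.
have := pair_good half yx0 Ey gd; rewrite wx1; lra.
Qed.

(** [T] measures the depth beyond the surface of [cap_reflect] in units of [sc]. In [P] the
    quadratic term in the distance localizes, [2 n T^2] makes the Laplacian positive since the
    gradient of [T] has length close to [1 / sc], and [- 10 n T] makes the sum of the two terms with
    [T] nonpositive, so that [P > 0] only within distance [sc] of [x1]. *)
Local Notation T y := ((rho s y - 2 * rho s x1) / sc).
Local Notation P y := (1 - sc ^- 2 * sqd x1 y + 2 * n%:R * T y ^+ 2 - 10 * n%:R * T y).

Let scq : sc <= 100^-1 * (100^-1 * q).
Proof. by apply: le_trans scN _; rewrite ler_pM2l. Qed.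

Let nsc : n%:R * sc <= 100^-1 * (100^-1 * q).
Proof.
have -> : n%:R * sc = om * n%:R * N by ring.
apply: ler_pM => //; [|exact: ltW].
by apply: mulr_ge0 => //; exact: ltW.
Qed.

Let rho10 : 0 <= rho s x1. Proof. exact: ss_ge0 st _ _ Ex1. Qed.

Let rho1sc : rho s x1 <= 100^-1 * sc.
Proof.
have e1 : sc / (200 * n%:R) = 200^-1 * (sc / n%:R) by rewrite invfM mulrCA.
have h1 : sc / n%:R <= sc.
  by rewrite ler_pdivrMr // -[leLHS]mulr1 ler_pM2l //; move: nR; lra.
by move: r1s; rewrite e1; move: sc0; lra.
Qed.

Lemma cap_depth_le y : enorm (y - x1) <= 2 * sc -> rho s y <= rho s x1 + 11 / 10 * enorm (y - x1).
Proof.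
move=> hy; have -> : rho s y = rho s (x1 + 1 *: (y - x1)) by rewrite scale1r addrC subrK.
rewrite depth_line // mul1r expr1n mul1r; set e := enorm (y - x1).
have e0 : 0 <= e := enorm_ge0 _.
have xc : enorm (x1 - c) <= 101 / 100 * q.
  have -> : x1 - c = (r - t1) *: nu by rewrite x1E addrAC foot -scalerBl.
  rewrite enormZ nu1 mulr1; apply: le_trans (ler_normB _ _) _; rewrite (ger0_norm t10).
  by move: t1sc scq q0; lra.
have e3 : - (edot (x1 - c) (y - x1) / r) <= 101 / 100 * e.
  apply: le_trans (ler_norm _) _; rewrite normrN normrM normfV ler_pdivrMr //.
  apply: le_trans (edot_le _ _) _.
  have -> : 101 / 100 * e * q = 101 / 100 * q * e by ring.
  by rewrite ler_wpM2r.
have e4 : - (edot (y - x1) (y - x1) / (2 * r)) <= 100^-1 * e.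
  apply: (@le_trans _ _ (e ^+ 2 / (2 * q))).
    rewrite sqr_enorm -mulrN; apply: ler_wpM2l; first exact: edot_ge0.
    by rewrite !invfM -mulrN ler_pM2l ?invr_gt0 // lerNl.
  rewrite expr2 -mulrA mulrC; apply: ler_wpM2r => //.
  by rewrite ler_pdivrMr ?mulr_gt0 //; move: hy scq q0; rewrite -/e; lra.
by move: e3 e4 e0; lra.
Qed.

Lemma cap_T y : enorm (y - x1) <= 2 * sc -> 2 * rho s x1 <= rho s y -> 0 <= T y <= 22 / 10.
Proof.
move=> hy ry; rewrite divr_ge0 ?(ltW sc0) ?subr_ge0 //= ler_pdivrMr //.
by have := cap_depth_le hy; move: hy rho10; lra.
Qed.

Lemma cap_P_cont E' y : cont_at E' (fun y => P y) y.
Proof.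
have cr : cont_at E' (fun y => T y) y.
  rewrite /depth; apply: cont_atM; last exact: cont_at_cst.
  apply: cont_atB; last exact: cont_at_cst.
  apply: cont_atM; last exact: cont_at_cst.
  by apply: cont_atB; [exact: cont_at_cst|exact: cont_at_dist].
apply: cont_atB; last exact: cont_atZ.
apply: cont_atD; last by apply: cont_atZ; exact: cont_atM.
by apply: cont_atB; [exact: cont_at_cst|apply: cont_atZ; exact: cont_at_dist].
Qed.

Lemma cap_P_jet y : enorm (y - x1) <= 2 * sc -> 2 * rho s x1 <= rho s y ->
  exists p M, jet2 (fun y => P y) y p M /\ 0 < \tr M.
Proof.
move=> hy ry; have := cap_T hy ry => /andP[T0 T1].
have jc (b : R) x : jet2 (fun=> b) x 0 0.
  by apply: jet2_exact => v; rewrite edot0l /qform mulmx0 edot0l mulr0 !addr0.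
have jr := jet2Z (- (2 * r * sc)^-1) (jet2_sqd c y).
have TE z : T z = (r / 2 - 2 * rho s x1) / sc + - (2 * r * sc)^-1 * sqd c z.
  rewrite {1}/depth; field; rewrite r0 lt0r_neq0 //= lt0r_neq0 //.
have jT := jet2_eq TE (erefl _) (erefl _) (jet2D (jc ((r / 2 - 2 * rho s x1) / sc) y) jr).
have jT2 := jet2_comp jT (taylor2_sqr (T y)).
have jP := jet2B (jet2D (jet2B (jc 1 y) (jet2Z (sc ^- 2) (jet2_sqd x1 y))) (jet2Z (2 * n%:R) jT2)) (jet2Z (10 * n%:R) jT).
eexists; eexists; split; first exact: jP.
rewrite !add0r; rewrite !mxtraceD !tr_neg !mxtraceZ !mxtraceD !mxtraceZ !tr_outer !mxtrace_scalar.
rewrite !edotZl !edotZr.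
have -> : edot (y - c) (y - c) = r ^+ 2 - 2 * r * rho s y by rewrite /depth; field.
set t := T y in T0 T1 *.
have -> : (2 : R) *+ n = 2 * n%:R by rewrite mulr_natr.
(* Up to the factor in front, the Laplacian is [- 1 + 2] plus small corrections due to the curvature
   of [s]. *)
set X := (X in 0 < X); have -> : X = 2 * n%:R / sc ^+ 2 *
   (- 1 + 2 * (1 - 2 * (rho s y / r)) + (5 - 2 * t) * (n%:R * sc / r)).
  by rewrite /X; field; rewrite r0 lt0r_neq0 //= lt0r_neq0.
apply: mulr_gt0; first by rewrite divr_gt0 ?mulr_gt0 ?exprn_gt0.
have ry0 : 0 <= rho s y by move: rho10 ry; lra.
have h1 : rho s y / r <= 100^-1.
  apply: (@le_trans _ _ (rho s y / q)); first by rewrite ler_wpM2l.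
  rewrite ler_pdivrMr //; have := cap_depth_le hy; move: hy rho1sc scq sc0; lra.
have h2 : - 100^-1 <= n%:R * sc / r.
  apply: (@le_trans _ _ (- (n%:R * sc / q))).
    by rewrite lerN2 ler_pdivrMr //; move: nsc q0; lra.
  by rewrite -mulrN ler_pM2l // mulr_gt0.
have h3 : - (5 * 100^-1) <= (5 - 2 * t) * (n%:R * sc / r).
  apply: (@le_trans _ _ ((5 - 2 * t) * - 100^-1)); first by move: T0 T1; lra.
  by apply: ler_wpM2l h2; move: T0 T1; lra.
by lra.
Qed.

(** Maximum principle for [w * P ^+ 2] on the part of a ball deeper than the surface of
    [cap_reflect]: [no_max_of_product] excludes an interior maximum with [P > 0], [cap_reflect]
    bounds [w] on the surface, where [P <= 1], and on the rest of the boundary [P] is negative. *)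
Lemma cap_barrier y : enorm (y - x1) <= 2 * sc -> 2 * rho s x1 <= rho s y -> 0 <= P y ->
  w y * P y ^+ 2 <= 4 * m.
Proof.
move=> hy ry Py.
have scD : 2 * sc < D by move: scN ND N0; lra.
pose X := [set y | enorm (y - x1) <= 2 * sc] `&` [set y | 2 * rho s x1 <= rho s y].
have XE z : X z -> E z.
  case=> hz rz; have [] // := @ballE z; first exact: le_lt_trans hz scD.
  by apply: le_trans rz; rewrite mulr_ge0.
(* With [P z * |P z|] in place of the square, points where [P] is negative do not compete for the
   maximum. *)
pose g z := - (w z * (P z * `|P z|)).
have [|||y0 [hy0 ry0] ymax] := @compact_min R n X g; first by exists y.
- apply: compact_closedI; first by apply: compact_cball; rewrite mulr_ge0 // ltW.
  apply: closed_superlevel => x; apply: cont_atM; last exact: cont_at_cst.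
  by apply: cont_atB; [exact: cont_at_cst|exact: cont_at_dist].
- move=> z /XE Ez; apply: cont_atN; apply: cont_atM.
    by apply: cont_at_sub (w_cont sol Ez) => z'; exact: XE.
  by apply: cont_atM; [|apply: cont_at_norm]; exact: cap_P_cont.
have le1 : w y * P y ^+ 2 <= w y0 * (P y0 * `|P y0|).
  have := ymax y (conj hy ry); rewrite lerN2 (ger0_norm Py) expr2.
  exact.
apply: le_trans le1 _; have Ey0 := XE y0 (conj hy0 ry0); have wy0 := so_pos sol Ey0.
have m40 : 0 <= 4 * m := mulr_ge0 (ler0n _ 4) (ltW m0).
have [P0|P0] := leP (P y0) 0.
  apply: le_trans m40; rewrite pmulr_rle0 //; exact: mulr_le0_ge0 P0 (normr_ge0 _).
have [T0 T1] := andP (cap_T hy0 ry0).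
have TT : n%:R * (T y0 * (2 * T y0 - 10)) <= 0.
  rewrite pmulr_rle0 //; apply: mulr_ge0_le0 => //; move: T1; lra.
have sc20 : 0 < sc ^+ 2 by rewrite exprn_gt0.
have P1 : P y0 <= 1 - sc ^- 2 * sqd x1 y0 by lra.
have s2 : sqd x1 y0 < sc ^+ 2.
  have : sc ^- 2 * sqd x1 y0 < 1 by lra.
  by rewrite mulrC ltr_pdivrMr // mul1r.
have ys : enorm (y0 - x1) < sc by rewrite enorm_ltE.
move: ry0; rewrite /= le_eqVlt => /orP[/eqP e|lt].
  have wl := cap_reflect Ey0 (esym e) (ltW ys).
  rewrite (gtr0_norm P0); have P11 : P y0 <= 1.
    by apply: le_trans P1 _; rewrite gerBl mulr_ge0 ?edot_ge0 // invr_ge0 ltW.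
  have : P y0 * P y0 <= 1 by rewrite -[leRHS]mulr1 ler_pM // ltW.
  by move=> h1; rewrite -[leRHS]mulr1; apply: ler_pM => //; [exact: ltW|rewrite mulr_ge0 // ltW].
exfalso.
have Oy0 : Om y0.
  apply: ballO; first by apply: lt_trans ys _; move: scD sc0; lra.
  by apply: le_lt_trans lt; rewrite mulr_ge0.
have [p [M [jP M0]]] := cap_P_jet hy0 (ltW lt).
have [d1 d10 hd1] := cont_at_pos (@cap_P_cont setT y0) P0.
have [||d2 d20 hd2] := @cont_at_pos _ _ setT (fun y => rho s y - 2 * rho s x1) y0.
- apply: cont_atB; last exact: cont_at_cst.
  apply: cont_atM; last exact: cont_at_cst.
  by apply: cont_atB; [exact: cont_at_cst|exact: cont_at_dist].
- by rewrite subr_gt0.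
pose d := Num.min (Num.min d1 d2) sc; have d0 : 0 < d by rewrite !lt_min d10 d20.
apply: (no_max_of_product n3 hGam sol Oy0 jP P0 M0 d0) => v.
rewrite !lt_min => /andP[/andP[v1 v2] v3].
have v1' : enorm (y0 + v - y0) < d1 by rewrite addrAC subrr add0r.
have v2' : enorm (y0 + v - y0) < d2 by rewrite addrAC subrr add0r.
have PP : 0 < P (y0 + v) by have /andP[h _] := hd1 _ Logic.I v1'; apply: lt_trans h; rewrite divr_gt0.
have rr : 2 * rho s x1 < rho s (y0 + v).
  by have /andP[h _] := hd2 _ Logic.I v2'; move: h lt; lra.
have Xv : X (y0 + v).
  split; last exact: ltW.
  rewrite /= addrAC; apply: le_trans (enormD _ _) _; move: ys v3; lra.
by have := ymax _ Xv; rewrite lerN2 (gtr0_norm P0) (gtr0_norm PP) !expr2.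
Qed.

(** The ball about [x2] lies at depth about [k / 40], beyond the surface of [cap_reflect] but
    shallow compared with [sc / n], so [P >= 1/2] and [w <= 16 m] on it. Its radius [k / 100] is too
    large for [not_small_on_ball], as [om] is small. *)
Lemma cap_contra : False.
Proof.
pose k := sc / n%:R; have k0 : 0 < k by rewrite divr_gt0.
have nk : n%:R * k = sc by rewrite /k mulrC divfK // lt0r_neq0.
have ksc : k <= 3^-1 * sc.
  by rewrite /k ler_pdivrMr // mulrAC -[leLHS]mul1r ler_pM2r //; move: nR; lra.
have r1k : rho s x1 <= 200^-1 * k by apply: le_trans r1s _; rewrite /k invfM mulrCA.
clearbody k.
pose x2 := x0 - (40^-1 * k) *: nu; pose r2 := 100^-1 * k.
have r20 : 0 < r2 by rewrite mulr_gt0 // invr_gt0.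
have inX y : enorm (y - x2) < r2 -> [/\ enorm (y - x1) <= 3^-1 * sc, 140 / (100 * 100) * k <= rho s y & rho s y <= 36 / 1000 * k].
  move=> hy; pose v := y - x2.
  have yx0 : y - x0 = v - (40^-1 * k) *: nu by rewrite /v /x2; apply/rowP => i; rewrite !mxE; ring.
  have n1 : enorm (y - x0) <= 35 / 1000 * k.
    rewrite yx0; apply: le_trans (enormB _ _) _; rewrite enormZ nu1 mulr1 gtr0_norm ?mulr_gt0 ?invr_gt0 //.
    by move: hy; rewrite -/v /r2; lra.
  have n2 : sqd x0 y / (2 * q) <= 10^-1 * (100^-1 * (100^-1 * k)).
    have kk : 35 / 1000 * k <= 100^-1 * q by move: ksc scq sc0; lra.
    rewrite -sqr_enorm ler_pdivrMr ?mulr_gt0 //.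
    have : enorm (y - x0) ^+ 2 <= (35 / 1000 * k) * (35 / 1000 * k).
      by rewrite expr2; apply: (ler_pM _ _ n1 n1); exact: enorm_ge0.
    have : k * k <= k * (3^-1 * (100^-1 * (100^-1 * q))).
      by rewrite ler_pM2l //; move: ksc scq; lra.
    have : 0 < k * q by rewrite mulr_gt0.
    by lra.
  have n3' : `|sqd x0 y / (2 * r)| <= 10^-1 * (100^-1 * (100^-1 * k)).
    rewrite normrM normfV normrM (ger0_norm (edot_ge0 _)) (@ger0_norm _ 2) //.
  have n4 : `|edot v nu| <= 100^-1 * k.
    by apply: le_trans (edot_le _ _) _; rewrite nu1 mulr1 ltW.
  have re : rho s y = 40^-1 * k - edot v nu - sqd x0 y / (2 * r).
    by rewrite capd yx0 !edotE nn; ring.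
  move: n3' n4; rewrite !ler_norml => /andP[a1 a2] /andP[a3 a4].
  split; [|by rewrite re; move: a2 a4 k0; lra|by rewrite re; move: a1 a3 k0; lra].
  have -> : y - x1 = (y - x0) + t1 *: nu by rewrite x1E; apply/rowP => i; rewrite !mxE; ring.
  apply: le_trans (enormD _ _) _; rewrite enormZ nu1 mulr1 ger0_norm //.
  by move: n1 t1sc ksc sc0; lra.
have h1 := @not_small_on_ball R n Gam f E Om w G H hGam hf sol s0 hs0 x2 (16 * m) r2 r20.
have : s0 * r2 ^+ 2 <= 8 * (16 * m) ^+ 2.
  apply: h1 => y hy; have [y1 y2 y3] := inX y hy.
    apply: ballO; last by apply: lt_le_trans y2; rewrite mulr_gt0.
    by apply: le_lt_trans y1 _; move: scN ND N0 sc0; lra.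
  have X1 : enorm (y - x1) <= 2 * sc by move: y1 sc0; lra.
  have X2 : 2 * rho s x1 <= rho s y by move: y2 r1k k0; lra.
  have [T0 T1] := andP (cap_T X1 X2).
  have nT : n%:R * T y <= 36 / 1000.
    rewrite mulrA ler_pdivrMr //.
    have : n%:R * (rho s y - 2 * rho s x1) <= n%:R * (36 / 1000 * k).
      by rewrite ler_pM2l //; move: y3 rho10; lra.
    have -> : n%:R * (36 / 1000 * k) = 36 / 1000 * (n%:R * k) by ring.
    by rewrite nk.
  have Ps : sc ^- 2 * sqd x1 y <= 9^-1.
    rewrite mulrC ler_pdivrMr ?exprn_gt0 // -sqr_enorm.
    have : enorm (y - x1) ^+ 2 <= (3^-1 * sc) ^+ 2 by rewrite !expr2; apply: (ler_pM _ _ y1 y1); exact: enorm_ge0.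
    by lra.
  have TT : 0 <= n%:R * T y ^+ 2 by rewrite mulr_ge0 ?sqr_ge0 // ltW.
  have Ph : 2^-1 <= P y by lra.
  have P0 : 0 <= P y by lra.
  have Ey : E y.
    have [] // := @ballE y; last by apply: le_trans X2; rewrite mulr_ge0.
    by apply: le_lt_trans y1 _; move: scN ND N0 sc0; lra.
  have wy := so_pos sol Ey; have hb := cap_barrier X1 X2 P0.
  have : w y * (2^-1) ^+ 2 <= w y * P y ^+ 2 by rewrite ler_pM2l // !expr2; apply: (ler_pM _ _ Ph Ph).
  by move: hb; lra.
rewrite leNgt => /negP; apply.
have -> : 8 * (16 * m) ^+ 2 = 8 * (16 * 240 * (bh * om * (n%:R * k))) ^+ 2 by rewrite nk; ring.
have : (100 * 100 * (200 * (n%:R * bh * om))) ^+ 2 * r2 ^+ 2 < s0 * r2 ^+ 2 by rewrite ltr_pM2r ?exprn_gt0.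
apply: le_lt_trans; rewrite /r2.
have : 0 <= (n%:R * bh * om * k) ^+ 2 by exact: sqr_ge0.
by lra.
Qed.

End Cap.

(** * Lower bound for w near a sphere *)

Section NearSphere.
Context {R : realType} {n : nat}.
Implicit Types (x y z v p : 'rV[R]_n).
Context {Gam : set 'rV[R]_n} {f : 'rV[R]_n -> R} {E Om : set 'rV[R]_n}.
Context {w : 'rV[R]_n -> R} {G : 'rV[R]_n -> 'rV[R]_n} {H : 'rV[R]_n -> 'M[R]_n}.
Hypotheses (n3 : (3 <= n)%N) (hGam : admissible_cone Gam) (hf : admissible_function Gam f).
Hypothesis sol : solution_on Gam f E Om w G H.
Context {J : Type} {cen : J -> 'rV[R]_n} {rad : J -> R} {jo : J} {ch : J -> R} {bh : R}.
Hypothesis st : sphere_setting cen rad jo ch bh E Om w G.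
Local Notation rho j := (depth (cen j) (rad j)).
Variables (s0 c om : R).
Hypotheses (hs0 : forall s, 0 < s -> s <= s0 -> f (const_mx s) < 1).
Hypothesis cs : c ^+ 2 < s0.
Hypothesis inner_bound : forall x r, 0 < r -> r <= rad jo ->
  (forall y, enorm (y - x) < r -> Om y) -> c * r / 4 <= w x.
Hypotheses (om0 : 0 < om) (omn : om * n%:R <= 100^-1).

Lemma foot_point ce (r : R) y : r != 0 -> 0 <= depth ce r y -> y != ce -> exists nu t,
  [/\ edot nu nu = 1, y - ce = (r - t) *: nu, 0 <= t & t <= 2 * depth ce r y].
Proof.
move=> r0 ry yc; set e := enorm (y - ce); have e0 : 0 < e by rewrite enorm_gt0 subr_eq0.
have q0 : 0 < `|r| by rewrite normr_gt0.
have [S [rE S2]] : exists S : R, r = S * `|r| /\ (S = 1 \/ S = -1).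
  case: (ltgtP r 0) => [h|h|h]; first by exists (-1); rewrite ltr0_norm // mulN1r opprK; split => //; right.
    by exists 1; rewrite gtr0_norm // mul1r; split => //; left.
  by rewrite h eqxx in r0.
have SS : S * S = 1 by case: S2 => ->; rewrite ?mulr1 // mulrNN mulr1.
have rr : 2 * depth ce r y = (S * (`|r| - e)) * (1 + e / `|r|).
  rewrite /depth -sqr_enorm -/e {1 2}rE; move: (`|r|) q0 => q q0.
  by case: S2 => ->; field; rewrite lt0r_neq0.
have K1 : 1 <= 1 + e / `|r| by rewrite lerDl divr_ge0 // ltW.
have t0 : 0 <= S * (`|r| - e).
  have h : 0 <= S * (`|r| - e) * (1 + e / `|r|) by rewrite -rr mulr_ge0.
  by move: h; rewrite pmulr_lge0 // (lt_le_trans _ K1).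
exists ((S / e) *: (y - ce)), (S * (`|r| - e)); split => //.
- rewrite edotZl (edotZr (_ / _)) -sqr_enorm -/e.
  have -> : S / e * (S / e * e ^+ 2) = S * S by field; rewrite lt0r_neq0.
  exact: SS.
- rewrite scalerA {1}rE -mulrBr opprB addrCA subrr addr0.
  have -> : S * e * (S / e) = S * S by field; rewrite lt0r_neq0.
  by rewrite SS scale1r.
- by rewrite rr -[leLHS]mulr1 ler_wpM2l.
Qed.

(** After doubling, [N] is defined by [w x1 = 480 bh om^2 N], the scaling of the cap. If [N] is
    comparable to [d1] the bound follows. Otherwise the depth of [x1] is small, since [inner_bound]
    on a ball of a quarter of this depth would make [w x1] too large, and the cap gives a
    contradiction. *)
Lemma near_sphere_bound x s (vr : R) : E x -> 0 < vr ->
  (forall y, enorm (y - x) < vr -> (0 < rho s y -> Om y) /\ (0 <= rho s y -> E y)) ->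
  (forall b y, b <> s -> enorm (y - x) < vr -> 0 < rho b y) ->
  vr <= `|rad s| -> vr <= rad jo -> enorm (x - cen s) <= 2 * `|rad s| ->
  100 * 100 * (200 * (n%:R * bh * om)) <= c ->
  2 * bh * om ^+ 4 * vr <= w x.
Proof.
move=> Ex v0 hOE hF vq vj xc omc'; have {omc'} omc t : t = om -> 100 * 100 * (200 * (n%:R * bh * t)) <= c by move=> ->.
set q := `|rad s| in vq xc.
have n0 : (0 < n)%N by apply: leq_trans n3.
have bh0 := ss_bh st; have r0 := ss_rad st s.
have q0 : 0 < q by rewrite normr_gt0.
have nR : 3 <= n%:R :> R by rewrite ler_nat.
have om1 : om <= 100^-1.
  by apply: le_trans omn; rewrite -[leLHS]mulr1 ler_pM2l //; apply: le_trans nR; rewrite ler1n.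
have om2 : om ^+ 2 <= 100^-1 * om by rewrite expr2 ler_pM2r.
have om20 : 0 < om ^+ 2 by rewrite exprn_gt0.
have v2 : 0 < vr / 2 by rewrite divr_gt0.
have v2v : vr / 2 < vr by lra.
have crho : forall y, cont_at setT (rho s) y.
  move=> y; apply: cont_atM; last exact: cont_at_cst.
  by apply: cont_atB; [exact: cont_at_cst|exact: cont_at_dist].
have [|x1 [Ex1 xx1 hw hd]] := doubling sol v2 Ex.
  have -> : E `&` [set y | enorm (y - x) <= vr / 2] =
    [set y | enorm (y - x) <= vr / 2] `&` [set y | 0 <= rho s y].
    apply/seteqP; split => y /= [h1 h2]; first by split => //; exact: ss_ge0 st _ _ h1.
    by split => //; have [_] := hOE y (le_lt_trans h1 v2v); apply.
  by apply: compact_closedI (closed_superlevel crho); apply: compact_cball; exact: ltW.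
pose d1 := vr / 2 - enorm (x1 - x); rewrite -/d1 in hw hd.
have d10 : 0 < d1 by rewrite subr_gt0.
have d1v : d1 <= vr / 2 by rewrite gerBl enorm_ge0.
have inx y : enorm (y - x1) < d1 -> enorm (y - x) < vr.
  by move=> h; have := enorm_dist x1 y x; move: h; rewrite /d1; lra.
have w1 := so_pos sol Ex1; have wx := so_pos sol Ex.
have [B BE'] : exists B, B = 240 * bh * om ^+ 2 by eexists.
have B0 : 0 < B by rewrite BE' !mulr_gt0 ?ltr0n.
have {BE'} BE t : t = B -> t = 240 * bh * om ^+ 2 by move=> ->.
pose N := w x1 / 2 / B.
have N0 : 0 < N by rewrite /N !divr_gt0.
have mE : w x1 = 2 * (B * N) by rewrite /N; field; rewrite lt0r_neq0.
clearbody N.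
have om4 : om ^+ 4 = om ^+ 2 * om ^+ 2 by rewrite -exprD.
have [Ns|Ns] := ltP (om ^+ 2 / 100 * d1) N.
  have h1 : 2 * bh * om ^+ 4 * vr * d1 <= w x1 * (vr / 2).
    rewrite mE (BE B erefl) om4; have -> : 2 * bh * (om ^+ 2 * om ^+ 2) * vr * d1 = 2 * bh * om ^+ 2 * vr * (om ^+ 2 * d1) by ring.
    have -> : 2 * (240 * bh * om ^+ 2 * N) * (vr / 2) = 2 * bh * om ^+ 2 * vr * (120 * N) by field.
    by rewrite ler_pM2l ?mulr_gt0 //; lra.
  by rewrite -(ler_pM2r d10); apply: le_trans h1 _; apply: le_trans hw _; rewrite ler_pM2l // /d1; lra.
exfalso.
have sc0 : 0 < om * N by rewrite mulr_gt0.
have n00 : 0 < n%:R :> R by rewrite ltr0n.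
have rh0 := ss_ge0 st s Ex1.
have D0 : 0 < d1 / 2 by rewrite divr_gt0.
have r1s : rho s x1 <= om * N / (200 * n%:R).
  rewrite leNgt; apply/negP => hlt.
  have rp : 0 < rho s x1 by apply: lt_trans hlt; by rewrite divr_gt0 ?mulr_gt0 ?ltr0n.
  pose r' := Num.min (rho s x1 / 4) (d1 / 2).
  have r'0 : 0 < r' by rewrite lt_min D0 divr_gt0.
  have r'j : r' <= rad jo by apply: (@le_trans _ _ (d1 / 2)); [rewrite ge_min lexx orbT|lra].
  have hO y : enorm (y - x1) < r' -> Om y.
    rewrite lt_min => /andP[y1 y2].
    have [hO _] := hOE y (inx y ltac:(lra)); apply: hO.
    have -> : rho s y = rho s (x1 + 1 *: (y - x1)) by rewrite scale1r addrC subrK.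
    rewrite depth_line // mul1r expr1n mul1r; set e := enorm (y - x1) in y1 y2.
    have e0 : 0 <= e := enorm_ge0 _.
    have e3 : edot (x1 - cen s) (y - x1) / rad s <= 3 * e.
      apply: le_trans (ler_norm _) _; rewrite normrM normfV ler_pdivrMr //.
      apply: le_trans (edot_le _ _) _.
      have -> : 3 * e * `|rad s| = 3 * q * e by rewrite /q; ring.
      rewrite ler_wpM2r //; have := enorm_dist x x1 (cen s); move: xx1 xc vq; lra.
    have e4 : edot (y - x1) (y - x1) / (2 * rad s) <= e.
      apply: (@le_trans _ _ (e ^+ 2 / (2 * q))).
        rewrite sqr_enorm; apply: ler_wpM2l; first exact: edot_ge0.
        by rewrite !invfM ler_pM2l ?invr_gt0 // /q -normfV ler_norm.
      rewrite ler_pdivrMr ?mulr_gt0 // expr2 ler_wpM2l //; move: y2 d1v vq; lra.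
    by lra.
  have := inner_bound r'0 r'j hO.
  rewrite leNgt => /negP; apply; rewrite mE (BE B erefl) /r' minElt; case: ifP => _.
    have -> : c * (rho s x1 / 4) / 4 = 16^-1 * (rho s x1 * c) by field.
    have : om * N / (200 * n%:R) * (100 * 100 * (200 * (n%:R * bh * om))) <= rho s x1 * c.
      apply: ler_pM (omc om erefl); [| |exact: ltW].
        by rewrite divr_ge0 ?mulr_ge0 ?ler0n ?(ltW om0) ?(ltW N0).
      by rewrite !mulr_ge0 ?ler0n ?(ltW bh0) ?(ltW om0).
    have -> : om * N / (200 * n%:R) * (100 * 100 * (200 * (n%:R * bh * om))) = 100 * 100 * (bh * om ^+ 2 * N).
      by field; rewrite lt0r_neq0.
    by have := mulr_gt0 (mulr_gt0 bh0 om20) N0; lra.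
  have h1 : 2 * (240 * bh * om ^+ 2 * N) <= 480 * bh * om ^+ 2 * (om ^+ 2 / 100 * d1).
    by have := ler_wpM2l (ltW B0) Ns; rewrite (BE B erefl); lra.
  have h2 : bh * om <= 3^-1 * (n%:R * bh * om).
    have := ler_wpM2r (ltW (mulr_gt0 bh0 om0)) nR; lra.
  have h3 : bh * om ^+ 2 * om ^+ 2 <= bh * om.
    have -> : bh * om ^+ 2 * om ^+ 2 = bh * om * (om * om ^+ 2) by ring.
    rewrite -[leRHS]mulr1 ler_pM2l ?mulr_gt0 // -[leRHS]mulr1.
    rewrite mulr1 -exprS exprn_ile1 ?(ltW om0) //.
    by apply: le_trans om1 _; rewrite invf_le1 ?ltr0n // ler1n.
  have h4 : 480 * bh * om ^+ 2 * (om ^+ 2 / 100 * d1) <= (480 / 100) * (bh * om) * d1.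
    have -> : 480 * bh * om ^+ 2 * (om ^+ 2 / 100 * d1) = 480 / 100 * (bh * om ^+ 2 * om ^+ 2) * d1 by field.
    by rewrite ler_pM2r //; apply: ler_wpM2l h3; rewrite divr_ge0 ?ler0n.
  apply: le_lt_trans h1 (le_lt_trans h4 _).
  have -> : c * (d1 / 2) / 4 = 8^-1 * c * d1 by field.
  by rewrite ltr_pM2r //; have : 0 < n%:R * bh * om by [rewrite !mulr_gt0]; move: (omc om erefl) h2; lra.
have scq : om * N / (200 * n%:R) <= 100^-1 * q.
  rewrite ler_pdivrMr ?mulr_gt0 ?ltr0n //.
  have : om * N <= 100^-1 * N by rewrite ler_pM2r.
  have : N <= q by have : om ^+ 2 / 100 * d1 <= 1 * d1 by [rewrite ler_pM2r //; lra]; lra.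
  have : 100^-1 * q * (200 * 1) <= 100^-1 * q * (200 * n%:R).
    by rewrite ler_pM2l ?mulr_gt0 ?invr_gt0 ?ltr0n // ler_pM2l ?ltr0n //; lra.
  by lra.
have r1q : rho s x1 <= 100^-1 * q := le_trans r1s scq.
have x1c : x1 != cen s.
  apply/eqP => e; have e1 : rho s x1 = rad s / 2.
    by rewrite /depth e subrr edot0l subr0; field; exact: r0.
  have rp : 0 <= rad s by move: rh0; rewrite e1; lra.
  by move: r1q q0; rewrite e1 /q ger0_norm //; lra.
have [nu [t1 [nn x1E t10 t1r]]] := foot_point r0 rh0 x1c.
pose x0 := x1 + t1 *: nu.
have wm : w x1 / 2 = B * N by rewrite mE mulrC mulKf.
rewrite (BE B erefl) in wm mE.
apply: (@cap_contra R n Gam f E Om w G H n3 hGam hf sol J cen rad jo ch bh st s0 hs0 s x0 x1 nu N om (d1 / 2) t1) => //.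
- apply: le_trans Ns _; rewrite ler_wpM2l ?divr_ge0 ?(ltW om20) //; move: d1v vq; rewrite /q; lra.
- have : om ^+ 2 / 100 * d1 <= 8^-1 * d1 by rewrite ler_pM2r //; lra.
  by move: Ns; lra.
- by rewrite /x0 addrAC x1E -scalerDl subrK.
- by rewrite /x0 addrK.
- move=> y y1 y2; have [_ hE] := hOE y (inx y ltac:(lra)); split; first exact: hE.
  by rewrite -wm; apply: hd => //; exact: hE.
- by move=> y y1 y2; have [hO _] := hOE y (inx y ltac:(lra)); exact: hO.
- by move=> b y bs y1; apply: hF => //; apply: inx; lra.
apply: le_lt_trans cs; rewrite !expr2; apply: (ler_pM _ _ (omc om erefl) (omc om erefl)).
  all: have h := ltW (mulr_gt0 (mulr_gt0 n00 bh0) om0).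
  all: by rewrite !mulr_ge0 ?ler0n ?(ltW bh0) ?(ltW om0).
Qed.

End NearSphere.

(** * Configurations of balls *)

Section Balls.
Context {R : realType} {n : nat}.
Implicit Types (x y z v p c : 'rV[R]_n).
Hypothesis n0 : (0 < n)%N.
Local Notation sqd z y := (edot (y - z) (y - z)).

Lemma closure_eball c (r : R) y : 0 < r -> closure (eball c r) y <-> enorm (y - c) <= r.
Proof.
move=> r0; split => [/closure_enormP h|h].
  rewrite leNgt; apply/negP => lt; have [|z zc zy] := h (enorm (y - c) - r); first by rewrite subr_gt0.
  by have := enorm_dist z y c; rewrite /eball /= in zc; rewrite enormBC in zy; lra.
apply/closure_enormP => d d0.
pose s := Num.min 2^-1 (d / (2 * r)); have s0 : 0 < s by rewrite lt_min invr_gt0 ltr0n /= divr_gt0 // mulr_gt0.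
have s1 : s <= 2^-1 by rewrite ge_min lexx.
have s2 : s * (2 * r) <= d by rewrite -ler_pdivlMr ?mulr_gt0 // ge_min lexx orbT.
exists (y + s *: (c - y)).
  rewrite /eball /=; have -> : y + s *: (c - y) - c = (1 - s) *: (y - c) by apply/rowP => i; rewrite !mxE; ring.
  rewrite enormZ ger0_norm; last by lra.
  apply: (@le_lt_trans _ _ ((1 - s) * r)); first by rewrite ler_wpM2l //; lra.
  by rewrite mulrBl mul1r gtrBl mulr_gt0.
have -> : y + s *: (c - y) - y = s *: (c - y) by rewrite addrAC subrr add0r.
rewrite enormZ gtr0_norm // enormBC; apply: (@le_lt_trans _ _ (s * r)); first by rewrite ler_wpM2l // ltW.
by have := mulr_gt0 s0 r0; lra.
Qed.

Lemma bdry_eball c (r : R) y : 0 < r -> bdry (eball c r) y <-> enorm (y - c) = r.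
Proof.
move=> r0; have ob : open (eball c r).
  apply/open_enormP => z zc; exists (r - enorm (z - c)); first by rewrite subr_gt0.
  by move=> t tz; rewrite /eball /=; have := enorm_dist z t c; lra.
split.
  case=> /(closure_eball _ _ r0) h1 h2; apply/eqP; rewrite eq_le h1 leNgt.
  by apply/negP => lt; apply: h2; apply: open_nbhs_nbhs; split.
move=> h; split; first by apply/closure_eball => //; rewrite h.
by move=> /interior_subset; rewrite /eball /= h ltxx.
Qed.

Lemma eball_disjoint c c' (r r' : R) : 0 < r -> 0 < r' -> eball c r `&` eball c' r' = set0 ->
  r + r' <= enorm (c - c').
Proof.
move=> r0 r'0 h; rewrite leNgt; apply/negP => lt.
have s0 : 0 < r + r' by rewrite addr_gt0.
pose s := r / (r + r'); have sE : s * (r + r') = r by rewrite /s divfK // lt0r_neq0.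
have sp : 0 < s by rewrite divr_gt0.
have sp1 : (1 - s) * (r + r') = r' by rewrite mulrBl sE mul1r addrAC subrr add0r.
have sq : 0 < 1 - s by rewrite -(pmulr_lgt0 _ s0) sp1.
suff : (eball c r `&` eball c' r') (c + s *: (c' - c)) by rewrite h.
rewrite /eball; split => /=.
  by rewrite addrAC subrr add0r enormZ gtr0_norm // enormBC -[ltRHS]sE ltr_pM2l.
have -> : c + s *: (c' - c) - c' = (1 - s) *: (c - c') by apply/rowP => i; rewrite !mxE; ring.
by rewrite enormZ gtr0_norm // -[ltRHS]sp1 ltr_pM2l.
Qed.

Lemma eball_sub c c' (r r' : R) : 0 < r -> eball c r `<=` eball c' r' -> enorm (c - c') <= r' - r.
Proof.
move=> r0 h; have [e e1 dE] := @dir_exists R n n0 (c - c').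
have c1 : enorm (c - c') < r' by apply: h; rewrite /eball /= subrr enorm0.
rewrite leNgt; apply/negP => lt.
have [t tE] : exists t, t + enorm (c - c') = r' by exists (r' - enorm (c - c')); rewrite subrK.
have t0 : 0 < t by lra.
have r0' : 0 <= r' := le_trans (enorm_ge0 _) (ltW c1).
have : eball c' r' (c + t *: e).
  apply: h; rewrite /eball /= addrAC subrr add0r enormZ e1 mulr1 gtr0_norm //; lra.
rewrite /eball /=; have -> : c + t *: e - c' = (t + enorm (c - c')) *: e.
  by rewrite addrAC {1}dE -scalerDl addrC.
by rewrite tE enormZ e1 mulr1 ger0_norm ?ltxx.
Qed.

(** The equality case of the triangle inequality: combining the three squared inequalities with
    weights [l] and [1 - l] bounds the squared distance from [z] to the tangency point by zero. *)
Lemma tangent_outside c c' (r r' : R) z : 0 < r -> 0 < r' -> r + r' <= enorm (c - c') ->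
  enorm (z - c) <= r -> enorm (z - c') <= r' -> z = c + (r / (r + r')) *: (c' - c).
Proof.
move=> r0 r'0 h h1 h2; apply/eqP; rewrite -subr_eq0 -edot_eq0 eq_le edot_ge0 andbT.
have s0 : 0 < r + r' by rewrite addr_gt0.
have a1 : sqd c z <= r ^+ 2 by rewrite -enorm_leE // ltW.
have a2 : sqd c' z <= r' ^+ 2 by rewrite -enorm_leE // ltW.
have a3 : (r + r') ^+ 2 <= sqd c c'.
  rewrite -sqr_enorm enormBC !expr2; by apply: (ler_pM _ _ h h); exact: ltW.
have -> : z - (c + (r / (r + r')) *: (c' - c)) = (z - c) - (r / (r + r')) *: (c' - c) by rewrite opprD addrA.
have e2 : z - c' = (z - c) - (c' - c) by apply/rowP => i; rewrite !mxE; ring.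
move: a2; rewrite e2; move: a1 a3; move: (z - c) (c' - c) => q v a1 a3 a2.
rewrite edot_sqrD !edotE; rewrite edot_sqrD !edotE in a2.
move: (edot q q) (edot q v) (edot v v) a1 a2 a3 => A B C a1 a2 a3.
set l := r / (r + r'); have lE : l * (r + r') = r by rewrite /l divfK // lt0r_neq0.
have l0 : 0 < l by rewrite divr_gt0.
have l1E : (1 - l) * (r + r') = r' by rewrite mulrBl lE mul1r addrAC subrr add0r.
have l1 : 0 < 1 - l by rewrite -(pmulr_lgt0 _ s0) l1E.
have b1 := ler_wpM2l (ltW l1) a1; have b2 := ler_wpM2l (ltW l0) a2.
have b3 := ler_wpM2l (mulr_ge0 (ltW l0) (ltW l1)) a3.
have e : l * (1 - l) * (r + r') ^+ 2 = (1 - l) * r ^+ 2 + l * r' ^+ 2.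
  have -> : r ^+ 2 = (l * (r + r')) ^+ 2 by rewrite lE.
  have -> : r' ^+ 2 = ((1 - l) * (r + r')) ^+ 2 by rewrite l1E.
  by ring.
move: b1 b2 b3; rewrite e; lra.
Qed.

Lemma tangent_inside c c' (r r' : R) z : 0 < r -> r < r' -> enorm (c - c') <= r' - r ->
  enorm (z - c) <= r -> r' <= enorm (z - c') -> z = c + (r / (r' - r)) *: (c - c').
Proof.
move=> r0 rr h h1 h2; apply/eqP; rewrite -subr_eq0 -edot_eq0 eq_le edot_ge0 andbT.
have s0 : 0 < r' - r by rewrite subr_gt0.
have r'0 : 0 < r' by apply: lt_trans rr.
have a1 : sqd c z <= r ^+ 2 by rewrite -enorm_leE // ltW.
have a2 : r' ^+ 2 <= sqd c' z by rewrite -sqr_enorm !expr2; apply: (ler_pM _ _ h2 h2); exact: ltW.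
have a3 : edot (c - c') (c - c') <= (r' - r) ^+ 2 by rewrite -enorm_leE // ltW.
have -> : z - (c + (r / (r' - r)) *: (c - c')) = (z - c) - (r / (r' - r)) *: (c - c') by rewrite opprD addrA.
have e2 : z - c' = (z - c) + (c - c') by apply/rowP => i; rewrite !mxE; ring.
move: a2; rewrite e2; move: a1 a3; move: (z - c) (c - c') => q v a1 a3 a2.
rewrite edot_sqrD !edotE; rewrite edot_sqrD in a2.
move: (edot q q) (edot q v) (edot v v) a1 a2 a3 => A B C a1 a2 a3.
set l := r / (r' - r); have lE : l * (r' - r) = r by rewrite /l divfK // lt0r_neq0.
have l0 : 0 < l by rewrite divr_gt0.
have l1 : 0 < 1 + l by lra.
have b1 := ler_wpM2l (ltW l1) a1; have b2 := ler_wpM2l (ltW l0) a2.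
have b3 := ler_wpM2l (mulr_ge0 (ltW l0) (ltW l1)) a3.
have e : l * (1 + l) * (r' - r) ^+ 2 = l * r' ^+ 2 - (1 + l) * r ^+ 2.
  have -> : r' = (1 + l) * (r' - r) by rewrite mulrDl lE mul1r subrK.
  by rewrite /l; field; rewrite lt0r_neq0.
move: b1 b2 b3; rewrite e; lra.
Qed.

(** Centers of balls of radius at least [t] are at mutual distance at least [2 t], so infinitely
    many of them cannot stay bounded. *)
Lemma radii_shrink (z : nat -> 'rV[R]_n) (rr : nat -> R) c (b : R) : 0 <= b ->
  (forall j, enorm (z j - c) <= b) -> (forall i j, i != j -> rr i + rr j <= enorm (z i - z j)) ->
  forall t, 0 < t -> exists k, forall j, (k <= j)%N -> rr j < t.
Proof.
move=> b0 hb hs t t0; apply: contrapT => hn.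
have hn' k : exists2 j, (k <= j)%N & t <= rr j.
  apply: contrapT => hk; apply: hn; exists k => j kj; rewrite ltNge; apply/negP => tj.
  by apply: hk; exists j.
(* The condition [1 <= e * j%:R] drives the index to infinity as [e] tends to 0, which yields two
   different indices near the accumulation point. *)
pose Q (e : R) y := exists j, [/\ 1 <= e * j%:R, t <= rr j & y = z j].
have [|e e0|e e' y ee [j [h1 h2 h3]]|y0 _ hy] := @compact_accum R _ [set y | enorm (y - c) <= b] Q.
- exact: compact_cball.
- have [j kj tj] := hn' (Num.truncn e^-1).+1; exists (z j); first exact: hb.
  exists j; split => //; rewrite mulrC -ler_pdivrMr // mul1r.
  apply: le_trans (ltW (truncnS_gt _)) _; rewrite ?ler_nat //.
- by exists j; split => //; apply: le_trans h1 _; rewrite ler_wpM2r.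
have U : nbhs y0 [set y | enorm (y - y0) < t / 2].
  by apply/nbhs_enormP; exists (t / 2) => //; rewrite divr_gt0.
have [_ [_ [i [_ ti ->]] hi]] := hy 1 _ ltr01 U.
have i0 : 0 < (i.+1%:R^-1 : R) by rewrite invr_gt0.
have [_ [_ [j [ij tj ->]] hj]] := hy _ _ i0 U.
have ne : i != j.
  by apply/eqP => e; move: ij; rewrite -e mulrC ler_pdivlMr // mul1r ler_nat ltnn.
have := hs _ _ ne; have := enorm_dist y0 (z i) (z j); rewrite /= in hi hj.
by rewrite (enormBC y0 (z j)); lra.
Qed.

End Balls.

Lemma cont_at_depth {R : realType} {n : nat} (X : set 'rV[R]_n) c (r : R) y :
  cont_at X (depth c r) y.
Proof.
apply: cont_atM; last exact: cont_at_cst.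
by apply: cont_atB; [exact: cont_at_cst|exact: cont_at_dist].
Qed.

(** * Isolating one sphere near a point of the closure *)

Section Geometry.
Context {R : realType} {n : nat} {I : countType}.
Implicit Types (x y z v p c : 'rV[R]_n).
Hypothesis n0 : (0 < n)%N.
Variables (x0 : 'rV[R]_n) (r : R) (xb : I -> 'rV[R]_n) (rb : I -> R) (Lam : set 'rV[R]_n).
Hypothesis conf : ball_configuration x0 r xb rb Lam.
Local Notation Om := (domain x0 r xb rb Lam).
Local Notation E := (closure Om `\` Lam).
Hypothesis dom0 : Om !=set0.

Definition cens (j : option I) := if j is Some a then xb a else x0.
Definition rads (j : option I) := if j is Some a then - rb a else r.
Local Notation rho j := (depth (cens j) (rads j)).

Let r0 : 0 < r := conf_r_gt0 conf.
Let rb0 a : 0 < rb a := conf_rb_gt0 conf a.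

Lemma rads_neq0 j : rads j != 0.
Proof. by case: j => [a|] /=; rewrite ?oppr_eq0 lt0r_neq0. Qed.

Lemma rads_outer j : 0 < rads j <-> j = None.
Proof.
case: j => [a|] //=; split => //; rewrite oppr_gt0 => h.
by have := lt_trans h (rb0 a); rewrite ltxx.
Qed.

Lemma rho_outer y : (0 < rho None y) = (enorm (y - x0) < r).
Proof. by rewrite depth_gt0_outer // enorm_ltE. Qed.

Lemma rho_outer_ge y : (0 <= rho None y) = (enorm (y - x0) <= r).
Proof. by rewrite depth_ge0_outer // enorm_leE // ltW. Qed.

Lemma rho_inner a y : (0 < rho (Some a) y) = (rb a < enorm (y - xb a)).
Proof.
by rewrite depth_gt0_inner ?oppr_lt0 // sqrrN -sqr_enorm ltr_pXn2r ?nnegrE ?enorm_ge0 // ltW.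
Qed.

Lemma rho_inner_ge a y : (0 <= rho (Some a) y) = (rb a <= enorm (y - xb a)).
Proof.
rewrite /depth nmulr_lge0; last by rewrite invr_lt0 pmulr_rlt0 ?oppr_lt0.
by rewrite subr_le0 sqrrN -sqr_enorm ler_pXn2r ?nnegrE ?enorm_ge0 // ltW.
Qed.

Lemma rho_zero j y : rho j y = 0 -> enorm (y - cens j) = `|rads j|.
Proof.
move=> /(depth0 _ _ (rads_neq0 j)) h; apply/eqP.
by rewrite -(@eqrXn2 _ 2) ?enorm_ge0 // sqr_enorm h real_normK ?num_real.
Qed.

Lemma domainP y : Om y <-> (forall j, 0 < rho j y) /\ ~ Lam y.
Proof.
split.
  case=> yB hn; split; last by move=> h; apply: hn; right.
  case=> [a|]; last by rewrite rho_outer.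
  rewrite rho_inner ltNge; apply/negP => h; apply: hn; left; exists a => //.
  exact/closure_eball.
case=> h nL; split; first by have := h None; rewrite rho_outer.
case=> // -[a _ /closure_eball hc]; have := h (Some a); rewrite rho_inner ltNge.
by rewrite hc.
Qed.

Lemma rho_clos_ge0 j y : closure Om y -> 0 <= rho j y.
Proof.
move=> /closure_enormP h; rewrite leNgt; apply/negP => lt.
have [||d d0 hd] := @cont_at_pos _ _ setT (fun y => - rho j y) y.
- by apply: cont_atN; exact: cont_at_depth.
- by rewrite oppr_gt0.
have [z /domainP[zr _] zy] := h d d0; have /andP[h1 _] := hd z Logic.I zy.
by have := zr j; move: h1 lt; lra.
Qed.

Lemma inner_apart a b : a != b -> rb a + rb b <= enorm (xb a - xb b).
Proof.
move=> ab; apply: eball_disjoint => //; apply/eqP/negPn/negP => /set0P[z hz].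
have := conf_disjoint conf; move=> /(_ a b Logic.I Logic.I) h.
by move/eqP: ab; apply; apply: h; exists z.
Qed.

Lemma inner_sub a : enorm (xb a - x0) <= r - rb a.
Proof. by apply: eball_sub => //; exact: conf_sub conf a. Qed.

(** A removed ball of radius [r] would fill the whole ball and leave an empty domain. *)
Lemma inner_lt a : rb a < r.
Proof.
have h := inner_sub a; have := enorm_ge0 (xb a - x0) => h0.
have : rb a <= r by lra.
rewrite le_eqVlt => /orP[/eqP e|//]; exfalso.
have [y /domainP[hy _]] := dom0; have := hy None; have := hy (Some a).
rewrite rho_outer rho_inner e => h1 h2.
have : enorm (xb a - x0) = 0 by apply/eqP; rewrite eq_le h0 andbT; move: h; rewrite e subrr.
move/eqP; rewrite enorm_eq0 subr_eq0 => /eqP xe; move: h1; rewrite xe; move: h2; lra.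
Qed.

(** A point of the closure of the domain on two of the spheres is a point of tangency, hence the
    only common point in the sense of hypothesis (ii), which puts it in [Lam]. *)
Lemma unique_sphere j k y : E y -> rho j y = 0 -> rho k y = 0 -> j = k.
Proof.
have outer a : E y -> rho (Some a) y = 0 -> rho None y = 0 -> False.
  move=> [cy nL] hj hk; apply: nL; have /= h1 := rho_zero hj; have /= h2 := rho_zero hk.
  rewrite normrN (gtr0_norm (rb0 a)) in h1; rewrite (gtr0_norm r0) in h2.
  apply: (conf_touch_outer conf (a := a)); apply/seteqP; split => z /=.
    case=> /(closure_eball _ _ (rb0 a)) z1 /(bdry_eball _ _ r0) z2.
    rewrite (tangent_inside (rb0 a) (inner_lt a) (inner_sub a) z1 _) ?z2 //.
    by rewrite [RHS](tangent_inside (rb0 a) (inner_lt a) (inner_sub a) _ _) ?h1 ?h2.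
  by move=> ->; split; [apply/closure_eball => //; rewrite h1|apply/bdry_eball].
case: j k => [a|] [b|] Ey hj hk //; [|by case: (outer _ Ey hj hk)|by case: (outer _ Ey hk hj)].
have [->//|ab] := eqVneq a b; case: Ey => cy; case.
have /= h1 := rho_zero hj; have /= h2 := rho_zero hk.
rewrite normrN (gtr0_norm (rb0 _)) in h1; rewrite normrN (gtr0_norm (rb0 _)) in h2.
apply: (conf_touch conf (a := a) (b := b)); apply/seteqP; split => z /=.
  case=> /(closure_eball _ _ (rb0 a)) z1 /(closure_eball _ _ (rb0 b)) z2.
  rewrite (tangent_outside (rb0 _) (rb0 _) (inner_apart ab) z1 z2).
  by rewrite [RHS](tangent_outside (rb0 _) (rb0 _) (inner_apart ab) _ _) ?h1 ?h2.
by move=> ->; split; apply/closure_eball => //; rewrite ?h1 ?h2.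
Qed.

Definition isolated x d s := forall y, enorm (y - x) < d -> ~ Lam y /\ forall b, b <> s -> 0 < rho b y.

Lemma isolated_domain x d s y : isolated x d s -> enorm (y - x) < d -> 0 < rho s y -> Om y.
Proof.
move=> h /h[nL hb] ys; apply/domainP; split => // j.
by have [->//|js] := pselect (j = s); exact: hb.
Qed.

Lemma depth_inward j y : rho j y = 0 -> forall d, 0 < d -> exists2 z, enorm (z - y) < d & 0 < rho j z.
Proof.
move=> ry d d0; pose v := - (rads j)^-1 *: (y - cens j).
have jr := rads_neq0 j; have q0 : 0 < `|rads j| by rewrite normr_gt0.
have v1 : edot v v = 1.
  rewrite edotZl (edotZr (- _)) ((depth0 _ _ jr).1 ry); field; exact: jr.
have v2 : edot (y - cens j) v / rads j = -1.
  rewrite (edotZr (- _)) ((depth0 _ _ jr).1 ry); field; exact: jr.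
pose t := Num.min (d / 2) `|rads j|; have t0 : 0 < t by rewrite lt_min q0 divr_gt0.
exists (y + t *: v).
  rewrite addrAC subrr add0r -(@ltr_pXn2r _ 2) ?nnegrE ?enorm_ge0 ?(ltW d0) // sqr_enorm.
  rewrite edotZl edotZr v1 mulr1 -expr2 ltr_pXn2r ?nnegrE ?(ltW t0) ?(ltW d0) //.
  by apply: (@le_lt_trans _ _ (d / 2)); [rewrite ge_min lexx|lra].
rewrite depth_line // ry v1 v2; have tq : t <= `|rads j| by rewrite ge_min lexx orbT.
have : t ^+ 2 * (1 / (2 * rads j)) <= t / 2.
  apply: le_trans (ler_norm _) _; rewrite normrM ger0_norm ?sqr_ge0 // normrM normfV normrM.
  rewrite normr1 (@ger0_norm _ 2) //; rewrite mul1r invfM expr2 -!mulrA ler_pM2l // mulrCA.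
  by rewrite -[leRHS]mulr1 ler_pM2l ?invr_gt0 // ler_pdivrMr // mul1r.
by move: t0; lra.
Qed.

Lemma isolated_closure x d s y : isolated x d s -> enorm (y - x) < d -> 0 <= rho s y -> E y.
Proof.
move=> h hy; rewrite le_eqVlt => /orP[/eqP e|lt]; last first.
  have Oy := isolated_domain h hy lt; split; first exact: subset_closure.
  by have /domainP[] := Oy.
split; last by have [] := h y hy.
apply/closure_enormP => e0 e00.
have [|z z1 z2] := depth_inward (esym e) (_ : 0 < Num.min e0 (d - enorm (y - x))).
  by rewrite lt_min e00 subr_gt0.
move: z1; rewrite lt_min => /andP[z1 z3]; exists z => //.
by apply: (isolated_domain h) z2; have := enorm_dist y z x; lra.
Qed.

(** If balls other than [s] came arbitrarily close to [x], there would be a sequence of them with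
    strictly decreasing distances to [x]. These balls are distinct, their radii tend to zero by
    disjointness, so they converge to [x], and hypothesis (iii) puts [x] in [Lam]. *)
Lemma exists_isolated x : E x -> exists s d, [/\ 0 < d, isolated x d s,
  enorm (x - cens s) <= `|rads s|, d <= `|rads s| & d <= r].
Proof.
move=> Ex; have [cx nL] := Ex.
have [s [sE sc]] : exists s, (forall j, j <> s -> 0 < rho j x) /\ enorm (x - cens s) <= `|rads s|.
  have [[s hs]|hn] := pselect (exists s, rho s x = 0).
    exists s; split; last by rewrite (rho_zero hs).
    move=> j js; rewrite lt0r (rho_clos_ge0 _ cx) andbT; apply/eqP => h.
    by apply: js; exact: unique_sphere h hs.
  exists None; split; last by rewrite /= (gtr0_norm r0) -rho_outer_ge rho_clos_ge0.
  by move=> j _; rewrite lt0r (rho_clos_ge0 _ cx) andbT; apply/eqP => h; apply: hn; exists j.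
have [dL dL0 hL] : exists2 d, 0 < d & forall y, enorm (y - x) < d -> ~ Lam y.
  have /open_enormP h : open (~` Lam) by apply: closed_openC; exact: conf_closed conf.
  exact: h.
have [dN dN0 hN] : exists2 d, 0 < d & forall y, enorm (y - x) < d -> None <> s -> 0 < rho None y.
  have [e|ns] := pselect (None = s); first by exists 1.
  have [||d d0 hd] := @cont_at_pos _ _ setT (rho None) x; [exact: cont_at_depth|exact: sE|].
  exists d => // y yd _; have /andP[h _] := hd y Logic.I yd; apply: lt_trans h.
  by rewrite divr_gt0 //; exact: sE.
have [dI dI0 hI] : exists2 d, 0 < d & forall a y, Some a <> s -> enorm (y - x) < d -> 0 < rho (Some a) y.
  pose g a := enorm (x - xb a) - rb a.
  suff [d d0 hd] : exists2 d, 0 < d & forall a, Some a <> s -> d <= g a.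
    exists d => // a y as_ yd; rewrite rho_inner; have := hd a as_; rewrite /g.
    by have := enorm_dist y x (xb a); rewrite (enormBC x y); lra.
  apply: contrapT => hn.
  have hn' (d : R) : exists a, 0 < d -> Some a <> s /\ g a < d.
    have ex e : 0 < e -> exists a, Some a <> s /\ g a < e.
      move=> e0; apply: contrapT => he; apply: hn; exists e => // a as_.
      by rewrite leNgt; apply/negP => lt; apply: he; exists a.
    have [d0|d0] := ltP 0 d; first by have [a ha] := ex d d0; exists a.
    by have [a _] := ex 1 ltr01; exists a.
  have [F hF] := choice hn'.
  (* Each new ball is closer than the previous one and than [1 / (k + 2)]; the strict decrease makes
     the sequence injective. *)
  pose si := nat_rect (fun _ => I) (F 1) (fun k a => F (Num.min (g a) k.+2%:R^-1)).
  have gp a : Some a <> s -> 0 < g a by move=> /sE; rewrite rho_inner subr_gt0.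
  have si1 k : Some (si k) <> s /\ g (si k) < k.+1%:R^-1.
    elim: k => [|k [h1 h2]]; first by rewrite invr1; exact: hF.
    have [|h3] := hF (Num.min (g (si k)) k.+2%:R^-1).
      by rewrite lt_min (gp _ h1) invr_gt0 ltr0n.
    by rewrite lt_min => /andP[_ h4].
  have si2 k : g (si k.+1) < g (si k).
    have [h1 _] := si1 k; have [|_] := hF (Num.min (g (si k)) k.+2%:R^-1).
      by rewrite lt_min (gp _ h1) invr_gt0 ltr0n.
    by rewrite lt_min => /andP[h _].
  have si3 i j : (i < j)%N -> g (si j) < g (si i).
    elim: j => // j IH; rewrite ltnS leq_eqVlt => /orP[/eqP ->//|/IH]; exact: lt_trans.
  have sinj : injective si.
    move=> i j e; case: (ltngtP i j) => // /si3; rewrite e ltxx //.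
  have rsh : forall t : R, 0 < t -> exists k, forall j, (k <= j)%N -> rb (si j) < t.
    apply: (@radii_shrink R n (xb \o si) (rb \o si) x0 r (ltW r0)).
      by move=> j /=; have := inner_sub (si j); have := rb0 (si j); lra.
    by move=> i j ij; apply: inner_apart; rewrite (inj_eq sinj).
  apply: nL; apply: (conf_shrink conf sinj).
  - by apply/closure_eball => //; rewrite -rho_outer_ge rho_clos_ge0.
  - apply/cvgrPdist_lt => e e0.
    have [k1 hk1] := rsh (e / 2) ltac:(by rewrite divr_gt0).
    have e2 : 0 < e / 2 by rewrite divr_gt0.
    exists (maxn k1 (Num.truncn (e / 2)^-1)) => // j /=; rewrite geq_max => /andP[j1 j2].
    apply: le_lt_trans (norm_le_enorm _) _; have [_ h] := si1 j; have h1 := hk1 j j1.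
    have h2 : j.+1%:R^-1 <= e / 2.
      rewrite -[leRHS]invrK lef_pV2 ?posrE ?invr_gt0 //; apply: ltW.
      by apply: lt_le_trans (truncnS_gt _) _; rewrite ler_nat.
    have h3 : enorm (x - xb (si j)) - rb (si j) < j.+1%:R^-1 := h.
    move: h1 h2 h3 => /=; move: (si j) => a; move: (j.+1%:R^-1) => b; lra.
  - apply/cvgrPdist_lt => e e0; have [k hk] := rsh e e0; exists k => // j kj.
    by rewrite sub0r normrN gtr0_norm //; exact: hk.
have q0 : 0 < `|rads s| by rewrite normr_gt0 rads_neq0.
pose d := Num.min (Num.min (Num.min dL dN) dI) (Num.min `|rads s| r).
exists s, d; split => //.
- by rewrite !lt_min dL0 dN0 dI0 q0 r0.
- move=> y; rewrite !lt_min => /andP[/andP[/andP[y1 y2] y3] _]; split; first exact: hL.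
  by case=> [a|] bs; [exact: hI|exact: hN].
- by rewrite !ge_min lexx !orbT.
- by rewrite !ge_min lexx !orbT.
Qed.

(** Half of the isolation radius at an accumulation point serves all points close to it; the factor
    2 in the distance to the center absorbs the change of point. *)
Lemma uniform_isolated (K : set 'rV[R]_n) : compact K -> K `<=` E -> exists2 d, 0 < d &
  forall x, K x -> exists s, [/\ isolated x d s, enorm (x - cens s) <= 2 * `|rads s|,
    d <= `|rads s| & d <= r].
Proof.
move=> cK KE; apply: contrapT => hn.
pose Q (e : R) x := ~ exists s, [/\ isolated x e s, enorm (x - cens s) <= 2 * `|rads s|,
    e <= `|rads s| & e <= r].
have [|e e0|e e' x ee qx [s [h1 h2 h3 h4]]|x Kx hx] := @compact_accum R _ K Q.
- exact: cK.
- apply: contrapT => he; apply: hn; exists e => // x Kx; apply: contrapT => hs; apply: he.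
  by exists x.
- apply: qx; exists s; split => //; [|exact: le_trans h3|exact: le_trans h4].
  by move=> y ye; apply: h1; exact: lt_le_trans ee.
have [s [d [d0 hd sc dq dr]]] := exists_isolated (KE _ Kx).
have d2 : 0 < d / 2 by rewrite divr_gt0.
have U : nbhs x [set y | enorm (y - x) < d / 2] by apply/nbhs_enormP; exists (d / 2).
have [x' [Kx' qx' /= Ux']] := hx _ _ d2 U; apply: qx'; exists s; split.
- by move=> y yx; apply: hd; have := enorm_dist x' y x; lra.
- have := enorm_dist x x' (cens s); lra.
- lra.
- lra.
Qed.

End Geometry.

(** * Taylor expansion of powers *)

Section Calculus.
Context {R : realType}.

Lemma is_derive_linear (g : R -> R) (t a : R) :
  (forall e, 0 < e -> exists2 d, 0 < d & forall s, `|s| < d -> `|g (t + s) - g t - a * s| <= e * `|s|) ->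
  is_derive t 1 g a.
Proof.
move=> h; suff hc : (fun s => s^-1 *: (g (s *: 1 + t) - g t)) @ (0 : R)^' --> a.
  by apply: DeriveDef; [apply/cvg_ex; exists a|exact: cvg_lim hc].
apply/cvgrPdist_le => e e0; have [d d0 hd] := h e e0.
exists d => //= s; rewrite /= sub0r normrN => sd s0; rewrite /= distrC.
have -> : s^-1 *: (g (s *: 1 + t) - g t) - a = (g (t + s) - g t - a * s) / s.
  have e1 : s *: (1 : R) = s by rewrite /GRing.scale /= mulr1.
  by rewrite e1 (addrC s) /GRing.scale /=; field.
by rewrite normrM normfV ler_pdivrMr ?normr_gt0 //; exact: hd.
Qed.

Lemma linear_is_derive (g : R -> R) (t a : R) : is_derive t 1 g a ->
  forall e, 0 < e -> exists2 d, 0 < d & forall s, `|s| < d -> `|g (t + s) - g t - a * s| <= e * `|s|.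
Proof.
move=> [dg <-] e e0; have /cvgrPdist_le /(_ e e0) := dg.
case=> d /= d0 hd; exists d => // s sd; have [->|s0] := eqVneq s 0.
  by rewrite addr0 subrr mulr0 subr0 normr0 mulr0.
have := hd s; rewrite /= sub0r normrN => /(_ sd s0).
rewrite distrC => h1; have -> : g (t + s) - g t - 'D_1 g t * s = (s^-1 *: (g (s *: 1 + t) - g t) - 'D_1 g t) * s.
  by rewrite (_ : s *: (1 : R) = s) ?(addrC s) /GRing.scale /= ?mulr1 //; field.
by rewrite normrM ler_wpM2r.
Qed.

(** The mean value theorem for the remainder along the increment, with the increment rescaled to the
    unit interval. *)
Lemma taylor2_derive (g g' : R -> R) (t b r : R) : 0 < r ->
  (forall s, `|s - t| < r -> is_derive s 1 g (g' s)) -> is_derive t 1 g' b -> taylor2 g t (g' t) b.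
Proof.
move=> r0 dg dg' e e0; have [d d0 hd] := linear_is_derive dg' e0.
exists (Num.min d r); first by rewrite lt_min d0.
move=> s; rewrite lt_min => /andP[sd sr].
pose k (y : R) := g (t + y * s) - g' t * s * y - 2^-1 * b * s ^+ 2 * y ^+ 2.
have kd (y : R) : 0 <= y <= 1 -> is_derive y 1 k (g' (t + y * s) * s - g' t * s - b * s ^+ 2 * y).
  move=> /andP[y0 y1]; have ys : `|t + y * s - t| < r.
    by rewrite addrAC subrr add0r normrM (ger0_norm y0); apply: le_lt_trans sr; rewrite ler_piMl.
  have h1 := linear_is_derive (dg _ ys).
  apply: is_derive_linear => e' e'0.
  have s1 : 0 < `|s| + 1 by rewrite ltr_wpDl.
  have s20 : 0 <= 2^-1 * `|b| * s ^+ 2 by rewrite mulr_ge0 ?sqr_ge0 // mulr_ge0.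
  pose B := 2^-1 * `|b| * s ^+ 2 + 1; have B0 : 0 < B by rewrite ltr_wpDl.
  have [|d' d'0 hd'] := h1 (e' / 2 / (`|s| + 1)); first by rewrite !divr_gt0.
  exists (Num.min (d' / (`|s| + 1)) (e' / 2 / B)); first by rewrite lt_min !divr_gt0.
  move=> v; rewrite lt_min !ltr_pdivlMr // => /andP[v1 v2].
  have vs : `|v * s| < d'.
    by rewrite normrM; apply: le_lt_trans v1; rewrite ler_wpM2l // lerDl.
  have h2 := hd' _ vs.
  have -> : k (y + v) - k y - (g' (t + y * s) * s - g' t * s - b * s ^+ 2 * y) * v =
    (g (t + y * s + v * s) - g (t + y * s) - g' (t + y * s) * (v * s)) - 2^-1 * b * s ^+ 2 * v ^+ 2.
    rewrite /k; have -> : t + (y + v) * s = t + y * s + v * s by ring.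
    by field.
  apply: le_trans (ler_normB _ _) _; have -> : e' * `|v| = e' / 2 * `|v| + e' / 2 * `|v| by field.
  apply: lerD.
    apply: le_trans h2 _; rewrite normrM.
    have q1 : `|s| / (`|s| + 1) <= 1 by rewrite ler_pdivrMr // mul1r lerDl.
    have -> : e' / 2 / (`|s| + 1) * (`|v| * `|s|) = e' / 2 * `|v| * (`|s| / (`|s| + 1)).
      by field; rewrite lt0r_neq0.
    by rewrite ler_piMr // mulr_ge0 // divr_ge0 // ltW.
  have hB : `|2^-1 * b * s ^+ 2| <= B.
    rewrite normrM (@ger0_norm _ (s ^+ 2)) ?sqr_ge0 // normrM (@ger0_norm _ 2^-1) ?invr_ge0 //.
    by rewrite lerDl.
  rewrite normrM (@ger0_norm _ (v ^+ 2)) ?sqr_ge0 // -(real_normK (num_real v)) [`|v| ^+ 2]expr2 mulrA.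
  rewrite ler_wpM2r //; have := ler_wpM2r (normr_ge0 v) hB; move: v2; lra.
have [|||c cI hc] := @MVT_segment R k (fun y => g' (t + y * s) * s - g' t * s - b * s ^+ 2 * y) 0 1.
- exact: ler01.
- by move=> y /andP[y0 y1]; apply: kd; rewrite !ltW.
- by apply: derivable_within_continuous => y; rewrite in_itv /= => /kd h; exact: ex_derive.
have -> : g (t + s) - g t - g' t * s - 2^-1 * b * s ^+ 2 = k 1 - k 0.
  by rewrite /k mul0r mul1r addr0; ring.
rewrite hc subr0 mulr1.
have cs : `|c * s| < d.
  move: cI; rewrite in_itv /= => /andP[c0 c1]; rewrite normrM (ger0_norm c0).
  by apply: le_lt_trans sd; rewrite ler_piMl.
have -> : g' (t + c * s) * s - g' t * s - b * s ^+ 2 * c = (g' (t + c * s) - g' t - b * (c * s)) * s by ring.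
rewrite normrM -(real_normK (num_real s)) [`|s| ^+ 2]expr2 (mulrA e) ler_wpM2r //.
apply: le_trans (hd _ cs) _; rewrite ler_wpM2l ?(ltW e0) //.
by move: cI; rewrite in_itv /= => /andP[c0 c1]; rewrite normrM (ger0_norm c0) ler_piMl.
Qed.

Lemma taylor2_powR (a t : R) : 0 < t ->
  taylor2 (fun s => s `^ a) t (a * t `^ (a - 1)) (a * (a - 1) * t `^ (a - 2)).
Proof.
move=> t0; apply: (@taylor2_derive _ (fun s => a * s `^ (a - 1)) t _ t t0).
  move=> s; rewrite ltr_norml => /andP[h _]; apply: is_derive1_powR; lra.
have h := @is_derive1_powR R (a - 1) t t0.
have -> : a * (a - 1) * t `^ (a - 2) = a *: ((a - 1) * t `^ (a - 1 - 1)).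
  by rewrite -[in RHS]addrA -opprD -mulrA.
exact: is_deriveZ.
Qed.

End Calculus.

(** * Strict differentiability up to the boundary *)

Section Paths.
Context {R : realType} {n : nat}.
Implicit Types (x y z v p c : 'rV[R]_n).

Lemma jet2_line (w : 'rV[R]_n -> R) y v p M (t : R) : jet2 w (y + t *: v) p M ->
  is_derive t 1 (fun s => w (y + s *: v)) (edot p v).
Proof.
move=> /jet2_fdiff h; apply: is_derive_linear => e e0.
have v1 : 0 < enorm v + 1 by rewrite ltr_wpDl ?enorm_ge0.
have [|d d0 hd] := h (e / (enorm v + 1)); first by rewrite divr_gt0.
exists (d / (enorm v + 1)); first by rewrite divr_gt0.
move=> s; rewrite ltr_pdivlMr // => sd.
have e1 : y + (t + s) *: v - (y + t *: v) = s *: v by rewrite scalerDl opprD addrACA subrr add0r addrAC subrr add0r.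
have := hd (y + (t + s) *: v) Logic.I; rewrite e1 enormZ edotZr (mulrC s).
move=> h1; have sv : `|s| * enorm v < d by apply: le_lt_trans sd; rewrite ler_wpM2l // lerDl.
apply: le_trans (h1 sv) _; rewrite mulrAC ler_pdivrMr // -mulrA ler_wpM2l ?(ltW e0) //.
by rewrite ler_wpM2l // lerDl.
Qed.

(** Derivatives are only known in [Om], with a gradient field continuous at [x]. To make it a strict
    derivative, [y] and [z] are joined through [p] by two segments in [Om] of length comparable to
    |z-y|, each treated by the mean value theorem. *)
Lemma sdiff_of_paths (E Om : set 'rV[R]_n) (w : 'rV[R]_n -> R) (G : 'rV[R]_n -> 'rV[R]_n) (H : 'rV[R]_n -> 'M[R]_n) x (d K : R) :
  Om `<=` E -> (forall y, E y -> cont_at E w y) -> (forall y, Om y -> jet2 w y (G y) (H y)) ->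
  (forall i, cont_at E (fun y => G y 0 i) x) -> 0 < d -> 0 < K ->
  (forall y z, E y -> E z -> y != z -> enorm (y - x) < d -> enorm (z - x) < d -> exists p,
     [/\ enorm (p - y) <= K * enorm (z - y), enorm (p - z) <= K * enorm (z - y) &
       forall t, 0 < t <= 1 -> Om (y + t *: (p - y)) /\ Om (z + t *: (p - z))]) ->
  sdiff E w x (G x).
Proof.
move=> OE wc hj Gc d0 K0 hp e e0.
have [d1 d10 hd1] : exists2 d1, 0 < d1 & forall y, E y -> enorm (y - x) < d1 -> enorm (G y - G x) <= e / (2 * K).
  have e1 : 0 < (e / (2 * K)) ^+ 2 by rewrite exprn_gt0 // divr_gt0 // mulr_gt0.
  have cc : cont_at E (fun y => edot (G y - G x) (G y - G x)) x.
    apply: cont_at_sum => i; have ci : cont_at E (fun y => (G y - G x) 0 i) x.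
      move=> e' e'0; have [d' d'0 hd'] := Gc i e' e'0; exists d' => // y Ey yd.
      by rewrite !mxE subrr subr0; exact: hd'.
    exact: cont_atM.
  have [d1 d10 hd1] := cc _ e1; exists d1 => // y Ey yd.
  rewrite enorm_leE ?divr_ge0 ?(ltW e0) ?mulr_ge0 ?(ltW K0) //.
  have := hd1 y Ey yd; rewrite subrr edot0l subr0 ger0_norm ?edot_ge0 //; exact: ltW.
pose d2 := d1 / (1 + 2 * K); have K2 : 0 < 1 + 2 * K by rewrite addr_gt0 ?mulr_gt0.
have d20 : 0 < d2 by rewrite divr_gt0.
have d2E : d2 * (1 + 2 * K) = d1 by rewrite /d2 divfK // lt0r_neq0.
have half y z p : E y -> enorm (y - x) < d2 -> enorm (p - y) <= K * enorm (z - y) -> enorm (z - x) < d2 ->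
  (forall t, 0 < t <= 1 -> Om (y + t *: (p - y))) -> `|w p - w y - edot (G x) (p - y)| <= e / 2 * enorm (z - y).
  move=> Ey yd py zd hO; pose k (t : R) := w (y + t *: (p - y)).
  have yE t : 0 <= t <= 1 -> E (y + t *: (p - y)).
    move=> /andP[t0 t1]; have [->|tn] := eqVneq t 0; first by rewrite scale0r addr0.
    by apply: OE; apply: hO; rewrite lt0r tn t0.
  have [|||c cI hc] := @MVT R k (fun t => edot (G (y + t *: (p - y))) (p - y)) 0 1.
  - exact: ltr01.
  - move=> t; rewrite in_itv /= => /andP[t0 t1].
    by apply: jet2_line; apply: hj; apply: hO; rewrite t0 ltW.
  - apply/subspace_continuousP => t; rewrite /= in_itv /= => tI; apply/cvgrPdist_lt => e' e'0.
    have [d' d'0 hd'] := wc _ (yE t tI) _ e'0.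
    have v1 : 0 < enorm (p - y) + 1 by rewrite ltr_wpDl ?enorm_ge0.
    exists (d' / (enorm (p - y) + 1)); first by rewrite /= divr_gt0.
    move=> s /=; rewrite ltr_pdivlMr // => sd; rewrite in_itv /= => sI; rewrite distrC; apply: hd'; first exact: yE.
    have -> : y + s *: (p - y) - (y + t *: (p - y)) = (s - t) *: (p - y) by apply/rowP => i; rewrite !mxE; ring.
    rewrite enormZ distrC; apply: le_lt_trans sd; rewrite ler_wpM2l // lerDl; exact: ler01.
  move: hc; rewrite /k scale1r scale0r addr0 subr0 mulr1 [y + _]addrC subrK => ->.
  rewrite -edotNl -edotDl; apply: le_trans (edot_le _ _) _.
  move: cI; rewrite in_itv /= => /andP[c0 c1].
  have gl : enorm (G (y + c *: (p - y)) - G x) <= e / (2 * K).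
    apply: hd1; first by apply: yE; rewrite !ltW.
    rewrite addrAC; apply: le_lt_trans (enormD _ _) _; rewrite enormZ gtr0_norm //.
    have b1 : c * enorm (p - y) <= enorm (p - y) by rewrite ler_piMl ?enorm_ge0 // ltW.
    have zy : enorm (z - y) <= 2 * d2 by have := enorm_dist x z y; rewrite (enormBC x y); lra.
    have := ler_wpM2l (ltW K0) zy; lra.
  apply: le_trans (ler_pM (enorm_ge0 _) (enorm_ge0 _) gl py) _.
  by rewrite le_eqVlt; apply/orP; left; apply/eqP; field; rewrite lt0r_neq0.
exists (Num.min d d2); first by rewrite lt_min d0.
move=> y z Ey Ez; rewrite !lt_min => /andP[y1 y2] /andP[z1 z2].
have [->|yz] := eqVneq y z; first by rewrite !subrr edot0r subr0 normr0 enorm0 mulr0.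
have [p [p1 p2 hO]] := hp y z Ey Ez yz y1 z1.
have h1 := half y z p Ey y2 p1 z2 (fun t ht => (hO t ht).1).
have p2' : enorm (p - z) <= K * enorm (y - z) by rewrite (enormBC y z).
have h2 := half z y p Ez z2 p2' y2 (fun t ht => (hO t ht).2).
have -> : w z - w y - edot (G x) (z - y) = (w p - w y - edot (G x) (p - y)) - (w p - w z - edot (G x) (p - z)).
  have -> : z - y = (p - y) - (p - z) by apply/rowP => i; rewrite !mxE; ring.
  by rewrite edotDr edotNr; ring.
apply: le_trans (ler_normB _ _) _; rewrite (enormBC y z) in h2; lra.
Qed.

End Paths.

(** * From u to w *)

Section Extension.
Context {R : realType} {n : nat}.
Implicit Types (x y z v p c : 'rV[R]_n).
Variables (Om E : set 'rV[R]_n) (u : 'rV[R]_n -> R).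
Hypotheses (OE : Om `<=` E) (EO : E `<=` closure Om) (hu : Ck_upto 2 Om E u).

Lemma ext_continuous s : (size s <= 2)%N -> forall x, E x ->
  cont_at E (ext Om (partials s u)) x /\ (Om x -> ext Om (partials s u) x = partials s u x).
Proof.
move=> s2; have [_ _ /(_ s s2) [h /cont_atP hc hO]] := hu.
have eE y : E y -> ext Om (partials s u) y = h y.
  move=> Ey; have PF : ProperFilter (within Om (nbhs y)).
    by apply: within_nbhs_proper; exact: EO.
  apply: cvg_lim => //; apply/cvgrPdist_lt => e e0.
  have [d d0 hd] := hc y Ey e e0.
  apply/nbhs_enormP; exists d => // z zd Oz.
  by rewrite -(hO z Oz) distrC; apply: hd => //; exact: OE.
move=> x Ex; split; last by move=> Ox; rewrite eE // hO.
move=> e e0; have [d d0 hd] := hc x Ex e e0; exists d => // y Ey yd.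
by rewrite !eE //; exact: hd.
Qed.

Lemma cont_at_eq (g h : 'rV[R]_n -> R) x : E x -> cont_at E g x -> cont_at E h x ->
  (forall y, Om y -> g y = h y) -> g x = h x.
Proof.
move=> Ex hg hh e; apply/eqP; rewrite -subr_eq0 -normr_le0.
apply/ler_addgt0Pl => e' e'0; rewrite addr0.
have e2 : 0 < e' / 2 by rewrite divr_gt0.
have [d1 d10 hd1] := hg _ e2; have [d2 d20 hd2] := hh _ e2.
have /closure_enormP cx := EO Ex.
have [|y Oy] := cx (Num.min d1 d2); first by rewrite lt_min d10.
rewrite lt_min => /andP[y1 y2]; have Ey := OE Oy.
have a1 := hd1 y Ey y1; have a2 := hd2 y Ey y2; rewrite -(e y Oy) in a2.
have -> : g x - h x = (g y - h x) - (g y - g x) by ring.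
by apply: le_trans (ler_normB _ _) _; lra.
Qed.

Lemma ehess_sym x : open Om -> E x -> (ehess Om u x)^T = ehess Om u x.
Proof.
move=> oO Ex; apply/matrixP => i j; rewrite mxE.
have eh k l y : ehess Om u y k l = ext Om (partials [:: k; l] u) y by apply: mxE.
refine (etrans (eh j i x) (etrans _ (esym (eh i j x)))).
refine (cont_at_eq Ex (ext_continuous (s := [:: j; i]) isT Ex).1 (ext_continuous (s := [:: i; j]) isT Ex).1 _).
move=> y Oy; have Ey := OE Oy.
have [_ /(_ Oy) b1] := @ext_continuous [:: i; j] isT y Ey.
have [_ /(_ Oy) b2] := @ext_continuous [:: j; i] isT y Ey.
refine (etrans b2 (etrans _ (esym b1))).
have [hC _ _] := hu; have hs : (hess u y)^T i j = hess u y i j by rewrite (hess_sym oO hC Oy).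
have hh k l : hess u y k l = partials [:: k; l] u y by apply: mxE.
refine (etrans (esym (hh j i)) (etrans _ (hh i j))).
have ht : (hess u y)^T i j = hess u y j i by apply: mxE.
exact (etrans (esym ht) hs).
Qed.

Lemma ext_jet2 x : open Om -> Om x -> jet2 u x (egrad Om u x) (ehess Om u x).
Proof.
move=> oO Ox; have [hC _ _] := hu; have Ex := OE Ox.
apply: (jet2_eq (fun=> erefl) _ _ (C2_jet2 oO hC Ox)).
  apply/rowP => i; rewrite !mxE.
  by have [_ /(_ Ox) ->] := @ext_continuous [:: i] isT x Ex.
apply/matrixP => i j; rewrite !mxE.
by have [_ /(_ Ox) ->] := @ext_continuous [:: i; j] isT x Ex.
Qed.

End Extension.

Lemma cont_at_taylor2 {R : realType} {n : nat} (X : set 'rV[R]_n) (phi : R -> R) (a b : R) (g : 'rV[R]_n -> R) x :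
  taylor2 phi (g x) a b -> cont_at X g x -> cont_at X (fun y => phi (g y)) x.
Proof.
move=> ht hg e e0; have [d d0 hd] := ht 1 ltr01.
pose K := `|a| + `|2^-1 * b| + 1 + 1; have K0 : 0 < K by rewrite ltr_wpDl // !addr_ge0.
have [|d' d'0 hd'] := hg (Num.min (Num.min d 1) (e / K)); first by rewrite !lt_min d0 ltr01 divr_gt0.
exists d' => // y Xy yd; have := hd' y Xy yd; rewrite !lt_min; set s := g y - g x => /andP[/andP[s1 s2] s3].
have := hd s s1; have -> : g x + s = g y by rewrite /s addrC subrK.
move=> h1.
have ss : s ^+ 2 <= `|s| by rewrite -(real_normK (num_real s)) expr2 ler_piMl // ltW.
have -> : phi (g y) - phi (g x) = (phi (g y) - phi (g x) - a * s - 2^-1 * b * s ^+ 2) + (a * s + 2^-1 * b * s ^+ 2) by ring.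
apply: le_lt_trans (ler_normD _ _) _; apply: (@le_lt_trans _ _ (`|s| + (`|a| * `|s| + `|2^-1 * b| * `|s|))).
  apply: lerD; first by apply: le_trans h1 _; rewrite mul1r.
  apply: le_trans (ler_normD _ _) _; rewrite normrM lerD2l normrM ler_wpM2l //.
  by rewrite ger0_norm ?sqr_ge0.
move: s3; rewrite ltr_pdivlMr // /K; have := normr_ge0 s; lra.
Qed.

Section Conversion.
Context {R : realType} {n : nat} {I : countType}.
Implicit Types (x y z v p c : 'rV[R]_n).
Hypothesis n3 : (3 <= n)%N.
Variables (x0 : 'rV[R]_n) (r : R) (xb : I -> 'rV[R]_n) (rb : I -> R) (Lam : set 'rV[R]_n).
Hypothesis conf : ball_configuration x0 r xb rb Lam.
Local Notation Om := (domain x0 r xb rb Lam).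
Local Notation E := (closure Om `\` Lam).
Hypothesis dom0 : Om !=set0.
Context {Gam : set 'rV[R]_n} {f : 'rV[R]_n -> R}.
Hypotheses (hGam : admissible_cone Gam) (hf : admissible_function Gam f).
Variables (cB : R) (cb : I -> R) (u : 'rV[R]_n -> R) (beta : R).
Hypotheses (beta0 : 0 < beta) (cBb : - beta < cB) (cbb : forall a, - beta < cb a).
Hypothesis sol : conf_solution x0 r xb rb Lam Gam f cB cb u.
Local Notation cens := (cens x0 xb).
Local Notation rads := (rads r rb).
Local Notation rho j := (depth (cens j) (rads j)).

Let n0 : (0 < n)%N. Proof. by apply: leq_trans n3. Qed.
Let m : R := n%:R - 2.
Let m0 : 0 < m.
Proof. by rewrite subr_gt0 ltr_nat. Qed.
Let al : R := - (2 / m).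

Definition conf_w x : R := u x `^ (- (2 / (n%:R - 2))).
Definition conf_G x : 'rV[R]_n := (al * u x `^ (al - 1)) *: egrad Om u x.
Definition conf_H x : 'M[R]_n := (al * u x `^ (al - 1)) *: ehess Om u x +
  (al * (al - 1) * u x `^ (al - 2)) *: ((egrad Om u x)^T *m egrad Om u x).
Definition conf_c (j : option I) : R := 2 / m * (if j is Some a then cb a else cB).

Local Notation w := conf_w.
Local Notation G := conf_G.
Local Notation H := conf_H.

Let OE : Om `<=` E.
Proof. by move=> y Oy; split; [exact: subset_closure|have /domainP[] := Oy]. Qed.
Let EO : E `<=` closure Om. Proof. by move=> y []. Qed.
Let hu := sol_C2 sol.

Lemma domain_ball y : Om y -> exists2 d, 0 < d & forall z, enorm (z - y) < d -> Om z.
Proof.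
move=> Oy; have [s [d [d0 hd _ _ _]]] := exists_isolated n0 conf dom0 (OE Oy).
have [/(_ s) ry _] := (domainP conf y).1 Oy.
have [||d' d'0 hd'] := @cont_at_pos _ _ setT (rho s) y; [exact: cont_at_depth|exact: ry|].
exists (Num.min d d'); first by rewrite lt_min d0.
move=> z; rewrite lt_min => /andP[z1 z2]; apply: (isolated_domain conf hd z1).
by have /andP[h _] := hd' z Logic.I z2; apply: lt_trans h; rewrite divr_gt0.
Qed.

Let oOm : open Om. Proof. exact/open_enormP/domain_ball. Qed.

(** Chain rule for [u] to the power [al]: in each of the three terms the exponents of [u] add up to
    the one in the Schouten matrix. *)
Lemma confA_conf y : 0 < u y -> confA (w y) (G y) (H y) = conf_schouten Om u y.
Proof.
move=> u0; rewrite /confA /conf_schouten /conf_schouten_mx /w /G /H -/m -/al.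
set t := u y in u0 *; set p := egrad _ _ _; set K := ehess _ _ _.
have tn : t != 0 by rewrite lt0r_neq0.
have mn : m != 0 by rewrite lt0r_neq0.
have e1 : t `^ al * t `^ (al - 1) = t `^ (- ((n%:R + 2) / m)).
  rewrite -powRD; last by rewrite tn implybT.
  by congr (_ `^ _); rewrite /al /m; field.
have e2 : t `^ al * t `^ (al - 2) = t `^ (- (2 * n%:R / m)).
  rewrite -powRD; last by rewrite tn implybT.
  by congr (_ `^ _); rewrite /al /m; field.
have e3 : t `^ (al - 1) * t `^ (al - 1) = t `^ (- (2 * n%:R / m)).
  rewrite -powRD; last by rewrite tn implybT.
  by congr (_ `^ _); rewrite /al /m; field.
have a1 : al * (al - 1) = 2 * n%:R / m ^+ 2 by rewrite /al /m; field.
have a2 : al * al = 4 / m ^+ 2 by rewrite /al; field.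
rewrite scalerDr !scalerA; congr (_ + _ - _).
- by congr (_ *: _); rewrite mulrCA e1 /al mulNr.
- by congr (_ *: _); rewrite mulrCA e2 a1.
- congr (_%:M); rewrite edotZl (edotZr (_ * _)) -e3.
  have -> : 2 / m ^+ 2 = 2^-1 * (al * al) by rewrite a2; field.
  by ring.
Qed.

Lemma w_gt0 y : E y -> 0 < w y.
Proof. by move=> /(sol_gt0 sol) uy; exact: powR_gt0. Qed.

Lemma conf_w_inv (k : R) y : 0 < k -> E y -> k <= w y -> u y <= k `^ (- ((n%:R - 2) / 2)).
Proof.
move=> k0 Ey kw; have uy := sol_gt0 sol Ey.
have -> : u y = w y `^ (- (m / 2)).
  rewrite /w -powRrM (_ : _ * _ = 1) ?powRr1 // ?(ltW uy) //.
  by rewrite -/m; field; rewrite lt0r_neq0.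
have w0 : 0 < w y := lt_le_trans k0 kw.
rewrite -/m !powRN lef_pV2 ?posrE ?powR_gt0 //.
by apply: ge0_ler_powR; rewrite ?nnegrE ?(ltW k0) ?(ltW w0) // divr_ge0 // ltW.
Qed.

Let u_cont y : E y -> cont_at E u y.
Proof. by have [_ /cont_atP h _] := hu; exact: h. Qed.

Let pow_cont a y : E y -> cont_at E (fun y => u y `^ a) y.
Proof. by move=> Ey; exact: cont_at_taylor2 (taylor2_powR a (sol_gt0 sol Ey)) (u_cont Ey). Qed.

Let egrad_cont y i : E y -> cont_at E (fun y => egrad Om u y 0 i) y.
Proof.
move=> Ey; have [h _] := ext_continuous OE EO hu (s := [:: i]) isT Ey.
move=> e e0; have [d d0 hd] := h e e0; exists d => // z Ez zd; rewrite !mxE; exact: hd.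
Qed.

Let G_cont y i : E y -> cont_at E (fun y => G y 0 i) y.
Proof.
move=> Ey; have h : cont_at E (fun y => al * u y `^ (al - 1) * egrad Om u y 0 i) y.
  apply: cont_atM; last exact: egrad_cont.
  by apply: cont_atZ; exact: pow_cont.
move=> e e0; have [d d0 hd] := h e e0; exists d => // z Ez zd; rewrite /G [_ 0 i]mxE [X in _ - X]mxE; exact (hd z Ez zd).
Qed.

Let H_cont y i j : E y -> cont_at E (fun y => H y i j) y.
Proof.
move=> Ey; have h : cont_at E (fun y => al * u y `^ (al - 1) * ehess Om u y i j +
    al * (al - 1) * u y `^ (al - 2) * (egrad Om u y 0 i * egrad Om u y 0 j)) y.
  apply: cont_atD; apply: cont_atM.
  - by apply: cont_atZ; exact: pow_cont.
  - have [h _] := ext_continuous OE EO hu (s := [:: i; j]) isT Ey.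
    by move=> e e0; have [d d0 hd] := h e e0; exists d => // z Ez zd; rewrite !mxE; exact: hd.
  - by apply: cont_atZ; exact: pow_cont.
  - by apply: cont_atM; exact: egrad_cont.
have HE z : H z i j = al * u z `^ (al - 1) * ehess Om u z i j +
    al * (al - 1) * u z `^ (al - 2) * (egrad Om u z 0 i * egrad Om u z 0 j).
  rewrite /H; move: (egrad Om u z) (ehess Om u z) => p K.
  by rewrite !mxE big_ord1 !mxE.
by move=> e e0; have [d d0 hd] := h e e0; exists d => // z Ez zd; rewrite (HE z) (HE y); exact (hd z Ez zd).
Qed.

Lemma w_jet y : Om y -> jet2 w y (G y) (H y).
Proof.
move=> Oy; have h := jet2_comp (ext_jet2 OE EO hu oOm Oy) (taylor2_powR al (sol_gt0 sol (OE Oy))).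
by apply: (jet2_eq (fun=> erefl) (erefl _) _ h); rewrite /H.
Qed.

(** Near a boundary point both points are joined to their midpoint shifted by |z-y| along the inner
    normal. The shift outweighs the sideways displacement, so the depth becomes positive at once on
    both segments. *)
Lemma short_paths x : E x -> exists2 d, 0 < d & forall y z, E y -> E z -> y != z ->
  enorm (y - x) < d -> enorm (z - x) < d -> exists p,
     [/\ enorm (p - y) <= 3 / 2 * enorm (z - y), enorm (p - z) <= 3 / 2 * enorm (z - y) &
       forall t, 0 < t <= 1 -> Om (y + t *: (p - y)) /\ Om (z + t *: (p - z))].
Proof.
move=> Ex; have [s [d [d0 hd _ dq _]]] := exists_isolated n0 conf dom0 Ex.
have r0 := rads_neq0 conf s; have q0 : 0 < `|rads s| by rewrite normr_gt0.
have := rho_clos_ge0 conf s (EO Ex); rewrite le_eqVlt => /orP[/eqP e|rp]; last first.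
  have [||d' d'0 hd'] := @cont_at_pos _ _ setT (rho s) x; [exact: cont_at_depth|exact: rp|].
  have inO y : enorm (y - x) < Num.min d d' -> Om y.
    rewrite lt_min => /andP[y1 y2]; apply: (isolated_domain conf hd y1).
    by have /andP[h _] := hd' y Logic.I y2; apply: lt_trans h; rewrite divr_gt0.
  exists (Num.min d d'); first by rewrite lt_min d0.
  move=> y z _ _ _ y1 z1; exists y; rewrite subrr enorm0; split.
  - by rewrite mulr_ge0 ?enorm_ge0.
  - by rewrite (enormBC y z); have := enorm_ge0 (z - y); lra.
  move=> t /andP[t0 t1]; rewrite scaler0 addr0; split; first exact: inO.
  apply: inO; have -> : z + t *: (y - z) - x = (1 - t) *: (z - x) + t *: (y - x) by apply/rowP => i; rewrite !mxE; ring.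
  apply: le_lt_trans (enormD _ _) _; rewrite !enormZ ger0_norm ?subr_ge0 // gtr0_norm //.
  have -> : Num.min d d' = (1 - t) * Num.min d d' + t * Num.min d d' by ring.
  by rewrite ler_ltD // ?ltr_pM2l // ler_wpM2l ?subr_ge0 // ltW.
have [N NE] : exists N, N = - (rads s)^-1 *: (x - cens s) by exists (- (rads s)^-1 *: (x - cens s)).
have N1 : edot N N = 1.
  by rewrite NE edotZl (edotZr (- _)) ((depth0 _ _ r0).1 (esym e)); field; exact: r0.
have eN : enorm N = 1 by apply/eqP; rewrite -(@eqrXn2 _ 2) ?enorm_ge0 // sqr_enorm N1 expr1n.
exists (d / 10); first by rewrite divr_gt0.
have half y z t p : E y -> y != z -> enorm (y - x) < d / 10 -> enorm (z - x) < d / 10 ->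
    p - y = 2^-1 *: (z - y) + enorm (z - y) *: N -> enorm (p - y) <= 3 / 2 * enorm (z - y) /\
    (0 < t <= 1 -> Om (y + t *: (p - y))).
  move=> Ey yz yd zd pE; set l := enorm (z - y) in pE *.
  have l0 : 0 < l by rewrite enorm_gt0 subr_eq0 eq_sym.
  have ld : l <= 2 * (d / 10) by have := enorm_dist x z y; rewrite (enormBC x y) -/l; lra.
  have pl : enorm (p - y) <= 3 / 2 * l.
    rewrite pE; apply: le_trans (enormD _ _) _; rewrite !enormZ eN (gtr0_norm l0) gtr0_norm ?invr_gt0 // -/l; lra.
  split => // /andP[t0 t1]; apply: (isolated_domain conf hd).
    have -> : y + t *: (p - y) - x = (y - x) + t *: (p - y) by rewrite addrAC.
    apply: le_lt_trans (enormD _ _) _; rewrite enormZ gtr0_norm //.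
    have : t * enorm (p - y) <= enorm (p - y) by rewrite ler_piMl ?enorm_ge0.
    by lra.
  rewrite depth_line //; have ry := rho_clos_ge0 conf s (EO Ey).
  set v := p - y in pE pl *.
  have Nv : 2^-1 * l <= edot N v.
    rewrite pE edotDr !edotZr N1; have := edot_ge' N (z - y); rewrite eN -/l; lra.
  have b1 : edot (y - cens s) v / rads s = edot (y - x) v / rads s - edot N v.
    rewrite NE edotZl -mulNr opprK; have -> : y - cens s = (y - x) + (x - cens s) by rewrite addrA subrK.
    by rewrite edotDl mulrDl [X in _ + X]mulrC.
  have b2 : edot (y - x) v / rads s <= 3 / 20 * l.
    apply: le_trans (ler_norm _) _; rewrite normrM normfV ler_pdivrMr //.
    apply: le_trans (edot_le _ _) _.
    have : enorm (y - x) * enorm v <= (d / 10) * (3 / 2 * l).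
      by apply: ler_pM; rewrite ?enorm_ge0 // ltW.
    have : l * d <= l * `|rads s| by rewrite ler_pM2l.
    by lra.
  have b3 : t ^+ 2 * (edot v v / (2 * rads s)) <= t * (9 / 40 * l).
    rewrite expr2 -mulrA ler_pM2l //.
    apply: le_trans (ler_norm _) _; rewrite normrM (gtr0_norm t0).
    have h : `|edot v v / (2 * rads s)| <= 9 / 40 * l.
      rewrite normrM (ger0_norm (edot_ge0 _)) normfV normrM (@ger0_norm _ 2) // ler_pdivrMr ?mulr_gt0 // -sqr_enorm.
      have : enorm v ^+ 2 <= 3 / 2 * l * (3 / 2 * l) by rewrite expr2; apply: (ler_pM _ _ pl pl); exact: enorm_ge0.
      have : l * l <= l * (2 * (d / 10)) by rewrite ler_pM2l.
      have : l * d <= l * `|rads s| by rewrite ler_pM2l.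
      by lra.
    by apply: le_trans (ler_wpM2l (ltW t0) h) _; rewrite ler_piMl // mulr_ge0 // ltW.
  rewrite b1; have : t * (edot (y - x) v / rads s - edot N v) <= t * (3 / 20 * l - 2^-1 * l).
    by rewrite ler_pM2l //; lra.
  have := mulr_gt0 t0 l0; lra.
move=> y z Ey Ez yz yd zd; pose p := 2^-1 *: (y + z) + enorm (z - y) *: N; exists p.
have p1 : p - y = 2^-1 *: (z - y) + enorm (z - y) *: N.
  by rewrite /p; move: (enorm _ *: N) => V; apply/rowP => i; rewrite !mxE; field.
have p2 : p - z = 2^-1 *: (y - z) + enorm (y - z) *: N.
  by rewrite /p (enormBC y z); move: (enorm _ *: N) => V; apply/rowP => i; rewrite !mxE; field.
have zy : z != y by rewrite eq_sym.
split.
- by have [] := half y z 1 p Ey yz yd zd p1.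
- by rewrite (enormBC z y); have [] := half z y 1 p Ez zy zd yd p2.
move=> t ht; split.
- by have [_] := half y z t p Ey yz yd zd p1; apply.
- by have [_] := half z y t p Ez zy zd yd p2; apply.
Qed.

Lemma conf_solution_on : solution_on Gam f E Om w G H.
Proof.
have key y : E y -> Gam (evs (confA (w y) (G y) (H y))) /\
    f (evs (confA (w y) (G y) (H y))) = f (eigvals (conf_schouten Om u y)).
  move=> Ey; rewrite confA_conf ?(sol_gt0 sol) //; apply: (f_eigvals hGam hf); last exact (sol_cone sol Ey).
  by rewrite -confA_conf ?(sol_gt0 sol) //; apply: confA_sym; rewrite /H linearD /= !linearZ /= trmx_mul trmxK (ehess_sym OE EO hu oOm Ey).
split.
- exact: OE.
- exact: domain_ball.
- exact: w_gt0.
- move=> x Ex; have [d d0 hd] := short_paths Ex.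
  apply: (sdiff_of_paths OE _ w_jet _ d0 _ hd) => //.
  + by move=> y Ey; exact: pow_cont.
  + by move=> i; exact: G_cont.
- exact: w_jet.
- by move=> x Ex; rewrite /H linearD /= !linearZ /= trmx_mul trmxK (ehess_sym OE EO hu oOm Ex).
- by move=> x i; exact: G_cont.
- by move=> x i j; exact: H_cont.
- by move=> x /key[].
- by move=> x Ox; have [_ ->] := key x (OE Ox); exact (sol_eq sol Ox).
Qed.

End Conversion.

Lemma edist_toP {R : realType} {n : nat} (x : 'rV[R]_n) (A : set 'rV[R]_n) (d : R) :
  (d%:E <= edist_to x A)%E <-> forall p, A p -> d <= enorm (x - p).
Proof.
split=> [h p Ap|h].
  rewrite -lee_fin; apply: le_trans h _; apply: ereal_inf_lbound; exists p => //.
by apply: le_ereal_inf_tmp => _ [p Ap <-]; rewrite lee_fin; exact: h.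
Qed.

(** * The configuration satisfies the abstract setting *)

Section Setting.
Context {R : realType} {n : nat} {I : countType}.
Implicit Types (x y z v p c : 'rV[R]_n).
Hypothesis n3 : (3 <= n)%N.
Variables (x0 : 'rV[R]_n) (r : R) (xb : I -> 'rV[R]_n) (rb : I -> R) (Lam : set 'rV[R]_n).
Hypothesis conf : ball_configuration x0 r xb rb Lam.
Local Notation Om := (domain x0 r xb rb Lam).
Local Notation E := (closure Om `\` Lam).
Hypothesis dom0 : Om !=set0.
Local Notation cens := (cens x0 xb).
Local Notation rads := (rads r rb).
Local Notation rho j := (depth (cens j) (rads j)).

Let n0 : (0 < n)%N. Proof. by apply: leq_trans n3. Qed.
Let m : R := n%:R - 2.
Let m0 : 0 < m. Proof. by rewrite subr_gt0 ltr_nat. Qed.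

Lemma compact_away (d : R) : 0 < d ->
  compact (closure Om `&` [set x | (d%:E <= edist_to x Lam)%E]) /\
  closure Om `&` [set x | (d%:E <= edist_to x Lam)%E] `<=` E.
Proof.
move=> d0; split.
  apply: (@enorm_bounded_compact R n _ x0 r).
    apply: closedI; first exact: closed_closure.
    move=> x /closure_enormP hx; apply/edist_toP => p Lp; apply/ler_addgt0Pl => e e0.
    have [y /edist_toP/(_ p Lp) hy yx] := hx e e0.
    by have := enorm_dist x y p; lra.
  by move=> y [cy _]; rewrite -(rho_outer_ge conf) (rho_clos_ge0 conf).
move=> x [cx /edist_toP h]; split => // Lx; have := h x Lx.
by rewrite subrr enorm0 leNgt d0.
Qed.

(** The inequality is |c-c'| >= r+r' for disjoint balls and |c-c'| <= r-r' for nested ones, after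
    squaring; signed radii give both the same form. *)
Lemma spheres_apart b s : b <> s -> 2 <=
  (edot (cens s - cens b) (cens s - cens b) - rads s ^+ 2 - rads b ^+ 2) / (rads s * rads b).
Proof.
have r0 := conf_r_gt0 conf; have rb0 := conf_rb_gt0 conf.
have mixed a (v : 'rV[R]_n) : enorm v <= r - rb a ->
    2 <= (edot v v - r ^+ 2 - rb a ^+ 2) / (- (r * rb a)).
  move=> h; have hr := rb0 a; rewrite invrN mulrN -mulNr ler_pdivlMr ?mulr_gt0 //.
  have : edot v v <= (r - rb a) ^+ 2.
    by rewrite -enorm_leE //; exact: le_trans (enorm_ge0 _) h.
  by lra.
case: b s => [b|] [s|] //= bs.
- rewrite mulrNN !sqrrN ler_pdivlMr ?mulr_gt0 //.
  have sb : s != b by apply/eqP => e; apply: bs; rewrite e.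
  have h := inner_apart conf sb; rewrite -sqr_enorm.
  have h2 : (rb s + rb b) ^+ 2 <= enorm (xb s - xb b) ^+ 2.
    by rewrite !expr2; apply: (ler_pM _ _ h h); rewrite addr_ge0 // ltW.
  by move: h2; lra.
- have := @mixed b (x0 - xb b); rewrite enormBC => /(_ (inner_sub n0 conf b)).
  by rewrite sqrrN mulrN.
- have := @mixed s (xb s - x0) (inner_sub n0 conf s).
  by rewrite sqrrN mulNr (mulrC (rb s)) [X in _ -> 2 <= X / _]addrAC.
Qed.

Context {Gam : set 'rV[R]_n} {f : 'rV[R]_n -> R}.
Hypotheses (hGam : admissible_cone Gam) (hf : admissible_function Gam f).
Variable beta : R.
Hypothesis beta0 : 0 < beta.

(** The power of [u] on the right of the boundary condition cancels, which leaves a condition affine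
    in [w]. Blow-up of [u] keeps superlevel sets of [w] away from [Lam], hence compact, and
    hypothesis (i) supplies the point outside [E]. *)
Lemma conf_setting (cB : R) (cb : I -> R) (u : 'rV[R]_n -> R) : - beta < cB ->
  (forall a, - beta < cb a) -> conf_solution x0 r xb rb Lam Gam f cB cb u ->
  sphere_setting cens rads None (@conf_c R n I cB cb) (2 / m * beta) E Om (conf_w u) (conf_G x0 r xb rb Lam u).
Proof.
move=> cBb cbb sol; have m20 : 0 < 2 / m by rewrite divr_gt0.
have E0 j y : E y -> 0 <= rho j y by case=> cy _; exact: rho_clos_ge0 conf _ _ cy.
split.
- exact: rads_neq0 conf.
- exact: rads_outer conf.
- by rewrite mulr_gt0.
- by move=> j; rewrite /conf_c -mulrN ltr_pM2l //; case: j.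
- exact: E0.
- by move=> j y /(domainP conf)[].
- move=> y Ey nO; apply: contrapT => hn; apply: nO; apply/(domainP conf); split; last by case: Ey.
  by move=> j; rewrite lt0r (E0 _ _ Ey) andbT; apply/eqP => h; apply: hn; exists j.
- move=> j y Ey ry; have [s [d [d0 hd _ _ _]]] := exists_isolated n0 conf dom0 Ey.
  have js : j = s.
    apply: contrapT => ne; have [|_ /(_ j ne)] := hd y; first by rewrite subrr enorm0.
    by rewrite ry ltxx.
  exists d => // y' yd; rewrite js; split; first exact: isolated_domain hd yd.
  exact: isolated_closure hd yd.
- move=> k k0; have sl := conf_solution_on n3 conf dom0 hGam hf sol.
  have [d d0 hd] := sol_blowup sol (k `^ (- (m / 2))).
  have [cK KE] := compact_away d0; set K := _ `&` _ in cK KE.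
  have XK : E `&` [set y | k <= conf_w u y] `<=` K.
    move=> y [Ey hy]; split; first by case: Ey.
    rewrite /= leNgt; apply/negP => /(hd y Ey); rewrite ltNge.
    by rewrite (conf_w_inv n3 sol k0 Ey hy).
  apply: (subclosed_compact _ cK XK).
  move=> y /closure_enormP hy; have Ky : K y.
    apply: (compact_closed _ cK) => //; apply/closure_enormP => e e0.
    by have [z Xz zy] := hy e e0; exists z => //; exact: XK.
  have Ey := KE y Ky; split => //=; apply/ler_addgt0Pl => e e0.
  have [d' d'0 hd'] := w_cont sl Ey e0; have [z [Ez hz] zy] := hy d' d'0.
  by have := hd' z Ez zy; rewrite /= in hz; rewrite ltr_norml => /andP[_]; lra.
- case: (conf_nonempty conf) => o [[a _ oa]|Lo]; exists o.
  + by rewrite (rho_outer_ge conf); apply: ltW; exact: (@conf_sub _ _ _ _ _ _ _ _ conf a o oa).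
  + move=> /(E0 (Some a)); rewrite (rho_inner_ge conf) leNgt => /negP; apply; exact: oa.
  + rewrite (rho_outer_ge conf); apply/(closure_eball _ _ (conf_r_gt0 conf)).
    by have [] := conf_Lam_sub conf Lo.
  + by case.
- exact: spheres_apart.
move=> j y Ey ry; have uy := sol_gt0 sol Ey; have hr := rho_zero conf ry.
have un : u y != 0 by rewrite lt0r_neq0.
have nm : n%:R - 2 = m by []; have mn : m != 0 by rewrite lt0r_neq0.
have nE : n%:R = m + 2 by rewrite /m subrK.
have e1 : u y `^ (- (2 / m) - 1) * u y `^ (n%:R / (n%:R - 2)) = 1.
  rewrite -powRD; last by rewrite un implybT.
  rewrite nm nE (_ : _ + _ = 0) ?powRr0 //; by field.
have e2 : u y `^ (- (2 / m) - 1) * u y = conf_w u y.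
  rewrite -{2}(powRr1 (ltW uy)) -powRD; last by rewrite un implybT.
  by rewrite subrK.
case: j ry hr => [a|] ry /= hr; rewrite /conf_G edotZl -/m.
- rewrite normrN (gtr0_norm (conf_rb_gt0 conf a)) in hr.
  have := @sol_inner _ _ _ _ _ _ _ _ _ _ _ _ _ sol a y; rewrite nm => hs.
  have {}hs := hs (conj ((bdry_eball _ _ (conf_rb_gt0 conf a)).2 hr) Ey.2).
  rewrite invrN scaleNr.
  have -> : edot (egrad Om u y) (- ((rb a)^-1 *: (y - xb a))) = cb a * u y `^ (n%:R / m) + m / (2 * rb a) * u y.
    by move: hs; lra.
  rewrite mulrDr /conf_c -/m.
  have -> : - (2 / m) * u y `^ (- (2 / m) - 1) * (cb a * u y `^ (n%:R / m)) = - (2 / m * cb a) * (u y `^ (- (2 / m) - 1) * u y `^ (n%:R / m)) by ring.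
  have -> : - (2 / m) * u y `^ (- (2 / m) - 1) * (m / (2 * rb a) * u y) = - (2 / m * m / (2 * rb a)) * (u y `^ (- (2 / m) - 1) * u y) by ring.
  rewrite e1 e2; field; rewrite mn lt0r_neq0 ?(conf_rb_gt0 conf) //.
- rewrite (gtr0_norm (conf_r_gt0 conf)) in hr.
  have := @sol_outer _ _ _ _ _ _ _ _ _ _ _ _ _ sol y; rewrite nm => hs.
  have {}hs := hs (conj ((bdry_eball _ _ (conf_r_gt0 conf)).2 hr) Ey.2).
  have -> : edot (egrad Om u y) (r^-1 *: (y - x0)) = cB * u y `^ (n%:R / m) - m / (2 * r) * u y.
    by move: hs; lra.
  rewrite mulrBr /conf_c -/m.
  have -> : - (2 / m) * u y `^ (- (2 / m) - 1) * (cB * u y `^ (n%:R / m)) = - (2 / m * cB) * (u y `^ (- (2 / m) - 1) * u y `^ (n%:R / m)) by ring.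
  have -> : - (2 / m) * u y `^ (- (2 / m) - 1) * (m / (2 * r) * u y) = - (2 / m * m / (2 * r)) * (u y `^ (- (2 / m) - 1) * u y) by ring.
  rewrite e1 e2; field; rewrite mn lt0r_neq0 ?(conf_r_gt0 conf) //.
Qed.

End Setting.

Theorem theorem4 (R : realType) (n : nat) (hn : (3 <= n)%N)
    (x0 : 'rV[R]_n) (r : R)
    (I : countType) (xb : I -> 'rV[R]_n) (rb : I -> R)
    (Lam : set 'rV[R]_n) (hconf : ball_configuration x0 r xb rb Lam)
    (Gam : set 'rV[R]_n) (hGam : admissible_cone Gam)
    (f : 'rV[R]_n -> R) (hf : admissible_function Gam f)
    (beta eps : R) (hbeta : 0 < beta) (heps : 0 < eps) :
  exists C : R, forall (u : 'rV[R]_n -> R) (cB : R) (cb : I -> R),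
    - beta < cB -> (forall a, - beta < cb a) ->
    conf_solution x0 r xb rb Lam Gam f cB cb u ->
    (ereal_sup [set (u x)%:E |
       x in closure (domain x0 r xb rb Lam) `&`
            [set x | eps%:E <= edist_to x Lam]] <= C%:E)%E.
Proof.
set Om := domain x0 r xb rb Lam.
have [/set0P dom0|/negPn/eqP dom0] := boolP (Om != set0); last first.
  (* For an empty domain the supremum is that of the empty set, minus infinity. *)
  by exists 0 => u cB cb _ _ _; apply: ge_ereal_sup => _ [x [cx _] <-]; move: cx; rewrite dom0 closure0.
have n0 : (0 < n)%N by apply: leq_trans hn.
have m0 : 0 < n%:R - 2 :> R by rewrite subr_gt0 ltr_nat.
have n00 : 0 < n%:R :> R by rewrite ltr0n.
have [cK KE] := compact_away hconf heps.
have [vr vr0 hvr] := uniform_isolated n0 hconf dom0 cK KE.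
have [s0 s00 hs0] := f_small hGam hf n0.
have [bh bhE] : exists bh, bh = 2 / (n%:R - 2) * beta by exists (2 / (n%:R - 2) * beta).
have bh0 : 0 < bh by rewrite bhE mulr_gt0 // divr_gt0.
(* [c] meets both smallness conditions of [interior_bound], and [om] below those of the cap; they
   depend on [n], [bh] and [s0] only. *)
pose c := Num.min 1 (s0 / (100 * 100 * (1 + bh))).
have k0 : 0 < 100 * 100 * (1 + bh) by rewrite !mulr_gt0 // addr_gt0.
have c0 : 0 < c by rewrite lt_min ltr01 divr_gt0.
have c1 : c <= 1 by rewrite ge_min lexx.
have cs : c * (100 * 100 * (1 + bh)) <= s0 by rewrite -ler_pdivlMr // ge_min lexx orbT.
clearbody c.
have cb0 : 0 < c * bh by rewrite mulr_gt0.
have c2 : c ^+ 2 <= c by rewrite expr2 ler_piMl // ltW.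
have cs1 : 100 * 100 * c ^+ 2 <= s0 by lra.
have cs2 : 100 * 100 * bh * c <= s0 by lra.
have cs3 : c ^+ 2 < s0 by lra.
pose om := Num.min (100 * n%:R)^-1 (c / (100 * 100 * (200 * (n%:R * bh)))).
have k1 : 0 < 100 * 100 * (200 * (n%:R * bh)) by rewrite !mulr_gt0.
have om0 : 0 < om by rewrite lt_min invr_gt0 mulr_gt0 //= divr_gt0.
have om1 : om * n%:R <= 100^-1.
  rewrite -ler_pdivlMr // -invfM ge_min lexx //.
have om2 : 100 * 100 * (200 * (n%:R * bh * om)) <= c.
  have -> : 100 * 100 * (200 * (n%:R * bh * om)) = om * (100 * 100 * (200 * (n%:R * bh))) by ring.
  by rewrite -ler_pdivlMr // ge_min lexx orbT.
clearbody om.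
(* The lower bound for [w]. The configuration and [eps] enter it only through [vr]. *)
pose kap := 2 * bh * om ^+ 4 * vr; have kap0 : 0 < kap by rewrite /kap !mulr_gt0 ?exprn_gt0.
exists (kap `^ (- ((n%:R - 2) / 2))) => u cB cb cBb cbb sol.
have st := conf_setting hn hconf dom0 hGam hf hbeta cBb cbb sol; rewrite -bhE in st.
have sl := conf_solution_on hn hconf dom0 hGam hf sol.
have hin x ro := @interior_bound _ _ _ _ _ _ _ _ _ n0 hGam hf sl _ _ _ _ _ _ st s0 hs0 x c ro c0 cs1 cs2.
apply: ge_ereal_sup => _ [x Kx <-]; rewrite lee_fin.
have Ex := KE x Kx; have [s [hi xs vs vo]] := hvr x Kx.
apply: (conf_w_inv hn sol kap0 Ex).
have hOE y : enorm (y - x) < vr -> (0 < depth (cens x0 xb s) (rads r rb s) y -> Om y) /\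
    (0 <= depth (cens x0 xb s) (rads r rb s) y -> (closure Om `\` Lam) y).
  by move=> yx; split; [exact: isolated_domain hi yx|exact: isolated_closure hi yx].
have hF b y : b <> s -> enorm (y - x) < vr -> 0 < depth (cens x0 xb b) (rads r rb b) y.
  by move=> bs yx; have [_] := hi y yx; apply.
have := near_sphere_bound hn hGam hf sl st hs0 cs3 hin om0 om1 Ex vr0 hOE hF vs vo xs om2.
exact.
Qed.
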